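(* Let $D\subset\mathbb{R}^d$, $d\ge2$, be a bounded $C^{1,1}$ open set, $Q\in\partial D$, and let $v$ be a nonnegative harmonic function with respect to $X^D$ with Martin measure $\nu$. Suppose $u(x)=\int_{\partial D}M_D(x,z)\mu(dz)$ for a finite nonnegative measure $\mu$ on $\partial D$ with $d\mu=f\,d\nu$, where $f\in L^1(\partial D,\nu)$ is continuous at $Q$. If $\lim_{D\ni x\to Q}\delta_D(x)/v(x)=0$, then $\lim_{D\ni x\to Q}u(x)/v(x)=f(Q)$. If instead one assumes only that $\delta_D(x)/v(x)\to0$ as $x\to Q$ nontangentially, then $u(x)/v(x)\to f(Q)$ as $x\to Q$ nontangentially.
   Context: Let $d\ge2$. Let $S=(S_t)_{t\ge0}$ be a subordinator with Laplace exponent $\phi(\lambda)=\lambda+\int_0^\infty(1-e^{-\lambda t})\mu_0(t)\,dt$, where the Lévy density $\mu_0$ satisfies $\int_0^\infty(1\wedge t)\mu_0(t)dt<\infty$, is completely monotone, and for every $K>0$ there is $c=c(K)>1$ with $\mu_0(r)\le c\,\mu_0(2r)$ for $r\in(0,K)$. Let $W$ be a $d$-dimensional Brownian motion with generator $\Delta$, independent of $S$, and $X_t=W(S_t)$. $\mathbb{P}_x,\mathbb{E}_x$ refer to $X$ started at $x$. For open $D$, $\tau_D=\inf\{t>0:X_t\notin D\}$; $X^D$ is $X$ killed at $\tau_D$ (functions set to $0$ at the cemetery); $G_D(x,y)=\int_0^\infty p_D(t,x,y)dt$ is its Green function. A function $u:D\to[0,\infty)$ is harmonic with respect to $X^D$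 if $u(x)=\mathbb{E}_x[u(X^D_{\tau_B})]$ for every open $B$ with $\overline B$ compact in $D$ and every $x\in B$. $D$ is a bounded $C^{1,1}$ open set with characteristics $(r_0,\Lambda_0)$ (locally near each boundary point, within a ball of radius $r_0$, $D$ is the region above the graph of a $C^{1,1}$ function whose gradient vanishes at the point and is $\Lambda_0$-Lipschitz). A point $x_0\in D$ is fixed; for $z\in\partial D$, $M_D(x,z)=\lim_{D\ni y\to z}G_D(x,y)/G_D(x_0,y)$ (Martin kernel; the limit exists), and every nonnegative harmonic $v$ with respect to $X^D$ equals $\int_{\partial D}M_D(\cdot,z)\nu(dz)$ for a unique finite measure $\nu$ on $\partial D$, its Martin measure. $\delta_D(x)=\mathrm{dist}(x,D^c)$. For $Q\in\partial D$, $\beta>1$, $A_Q^\beta=\{x\in D:\delta_D(x)<r_0,|x-Q|<\beta\delta_D(x)\}$; ''as $x\to Q$ nontangentially'' means as $x\to Q$ within $A_Q^\beta$, for every $\beta>1$. *)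

(* Defs.v *)
From HB Require Import structures.
From mathcomp Require Import all_boot all_order all_algebra.
From mathcomp Require Import all_classical all_reals all_analysis.

Set Implicit Arguments.
Unset Strict Implicit.
Unset Printing Implicit Defensive.

Import Order.TTheory GRing.Theory Num.Theory.
Import numFieldNormedType.Exports.

Local Open Scope classical_set_scope.
Local Open Scope ring_scope.

(* Points of R^d are row vectors 'rV[R]_d.  The topology of 'rV[R]_d is
   the usual (product) topology; all metric quantities below use the
   Euclidean norm [enorm]. *)

Notation Borel R d := (g_sigma_algebraType (@open 'rV[R]_d)).

Section Geometry.
Variables (R : realType) (d : nat).
Implicit Types (x y : 'rV[R]_d) (D : set 'rV[R]_d).

Definition dotp x y : R := \sum_(i < d) x 0 i * y 0 i.
Definition enorm x : R := Num.sqrt (dotp x x).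

Definition delta D x : R := inf [set enorm (x - y) | y in ~` D].

Definition bounded_set_e D := exists M : R, forall x, D x -> enorm x <= M.

Definition bdry D := closure D `\` interior D.

Definition firstc x : 'rV[R]_d.-1 := \row_(i < d.-1) x 0 (widen_ord (leq_pred d) i).
Definition lastc x : R := \sum_(i < d | val i == d.-1) x 0 i.

Definition enorm' (w : 'rV[R]_d.-1) : R := Num.sqrt (\sum_(i < d.-1) w 0 i ^+ 2).

(* D is a C^{1,1} open set with characteristics (r0, L0): near each boundary
   point Q, within the ball B(Q,r0), D is the region above the graph of a
   C^{1,1} function phi (in an orthonormal coordinate system centred at Q)
   with phi(0)=0, grad phi(0)=0 and grad phi L0-Lipschitz. *)
Definition C11_open D (r0 L0 : R) :=
  open D /\ 0 < r0 /\ 0 < L0 /\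
  forall Q, bdry D Q ->
  exists (O : 'M[R]_d) (phi : 'rV[R]_d.-1 -> R),
    O *m O^T = 1%:M /\
    phi 0 = 0 /\
    (forall a, differentiable phi a) /\
    (forall h, 'd phi 0 h = 0) /\
    (forall a b h, `|'d phi a h - 'd phi b h| <= L0 * enorm' (a - b) * enorm' h) /\
    (forall y, (enorm (y - Q) < r0 /\ D y) <->
       (enorm (y - Q) < r0 /\
        lastc ((y - Q) *m O) > phi (firstc ((y - Q) *m O)))).

Definition ntA D (r0 : R) (Q : 'rV[R]_d) (beta : R) : set 'rV[R]_d :=
  [set x | D x /\ delta D x < r0 /\ enorm (x - Q) < beta * delta D x].

End Geometry.

Section Process.
Variables (R : realType) (d : nat).
Variables (dO : measure_display) (Omega : measurableType dO).
Variable (P : probability Omega R).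
Variable (W : R -> Omega -> 'rV[R]_d).
Variable (S : R -> Omega -> R).
Variable (mu0 : R -> R).

Local Notation leb := (@lebesgue_measure R).

Definition levy_density :=
  (forall t, 0 < t -> 0 <= mu0 t) /\
  (\int[leb]_(t in [set t : R | (0 < t)%R]) (Num.min 1 t * mu0 t)%R%:E < +oo)%E /\
  (forall (n : nat) t, 0 < t ->
      derivable (derive1n n mu0) t 1 /\ 0 <= (-1) ^+ n * derive1n n mu0 t) /\
  (forall K, 0 < K -> exists c, 1 < c /\
      forall r, 0 < r < K -> mu0 r <= c * mu0 (2 * r)).

Definition laplace_exponent (lam : R) : R :=
  lam + fine (\int[leb]_(t in [set t : R | (0 < t)%R]) ((1 - expR (- (lam * t))) * mu0 t)%:E).

(* W is a d-dimensional Brownian motion started at 0 with generator Delta: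
   continuous paths, W_0 = 0, and independent centred Gaussian increments
   with covariance 2(t-s) I, expressed through the joint characteristic
   function of the increments over any partition 0 = t_0 < ... < t_n. *)
Definition brownian :=
  (forall t (i : 'I_d), measurable_fun setT (fun w => W t w 0 i)) /\
  (forall w, W 0 w = 0) /\
  (forall w, {within `[0, +oo[, continuous (fun t => W t w)}) /\
  (forall (n : nat) (t : nat -> R) (xi : nat -> 'rV[R]_d),
     t 0%N = 0 -> (forall k, (k < n)%N -> t k < t k.+1) ->
     let Z w := \sum_(k < n) dotp (xi k) (W (t k.+1) w - W (t k) w) in
     (\int[P]_w (cos (Z w))%:E =
        (\prod_(k < n) expR (- ((t k.+1 - t k) * dotp (xi k) (xi k))))%:E)%E /\
     (\int[P]_w (sin (Z w))%:E = 0)%E).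

(* S is a subordinator with Laplace exponent [laplace_exponent]:
   S_0 = 0, nondecreasing right-continuous paths, and stationary independent
   increments, expressed through the joint Laplace transform of increments. *)
Definition subordinator :=
  (forall t, measurable_fun setT (S t)) /\
  (forall w, S 0 w = 0) /\
  (forall w s t, 0 <= s -> s <= t -> S s w <= S t w) /\
  (forall w t, 0 <= t -> (fun s => S s w) @ t^'+ --> S t w) /\
  (forall (n : nat) (t : nat -> R) (lam : nat -> R),
     t 0%N = 0 -> (forall k, (k < n)%N -> t k < t k.+1) ->
     (forall k, 0 <= lam k) ->
     (\int[P]_w (expR (- \sum_(k < n) lam k * (S (t k.+1) w - S (t k) w)))%:E =
        (\prod_(k < n) expR (- ((t k.+1 - t k) * laplace_exponent (lam k))))%:E)%E).

Definition gen_W : set (set Omega) :=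
  [set A | exists t (i : 'I_d) (B : set R),
     measurable B /\ A = (fun w => W t w 0 i) @^-1` B].
Definition gen_S : set (set Omega) :=
  [set A | exists t (B : set R), measurable B /\ A = S t @^-1` B].

Definition independent_WS :=
  forall A B, <<s gen_W >> A -> <<s gen_S >> B -> P (A `&` B) = (P A * P B)%E.

(* X_t = W(S_t); under P_x the process is x + W(S_t). *)
Definition Xp (x : 'rV[R]_d) (t : R) (w : Omega) : 'rV[R]_d := x + W (S t w) w.

Definition exit_time (A : set 'rV[R]_d) (x : 'rV[R]_d) (w : Omega) : \bar R :=
  ereal_inf [set t%:E | t in [set t : R | 0 < t /\ ~ A (Xp x t w)]].

(* u harmonic_XD with respect to X^D: u >= 0 on D and for every open B with
   compact closure contained in D and every x in B,
   u(x) = E_x[u(X^D_{tau_B})], where X^D is killed at tau_D and u is 0 at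
   the cemetery. *)
Definition harmonic_XD (D : set 'rV[R]_d) (u : 'rV[R]_d -> R) :=
  (forall x, D x -> 0 <= u x) /\
  forall B : set 'rV[R]_d, open B -> compact (closure B) -> closure B `<=` D ->
  forall x, B x ->
   ((u x)%:E = \int[P]_w
      (if (exit_time B x w < exit_time D x w)%E
       then u (Xp x (fine (exit_time B x w)) w) else 0)%:E)%E.

Definition cube (y : 'rV[R]_d) (r : R) : set 'rV[R]_d :=
  [set z | forall i : 'I_d, `|z 0 i - y 0 i| < r].

(* Green function of X^D, G_D(x,y) = int_0^oo p_D(t,x,y) dt, i.e. the
   (continuous) density at y of the occupation measure
   A |-> E_x[ int_0^{tau_D} 1_A(X_t) dt ]; obtained by differentiation. *)
Definition green (D : set 'rV[R]_d) (x y : 'rV[R]_d) : \bar R :=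
  lim ((fun r : R =>
     ((((2 * r) ^+ d)^-1)%:E *
       \int[P]_w \int[leb]_(t in [set t : R | (0 <= t)%R /\ (t%:E < exit_time D x w)%E])
            (\1_(cube y r) (Xp x t w))%:E)%E) @ 0^'+).

Definition martin (D : set 'rV[R]_d) (x0 x z : 'rV[R]_d) : R :=
  lim ((fun y => fine (green D x y) / fine (green D x0 y)) @ within D (nbhs z)).

End Process.

(* Main.v *)
(** The whole matter is the bound [M_D(x, z) <= C delta_D(x)] for [|x - z| >= eta],
    with [C] depending on [eta] only.  Granted it, split [u] and [v] at a small
    neighbourhood [E] of [Q] in the boundary: on [E] the measures [mu] and
    [f(Q) nu] agree up to a factor [epsilon] of [nu], and the rest of the boundary
    contributes [O(delta_D)] to both integrals.  Hence [|u - f(Q) v| <= epsilon v +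
    C delta_D] near [Q], and one divides by [v].  Since [M_D(x, .)] need not be known
    to be measurable, only monotonicity properties of lower integrals are used.

    For the bound, let [g(x, A)] be the mean time [X^D] spends in [A].  It suffices that
    [g(x, A) <= C delta_D(x) \int_A delta_D] when [A] is far from [x], and that
    [g(x0, A) >= c \int_A delta_D] for small [A] near the boundary, unless
    [g(x0, A) = 0].  Both are proved for the random walk [X_0, X_h, X_{2h}, ...], whose
    transition kernel is the symmetric mixture [E gauss(S_h, x, y)], uniformly in [h],
    and then pass to the limit [h -> 0].

    Upper bound: the law of [(S_t)] is only used through [E e^{-l S_t} = e^{-t phi(l)}],
    and Gaussian averages of [e^{-a |y - c|^2}] are explicit.  A concave function of
    [|y - c|^2 - r^2], [c] being the centre of an exterior tangent ball, written as a
    combination of [1 - e^{-l z}] over dyadic [l], is therefore a barrier: its loss from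
    crossing the tangent sphere is absorbed by its concavity scale by scale, and
    it bounds the mean exit time by [C delta_D(x)].  Applied at [x] and, by symmetry of
    the kernel, at the points of [A], this yields both factors [delta_D].

    Lower bound: the Hopf function [e^{-K |y - c|^2} - e^{-K r^2}] of an interior
    tangent ball bounds from below, by [c delta_D(y)], the time spent near the centre
    [c], and finitely many small balls cover all such centres. *)

Require Import Defs.
From HB Require Import structures.
From mathcomp Require Import all_boot all_order all_algebra.
From mathcomp Require Import all_classical all_reals all_analysis.
From mathcomp Require Import measurable_realfun.
From mathcomp Require Import ring lra zify.
Import Order.TTheory GRing.Theory Num.Theory.
Import numFieldNormedType.Exports.
Set Implicit Arguments.
Unset Strict Implicit.
Unset Printing Implicit Defensive.
Local Open Scope classical_set_scope.
Local Open Scope ring_scope.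

(** The subordinator is only reached through means of functions of [S_h], and only exponentials have
    known means. Each bound depending on the random time is therefore first dominated, for all times
    [t >= h], by a finite sum of exponentials in [t] ([expsum]), and one such sum must serve short,
    intermediate and long times at once. The drift is the obstacle for the barrier: the mean of
    [1 - e^{-l S_h}] is at least about [h l], too large to pay for crossings of the sphere at every
    dyadic [l]. In the squares [(1 - e^{-l S_h})^2] the drift cancels: their means are about
    [h (2 phi(l) - phi(2l))], and the sum over dyadic [l] of these divided by [l] converges. The
    barrier is built for a sphere shrunk by [eps], so that finitely many scales suffice; [eps] is
    later taken below both boundary distances, and only then [h -> 0]. The alternative
    [g(x0, A) = 0] does occur: if [mu0 = 0] and [D] is disconnected, [X^D] never leaves the
    component of [x0]. Quotients by 0 and limits that fail to exist take the value 0, which the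
    bound on [M_D] accommodates. *)

Section BorelRV.
Context {R : realType} {d : nat}.
Implicit Types x y : 'rV[R]_d.

Lemma open_rV_ballP (U : set 'rV[R]_d) :
  open U <-> forall x, U x -> exists2 e, 0 < e & cube x e `<=` U.
Proof.
split=> [oU x Ux|H].
  have /nbhs_ballP[e /= e0 eU] : nbhs x U by exact: open_nbhs_nbhs.
  exists e => // y xy; apply: eU; split => // i j.
  by rewrite (ord1 i) /ball /= distrC; exact: xy.
rewrite openE => x Ux; apply/nbhs_ballP.
have [e e0 eU] := H x Ux; exists e => //= y [_ xy]; apply: eU => j.
by have := xy 0 j; rewrite /ball /= distrC.
Qed.

Lemma open_cube (y : 'rV[R]_d) r : open (cube y r).
Proof.
apply/open_rV_ballP => x xy.
have [d0|d0] := eqVneq d 0%N.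
  exists 1 => // z _ i; exfalso; move: i; rewrite d0; by case.
pose e := \big[Num.min/1]_(i < d) (r - `|x 0 i - y 0 i|).
exists e.
  by apply: lt_bigmin => // i _; rewrite subr_gt0 xy.
move=> z zx i; have := zx i.
have : e <= r - `|x 0 i - y 0 i| by apply: bigmin_le_cond.
move=> h1 h2; have := ler_normD (z 0 i - x 0 i) (x 0 i - y 0 i).
rewrite addrA subrK; move: h1 h2; lra.
Qed.

Definition ratpt (q : 'rV[rat]_d) : 'rV[R]_d := map_mx (@ratr R) q.

(** Second countability: the union is countable, which is what turns measurability of the
    coordinates into Borel measurability of a vector-valued map in [measurable_rV]. *)
Lemma open_bigcup_cube (U : set 'rV[R]_d) : open U ->
  U = \bigcup_(p in [set p : 'rV[rat]_d * nat |
         cube (ratpt p.1) p.2.+1%:R^-1 `<=` U]) cube (ratpt p.1) p.2.+1%:R^-1.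
Proof.
move=> oU; apply/seteqP; split=> [x Ux|x [p pU]]; last exact: pU.
have [e e0 eU] := (open_rV_ballP U).1 oU x Ux.
have [n ne] : exists n, n.+1%:R^-1 < e / 2 :> R.
  have [n _ nP] := near_infty_natSinv_lt (PosNum (divr_gt0 e0 (@ltr0Sn R 1))).
  by exists n; exact: (nP n (leqnn n)).
pose w : R := n.+1%:R^-1.
have w0 : 0 < w by rewrite invr_gt0.
have qP i : exists q : rat, ratr q \in `]x 0 i - w, x 0 i + w[.
  by apply: rat_in_itvoo; lra.
pose q : 'rV[rat]_d := \row_i (sval (cid (qP i))).
have xq i : `|x 0 i - (ratpt q) 0 i| < w.
  rewrite mxE mxE; case: cid => /= r; rewrite in_itv /= => /andP[r1 r2].
  by rewrite ltr_norml; lra.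
exists (q, n) => //= y yq; apply: eU => i.
have := ler_normD (y 0 i - (ratpt q) 0 i) ((ratpt q) 0 i - x 0 i).
rewrite addrA subrK => h; have h1 := yq i; have h2 := xq i.
rewrite -/w in h1 ne; rewrite distrC in h2; lra.
Qed.

Lemma measurable_rV dT (T : measurableType dT) (f : T -> 'rV[R]_d) :
  (forall i, measurable_fun setT (fun t => f t 0 i)) ->
  measurable_fun setT (f : T -> Borel R d).
Proof.
move=> mf; apply: (@measurability _ _ _ (Borel R d) setT f (@open 'rV[R]_d)) => // _ [U oU <-].
rewrite setTI (open_bigcup_cube oU) preimage_bigcup.
have mc q r : measurable (f @^-1` cube q r).
  rewrite (_ : _ @^-1` _ = \bigcap_(i in [set: 'I_d])
      (fun t => f t 0 i) @^-1` (ball (q 0 i) r)).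
    apply: fin_bigcap_measurable => // i _.
    by rewrite -[X in measurable X]setTI; apply: mf => //; exact: measurable_ball.
  apply/seteqP; split=> t /= H i; first by move=> _; rewrite /ball /= distrC.
  by have := H i I; rewrite /ball /= distrC.
(* The countable index set is enumerated by [unpickle]; codes of no pair, or of cubes not inside
   [U], contribute the empty set. *)
rewrite (_ : \bigcup_(i in _) _ = \bigcup_(n in [set: nat])
   (if unpickle n is Some p then
     if pselect (cube (ratpt p.1) p.2.+1%:R^-1 `<=` U) then
      f @^-1` cube (ratpt p.1) p.2.+1%:R^-1 else set0 else set0)).
  apply: bigcupT_measurable => n; case: unpickle => // p.
  by case: pselect => ? /=; [exact: mc|].
apply/seteqP; split=> [t [p pU tp]|t [n _]].
  by exists (pickle p) => //; rewrite pickleK; case: pselect.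
case: unpickle => // p; case: pselect => // pU tp; by exists p.
Qed.

Lemma measurable_coord (i : 'I_d) :
  measurable_fun setT (fun x : Borel R d => (x : 'rV[R]_d) 0 i).
Proof.
apply: (measurability (@RGenOInfty.G R)); first exact: RGenOInfty.measurableE.
move=> _ [_ [a ->] <-]; rewrite setTI; apply: sub_sigma_algebra.
apply: open_comp => [x _|]; [exact: coord_continuous|exact: interval_open].
Qed.

End BorelRV.

(** * Uniqueness of characteristic functions *)

Section TrigUnique1.
Context {R : realType} d1 d2 (T1 : measurableType d1) (T2 : measurableType d2).
Variables (mu1 : {measure set T1 -> \bar R}) (mu2 : {measure set T2 -> \bar R}).
Variables (phi1 Z1 : T1 -> R) (phi2 Z2 : T2 -> R).
Hypothesis iphi1 : mu1.-integrable setT (EFin \o phi1).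
Hypothesis iphi2 : mu2.-integrable setT (EFin \o phi2).
Hypothesis mZ1 : measurable_fun setT Z1.
Hypothesis mZ2 : measurable_fun setT Z2.

(** The test functions that the weights [phi1] and [phi2], which may change sign, integrate equally
    along [Z1] and [Z2]. Measurability and boundedness are bundled in, so that the class is stable
    under linear combinations and bounded pointwise limits. *)
Definition eqint (f : R -> R) := [/\ measurable_fun setT f,
  exists M, forall z, `|f z| <= M &
  \int[mu1]_t (phi1 t * f (Z1 t)) = \int[mu2]_t (phi2 t * f (Z2 t))].

Lemma integrable_weight_comp dd (T : measurableType dd)
    (mu : {measure set T -> \bar R}) (phi Z : T -> R) (f : R -> R) (M : R) :
  mu.-integrable setT (EFin \o phi) -> measurable_fun setT Z ->
  measurable_fun setT f -> (forall z, `|f z| <= M) ->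
  mu.-integrable setT (EFin \o (fun t => phi t * f (Z t))).
Proof.
move=> ip mZ mf fM.
have M0 : 0 <= M by apply: le_trans (fM 0); exact: normr_ge0.
apply: (@le_integrable _ _ _ mu _ measurableT _ (fun t => M%:E * (EFin \o phi) t)%E).
- apply/measurable_EFinP; apply: measurable_funM.
    exact/measurable_EFinP/(measurable_int mu).
  exact: measurableT_comp.
- move=> t _ /=; rewrite lee_fin normrM normrM (ger0_norm M0) mulrC.
  by rewrite ler_wpM2r.
- exact: integrableZl.
Qed.

Lemma eqint_lin (f g : R -> R) (a b : R) : eqint f -> eqint g ->
  eqint (fun z => a * f z + b * g z).
Proof.
move=> [mf [M fM] fe] [mg [N gN] ge]; split.
- by apply: measurable_funD; apply: measurable_funM.
- exists (`|a| * M + `|b| * N) => z; rewrite (le_trans (ler_normD _ _))//.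
  by rewrite !normrM lerD// ler_wpM2l.
- have E dd (T : measurableType dd) (mu : {measure set T -> \bar R}) (phi Z : T -> R) :
    mu.-integrable setT (EFin \o phi) -> measurable_fun setT Z ->
    \int[mu]_t (phi t * (a * f (Z t) + b * g (Z t))) =
    a * \int[mu]_t (phi t * f (Z t)) + b * \int[mu]_t (phi t * g (Z t)).
    move=> ip mZ.
    have i1 := integrable_weight_comp ip mZ mf fM.
    have i2 := integrable_weight_comp ip mZ mg gN.
    rewrite -!RintegralZl// -RintegralD//; last 2 first.
    - exact: (integrableZl measurableT a i1).
    - exact: (integrableZl measurableT b i2).
    by apply: eq_Rintegral => t _; rewrite mulrDr !(mulrCA (phi t)).
  by rewrite !E// fe ge.
Qed.

Lemma eqint_lim (f_ : nat -> R -> R) (f : R -> R) (M : R) :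
  (forall n, eqint (f_ n)) -> (forall n z, `|f_ n z| <= M) ->
  (forall z, f_ ^~ z @ \oo --> f z) -> eqint f.
Proof.
move=> ef fM ff.
have mf : measurable_fun setT f.
  by apply: (measurable_fun_cvg (h := f_)) => [n|z _]; [have [] := ef n|exact: ff].
have fb z : `|f z| <= M.
  rewrite -(cvg_lim (@Rhausdorff R) (cvg_norm (ff z))).
  apply: limr_le; first by apply/cvg_ex; exists `|f z|; apply: cvg_norm; exact: ff.
  by apply: nearW => n.
split=> //; first by exists M.
have E dd (T : measurableType dd) (mu : {measure set T -> \bar R}) (phi Z : T -> R) :
    mu.-integrable setT (EFin \o phi) -> measurable_fun setT Z ->
    (\int[mu]_t (phi t * f_ n (Z t))) @[n --> \oo] --> \int[mu]_t (phi t * f (Z t)).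
  move=> ip mZ.
  have i1 := integrable_weight_comp ip mZ mf fb.
  apply: fine_cvg; rewrite fineK; last exact: integrable_fin_num.
  have [] := @dominated_convergence _ _ _ mu setT measurableT
    (fun n t => (phi t * f_ n (Z t))%:E) (fun t => (phi t * f (Z t))%:E)
    (fun t => M%:E * `|(EFin \o phi) t|)%E.
  - move=> n; have [mfn _ _] := ef n.
    by apply: (measurable_int mu); apply: (integrable_weight_comp ip mZ mfn (fM n)).
  - exact: (measurable_int mu).
  - apply: aeW => t _; apply: cvg_EFin; first by apply: nearW.
    by apply: cvgMr; exact: ff.
  - by apply: integrableZl => //; exact: integrable_abse.
  - apply: aeW => t n _ /=; rewrite lee_fin normrM mulrC ler_wpM2r//.
  - by move=> _ _; apply.
have c1 := E _ _ mu1 _ _ iphi1 mZ1.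
have c2 := E _ _ mu2 _ _ iphi2 mZ2.
have e12 : (fun n => \int[mu1]_t (phi1 t * f_ n (Z1 t))) =
           (fun n => \int[mu2]_t (phi2 t * f_ n (Z2 t))).
  by apply/funext => n; have [] := ef n.
rewrite e12 in c1; exact: (cvg_unique _ c1 c2).
Qed.

Lemma eqint_ext f g : f =1 g -> eqint f -> eqint g.
Proof. by move=> /funext ->. Qed.

Hypothesis Hcos : forall xi b,
  \int[mu1]_t (phi1 t * cos (xi * Z1 t + b)) =
  \int[mu2]_t (phi2 t * cos (xi * Z2 t + b)).

(** Equality is demanded after every modulation by a cosine, because this stronger property survives
    multiplication by cosines ([tp_cos]), hence passes to polynomials in a cosine. *)
Let tp (f : R -> R) := forall xi b, eqint (fun z => f z * cos (xi * z + b)).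

Let mcosl xi b : measurable_fun setT (fun z : R => cos (xi * z + b)).
Proof.
apply: measurableT_comp; first by apply: continuous_measurable_fun; exact: continuous_cos.
by apply: measurable_funD => //; apply: measurable_funM.
Qed.

Let tp1 : tp (fun=> 1).
Proof.
move=> xi b; split.
- by apply: measurable_funM.
- by exists 1 => z; rewrite mul1r cos_max.
- by under eq_Rintegral do rewrite mul1r; under [RHS]eq_Rintegral do rewrite mul1r.
Qed.

Let tp_eqint f : tp f -> eqint f.
Proof.
move=> /(_ 0 0); apply: eqint_ext => z.
by rewrite mul0r add0r cos0 mulr1.
Qed.

Let tp_lin f g a b : tp f -> tp g -> tp (fun z => a * f z + b * g z).
Proof.
move=> tf tg xi c; apply: eqint_ext (eqint_lin a b (tf xi c) (tg xi c)) => z.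
by rewrite mulrDl !mulrA.
Qed.

Let tp_ext f g : f =1 g -> tp f -> tp g.
Proof. by move=> /funext ->. Qed.

Let tp_cos f e c : tp f -> tp (fun z => f z * cos (e * z + c)).
Proof.
move=> tf xi b.
apply: eqint_ext (eqint_lin (2^-1) (2^-1) (tf (e + xi) (c + b)) (tf (e - xi) (c - b))) => z.
rewrite (_ : (e + xi) * z + (c + b) = (e * z + c) + (xi * z + b)); last by ring.
rewrite (_ : (e - xi) * z + (c - b) = (e * z + c) - (xi * z + b)); last by ring.
by rewrite cosD cosB; field.
Qed.

Let tp_lim (f_ : nat -> R -> R) (f : R -> R) (M : R) :
  (forall n, tp (f_ n)) -> (forall n z, `|f_ n z| <= M) ->
  (forall z, f_ ^~ z @ \oo --> f z) -> tp f.
Proof.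
move=> tf fM ff xi b; apply: (@eqint_lim (fun n z => f_ n z * cos (xi * z + b)) _ M).
- by move=> n; exact: tf.
- by move=> n z; rewrite normrM -[leRHS]mulr1 ler_pM// cos_max.
- by move=> z; apply: cvgMl; exact: ff.
Qed.

Let tp_poly (p : {poly R}) e c : tp (fun z => p.[2^-1 + 2^-1 * cos (e * z + c)]).
Proof.
elim/poly_ind: p => [|p a ih].
  apply: tp_ext (tp_lin 0 0 tp1 tp1) => z; rewrite horner0; ring.
have h := tp_lin 1 a (tp_lin 2^-1 2^-1 ih (tp_cos e c ih)) tp1.
apply: tp_ext h => z; rewrite hornerMXaddC; ring.
Qed.

(** The smoothstep polynomial fixes 0, 1/2 and 1, and its iterates on [0, 1] converge to 0 below 1/2
    and to 1 above. Composed with [2^-1 + 2^-1 * cos], they exhibit the sign of a cosine as a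
    bounded limit of trigonometric polynomials. *)
Let sstep : {poly R} := 3%:R *: 'X^2 - 2%:R *: 'X^3.

Let sstepE y : sstep.[y] = 3 * y ^+ 2 - 2 * y ^+ 3.
Proof. by rewrite /sstep !hornerE. Qed.

Let itp n : {poly R} := iter n (fun p => sstep \Po p) 'X.

Let itpS n y : (itp n.+1).[y] = 3 * (itp n).[y] ^+ 2 - 2 * (itp n).[y] ^+ 3.
Proof. by rewrite /itp /= horner_comp sstepE. Qed.

Let itp01 n (y : R) : 0 <= y <= 1 -> 0 <= (itp n).[y] <= 1.
Proof.
move=> y01; elim: n => [|n]; first by rewrite /itp /= hornerX.
rewrite itpS; move: (itp n).[y] => a /andP[a0 a1]; apply/andP; split.
  rewrite (_ : _ - _ = a ^+ 2 * (3 - 2 * a)); last by ring.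
  by apply: mulr_ge0; [exact: sqr_ge0|lra].
rewrite -subr_ge0 (_ : _ - _ = (1 - a) ^+ 2 * (1 + 2 * a)); last by ring.
by apply: mulr_ge0; [exact: sqr_ge0|lra].
Qed.

Let itp_sym n (y : R) : (itp n).[1 - y] = 1 - (itp n).[y].
Proof.
elim: n => [|n ih]; first by rewrite /itp /= !hornerX.
rewrite !itpS ih; ring.
Qed.

Let itp_half n : (itp n).[2^-1] = 2^-1.
Proof.
elim: n => [|n ih]; first by rewrite /itp /= !hornerX.
by rewrite !itpS ih; field.
Qed.

(** The ratio [s(a) / a = 3 a - 2 a^2] increases on [0, 1/2], so along the orbit of [y] each
    iteration multiplies by at most its value [r < 1] at [y]. *)
Let itp_cvg0 (y : R) : 0 <= y < 2^-1 -> (itp n).[y] @[n --> \oo] --> (0 : R).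
Proof.
move=> /andP[y0 y1].
pose r := 3 * y - 2 * y ^+ 2.
have r0 : 0 <= r by rewrite /r; nra.
have r1 : r < 1 by rewrite /r; nra.
have B n : 0 <= (itp n).[y] <= y /\ (itp n).[y] <= y * r ^+ n.
  elim: n => [|n]; first by rewrite /itp /= hornerX expr0 mulr1 y0 lexx.
  rewrite itpS (exprS r); move: (itp n).[y] => a [/andP[a0 ay] ar].
  have h : 3 * a ^+ 2 - 2 * a ^+ 3 <= a * r.
    rewrite -subr_ge0 /r (_ : _ - _ = a * ((y - a) * (3 - 2 * (y + a)))); last by ring.
    by apply: mulr_ge0 => //; apply: mulr_ge0; lra.
  have h0 : 0 <= 3 * a ^+ 2 - 2 * a ^+ 3 by nra.
  have h1 : a * r <= a by nra.
  split; first by rewrite h0 /=; lra.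
  apply: (le_trans h); rewrite mulrCA mulrC; exact: ler_wpM2l.
apply: (@squeeze_cvgr _ _ _ _ (fun=> 0) (fun n => y * r ^+ n)).
- by apply: nearW => n; have [/andP[-> _] ->] := B n.
- exact: cvg_cst.
- rewrite -[X in _ --> X](mulr0 y); apply: cvgMr.
  by apply: cvg_expr; rewrite ger0_norm.
Qed.

Let itp_cvg (y : R) : 0 <= y <= 1 ->
  (itp n).[y] @[n --> \oo] --> 2^-1 + 2^-1 * Num.sg (y - 2^-1).
Proof.
move=> /andP[y0 y1]; have [yh|yh|->] := ltgtP y 2^-1.
- rewrite ltr0_sg ?subr_lt0// mulrN1 subrr; apply: itp_cvg0; by rewrite y0.
- rewrite gtr0_sg ?subr_gt0// mulr1.
  have -> : (fun n => (itp n).[y]) = (fun n => 1 - (itp n).[1 - y]).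
    by apply/funext => n; rewrite itp_sym opprB addrCA subrr addr0.
  rewrite (_ : 2^-1 + 2^-1 = 1 - 0 :> R); last by field.
  apply: cvgB; first exact: cvg_cst.
  apply: itp_cvg0; lra.
- rewrite subrr sgr0 mulr0 addr0.
  rewrite (_ : (fun n => _) = (fun=> 2^-1)); first exact: cvg_cst.
  by apply/funext => n; rewrite itp_half.
Qed.

Let tp_sgcos e c : tp (fun z => Num.sg (cos (e * z + c))).
Proof.
have h : tp (fun z => 2^-1 + 2^-1 * Num.sg (2^-1 + 2^-1 * cos (e * z + c) - 2^-1)).
  have hb z : 0 <= 2^-1 + 2^-1 * cos (e * z + c) <= 1.
    have := cos_geN1 (e * z + c); have := cos_le1 (e * z + c); lra.
  apply: (@tp_lim (fun n z => (itp n).[2^-1 + 2^-1 * cos (e * z + c)]) _ 1).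
  - by move=> n; exact: tp_poly.
  - by move=> n z; have /andP[? ?] := itp01 n (hb z); rewrite ger0_norm.
  - by move=> z; exact: itp_cvg.
apply: tp_ext (tp_lin 2 (-1) h tp1) => z.
rewrite addrAC subrr add0r sgrM gtr0_sg ?invr_gt0// mul1r; by field.
Qed.

(** The cosine shifted by a quarter period is the sine of [(z - a) / (n + 1)], which has the sign of
    [z - a] as soon as [|z - a| < (n + 1) pi]. *)
Let tp_sg (a : R) : tp (fun z => Num.sg (z - a)).
Proof.
apply: (@tp_lim (fun n z => Num.sg (cos (n.+1%:R^-1 * z + (- (n.+1%:R^-1 * a) - pi / 2)))) _ 1).
- by move=> n; exact: tp_sgcos.
- by move=> n z; rewrite normr_sg; case: (_ == _).
- move=> z; apply: cvg_near_cst.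
  have : (n.+1%:R^-1 * `|z - a|) @[n --> \oo] --> 0 * `|z - a|.
    by apply: cvgMl; exact: cvg_harmonic.
  rewrite mul0r => /cvgrPdist_lt /(_ pi (pi_gt0 _)).
  apply: filterS => n; rewrite sub0r normrN normrM normr_id => hn.
  rewrite addrA -mulrBr cosB sin_pihalf cos_pihalf mulr0 add0r mulr1.
  have n0 : 0 < n.+1%:R^-1 :> R by rewrite invr_gt0.
  rewrite (gtr0_norm n0) in hn.
  have [za|za|->] := ltgtP z a.
  + have az : z - a < 0 by rewrite subr_lt0.
    rewrite (ltr0_sg az) -[_ * _]opprK sinN sgrN gtr0_sg// sin_gt0_pi// -mulrN.
    by rewrite ltr0_norm// in hn; rewrite hn mulr_gt0// oppr_gt0.
  + have az : 0 < z - a by rewrite subr_gt0.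
    rewrite (gtr0_sg az) gtr0_sg// sin_gt0_pi//.
    by rewrite gtr0_norm// in hn; rewrite hn mulr_gt0.
  + by rewrite subrr mulr0 sin0 sgr0.
Qed.

Lemma eqint_ray a : eqint (\1_(`]a, +oo[%classic) : R -> R).
Proof.
have h : tp (fun z => 2 * \1_(`]a, +oo[%classic) z - 1).
  apply: (@tp_lim (fun n z => Num.sg (z - (a + n.+1%:R^-1))) _ 1).
  - by move=> n; exact: tp_sg.
  - by move=> n z; rewrite normr_sg; case: (_ == _).
  - move=> z; apply: cvg_near_cst; rewrite indicE.
    have [za|za] := ltP a z; last first.
      rewrite memNset ?mulr0 ?sub0r; last by rewrite /= in_itv /= andbT; apply/negP; rewrite -leNgt.
      apply: nearW => n; rewrite ltr0_sg//.
      have : 0 < n.+1%:R^-1 :> R by [].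
      by move: (n.+1%:R^-1) => w; move: za; lra.
    rewrite mem_set ?mulr1; last by rewrite /= in_itv /= za.
    have := near_infty_natSinv_lt (PosNum (divr_gt0 (_ : 0 < z - a) (@ltr0Sn R 0))).
    move=> /(_ ltac:(by rewrite subr_gt0)); apply: filterS => n /= hn.
    rewrite gtr0_sg//; move: hn; move: (n.+1%:R^-1) => w; lra.
have := tp_eqint (tp_lin 2^-1 2^-1 h tp1).
by apply: eqint_ext => z; field.
Qed.

End TrigUnique1.

Section TrigUnique.
Context {R : realType} {d : nat} d1 d2 (T1 : measurableType d1) (T2 : measurableType d2).
Variables (mu1 : {measure set T1 -> \bar R}) (mu2 : {measure set T2 -> \bar R}).
Variables (phi1 : T1 -> R) (Z1 : T1 -> 'rV[R]_d) (phi2 : T2 -> R) (Z2 : T2 -> 'rV[R]_d).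
Hypothesis iphi1 : mu1.-integrable setT (EFin \o phi1).
Hypothesis iphi2 : mu2.-integrable setT (EFin \o phi2).
Hypothesis mZ1 : forall i, measurable_fun setT (fun t => Z1 t 0 i).
Hypothesis mZ2 : forall i, measurable_fun setT (fun t => Z2 t 0 i).
Hypothesis Hcos : forall xi b,
  \int[mu1]_t (phi1 t * cos (dotp xi (Z1 t) + b)) =
  \int[mu2]_t (phi2 t * cos (dotp xi (Z2 t) + b)).

Definition raybox (a : 'rV[R]_d) : set 'rV[R]_d := [set y | forall i, a 0 i < y 0 i].

Lemma dotpD (x y z : 'rV[R]_d) : dotp (x + y) z = dotp x z + dotp y z.
Proof.
by rewrite /dotp -big_split; apply: eq_bigr => i _; rewrite mxE mulrDl.
Qed.

Lemma dotpN (x z : 'rV[R]_d) : dotp (- x) z = - dotp x z.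
Proof. by rewrite /dotp -sumrN; apply: eq_bigr => i _; rewrite mxE mulNr. Qed.

Lemma dotpC (x y : 'rV[R]_d) : dotp x y = dotp y x.
Proof. by apply: eq_bigr => i _; rewrite mulrC. Qed.

Lemma dotpZ c (x z : 'rV[R]_d) : dotp (c *: x) z = c * dotp x z.
Proof. by rewrite /dotp mulr_sumr; apply: eq_bigr => i _; rewrite mxE mulrA. Qed.

Lemma dotp_delta i (x : 'rV[R]_d) : dotp (delta_mx 0 i) x = x 0 i.
Proof.
rewrite /dotp (bigD1 i)//= mxE !eqxx mul1r big1 ?addr0// => j ji.
by rewrite mxE (negPf ji) andbF mul0r.
Qed.

Lemma measurable_dotp dd (T : measurableType dd) (Z : T -> 'rV[R]_d) xi :
  (forall i, measurable_fun setT (fun t => Z t 0 i)) ->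
  measurable_fun setT (fun t => dotp xi (Z t)).
Proof.
by move=> mZ; apply: measurable_sum => i; apply: measurable_funM.
Qed.

Let W (a : 'rV[R]_d) (j : nat) (y : 'rV[R]_d) : R :=
  \prod_(i < d | (i < j)%N) \1_(`]a 0 i, +oo[%classic) (y 0 i).

Let W01 a j y : `|W a j y| <= 1.
Proof.
suff /andP[_ ->//] : 0 <= `|W a j y| <= 1.
rewrite /W normr_prod; apply: (big_ind (fun x : R => 0 <= x <= 1)).
- by rewrite ler01 lexx.
- by move=> x z /andP[x0 x1] /andP[z0 z1]; rewrite mulr_ge0//= mulr_ile1.
- by move=> i _; rewrite indicE; case: (_ \in _); rewrite ?normr1 ?normr0 lexx ler01.
Qed.

Let mW dd (T : measurableType dd) (Z : T -> 'rV[R]_d) a j :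
  (forall i, measurable_fun setT (fun t => Z t 0 i)) ->
  measurable_fun setT (fun t => W a j (Z t)).
Proof.
move=> mZ; rewrite /W; under eq_fun do rewrite big_mkcond.
apply: measurable_prod => i _; case: (_ < _)%N => //.
apply: (measurableT_comp (f := \1_(`]a 0 i, +oo[%classic) : R -> R)) => //.
Qed.

(** Induction on the coordinates: at stage [j] the indicators of rays in the first [j] coordinates
    have entered the weight, and only frequencies vanishing on these coordinates are still free. The
    one-dimensional [eqint_ray] then treats coordinate [j] with weight [phi * g]; as [g] contains a
    cosine, weights of either sign are essential. *)
Lemma eqint_raybox a :
  \int[mu1]_t (phi1 t * \1_(raybox a) (Z1 t)) =
  \int[mu2]_t (phi2 t * \1_(raybox a) (Z2 t)).
Proof.
suff H j : (j <= d)%N -> forall (xi : 'rV[R]_d) (b : R), (forall i : 'I_d, (i < j)%N -> xi 0 i = 0) ->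
    \int[mu1]_t (phi1 t * (W a j (Z1 t) * cos (dotp xi (Z1 t) + b))) =
    \int[mu2]_t (phi2 t * (W a j (Z2 t) * cos (dotp xi (Z2 t) + b))).
  have := H d (leqnn d) 0 0 (fun i _ => mxE _ _ _ _).
  have E dd (T : measurableType dd) (Z : T -> 'rV[R]_d) t :
     W a d (Z t) * cos (dotp 0 (Z t) + 0) = \1_(raybox a) (Z t).
    rewrite addr0 (_ : dotp 0 _ = 0) ?cos0 ?mulr1; last first.
      by rewrite /dotp big1// => i _; rewrite mxE mul0r.
    rewrite /W [in RHS]indicE; have [/set_mem ar|/negP ar] := boolP (Z t \in _).
      by rewrite big1// => i _; rewrite indicE mem_set//= in_itv /= ar.
    have [i ia] : exists i, ~~ (a 0 i < Z t 0 i).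
      apply: contrapT => h; apply: ar; rewrite inE => i.
      by apply: contrapT => /negP h2; apply: h; exists i.
    by rewrite (bigD1 i)//= indicE memNset ?mul0r//= in_itv /= andbT; exact/negP.
  by under eq_Rintegral do rewrite E; under [RHS]eq_Rintegral do rewrite E.
elim: j => [_ xi b _|j ih jd xi b xi0].
  have E y : W a 0 y = 1 by rewrite /W big_pred0.
  by under eq_Rintegral do rewrite E mul1r; under [RHS]eq_Rintegral do rewrite E mul1r.
pose i0 := Ordinal jd.
pose g (y : 'rV[R]_d) := W a j y * cos (dotp xi y + b).
have mg dd (T : measurableType dd) (Z : T -> 'rV[R]_d) :
    (forall i, measurable_fun setT (fun t => Z t 0 i)) ->
    measurable_fun setT (fun t => g (Z t)).
  move=> mZ; apply: measurable_funM; first exact: mW.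
  apply: (measurableT_comp (f := @cos R)).
    by apply: continuous_measurable_fun; exact: continuous_cos.
  by apply: measurable_funD => //; exact: measurable_dotp.
have gb y : `|g y| <= 1.
  by rewrite /g normrM -[leRHS]mulr1 ler_pM// cos_max.
have ig dd (T : measurableType dd) (mu : {measure set T -> \bar R}) (phi : T -> R)
    (Z : T -> 'rV[R]_d) (h : 'rV[R]_d -> R) : mu.-integrable setT (EFin \o phi) ->
    measurable_fun setT (fun t => h (Z t)) -> (forall y, `|h y| <= 1) ->
    mu.-integrable setT (EFin \o (fun t => phi t * h (Z t))).
  move=> ip mh hb; apply: (le_integrable _ _ _ ip) => //.
    apply/measurable_EFinP; apply: measurable_funM => //.
    exact/measurable_EFinP/(measurable_int mu).
  by move=> t _ /=; rewrite lee_fin normrM ler_piMr.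
have Wj y : W a j.+1 y = \1_(`]a 0 i0, +oo[%classic) (y 0 i0) * W a j y.
  rewrite /W (bigD1 i0)//=; congr (_ * _); apply: eq_bigl => i.
  by rewrite ltnS -(inj_eq val_inj) /=; case: ltngtP.
have hyp e c : \int[mu1]_t ((phi1 t * g (Z1 t)) * cos (e * Z1 t 0 i0 + c)) =
               \int[mu2]_t ((phi2 t * g (Z2 t)) * cos (e * Z2 t 0 i0 + c)).
  pose x1 := xi + e *: delta_mx 0 i0; pose x2 := xi - e *: delta_mx 0 i0.
  have E dd (T : measurableType dd) (mu : {measure set T -> \bar R}) (phi : T -> R)
    (Z : T -> 'rV[R]_d) : mu.-integrable setT (EFin \o phi) ->
    (forall i, measurable_fun setT (fun t => Z t 0 i)) ->
    \int[mu]_t ((phi t * g (Z t)) * cos (e * Z t 0 i0 + c)) =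
    2^-1 * \int[mu]_t (phi t * (W a j (Z t) * cos (dotp x1 (Z t) + (b + c)))) +
    2^-1 * \int[mu]_t (phi t * (W a j (Z t) * cos (dotp x2 (Z t) + (b - c)))).
    move=> ip mZ.
    have int x c' : mu.-integrable setT (EFin \o
       (fun t => phi t * (W a j (Z t) * cos (dotp x (Z t) + c')))).
      apply: (ig _ _ _ _ Z (fun y => W a j y * cos (dotp x y + c'))) => //.
        apply: measurable_funM; first exact: mW.
        apply: (measurableT_comp (f := @cos R)).
          by apply: continuous_measurable_fun; exact: continuous_cos.
        by apply: measurable_funD => //; exact: measurable_dotp.
      by move=> y; rewrite normrM -[leRHS]mulr1 ler_pM// cos_max.
    rewrite -!RintegralZl// -RintegralD//; last 2 first.
    - exact: (integrableZl measurableT 2^-1 (int x1 (b + c))).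
    - exact: (integrableZl measurableT 2^-1 (int x2 (b - c))).
    apply: eq_Rintegral => t _; rewrite /g /x1 /x2 !dotpD dotpN dotpZ dotp_delta.
    rewrite (_ : dotp xi (Z t) + e * Z t 0 i0 + (b + c) =
       (dotp xi (Z t) + b) + (e * Z t 0 i0 + c)); last by ring.
    rewrite (_ : dotp xi (Z t) - e * Z t 0 i0 + (b - c) =
       (dotp xi (Z t) + b) - (e * Z t 0 i0 + c)); last by ring.
    rewrite (cosD (dotp xi (Z t) + b)) (cosB (dotp xi (Z t) + b)) /g; by field.
  have x0 (s : R) : forall i : 'I_d, (i < j)%N -> (xi + s *: delta_mx 0 i0) 0 i = 0.
    move=> i ij; rewrite !mxE xi0 ?(ltn_trans ij)//.
    by rewrite (_ : (i == i0) = false) ?andbF ?mulr0 ?addr0//; apply/negbTE; rewrite -(inj_eq val_inj)/= neq_ltn ij.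
  have x2' : forall i : 'I_d, (i < j)%N -> x2 0 i = 0.
    by rewrite /x2 -scaleNr; exact: x0.
  rewrite !E//; congr (_ * _ + _ * _); apply: (ih (ltnW jd)) => //; exact: x0.
have [_ _] := @eqint_ray R _ _ _ _ mu1 mu2 (fun t => phi1 t * g (Z1 t)) (fun t => Z1 t 0 i0)
  (fun t => phi2 t * g (Z2 t)) (fun t => Z2 t 0 i0)
  (ig _ _ _ _ _ _ iphi1 (mg _ _ _ mZ1) gb) (ig _ _ _ _ _ _ iphi2 (mg _ _ _ mZ2) gb)
  (mZ1 i0) (mZ2 i0) hyp (a 0 i0).
under eq_Rintegral => t _.
  rewrite -mulrA (_ : g _ * _ = W a j.+1 (Z1 t) * cos (dotp xi (Z1 t) + b)); last first.
    by rewrite Wj /g; ring.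
  over.
move=> ->; apply: eq_Rintegral => t _; rewrite Wj /g; ring.
Qed.

End TrigUnique.

Lemma measurable_raybox {R : realType} {d : nat} :
  @measurable _ (Borel R d) = <<s range (@raybox R d) >>.
Proof.
apply/seteqP; split; last first.
  apply: smallest_sub; first exact: smallest_sigma_algebra.
  move=> _ [a _ <-].
  rewrite (_ : raybox a = \bigcap_(i in [set: 'I_d])
     ((fun x : Borel R d => (x : 'rV[R]_d) 0 i) @^-1` `]a 0 i, +oo[%classic)).
    apply: fin_bigcap_measurable => // i _.
    by rewrite -[X in measurable X]setTI; apply: measurable_coord => //.
  apply/seteqP; split=> y /= H i; first by move=> _; rewrite /= in_itv /= H.
  by have := H i I; rewrite /= in_itv /= andbT.
have mid : measurable_fun setT (id : g_sigma_algebraType (range (@raybox R d)) -> Borel R d).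
  apply: measurable_rV => i.
  apply: (measurability (@RGenOInfty.G R)); first exact: RGenOInfty.measurableE.
  move=> _ [_ [a ->] <-]; rewrite setTI.
  (* A half-space is an increasing union of ray boxes whose other corners tend to minus infinity. *)
  rewrite (_ : _ @^-1` _ = \bigcup_n raybox (\row_j (if j == i then a else - n%:R))).
    by apply: bigcupT_measurable => n; apply: sub_sigma_algebra; exists (\row_j (if j == i then a else - n%:R)).
  apply/seteqP; split=> y /=; rewrite in_itv /= andbT.
    move=> ay.
    pose n := Num.truncn (\sum_j `|y 0 j|).
    exists n.+1 => // j; rewrite mxE; case: eqP => [->//|_].
    rewrite ltrNl (le_lt_trans (ler_norm _))// normrN.
    apply: le_lt_trans (truncnS_gt _).
    by rewrite (bigD1 j)//= lerDl sumr_ge0.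
  by case=> n _ /(_ i); rewrite mxE eqxx.
move=> A mA; have := mid measurableT A mA; rewrite setTI preimage_id; exact.
Qed.

Lemma raybox_measure_unique {R : realType} {d : nat} (m1 m2 : {measure set (Borel R d) -> \bar R}) :
  (m1 setT < +oo)%E -> (forall a, m1 (raybox a) = m2 (raybox a)) ->
  forall A, measurable A -> m1 A = m2 A.
Proof.
move=> f1 E A mA.
apply: (@measure_unique _ R (Borel R d) (range (@raybox R d)) (fun n => raybox (const_mx (- n%:R)))) => //.
- exact: measurable_raybox.
- move=> _ _ [a _ <-] [b _ <-]; exists (\row_i Num.max (a 0 i) (b 0 i)) => //.
  apply/seteqP; split=> y /=.
    by move=> h; split => i; have := h i; rewrite mxE gt_max => /andP[].
  by case=> h1 h2 i; rewrite mxE gt_max h1 h2.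
- rewrite -subTset => y _.
  pose n := Num.truncn (\sum_j `|y 0 j|).
  exists n.+1 => // j; rewrite mxE.
  rewrite ltrNl (le_lt_trans (ler_norm _))// normrN.
  apply: le_lt_trans (truncnS_gt _).
  by rewrite (bigD1 j)//= lerDl sumr_ge0.
- by move=> _ [a _ <-].
- by move=> n; apply: le_lt_trans f1; apply: le_measure; rewrite ?inE// measurable_raybox; apply: sub_sigma_algebra; exists (const_mx (- n%:R)).
Qed.

(** * The heat kernel and Lebesgue measure *)

Section Gauss1.
Context {R : realType}.
Notation leb := (@lebesgue_measure R).

(** Normal density of mean [c] and variance [2 s]: the heat kernel of the second derivative without
    the factor 1/2, matching generator Delta. *)
Definition gauss1 (s c y : R) : R :=
  (Num.sqrt (4 * pi * s))^-1 * expR (- ((c - y) ^+ 2 / (4 * s))).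

Lemma gauss1E s c : 0 < s -> gauss1 s c = normal_pdf c (Num.sqrt (2 * s)).
Proof.
move=> s0; apply/funext => y.
have s2 : Num.sqrt (2 * s) != 0 by rewrite gt_eqF// sqrtr_gt0 mulr_gt0.
have s2E : Num.sqrt (2 * s) ^+ 2 = 2 * s by rewrite sqr_sqrtr// mulr_ge0// ltW.
rewrite normal_pdfE// /gauss1 /normal_peak /normal_fun s2E; congr (_ * expR _).
  by congr (_^-1); congr Num.sqrt; rewrite mulr2n; ring.
rewrite mulr2n mulNr; congr (- _).
have -> : 2 * s + 2 * s = 4 * s by ring.
by congr (_ / _); ring.
Qed.

Lemma gauss1_ge0 s c y : 0 <= gauss1 s c y.
Proof. by rewrite mulr_ge0 ?expR_ge0// invr_ge0. Qed.

Lemma measurable_gauss1 s c : measurable_fun setT (gauss1 s c).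
Proof.
apply: measurable_funM => //; apply: measurableT_comp => //.
apply: measurable_funN; apply: measurable_funM => //.
by apply: measurable_funX; exact: measurable_funB.
Qed.

Lemma integrableMb dT (T : measurableType dT) (mu : {measure set T -> \bar R}) (f g : T -> R) :
  mu.-integrable setT (EFin \o f) ->
  measurable_fun setT g -> (forall y, `|g y| <= 1) ->
  mu.-integrable setT (EFin \o (fun y => f y * g y)).
Proof.
move=> ip mh hb; apply: (le_integrable _ _ _ ip) => //.
  apply/measurable_EFinP; apply: measurable_funM => //.
  exact/measurable_EFinP/(measurable_int mu).
by move=> t _ /=; rewrite lee_fin normrM ler_piMr.
Qed.

Lemma integrable_gauss1 s c : 0 < s -> leb.-integrable setT (EFin \o gauss1 s c).
Proof. move=> s0; rewrite gauss1E//; exact: integrable_normal_pdf. Qed.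

Lemma integral_gauss1 s c : 0 < s -> \int[leb]_y gauss1 s c y = 1.
Proof. by move=> s0; rewrite gauss1E// /Rintegral integral_normal_pdf. Qed.

Lemma integrable_gauss1X (s c : R) : 0 < s ->
  leb.-integrable setT (fun y => ((y - c) * gauss1 s c y)%:E).
Proof.
(* The dominating function is the kernel at the doubled time [2 s], whose exponent is half as large.
   The other half, [e^{-u} <= 1 / (1 + u)], absorbs [|y - c| <= 1 + (y - c)^2]; the factor [sqrt 2]
   compensates for the normalisations. *)
move=> s0; pose C := 2 * (4 * s + 1) * Num.sqrt 2.
have := integrableZl measurableT C (integrable_gauss1 c (mulr_gt0 (@ltr0n R 2) s0)).
apply: le_integrable => //.
  apply/measurable_EFinP; apply: measurable_funM; first exact: measurable_funB.
  exact: measurable_gauss1.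
move=> y _ /=; rewrite lee_fin normrM [leRHS]normrM !(ger0_norm (gauss1_ge0 _ _ _)).
have C0 : 0 <= C by rewrite /C !mulr_ge0// addr_ge0// mulr_ge0// ltW.
rewrite (ger0_norm C0) /gauss1 /C.
rewrite (_ : 4 * pi * (2 * s) = 2 * (4 * pi * s)); last by ring.
set A := (Num.sqrt (4 * pi * s))^-1.
have -> : (Num.sqrt (2 * (4 * pi * s)))^-1 = (Num.sqrt 2)^-1 * A.
  by rewrite (@sqrtrM _ 2 _ (ler0n _ 2)) invfM.
have s2 : Num.sqrt 2 != 0 :> R by rewrite gt_eqF// sqrtr_gt0.
rewrite (_ : _ * Num.sqrt 2 * _ = A * (2 * (4 * s + 1) * expR (- ((c - y) ^+ 2 / (4 * (2 * s))))));
  last by field.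
rewrite mulrCA; apply: ler_wpM2l; first by rewrite /A invr_ge0.
pose u := (c - y) ^+ 2 / (8 * s).
have uE : (c - y) ^+ 2 / (4 * s) = u + u by rewrite /u; field; rewrite gt_eqF.
have uE' : (c - y) ^+ 2 / (4 * (2 * s)) = u by rewrite /u; congr (_ / _); ring.
rewrite uE uE' opprD expRD mulrA; apply: ler_wpM2r; first exact: expR_ge0.
have u0 : 0 <= u by rewrite /u mulr_ge0 ?sqr_ge0// invr_ge0 mulr_ge0// ltW.
rewrite expRN -ler_pdivlMr ?invr_gt0 ?expR_gt0// invrK.
apply: (@le_trans _ _ (2 * (4 * s + 1) * (1 + u))); last first.
  apply: ler_wpM2l; [by rewrite mulr_ge0// addr_ge0// mulr_ge0// ltW|].
  exact: expR_ge1Dx.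
have E : (y - c) ^+ 2 = u * (8 * s) by rewrite /u mulfVK ?gt_eqF// ?mulr_gt0// -sqrrN opprB.
have : `|y - c| <= 1 + (y - c) ^+ 2.
  rewrite -(real_normK (num_real (y - c))); have := normr_ge0 (y - c); nra.
rewrite E; nra.
Qed.

Lemma integrable_lin dT (T : measurableType dT) (mu : {measure set T -> \bar R})
    (f g : T -> R) (a b : R) :
  mu.-integrable setT (EFin \o f) -> mu.-integrable setT (EFin \o g) ->
  mu.-integrable setT (EFin \o (fun y => a * f y + b * g y)).
Proof.
move=> i1 i2; apply: eq_integrable (integrableD measurableT
  (integrableZl measurableT a i1) (integrableZl measurableT b i2)) => //.
Qed.

Lemma Rintegral_lin dT (T : measurableType dT) (mu : {measure set T -> \bar R})
    (f g : T -> R) (a b : R) :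
  mu.-integrable setT (EFin \o f) -> mu.-integrable setT (EFin \o g) ->
  \int[mu]_y (a * f y + b * g y) = a * \int[mu]_y f y + b * \int[mu]_y g y.
Proof.
move=> i1 i2; rewrite RintegralD//; last 2 first.
- exact: (integrableZl measurableT a i1).
- exact: (integrableZl measurableT b i2).
by rewrite !RintegralZl.
Qed.

Let ph (s c b xi y : R) := gauss1 s c y * cos (xi * (y - c) + b).

Let mtrig (f : R -> R) (xi c b : R) : continuous f -> measurable_fun setT (fun y : R => f (xi * (y - c) + b)).
Proof.
move=> cf; apply: measurableT_comp; first exact: continuous_measurable_fun.
by apply: measurable_funD => //; apply: measurable_funM => //; exact: measurable_funB.
Qed.

Let is_derive_lin (a c b y : R) : is_derive (y : R) (1 : R) (fun y : R => a * (y - c) + b) a.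
Proof.
apply: is_derive_eq; rewrite /GRing.scale /=; ring.
Qed.

Let is_derive_gauss1 (s c y : R) : 0 < s -> is_derive (y : R) (1 : R) (gauss1 s c)
  (- ((y - c) / (2 * s)) * gauss1 s c y).
Proof.
move=> s0.
have h : is_derive (y : R) (1 : R) (fun y => - ((c - y) ^+ 2 / (4 * s))) (- ((y - c) / (2 * s))).
  by apply: is_derive_eq; rewrite /GRing.scale /=; field; rewrite gt_eqF.
rewrite /gauss1; apply: is_derive_eq.
rewrite /GRing.scale /=; ring.
Qed.

Let continuous_gauss1 (s c : R) : 0 < s -> continuous (gauss1 s c).
Proof.
move=> s0 y; apply: differentiable_continuous; apply/derivable1_diffP.
by have [] := is_derive_gauss1 c y s0.
Qed.

(** Integration by parts: [f] is the derivative of [F], which vanishes at infinity, so the integral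
    of [f] is 0. The fundamental theorem of calculus on growing intervals passes to the limit by
    domination. *)
Lemma gauss1_ibp (s c b xi : R) : 0 < s ->
  \int[leb]_y ((y - c) * gauss1 s c y * sin (xi * (y - c) + b)) =
  2 * s * xi * \int[leb]_y ph s c b xi y.
Proof.
move=> s0.
pose F y := gauss1 s c y * sin (xi * (y - c) + b).
pose f y := - ((2 * s)^-1) * ((y - c) * gauss1 s c y * sin (xi * (y - c) + b)) + xi * ph s c b xi y.
have dF y : is_derive (y : R) (1 : R) F (f y).
  have h1 := is_derive_gauss1 c y s0.
  have h2 := is_derive_lin xi c b y.
  apply: is_derive_eq; rewrite /GRing.scale /= /f /ph; field; by rewrite gt_eqF.
have cF : continuous F.
  move=> y; apply: differentiable_continuous; apply/derivable1_diffP.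
  by have [] := dF y.
have i1 : leb.-integrable setT (EFin \o (fun y => (y - c) * gauss1 s c y * sin (xi * (y - c) + b))).
  apply: integrableMb; first exact: integrable_gauss1X.
  - by apply: mtrig; exact: continuous_sin.
  - by move=> y; exact: sin_max.
have i2 : leb.-integrable setT (EFin \o ph s c b xi).
  apply: integrableMb; first exact: integrable_gauss1.
  - by apply: mtrig; exact: continuous_cos.
  - by move=> y; exact: cos_max.
have if_ : leb.-integrable setT (EFin \o f).
  exact: integrable_lin.
have cf : continuous f.
  move=> y; apply: cvgD; apply: cvgM; try exact: cvg_cst.
  - apply: cvgM; [apply: cvgM; [apply: cvgB; [exact: cvg_id|exact: cvg_cst]|exact: continuous_gauss1]|].
    apply: continuous_comp; last exact: continuous_sin.
    by apply: differentiable_continuous; apply/derivable1_diffP; have [] := is_derive_lin xi c b y.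
  - apply: cvgM; first exact: continuous_gauss1.
    apply: continuous_comp; last exact: continuous_cos.
    by apply: differentiable_continuous; apply/derivable1_diffP; have [] := is_derive_lin xi c b y.
have cvgu (t : nat -> R) : (forall n, `|t n| = n.+1%:R) -> F (t n) @[n --> \oo] --> (0 : R).
  move=> tn; apply: norm_cvg0.
  apply: (@squeeze_cvgr _ _ _ _ (fun=> 0) (fun n => gauss1 s c (t n))).
  - apply: nearW => n; rewrite normr_ge0 /= /F normrM (ger0_norm (gauss1_ge0 _ _ _)).
    by rewrite ler_piMr ?gauss1_ge0// sin_max.
  - exact: cvg_cst.
  - rewrite -[X in _ --> X](mulr0 (Num.sqrt (4 * pi * s))^-1); apply: cvgMr.
    have : (c - t n) ^+ 2 / (4 * s) @[n --> \oo] --> +oo.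
      apply/cvgryPge => A; near=> n.
      have s4 : 0 < 4 * s by rewrite mulr_gt0.
      rewrite ler_pdivlMr//.
      have h1 : 1 + `|A| * (4 * s) + `|c| <= n.+1%:R.
        rewrite (le_trans (ltW (truncnS_gt _)))// ler_nat ltnS; near: n; exact: nbhs_infty_ge.
      have h2 : 1 + `|A| * (4 * s) <= `|c - t n|.
        have := ler_normD (c - t n) (- c); rewrite addrAC subrr add0r !normrN tn.
        move: h1; lra.
      have h3 : 0 <= `|A| * (4 * s) by rewrite mulr_ge0// ltW.
      have h4 : A * (4 * s) <= `|A| * (4 * s) by rewrite ler_pM2r// ler_norm.
      rewrite -(real_normK (num_real (c - t n))); nra.
    by move=> /(cvg_comp _ _)/(_ (@cvgr_expR R)).
suff H : \int[leb]_y f y = 0.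
  move: H; rewrite /f Rintegral_lin// => /eqP.
  rewrite mulNr addrC subr_eq0 => /eqP h.
  by rewrite -mulrA h mulrA divff ?mul1r// gt_eqF// mulr_gt0.
pose J (n : nat) : set R := `[- n.+1%:R, n.+1%:R]%classic.
have mJ n : measurable (J n) by exact: measurable_itv.
have iJ n : leb.-integrable setT (EFin \o (fun y => f y * \1_(J n) y)).
  apply: (@integrableMb _ _ leb f (\1_(J n)) if_) => [|y].
    apply: measurable_indic.  exact: mJ.
  by rewrite indicE; case: (_ \in _); rewrite ?normr1 ?normr0.
have c1 : \int[leb]_y (f y * \1_(J n) y) @[n --> \oo] --> \int[leb]_y f y.
  apply: fine_cvg; rewrite fineK; last exact: (integrable_fin_num measurableT if_).
  have [] := @dominated_convergence _ _ _ leb setT measurableT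
    (fun n y => (f y * \1_(J n) y)%:E) (EFin \o f) (fun y => `|(EFin \o f) y|)%E.
  - by move=> n; exact: (measurable_int leb (iJ n)).
  - exact: (measurable_int leb if_).
  - apply: aeW => y _; apply: cvg_near_cst.
    near=> n; rewrite indicE mem_set ?mulr1//= /J /= in_itv /= -ler_norml.
    rewrite (le_trans (ltW (truncnS_gt _)))// ler_nat ltnS; near: n; exact: nbhs_infty_ge.
  - exact: integrable_abse.
  - apply: aeW => y n _ /=; rewrite lee_fin normrM ler_piMr// indicE.
    by case: (_ \in _); rewrite ?normr1 ?normr0.
  - by move=> _ _; apply.
have c2 : \int[leb]_y (f y * \1_(J n) y) @[n --> \oo] --> (0 : R).
  rewrite (_ : (fun n => _) = (fun n => F n.+1%:R - F (- n.+1%:R))).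
    rewrite -[X in _ --> X](subrr 0); apply: cvgB; apply: cvgu => n; rewrite ?normrN ger0_norm//.
  apply/funext => n.
  rewrite /Rintegral; under eq_integral do rewrite EFinM.
  have -> : (\int[leb]_x ((f x)%:E * (\1_(J n) x)%:E) = \int[leb]_(x in J n) (f x)%:E)%E.
    rewrite [RHS]integral_mkcond; apply: eq_integral => x _.
    by rewrite patchE indicE; case: (_ \in _); rewrite ?mule1 ?mule0.
  rewrite (@continuous_FTC2 _ f F)//.
  - by rewrite (lt_trans (_ : _ < 0))// oppr_lt0.
  - exact: continuous_subspaceT.
  - split.
    + by move=> x _; have [] := dF x.
    + by apply: cvg_at_right_filter; exact: cF.
    + by apply: cvg_at_left_filter; exact: cF.
  - by move=> x _; rewrite derive1E; have [_ ->] := dF x.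
exact: (cvg_unique _ c1 c2).
Unshelve. all: by end_near. Qed.

Lemma gauss1_ode (s c b xi : R) : 0 < s ->
  is_derive (xi : R) (1 : R) (fun z => \int[leb]_y ph s c b z y) (- (2 * s * xi) * \int[leb]_y ph s c b xi y).
Proof.
move=> s0.
have i2 z : leb.-integrable setT (EFin \o ph s c b z).
  apply: integrableMb; first exact: integrable_gauss1.
  - by apply: mtrig; exact: continuous_cos.
  - by move=> y; exact: cos_max.
have d1 (x y : R) : is_derive (x : R) (1 : R) (fun z => ph s c b z y)
    (- ((y - c) * gauss1 s c y * sin (x * (y - c) + b))).
  rewrite /ph.
  have h : is_derive (x : R) (1 : R) (fun z => z * (y - c) + b) (y - c).
    by apply: is_derive_eq; rewrite /GRing.scale /=; ring.
  apply: is_derive_eq; rewrite /GRing.scale /=; ring.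
have d1E (x y : R) : partial1of2 (ph s c b) x y = (- ((y - c) * gauss1 s c y * sin (x * (y - c) + b))).
  by rewrite partial1of2E; have [_ ->] := d1 x y.
have Ia : `]xi - 1, xi + 1[%classic xi by rewrite /= in_itv /=; apply/andP; split; lra.
have gub x y : `]xi - 1, xi + 1[%classic x -> [set: R] y ->
   `|partial1of2 (ph s c b) x y| <= `|(y - c) * gauss1 s c y|.
  by move=> _ _; rewrite d1E normrN normrM ler_piMr// sin_max.
have dr x y : `]xi - 1, xi + 1[%classic x -> [set: R] y -> derivable ((ph s c b)^~ y) x 1.
  by move=> _ _; have [] := d1 x y.
have ig := integrable_norm (integrable_gauss1X c s0).
have D := @derivable_under_integral R _ _ leb (ph s c b) setT measurableT xi (xi - 1) (xi + 1)
  Ia (fun x _ => i2 x) dr _ (fun y => normr_ge0 _) ig gub.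
have E := @differentiation_under_integral R _ _ leb (ph s c b) setT measurableT xi (xi - 1) (xi + 1)
  Ia (fun x _ => i2 x) dr _ (fun y => normr_ge0 _) ig gub.
split; first exact: D.
rewrite -derive1E E.
under eq_Rintegral do rewrite d1E -mulN1r.
rewrite RintegralZl//; last first.
  apply: integrableMb; first exact: integrable_gauss1X.
  - by apply: mtrig; exact: continuous_sin.
  - by move=> y; exact: sin_max.
rewrite gauss1_ibp//; ring.
Qed.

(** With the phase centred at [c], the integral solves the linear equation of [gauss1_ode] in the
    frequency [z]; multiplied by [e^{s z^2}] it is constant, equal to its value [cos b'] at
    [z = 0]. *)
Lemma gauss1_char (s c b xi : R) : 0 < s ->
  \int[leb]_y (gauss1 s c y * cos (xi * y + b)) = expR (- (s * xi ^+ 2)) * cos (xi * c + b).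
Proof.
move=> s0.
pose b' := b + xi * c.
transitivity (\int[leb]_y ph s c b' xi y).
  by apply: eq_Rintegral => y _; rewrite /ph /b'; congr (_ * cos _); ring.
pose h z := expR (s * z ^+ 2) * \int[leb]_y ph s c b' z y.
have dh z : is_derive (z : R) (1 : R) h 0.
  have h1 := gauss1_ode c b' z s0.
  have h2 : is_derive (z : R) (1 : R) (fun z => s * z ^+ 2) (2 * s * z).
    by apply: is_derive_eq; rewrite /GRing.scale /=; ring.
  rewrite /h; apply: is_derive_eq; rewrite /GRing.scale /=; ring.
have /= := @is_derive_0_is_cst R h xi 0 dh.
rewrite /h expr0n /= mulr0 expR0 mul1r => e.
have e0 : \int[leb]_y ph s c b' 0 y = cos b'.
  rewrite /ph; under eq_Rintegral do rewrite mul0r add0r mulrC.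
  by rewrite RintegralZl// ?integral_gauss1 ?mulr1//; exact: integrable_gauss1.
rewrite e0 in e; rewrite -[LHS]mul1r -(expR0) -(subrr (s * xi ^+ 2)) addrC expRD -mulrA e.
by rewrite /b' addrC.
Qed.

End Gauss1.

Definition gauss {R : realType} {d : nat} (s : R) (x y : 'rV[R]_d) : R :=
  \prod_(i < d) gauss1 s (x 0 i) (y 0 i).

Section GaussD.
Context {R : realType}.

Lemma measurable_inv dT (T : measurableType dT) (f : T -> R) :
  measurable_fun setT f -> measurable_fun setT (fun t => (f t)^-1).
Proof.
(* The power [-1] agrees with the inverse on nonnegative numbers, hence the passage through the
   square; at 0 both sides are 0. *)
move=> mf; rewrite (_ : (fun t => _) = (fun t => f t * (fun x => x `^ (-1)) (f t ^+ 2))).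
  apply: measurable_funM => //; apply: (measurableT_comp (measurable_powR (-1))).
  exact: measurable_funX.
apply/funext => t; have [->|f0] := eqVneq (f t) 0; first by rewrite invr0 mul0r.
by rewrite /= powR_inv1 ?sqr_ge0// expr2 invfM mulrA divff// mul1r.
Qed.

Lemma measurable_sqrt dT (T : measurableType dT) (f : T -> R) :
  measurable_fun setT f -> measurable_fun setT (fun t => Num.sqrt (f t)).
Proof.
move=> mf; apply: (measurableT_comp (f := @Num.sqrt R)) => //.
by apply: nondecreasing_measurable => // x y; exact: ler_wsqrtr.
Qed.

Lemma gauss_ge0 d s (x y : 'rV[R]_d) : 0 <= gauss s x y.
Proof. by apply: prodr_ge0 => i _; exact: gauss1_ge0. Qed.

Lemma gaussE d s (x y : 'rV[R]_d) : gauss s x y =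
  (Num.sqrt (4 * pi * s))^-1 ^+ d * expR (- (dotp (x - y) (x - y) / (4 * s))).
Proof.
rewrite /gauss /gauss1 big_split /= prodr_const card_ord -expR_sum; congr (_ * expR _).
rewrite /dotp mulr_suml -sumrN; apply: eq_bigr => i _.
by rewrite !mxE expr2.
Qed.

Lemma measurable_gauss d dT (T : measurableType dT) (s : T -> R) (f g : T -> 'rV[R]_d) :
  measurable_fun setT s ->
  (forall i, measurable_fun setT (fun t => f t 0 i)) ->
  (forall i, measurable_fun setT (fun t => g t 0 i)) ->
  measurable_fun setT (fun t => gauss (s t) (f t) (g t)).
Proof.
move=> ms mf mg; apply: measurable_prod => i _; rewrite /gauss1.
have ms' : measurable_fun setT (fun t => 4 * pi * s t) by apply: measurable_funM.
apply: measurable_funM; first by apply: measurable_inv; exact: measurable_sqrt.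
apply: measurableT_comp => //; apply: measurable_funN; apply: measurable_funM.
  by apply: measurable_funX; exact: measurable_funB.
by apply: measurable_inv; apply: measurable_funM.
Qed.

Lemma measurable_gaussr d s (x : 'rV[R]_d) : measurable_fun setT (gauss s x : Borel R d -> R).
Proof.
apply: (@measurable_gauss d _ (Borel R d) (fun=> s) (fun=> x) (fun y => y)) => //.
exact: measurable_coord.
Qed.

(* The only property of Lebesgue measure that is needed: the Fourier transform of the
   heat kernel. *)
Definition heat_ref d (m : {measure set (Borel R d) -> \bar R}) :=
  forall (s : R) (x : 'rV[R]_d), 0 < s ->
  m.-integrable setT (EFin \o gauss s x) /\
  forall (xi : 'rV[R]_d) (b : R),
    \int[m]_y (gauss s x y * cos (dotp xi y + b)) =
    expR (- (s * dotp xi xi)) * cos (dotp xi x + b).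

(** Local finiteness comes from integrability of the Gaussian at time 1, which is at least the
    constant [c] on the cube. *)
Lemma heat_ref_cube d (m : {measure set (Borel R d) -> \bar R}) r :
  heat_ref m -> (m (cube 0 r) < +oo)%E.
Proof.
move=> Hm; have [ig _] := Hm 1 0 ltr01.
have mc : measurable (cube 0 r : set (Borel R d)).
  by apply: sub_sigma_algebra; exact: open_cube.
pose c := \prod_(i < d) ((Num.sqrt (4 * pi * 1 : R))^-1 * expR (- (r ^+ 2 / (4 * 1)))).
have c0 : 0 < c.
  apply: prodr_gt0 => i _; rewrite mulr_gt0 ?expR_gt0// invr_gt0 sqrtr_gt0.
  by rewrite !mulr_gt0// pi_gt0.
have h : (c%:E * m (cube 0 r) <= \int[m]_y (gauss 1 0 y)%:E)%E.
  rewrite -(setIT (cube 0 r)) -integral_indic// -ge0_integralZl//.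
  - apply: ge0_le_integral => //.
    + by move=> y _; rewrite mule_ge0// lee_fin// ltW.
    + exact/measurable_EFinP/measurable_funM.
    + exact: (measurable_int m ig).
    + move=> y _; rewrite -EFinM lee_fin indicE.
      have [/set_mem yc|_] := boolP (y \in _); last by rewrite mulr0 gauss_ge0.
      rewrite mulr1 /gauss /c; apply: ler_prod => i _; apply/andP; split.
        by rewrite mulr_ge0 ?expR_ge0// invr_ge0.
      rewrite /gauss1; apply: ler_wpM2l; first by rewrite invr_ge0.
      rewrite ler_expR lerN2 ler_pM2r ?invr_gt0//.
      have := yc i; rewrite !mxE subr0 sub0r sqrrN => yr.
      rewrite -(real_normK (num_real (y 0 i))) ler_sqr ?nnegrE ?normr_ge0//; first exact: ltW.
      exact: le_trans (ltW yr).
  - by apply/measurable_EFinP; exact: measurable_indic.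
  - by rewrite lee_fin ltW.
have hoo : (\int[m]_y (gauss 1 0 y)%:E < +oo)%E.
  move/integrableP : ig => [_]; apply: le_lt_trans; apply: ge0_le_integral => //.
  - by move=> y _; rewrite lee_fin gauss_ge0.
  - by apply: measurable_int; exact: (Hm 1 0 ltr01).1.
  - by apply: measurableT_comp => //; apply: measurable_int; exact: (Hm 1 0 ltr01).1.
  - by move=> y _ /=; rewrite lee_fin ler_norm.
rewrite ltey; apply/eqP => moo; move: h; rewrite moo mulry gtr0_sg// mul1e.
by rewrite leye_eq => /eqP h; rewrite h in hoo.
Qed.

Lemma heat_ref_sigma_finite d (m : {measure set (Borel R d) -> \bar R}) :
  heat_ref m -> sigma_finite setT m.
Proof.
move=> Hm; exists (fun n => cube 0 n.+1%:R).
  apply/esym; rewrite -subTset => y _.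
  pose n := Num.truncn (\sum_j `|y 0 j|).
  exists n => // j; rewrite mxE subr0.
  apply: le_lt_trans (truncnS_gt _).
  by rewrite (bigD1 j)//= lerDl sumr_ge0.
move=> n; split; last exact: heat_ref_cube.
by apply: sub_sigma_algebra; exact: open_cube.
Qed.

End GaussD.

Section SigmaFinitePack.
Context dT (T : measurableType dT) (R : realType) (m : {measure set T -> \bar R}).
Hypothesis H : sigma_finite setT m.
Let f : set T -> \bar R := m.
HB.instance Definition _ := Measure.on f.
HB.instance Definition _ := @Measure_isSigmaFinite.Build _ T R f H.
Definition sigma_finite_pack : {sigma_finite_measure set T -> \bar R} := f.
End SigmaFinitePack.

Definition image_measure d1 d2 (T1 : measurableType d1) (T2 : measurableType d2) (R : realType)
    (m : {measure set T1 -> \bar R}) (f : T1 -> T2) (mf : measurable_fun setT f) :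
    {measure set T2 -> \bar R} :=
  measure_function_pushforward__canonical__measure_function_Measure m mf.

Section HeatRefExists.
Context {R : realType}.

Lemma RintegralE dT (T : measurableType dT) (mu : {measure set T -> \bar R}) (f : T -> R) c :
  mu.-integrable setT (EFin \o f) -> \int[mu]_t f t = c ->
  (\int[mu]_t (f t)%:E = c%:E)%E.
Proof. by move=> i <-; rewrite /Rintegral fineK//; exact: integrable_fin_num. Qed.

Lemma heat_ref_integrable d (m : {measure set (Borel R d) -> \bar R}) s (x xi : 'rV[R]_d) b :
  heat_ref m -> 0 < s ->
  m.-integrable setT (EFin \o (fun y : Borel R d => gauss s x y * cos (dotp xi y + b))).
Proof.
move=> Hm s0; apply: integrableMb; first exact: (Hm s x s0).1.
  apply: (measurableT_comp (f := @cos R)).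
    by apply: continuous_measurable_fun; exact: continuous_cos.
  by apply: measurable_funD => //; apply: measurable_dotp; exact: measurable_coord.
by move=> y; exact: cos_max.
Qed.

Lemma heat_ref_gauss d (m : {measure set (Borel R d) -> \bar R}) s (x : 'rV[R]_d) :
  heat_ref m -> 0 < s -> (\int[m]_y (gauss s x y)%:E = 1)%E.
Proof.
move=> Hm s0; have [i h] := Hm s x s0; apply: RintegralE => //.
have := h 0 0; rewrite !addr0.
have d0 (z : 'rV[R]_d) : dotp 0 z = 0 by rewrite /dotp big1// => k _; rewrite mxE mul0r.
rewrite !d0 mulr0 oppr0 expR0 cos0 mulr1 => <-.
by apply: eq_Rintegral => y _; rewrite d0 addr0 cos0 mulr1.
Qed.

Let cons_rV d (p : R * 'rV[R]_d) : 'rV[R]_d.+1 :=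
  \row_i (if unlift ord0 i is Some j then p.2 0 j else p.1).
Let tl d (x : 'rV[R]_d.+1) : 'rV[R]_d := \row_i x 0 (lift ord0 i).

Let cons0 d (p : R * 'rV[R]_d) : cons_rV p 0 ord0 = p.1.
Proof. by rewrite mxE unlift_none. Qed.
Let consS d (p : R * 'rV[R]_d) i : cons_rV p 0 (lift ord0 i) = p.2 0 i.
Proof. by rewrite mxE liftK. Qed.

Let dotp_cons d (xi : 'rV[R]_d.+1) p : dotp xi (cons_rV p) = xi 0 ord0 * p.1 + dotp (tl xi) p.2.
Proof.
rewrite /dotp big_ord_recl cons0; congr (_ + _); apply: eq_bigr => i _.
by rewrite consS mxE.
Qed.

Let dotp_tl d (xi x : 'rV[R]_d.+1) : dotp xi x = xi 0 ord0 * x 0 ord0 + dotp (tl xi) (tl x).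
Proof. by rewrite /dotp big_ord_recl; congr (_ + _); apply: eq_bigr => i _; rewrite !mxE. Qed.

Let gauss_cons d s (x : 'rV[R]_d.+1) p :
  gauss s x (cons_rV p) = gauss1 s (x 0 ord0) p.1 * gauss s (tl x) p.2.
Proof.
rewrite /gauss big_ord_recl cons0; congr (_ * _); apply: eq_bigr => i _.
by rewrite consS mxE.
Qed.

Let mcons d : measurable_fun setT (@cons_rV d : measurableTypeR R * Borel R d -> Borel R d.+1).
Proof.
apply: measurable_rV => i; case: (unliftP ord0 i) => [j ->|->].
  under eq_fun do rewrite consS.
  by apply: (measurableT_comp (measurable_coord j)); exact: measurable_snd.
by under eq_fun do rewrite cons0; exact: measurable_fst.
Qed.

(** Induction on the dimension: the image of the product of Lebesgue measure on the line with the
    previous measure, under prefixing a coordinate; Fubini factorises the Fourier transform. In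
    dimension 0 the measure is the unit mass at the only point. *)
Lemma heat_ref_exists d : exists m : {measure set (Borel R d) -> \bar R}, heat_ref m.
Proof.
elim: d => [|d [m Hm]].
  exists (@dirac _ (Borel R 0) (0 : 'rV[R]_0) R) => s x s0.
  have g1 y : gauss s x y = 1 by rewrite /gauss big_ord0.
  split.
    apply/integrableP; split.
      apply/measurable_EFinP; rewrite (_ : gauss s x = cst 1)//.
      by apply/funext => y; rewrite g1.
    under eq_integral do rewrite /= g1 normr1.
    by rewrite integral_cst//= mul1e diracT ltry.
  move=> xi b; have d0 (y z : 'rV[R]_0) : dotp y z = 0 by rewrite /dotp big_ord0.
  under eq_Rintegral do rewrite g1 mul1r d0.
  by rewrite !d0 mulr0 oppr0 expR0 mul1r Rintegral_cst//= /dirac indicE in_setT mulr1.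
pose ms := sigma_finite_pack (heat_ref_sigma_finite Hm).
pose P := [the {measure set (measurableTypeR R * Borel R d) -> \bar R} of
   (@lebesgue_measure R \x ms)%E].
pose m' := image_measure P (@mcons d).
exists m' => s x s0.
pose g0 t := gauss1 s (x 0 ord0) t.
pose gd (u : 'rV[R]_d) := gauss s (tl x) u.
have mg : measurable_fun setT (gauss s x : Borel R d.+1 -> R) by exact: measurable_gaussr.
have mgd : measurable_fun setT (gd : Borel R d -> R) by exact: measurable_gaussr.
have iP : P.-integrable setT (EFin \o (gauss s x \o @cons_rV d)).
  apply/(@integrable12ltyP _ _ _ _ R (@lebesgue_measure R) ms).
    by apply/measurable_EFinP; exact: (measurableT_comp mg (@mcons d)).
  have E t : (\int[ms]_u `|(EFin \o (gauss s x \o @cons_rV d)) (t, u)|)%E = (g0 t)%:E.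
    under eq_integral do rewrite /= gauss_cons normrM !(ger0_norm (gauss1_ge0 _ _ _)) (ger0_norm (gauss_ge0 _ _ _)) EFinM.
    rewrite /= ge0_integralZl//.
    - by rewrite (heat_ref_gauss _ Hm s0) mule1.
    - exact/measurable_EFinP.
    - by move=> u _; rewrite lee_fin gauss_ge0.
    - by rewrite lee_fin gauss1_ge0.
  under eq_integral do rewrite E.
  have := integrable_gauss1 (x 0 ord0) s0; move=> /integrableP[_]; apply: le_lt_trans.
  apply: ge0_le_integral => //.
  - by move=> t _; rewrite lee_fin gauss1_ge0.
  - by apply/measurable_EFinP; exact: measurable_gauss1.
  - apply: measurableT_comp => //; apply/measurable_EFinP; exact: measurable_gauss1.
  - by move=> t _; rewrite /= lee_fin ler_norm.
split.
  apply: integrable_pushforward => //.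
  exact/measurable_EFinP.
move=> xi b.
have mcs : measurable_fun setT (fun y : Borel R d.+1 => cos (dotp xi y + b)).
  apply: (measurableT_comp (f := @cos R)).
    by apply: continuous_measurable_fun; exact: continuous_cos.
  by apply: measurable_funD => //; apply: measurable_dotp; exact: measurable_coord.
have iPc : P.-integrable setT (EFin \o ((fun y : Borel R d.+1 => gauss s x y * cos (dotp xi y + b)) \o @cons_rV d)).
  have mcc := measurableT_comp mcs (@mcons d).
  exact: (integrableMb iP mcc (fun y => cos_max _)).
rewrite /Rintegral (@integral_pushforward _ _ _ _ _ _ (@mcons d) P setT (fun y : Borel R d.+1 => (gauss s x y * cos (dotp xi y + b))%:E))//; last first.
  by apply/measurable_EFinP; exact: measurable_funM.
rewrite preimage_setT.
rewrite -(@integral12_prod_meas1 _ _ _ _ R (@lebesgue_measure R) ms _ iPc).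
have E t : fubini_F ms (EFin \o ((fun y : Borel R d.+1 => gauss s x y * cos (dotp xi y + b)) \o @cons_rV d)) t =
    (expR (- (s * dotp (tl xi) (tl xi))) * (g0 t * cos (xi 0 ord0 * t + (dotp (tl xi) (tl x) + b))))%:E.
  rewrite /fubini_F.
  transitivity (\int[m]_u ((g0 t)%:E * (gd u * cos (dotp (tl xi) u + (xi 0 ord0 * t + b)))%:E))%E.
    apply: eq_integral => u _; rewrite -EFinM /= gauss_cons dotp_cons /= -mulrA.
    by congr ((_ * (_ * cos _))%:E); ring.
  rewrite integralZl//; last exact: (heat_ref_integrable (tl x) (tl xi) _ Hm s0).
  rewrite (RintegralE (heat_ref_integrable (tl x) (tl xi) _ Hm s0) ((Hm s (tl x) s0).2 _ _)).
  by rewrite -EFinM mulrCA; congr ((_ * (_ * cos _))%:E); ring.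
transitivity (\int[@lebesgue_measure R]_t (expR (- (s * dotp (tl xi) (tl xi))) *
     (g0 t * cos (xi 0 ord0 * t + (dotp (tl xi) (tl x) + b))))).
  by congr fine; apply: eq_integral => t _; exact: E.
have ig0 : (@lebesgue_measure R).-integrable setT (EFin \o (fun t => g0 t * cos (xi 0 ord0 * t + (dotp (tl xi) (tl x) + b)))).
  apply: integrableMb; first exact: integrable_gauss1.
    apply: (measurableT_comp (f := @cos R)).
      by apply: continuous_measurable_fun; exact: continuous_cos.
    by apply: measurable_funD => //; exact: measurable_funM.
  by move=> y; exact: cos_max.
rewrite RintegralZl// (gauss1_char _ _ _ s0).
rewrite (dotp_tl xi xi) (dotp_tl xi x) mulrA -expRD.
by congr (expR _ * cos _); ring.
Qed.

End HeatRefExists.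

(** * Transition kernels and potentials of the sampled walk *)

(** What the analytic part keeps of the subordinator: its one-time laws through their Laplace
    transforms, and [tc_ge], the trace of the unit drift, which bounds the kernel at step [h] by
    [gmax h]. No relation between different times is recorded. *)
Record timechange (R : realType) := TimeChange {
  tc_disp : measure_display;
  tc_space : measurableType tc_disp;
  tc_prob : probability tc_space R;
  tc : R -> tc_space -> R;
  tc_phi : R -> R;
  tc_meas : forall h, measurable_fun setT (tc h);
  tc_ge : forall h w, 0 < h -> h <= tc h w;
  tc_lap : forall h lam, 0 < h -> 0 <= lam ->
    \int[tc_prob]_w expR (- (lam * tc h w)) = expR (- (h * tc_phi lam)) }.

Record refmeasure (R : realType) (d : nat) := RefMeasure {
  refm : {sigma_finite_measure set (Borel R d) -> \bar R};
  refm_heat : heat_ref refm }.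

Section Kernel.
Context {R : realType} {d : nat}.
Variables (X : timechange R) (M : refmeasure R d).
Notation P := (tc_prob X).
Notation m := (refm M).
Implicit Types (x y : 'rV[R]_d) (h : R) (F : set (Borel R d)).

Lemma tc_prob1 : (P setT = 1)%E.
Proof. exact: probability_setT. Qed.

Lemma tc_prob_lty : (P setT < +oo)%E.
Proof. by rewrite probability_setT ltry. Qed.

Lemma tc_eint_cst c : (\int[P]_w c%:E = c%:E)%E.
Proof.
rewrite integral_cst//; transitivity (c%:E * 1)%E; last by rewrite mule1.
by congr (_ * _)%E; exact: tc_prob1.
Qed.

Lemma tc_Rint_cst c : \int[P]_w c = c.
Proof. by rewrite /Rintegral tc_eint_cst. Qed.

(** The heat kernel on the diagonal at time [h]. Since the random time is at least [h], it bounds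
    the mixed kernel [kern h] as well. *)
Definition gmax h : R := (Num.sqrt (4 * pi * h))^-1 ^+ d.

Lemma gmax_ge0 h : 0 <= gmax h.
Proof. by rewrite exprn_ge0// invr_ge0. Qed.

Lemma gauss_le_gmax h s x y : 0 < h -> h <= s -> gauss s x y <= gmax h.
Proof.
move=> h0 hs; rewrite gaussE /gmax -[leRHS]mulr1; apply: ler_pM.
- by rewrite exprn_ge0// invr_ge0.
- exact: expR_ge0.
- apply: lerXn2r; rewrite ?nnegrE ?invr_ge0// lef_pV2 ?posrE.
  + by apply: ler_wsqrtr; rewrite ler_pM2l// mulr_gt0// pi_gt0.
  + by rewrite sqrtr_gt0 !mulr_gt0 ?pi_gt0// (lt_le_trans h0).
  + by rewrite sqrtr_gt0 !mulr_gt0 ?pi_gt0.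
- rewrite -expR0 ler_expR oppr_le0 mulr_ge0//; last first.
    by rewrite invr_ge0 mulr_ge0// (le_trans (ltW h0)).
  by apply: sumr_ge0 => i _; rewrite -expr2 sqr_ge0.
Qed.

Lemma gauss_sym s x y : gauss s x y = gauss s y x.
Proof.
by apply: eq_bigr => i _; rewrite /gauss1 -[(x 0 i - y 0 i) ^+ 2]sqrrN opprB.
Qed.

Definition kern h x y : R := \int[P]_w gauss (tc h w) x y.

Lemma measurable_gauss_tc h x y : measurable_fun setT (fun w => gauss (tc (t:=X) h w) x y).
Proof.
by apply: measurable_gauss => //; exact: tc_meas.
Qed.

Lemma integrable_gauss_tc h x y : 0 < h ->
  P.-integrable setT (EFin \o (fun w => gauss (tc h w) x y)).
Proof.
move=> h0; apply: measurable_bounded_integrable => //.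
- exact: tc_prob_lty.
- exact: measurable_gauss_tc.
- exists (gmax h); split; first exact: num_real.
  move=> z hz w _; rewrite /= ger0_norm ?gauss_ge0//.
  by apply: (le_trans _ (ltW hz)); apply: gauss_le_gmax => //; exact: tc_ge.
Qed.

Lemma kern_ge0 h x y : 0 <= kern h x y.
Proof. by apply: Rintegral_ge0 => w _; exact: gauss_ge0. Qed.

Lemma kernE h x y : 0 < h -> (kern h x y)%:E = (\int[P]_w (gauss (tc h w) x y)%:E)%E.
Proof. by move=> h0; rewrite /kern /Rintegral fineK//; apply: integrable_fin_num => //; exact: integrable_gauss_tc. Qed.

Lemma kern_le h x y c : 0 < h -> (forall s, h <= s -> gauss s x y <= c) -> kern h x y <= c.
Proof.
move=> h0 H.
rewrite -[leRHS]tc_Rint_cst.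
apply: le_Rintegral => //; first exact: integrable_gauss_tc.
  by apply: finite_measure_integrable_cst.
by move=> w _; apply: H; exact: tc_ge.
Qed.

Lemma kern_le_gmax h x y : 0 < h -> kern h x y <= gmax h.
Proof. by move=> h0; apply: kern_le => // s; exact: gauss_le_gmax. Qed.

Lemma kern_sym h x y : kern h x y = kern h y x.
Proof. by apply: eq_Rintegral => w _; exact: gauss_sym. Qed.

Lemma measurable_gauss3 h :
  measurable_fun setT (fun z : (Borel R d * Borel R d) * tc_space X =>
    (gauss (tc h z.2) z.1.1 z.1.2)%:E).
Proof.
apply/measurable_EFinP; apply: measurable_gauss.
- by apply: (measurableT_comp (tc_meas h)); exact: measurable_snd.
- move=> i; apply: (measurableT_comp (measurable_coord i)).
  by apply: measurableT_comp; [exact: measurable_fst|exact: measurable_fst].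
- move=> i; apply: (measurableT_comp (measurable_coord i)).
  by apply: measurableT_comp; [exact: measurable_snd|exact: measurable_fst].
Qed.

Lemma measurable_kern2 h : 0 < h ->
  measurable_fun setT (fun z : Borel R d * Borel R d => kern h z.1 z.2).
Proof.
move=> h0; apply/measurable_EFinP.
rewrite (_ : _ \o _ = fubini_F P (fun z : (Borel R d * Borel R d) * tc_space X =>
    (gauss (tc h z.2) z.1.1 z.1.2)%:E)).
  apply: measurable_fun_fubini_tonelli_F; first exact: measurable_gauss3.
  by move=> z /=; rewrite lee_fin gauss_ge0.
by apply/funext => z /=; rewrite kernE.
Qed.

Lemma measurable_kern h x : 0 < h -> measurable_fun setT (kern h x : Borel R d -> R).
Proof.
move=> h0; exact: (measurable_fun_pair2 (x : Borel R d) (measurable_kern2 h0)).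
Qed.

(* Tonelli in the mixing variable: the kernel averages Gaussian kernels. *)
Lemma kern_mix h x F (f : Borel R d -> \bar R) : 0 < h -> measurable F ->
  measurable_fun setT f -> (forall y, 0 <= f y)%E ->
  (\int[m]_(y in F) ((kern h x y)%:E * f y) =
   \int[P]_w \int[m]_(y in F) ((gauss (tc h w) x y)%:E * f y))%E.
Proof.
move=> h0 mF mf f0.
pose G (z : Borel R d * tc_space X) : \bar R :=
  ((gauss (tc h z.2) x z.1)%:E * (f z.1 * (\1_F z.1)%:E))%E.
have mG : measurable_fun setT G.
  apply: emeasurable_funM.
    apply/measurable_EFinP; apply: measurable_gauss => //.
    - by apply: (measurableT_comp (tc_meas h)); exact: measurable_snd.
    - by move=> i; apply: (measurableT_comp (measurable_coord i)); exact: measurable_fst.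
  apply: emeasurable_funM; first by apply: (measurableT_comp mf); exact: measurable_fst.
  apply/measurable_EFinP; apply: (measurableT_comp (f := \1_F : Borel R d -> R)); last exact: measurable_fst.
  exact: measurable_indic.
have G0 z : (0 <= G z)%E by rewrite !mule_ge0// lee_fin ?gauss_ge0.
have := @fubini_tonelli _ _ _ _ R m P G mG G0; rewrite /fubini_F /fubini_G => FT.
transitivity (\int[m]_y \int[P]_w G (y, w))%E.
  rewrite integral_mkcond; apply: eq_integral => y _.
  rewrite patchE; case: ifPn => yF; last first.
    by rewrite integral0_eq// => w _; rewrite /G /= indicE (negPf yF) mule0 mule0.
  rewrite /G /= kernE// -ge0_integralZr//.
  - by apply: eq_integral => w _; rewrite indicE yF mule1.
  - by apply/measurable_EFinP; exact: measurable_gauss_tc.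
  - by move=> w _; rewrite lee_fin gauss_ge0.
rewrite FT; apply: eq_integral => w _.
rewrite [RHS]integral_mkcond; apply: eq_integral => y _.
rewrite patchE /G /= indicE; case: ifPn => yF; first by rewrite mule1.
by rewrite mule0 mule0.
Qed.

Lemma kern_total h x : 0 < h -> (\int[m]_y (kern h x y)%:E = 1)%E.
Proof.
move=> h0; have := @kern_mix h x setT (cst 1%E) h0 measurableT.
move=> /(_ (@measurable_cst _ _ _ _ _ _) (fun _ => lee01)).
under eq_integral do rewrite mule1.
move=> ->; transitivity (\int[P]_w (cst 1 w))%E.
  apply: eq_integral => w _; under eq_integral do rewrite mule1.
  by rewrite (heat_ref_gauss _ (refm_heat M))// (lt_le_trans h0)// tc_ge.
exact: (tc_eint_cst 1).
Qed.

Lemma integrable_kern h x : 0 < h -> m.-integrable setT (EFin \o kern h x).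
Proof.
move=> h0; apply/integrableP; split.
  by apply/measurable_EFinP; exact: measurable_kern.
under eq_integral do rewrite /= ger0_norm ?kern_ge0//.
by rewrite kern_total// ltry.
Qed.

Lemma kern_char h x xi b : 0 < h ->
  \int[m]_y (kern h x y * cos (dotp xi y + b)) =
  expR (- (h * tc_phi X (dotp xi xi))) * cos (dotp xi x + b).
Proof.
move=> h0.
have xi0 : 0 <= dotp xi xi by apply: sumr_ge0 => i _; rewrite -expr2 sqr_ge0.
have mc : measurable_fun setT (fun y : Borel R d => cos (dotp xi y + b)).
  apply: (measurableT_comp (f := @cos R)).
    by apply: continuous_measurable_fun; exact: continuous_cos.
  by apply: measurable_funD => //; apply: measurable_dotp; exact: measurable_coord.
have ik := integrableMb (integrable_kern x h0) mc (fun y => cos_max _).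
(* shift the cosine to a nonnegative function to use Tonelli *)
have H : (\int[m]_y ((kern h x y)%:E * (1 + cos (dotp xi y + b))%:E) =
   (1 + expR (- (h * tc_phi X (dotp xi xi))) * cos (dotp xi x + b))%:E)%E.
  have f0 y : (0 <= (1 + cos (dotp xi y + b))%:E)%E.
    by rewrite lee_fin; have := cos_geN1 (dotp xi y + b); lra.
  have mf : measurable_fun setT (fun y : Borel R d => (1 + cos (dotp xi y + b))%:E).
    by apply/measurable_EFinP; apply: measurable_funD.
  rewrite (kern_mix x h0 measurableT mf f0).
  transitivity (\int[P]_w (1 + expR (- (dotp xi xi * tc h w)) * cos (dotp xi x + b))%:E)%E.
    apply: eq_integral => w _.
    have s0 : 0 < tc h w by rewrite (lt_le_trans h0)// tc_ge.
    have [ig hg] : _ /\ _ := @refm_heat _ _ M _ x s0.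
    have ic := heat_ref_integrable x xi b (refm_heat M) s0.
    have -> : (\int[m]_y ((gauss (tc h w) x y)%:E * (1 + cos (dotp xi y + b))%:E) =
      \int[m]_y ((gauss (tc h w) x y)%:E + (gauss (tc h w) x y * cos (dotp xi y + b))%:E))%E.
      by apply: eq_integral => y _; rewrite -EFinM -EFinD mulrDr mulr1.
    rewrite integralD_EFin//.
    rewrite (heat_ref_gauss _ (refm_heat M) s0) (RintegralE ic (hg xi b)) -EFinD.
    by rewrite (mulrC (tc h w)).
  have ie : P.-integrable setT (EFin \o (fun w => expR (- (dotp xi xi * tc h w)))).
    apply: measurable_bounded_integrable => //.
    - exact: tc_prob_lty.
    - apply: measurableT_comp => //; apply: measurable_funN; apply: measurable_funM => //.
      exact: tc_meas.
    - exists 1; split; first exact: num_real.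
      move=> z hz w _; rewrite /= ger0_norm ?expR_ge0// (le_trans _ (ltW hz))//.
      rewrite -expR0 ler_expR oppr_le0 mulr_ge0// (le_trans (ltW h0))//; exact: tc_ge.
  have i1 : P.-integrable setT (EFin \o cst (1:R)) by exact: finite_measure_integrable_cst.
  have := @Rintegral_lin _ _ _ P _ _ 1 (cos (dotp xi x + b)) i1 ie.
  have := @integrable_lin _ _ _ P _ _ 1 (cos (dotp xi x + b)) i1 ie.
  move=> il; rewrite (tc_lap X h0 xi0).
  have -> : \int[P]_w cst 1 w = 1 :> R by exact: tc_Rint_cst.
  move=> e.
  transitivity (\int[P]_w (1 * cst 1 w + cos (dotp xi x + b) * expR (- (dotp xi xi * tc h w)))%:E)%E.
    by apply: eq_integral => w _; rewrite mul1r mulrC.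
  by rewrite (RintegralE il e) mulr1 (mulrC (cos _)).
have E : (\int[m]_y ((kern h x y)%:E * (1 + cos (dotp xi y + b))%:E) =
   1 + (\int[m]_y (kern h x y * cos (dotp xi y + b)))%:E)%E.
  rewrite -(RintegralE ik erefl) -(kern_total x h0) -integralD_EFin//; last exact: integrable_kern.
  by apply: eq_integral => y _; rewrite -EFinM -EFinD mulrDr mulr1.
rewrite E -EFinD in H; by have [/addrI] := H.
Qed.

End Kernel.

Section Operator.
Context {R : realType} {d : nat}.
Variables (X : timechange R) (M : refmeasure R d).
Notation m := (refm M).
Notation k := (@kern R d X).
Implicit Types (x y : 'rV[R]_d) (h : R) (F : set (Borel R d)) (f g : Borel R d -> \bar R).
Local Open Scope ereal_scope.

Definition nonneg f := measurable_fun setT f /\ forall y, 0 <= f y.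

Fact Qop_key : unit. Proof. exact: tt. Qed.

(** One step of the walk, killed when it lands outside [F]. Only the landing point is tested, so the
    starting point [x] may be anywhere. *)
Definition Qop h F f : Borel R d -> \bar R :=
  locked_with Qop_key (fun x => \int[m]_(y in F) ((k h x y)%:E * f y)).

Lemma QopE h F f x : Qop h F f x = \int[m]_(y in F) ((k h x y)%:E * f y).
Proof. by rewrite /Qop unlock. Qed.

Lemma nonneg_kern_mul h x f : (0 < h)%R -> nonneg f ->
  nonneg (fun y => (k h x y)%:E * f y).
Proof.
move=> h0 [mf f0]; split; last by move=> y; rewrite mule_ge0// lee_fin kern_ge0.
by apply: emeasurable_funM => //; apply/measurable_EFinP; exact: measurable_kern.
Qed.

Lemma nonneg_indic F : measurable F -> nonneg (fun y => (\1_F y)%:E).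
Proof.
move=> mF; split; last by move=> y; rewrite lee_fin.
by apply/measurable_EFinP; exact: measurable_indic.
Qed.

Lemma nonneg_mul f g : nonneg f -> nonneg g -> nonneg (fun y => f y * g y).
Proof.
move=> [mf f0] [mg g0]; split; last by move=> y; rewrite mule_ge0.
exact: emeasurable_funM.
Qed.

Lemma nonneg_add f g : nonneg f -> nonneg g -> nonneg (fun y => f y + g y).
Proof.
move=> [mf f0] [mg g0]; split; last by move=> y; rewrite adde_ge0.
exact: emeasurable_funD.
Qed.

Lemma nonneg_cst (c : R) : (0 <= c)%R -> nonneg (fun=> c%:E).
Proof. by move=> c0; split => // y; rewrite lee_fin. Qed.

Lemma nonneg_scale (c : R) f : (0 <= c)%R -> nonneg f -> nonneg (fun y => c%:E * f y).
Proof. by move=> c0; apply: nonneg_mul; exact: nonneg_cst. Qed.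

Lemma Qop_nonneg h F f : (0 < h)%R -> measurable F -> nonneg f -> nonneg (Qop h F f).
Proof.
move=> h0 mF nf; have [mf f0] := nf; split; last first.
  by move=> x; rewrite QopE; apply: integral_ge0 => y _; rewrite mule_ge0// lee_fin kern_ge0.
rewrite (_ : Qop h F f = fubini_F m (fun z : Borel R d * Borel R d =>
   (k h z.1 z.2)%:E * (f z.2 * (\1_F z.2)%:E))).
  apply: measurable_fun_fubini_tonelli_F.
    apply: emeasurable_funM.
      by apply/measurable_EFinP; exact: measurable_kern2.
    apply: (measurableT_comp (f := fun y : Borel R d => f y * (\1_F y)%:E)); last exact: measurable_snd.
    by have [] := nonneg_mul nf (nonneg_indic mF).
  by move=> z /=; rewrite !mule_ge0// lee_fin// kern_ge0.
apply/funext => x; rewrite QopE /fubini_F [LHS]integral_mkcond.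
apply: eq_integral => y _; rewrite patchE /= indicE.
by case: ifPn => _; rewrite ?mule1 ?mule0.
Qed.

Lemma Qop_le h F f g x : (0 < h)%R -> measurable F -> nonneg f -> nonneg g ->
  (forall y, F y -> f y <= g y) -> Qop h F f x <= Qop h F g x.
Proof.
move=> h0 mF nf ng fg.
have [m1 p1] := nonneg_kern_mul x h0 nf; have [m2 p2] := nonneg_kern_mul x h0 ng.
rewrite !QopE; apply: ge0_le_integral => //.
- exact: measurable_funTS.
- exact: measurable_funTS.
- by move=> y Fy; apply: lee_wpmul2l; [rewrite lee_fin kern_ge0|exact: fg].
Qed.

Lemma Qop_leF h F F' f x : (0 < h)%R -> measurable F -> measurable F' -> nonneg f ->
  F `<=` F' -> Qop h F f x <= Qop h F' f x.
Proof.
move=> h0 mF mF' nf FF'.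
have [m1 p1] := nonneg_kern_mul x h0 nf.
by rewrite !QopE; apply: ge0_subset_integral => //; exact: measurable_funTS.
Qed.

Lemma QopD h F f g x : (0 < h)%R -> measurable F -> nonneg f -> nonneg g ->
  Qop h F (fun y => f y + g y) x = Qop h F f x + Qop h F g x.
Proof.
move=> h0 mF nf ng.
have [m1 p1] := nonneg_kern_mul x h0 nf; have [m2 p2] := nonneg_kern_mul x h0 ng.
rewrite !QopE -ge0_integralD//; [|exact: measurable_funTS|exact: measurable_funTS].
by apply: eq_integral => y _; rewrite ge0_muleDr//; [case: nf|case: ng].
Qed.

Lemma QopZ h F (c : R) f x : (0 < h)%R -> measurable F -> (0 <= c)%R -> nonneg f ->
  Qop h F (fun y => c%:E * f y) x = c%:E * Qop h F f x.
Proof.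
move=> h0 mF c0 nf; have [m1 p1] := nonneg_kern_mul x h0 nf.
rewrite !QopE -ge0_integralZl//; [|exact: measurable_funTS].
by apply: eq_integral => y _; rewrite muleCA.
Qed.

Lemma Qop_eq h F f g x : (forall y, F y -> f y = g y) -> Qop h F f x = Qop h F g x.
Proof. by move=> fg; rewrite !QopE; apply: eq_integral => y /set_mem yF; rewrite fg. Qed.

Lemma QopU h F F' f x : (0 < h)%R -> measurable F -> measurable F' -> nonneg f ->
  [disjoint F & F'] -> Qop h (F `|` F') f x = Qop h F f x + Qop h F' f x.
Proof.
move=> h0 mF mF' nf FF'; have [m1 p1] := nonneg_kern_mul x h0 nf.
by rewrite !QopE ge0_integral_setU//; exact: measurable_funTS.
Qed.

Lemma Qop_cst_le h F (c : R) x : (0 < h)%R -> measurable F -> (0 <= c)%R ->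
  Qop h F (fun=> c%:E) x <= c%:E.
Proof.
move=> h0 mF c0; apply: (le_trans (Qop_leF x h0 mF measurableT (nonneg_cst c0) _)) => //.
rewrite QopE; under eq_integral do rewrite muleC.
rewrite ge0_integralZl//; first by rewrite kern_total// mule1.
- by apply/measurable_EFinP; exact: measurable_kern.
- by move=> y _; rewrite lee_fin kern_ge0.
Qed.

Lemma Qop_mkcond h F f x : Qop h F f x = \int[m]_y ((k h x y)%:E * (f y * (\1_F y)%:E)).
Proof.
rewrite QopE integral_mkcond; apply: eq_integral => y _.
by rewrite patchE indicE; case: ifPn => _; rewrite ?mule1 ?mule0.
Qed.

Lemma integral_indic_mul F f : \int[m]_(y in F) f y = \int[m]_y (f y * (\1_F y)%:E).
Proof.
rewrite integral_mkcond; apply: eq_integral => y _.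
by rewrite patchE indicE; case: ifPn => _; rewrite ?mule1 ?mule0.
Qed.

Lemma Qop_sym h F f g : (0 < h)%R -> measurable F -> nonneg f -> nonneg g ->
  \int[m]_(x in F) (g x * Qop h F f x) = \int[m]_(x in F) (f x * Qop h F g x).
Proof.
move=> h0 mF nf ng.
pose f1 y := f y * (\1_F y)%:E; pose g1 y := g y * (\1_F y)%:E.
have [mf1 p1] : nonneg f1 := nonneg_mul nf (nonneg_indic mF).
have [mg1 q1] : nonneg g1 := nonneg_mul ng (nonneg_indic mF).
pose G (z : Borel R d * Borel R d) : \bar R := g1 z.1 * ((k h z.1 z.2)%:E * f1 z.2).
have mG : measurable_fun setT G.
  apply: emeasurable_funM.
    by apply: (measurableT_comp mg1); exact: measurable_fst.
  apply: emeasurable_funM; first by apply/measurable_EFinP; exact: measurable_kern2.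
  by apply: (measurableT_comp mf1); exact: measurable_snd.
have G0 z : 0 <= G z.
  by rewrite /G mule_ge0//; apply: mule_ge0 => //; rewrite lee_fin kern_ge0.
have := @fubini_tonelli _ _ _ _ R m m G mG G0; rewrite /fubini_F /fubini_G => FT.
transitivity (\int[m]_x \int[m]_y G (x, y)).
  rewrite integral_indic_mul; apply: eq_integral => x _.
  transitivity (g1 x * Qop h F f x); first by rewrite /g1 -!muleA; congr (_ * _); rewrite muleC.
  have [k1 k2] := nonneg_kern_mul x h0 (conj mf1 p1).
  by rewrite Qop_mkcond -(ge0_integralZl _ measurableT k1 (fun y _ => k2 y) (q1 x)).
rewrite FT integral_indic_mul; apply: eq_integral => x _.
transitivity (f1 x * Qop h F g x); last by rewrite /f1 -!muleA; congr (_ * _); rewrite muleC.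
transitivity (\int[m]_y (f1 x * ((k h x y)%:E * g1 y))).
  by apply: eq_integral => y _; rewrite /G /= kern_sym; rewrite muleCA [in RHS]muleCA; congr (_ * _); rewrite muleC.
have [k1 k2] := nonneg_kern_mul x h0 (conj mg1 q1).
by rewrite Qop_mkcond (ge0_integralZl _ measurableT k1 (fun y _ => k2 y) (p1 x)).
Qed.

Lemma Qop0 h F x : Qop h F (fun=> 0) x = 0.
Proof. by rewrite QopE; apply: integral0_eq => y _; rewrite mule0. Qed.

End Operator.

Section Iterates.
Context {R : realType} {d : nat}.
Variables (X : timechange R) (M : refmeasure R d) (h : R) (F : set (Borel R d)).
Hypotheses (h0 : 0 < h) (mF : measurable F).
Notation m := (refm M).
Notation Q := (Qop X M h F).
Implicit Types (x y : 'rV[R]_d) (f g : Borel R d -> \bar R) (n : nat).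
Local Open Scope ereal_scope.

(* [Uop n f] is [h] times the sum of the iterates [Q^k f], [1 <= k <= n]. *)
Fixpoint Uop n f : Borel R d -> \bar R :=
  if n is n'.+1 then Q (fun y => h%:E * f y + Uop n' f y) else fun=> 0.

Let h0' : (0 <= h)%R. Proof. exact: ltW. Qed.

Lemma Qiter_nonneg n f : nonneg f -> nonneg (iter n Q f).
Proof. by move=> nf; elim: n => //= n IH; exact: Qop_nonneg. Qed.

Lemma Uop_nonneg n f : nonneg f -> nonneg (Uop n f).
Proof.
move=> nf; elim: n => [|n IH] /=; first exact: (nonneg_cst (lexx 0%R)).
by apply: Qop_nonneg => //; apply: nonneg_add => //; exact: nonneg_scale.
Qed.

Lemma Usrc_nonneg n f : nonneg f -> nonneg (fun y => h%:E * f y + Uop n f y).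
Proof. by move=> nf; apply: nonneg_add; [exact: nonneg_scale|exact: Uop_nonneg]. Qed.

Lemma UopS n f x : nonneg f -> Uop n.+1 f x = h%:E * Q f x + Q (Uop n f) x.
Proof.
move=> nf /=; rewrite QopD//; [|exact: nonneg_scale|exact: Uop_nonneg].
by rewrite QopZ.
Qed.

Lemma Qiter_le n f g x : nonneg f -> nonneg g -> (forall y, f y <= g y) ->
  iter n Q f x <= iter n Q g x.
Proof.
move=> nf ng fg; elim: n x => [|n IH] x //=.
by apply: Qop_le => //; exact: Qiter_nonneg.
Qed.

Lemma Uop_le n f g x : nonneg f -> nonneg g -> (forall y, f y <= g y) ->
  Uop n f x <= Uop n g x.
Proof.
move=> nf ng fg; elim: n x => [|n IH] x //=.
apply: Qop_le => //; [exact: Usrc_nonneg|exact: Usrc_nonneg|move=> y _].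
by apply: leeD => //; apply: lee_wpmul2l => //; rewrite lee_fin.
Qed.

Lemma UopZ n (c : R) f x : (0 <= c)%R -> nonneg f ->
  Uop n (fun y => c%:E * f y) x = c%:E * Uop n f x.
Proof.
move=> c0 nf; elim: n x => [|n IH] x /=; first by rewrite mule0.
rewrite -QopZ//; last exact: Usrc_nonneg.
apply: Qop_eq => y _; rewrite IH muleDr//; first by rewrite muleCA.
rewrite ge0_adde_def// inE; last by have [] := Uop_nonneg n nf.
by rewrite mule_ge0// ?lee_fin//; case: nf.
Qed.

Lemma Uop_Q n f x : nonneg f -> Uop n (Q f) x = Q (Uop n f) x.
Proof.
move=> nf; elim: n x => [|n IH] x.
  by rewrite /= Qop0.
rewrite UopS; last exact: Qop_nonneg.
transitivity (Q (fun y => h%:E * Q f y + Q (Uop n f) y) x).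
  rewrite (QopD X M x h0 mF (nonneg_scale h0' (Qop_nonneg X M h0 mF nf))); last first.
    by apply: Qop_nonneg => //; exact: Uop_nonneg.
  rewrite (QopZ X M x h0 mF h0' (Qop_nonneg X M h0 mF nf)).
  by congr (_ + _); apply: Qop_eq => y _; exact: IH.
by apply: Qop_eq => y _; rewrite UopS.
Qed.

Lemma Uop_Qiter n k f x : nonneg f -> Uop n (iter k Q f) x = iter k Q (Uop n f) x.
Proof.
move=> nf; elim: k x => [|k IH] x //=.
rewrite Uop_Q//; last exact: Qiter_nonneg.
by apply: Qop_eq => y _; exact: IH.
Qed.

Lemma UopD k n f x : nonneg f -> Uop (k + n) f x = Uop k f x + iter k Q (Uop n f) x.
Proof.
move=> nf; elim: k x => [|k IH] x; first by rewrite add0n add0e.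
rewrite addSn UopS// UopS//= -addeA; congr (_ + _).
rewrite -QopD//; [|exact: Uop_nonneg|exact/Qiter_nonneg/Uop_nonneg].
by apply: Qop_eq => y _; exact: IH.
Qed.

Lemma Uop1 f x : nonneg f -> Uop 1 f x = h%:E * Q f x.
Proof.
move=> nf; by rewrite UopS//= Qop0 adde0.
Qed.

Lemma iterQZ n (c : R) f x : (0 <= c)%R -> nonneg f ->
  iter n Q (fun y => c%:E * f y) x = c%:E * iter n Q f x.
Proof.
move=> c0 nf; elim: n x => [|n IH] x //=.
rewrite -QopZ//; last exact: Qiter_nonneg.
by apply: Qop_eq => y _; exact: IH.
Qed.

Lemma Uop_rec n f x : nonneg f -> Uop n.+1 f x = Uop n f x + h%:E * iter n.+1 Q f x.
Proof.
move=> nf; rewrite -addn1 UopD//; congr (_ + _).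
rewrite addn1; elim: n x => [|n IH] x; first exact: Uop1.
rewrite iterS [in RHS]iterS -(QopZ _ _ _ h0 mF h0' (Qiter_nonneg n.+1 nf)).
by apply: Qop_eq => y _; exact: IH.
Qed.

Lemma Uop_sum n f x : nonneg f -> Uop n f x = \sum_(i < n) h%:E * iter i.+1 Q f x.
Proof.
move=> nf; elim: n => [|n IH]; first by rewrite big_ord0.
by rewrite Uop_rec// big_ord_recr/= IH.
Qed.

Lemma Uop_mono n k f x : nonneg f -> (n <= k)%N -> Uop n f x <= Uop k f x.
Proof.
move=> nf nk; rewrite -(subnKC nk) UopD// leeDl//.
by have [_] := Qiter_nonneg n (Uop_nonneg (k - n) nf).
Qed.

(** Each iterate satisfies [Q^j U_n f <= U_(j + n) f <= U_(k + n) f], and there are [k] of them with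
    weight [h]. It chains two lower bounds: time spent in a set as seen from the start, then the
    potential of [f] as seen from that set. *)
Lemma Uop_Uop k n f x : nonneg f ->
  Uop k (Uop n f) x <= (k%:R * h)%:E * Uop (k + n) f x.
Proof.
move=> nf; have nU j := Uop_nonneg j nf.
elim: k => [|k IH]; first by rewrite mul0r mul0e.
rewrite Uop_rec// -natr1 mulrDl mul1r EFinD ge0_muleDl//; [|by rewrite lee_fin mulr_ge0].
apply: leeD.
  apply: (le_trans IH); apply: lee_wpmul2l; first by rewrite lee_fin mulr_ge0.
  exact: Uop_mono.
apply: lee_wpmul2l; first by rewrite lee_fin.
by rewrite (UopD k.+1 n x nf) leeDr//; case: (nU k.+1).
Qed.

Lemma Uop_sym n f g : nonneg f -> nonneg g ->
  \int[m]_(x in F) (g x * Uop n f x) = \int[m]_(x in F) (f x * Uop n g x).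
Proof.
elim: n f g => [|n IH] f g nf ng.
  by rewrite /=; under eq_integral do rewrite mule0; under [RHS]eq_integral do rewrite mule0.
rewrite /= (Qop_sym X M h0 mF (Usrc_nonneg n nf) ng).
have [mf pf] := nf; have nQ : nonneg (Q g) by exact: Qop_nonneg.
have [mQ pQ] := nQ.
transitivity (\int[m]_(x in F) (f x * (h%:E * Q g x)) + \int[m]_(x in F) (f x * Uop n (Q g) x)).
  rewrite -IH// -ge0_integralD//.
  - apply: eq_integral => y _; rewrite ge0_muleDl//.
    + by rewrite (muleC h%:E) -muleA; congr (_ + _); rewrite muleC.
    + by rewrite mule_ge0// lee_fin.
    + by have [] := Uop_nonneg n nf.
  - by move=> y _; rewrite !mule_ge0.
  - by apply: measurable_funTS; have [] := nonneg_mul nf (nonneg_scale h0' nQ).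
  - by move=> y _; rewrite mule_ge0//; have [] := Uop_nonneg n nf.
  - by apply: measurable_funTS; have [] := nonneg_mul nQ (Uop_nonneg n nf).
rewrite -ge0_integralD//.
- apply: eq_integral => y _; rewrite -ge0_muleDr//.
  + by congr (_ * _); rewrite Uop_Q// -UopS.
  + by rewrite mule_ge0// lee_fin.
  + by have [] := Uop_nonneg n nQ.
- by move=> y _; rewrite !mule_ge0.
- by apply: measurable_funTS; have [] := nonneg_mul nf (nonneg_scale h0' nQ).
- by move=> y _; rewrite mule_ge0//; have [] := Uop_nonneg n nQ.
- by apply: measurable_funTS; have [] := nonneg_mul nf (Uop_nonneg n nQ).
Qed.

End Iterates.

(** * Measures with a density, and the semigroup property of the kernel *)

Section Density.
Context d (T : measurableType d) (R : realType) (mu : {measure set T -> \bar R}).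
Variable w : T -> R.
Hypotheses (mw : measurable_fun setT w) (w0 : forall x, 0 <= w x).
Local Open Scope ereal_scope.

Definition density : set T -> \bar R := fun A => \int[mu]_(x in A) (w x)%:E.

Let mwE : measurable_fun setT (EFin \o w). Proof. exact/measurable_EFinP. Qed.
Let wE0 x : 0 <= (w x)%:E. Proof. by rewrite lee_fin. Qed.

Let density0 : density set0 = 0.
Proof. by rewrite /density integral_set0. Qed.

Let density_ge0 A : 0 <= density A.
Proof. by apply: integral_ge0. Qed.

Let density_sigma_additive : semi_sigma_additive density.
Proof.
move=> F mF tF mUF; rewrite /density; apply: cvg_toP.
  apply: ereal_nondecreasing_is_cvgn => m n mn.
  apply: lee_sum_nneg_natr => // k _ _; exact: integral_ge0.
by rewrite ge0_integral_bigcup//=; exact: measurable_funTS.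
Qed.

HB.instance Definition _ := isMeasure.Build _ _ _ density
  density0 density_ge0 density_sigma_additive.

Definition density_measure : {measure set T -> \bar R} := density.

Import HBNNSimple.

Let integral_density_nnsfun (f : {nnsfun T >-> R}) :
  \int[density_measure]_x (f x)%:E = \int[mu]_x ((w x)%:E * (f x)%:E).
Proof.
under [LHS]eq_integral do rewrite fimfunE -fsumEFin//.
rewrite [LHS]ge0_integral_fsum//; last 2 first.
  - by move=> r; exact/measurable_EFinP/measurableT_comp.
  - by move=> n x _; rewrite EFinM nnfun_muleindic_ge0.
under [RHS]eq_integral.
  move=> x xD; rewrite fimfunE -fsumEFin// ge0_mule_fsumr; last first.
    by move=> r; rewrite EFinM nnfun_muleindic_ge0.
  over.
rewrite [RHS]ge0_integral_fsum//; last 2 first.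
  - move=> r; apply: emeasurable_funM => //.
    by apply/measurable_EFinP; do 2 apply/measurableT_comp => //.
  - by move=> n x _; rewrite EFinM mule_ge0// nnfun_muleindic_ge0.
apply: eq_fsbigr => r rr.
rewrite integralZl_indic_nnsfun// integral_indic// setIT.
have r0 : 0 <= r%:E by rewrite lee_fin; move: rr; rewrite inE/= => -[t _ <-].
transitivity (\int[mu]_x (r%:E * ((w x)%:E * (\1_(f @^-1` [set r]) x)%:E))); last first.
  by apply: eq_integral => x _; rewrite EFinM muleCA.
rewrite ge0_integralZl//.
- congr (_ * _); rewrite /density_measure/= /density integral_mkcond.
  apply: eq_integral => x _; rewrite patchE indicE.
  by case: ifPn => _; rewrite ?mule1 ?mule0.
- apply: emeasurable_funM => //; apply/measurable_EFinP; exact: measurable_indic.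
- by move=> x _; rewrite mule_ge0// lee_fin.
Qed.

Lemma integral_density (f : T -> \bar R) :
  measurable_fun setT f -> (forall x, 0 <= f x) ->
  \int[density_measure]_x f x = \int[mu]_x ((w x)%:E * f x).
Proof.
move=> mf f0.
pose f_ := nnsfun_approx measurableT mf.
have cf x : ((f_ n x)%:E @[n --> \oo]) --> f x by exact: cvg_nnsfun_approx.
transitivity (lim (\int[density_measure]_x (f_ n x)%:E @[n --> \oo])).
  rewrite -monotone_convergence//=.
  - by apply: eq_integral => x _; apply/esym/cvg_lim.
  - by move=> n; exact/measurable_EFinP/measurable_funTS.
  - by move=> n x _; rewrite lee_fin.
  - by move=> x _ a b ab; rewrite lee_fin; exact/lefP/nd_nnsfun_approx.
transitivity (lim (\int[mu]_x ((w x)%:E * (f_ n x)%:E) @[n --> \oo])).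
  by apply: congr_lim; apply/funext => n; exact: integral_density_nnsfun.
rewrite -monotone_convergence//=.
- apply: eq_integral => x _; apply/cvg_lim => //.
  exact: cvgeZl.
- by move=> n; apply: emeasurable_funM => //; exact/measurable_EFinP/measurable_funTS.
- by move=> n x _; rewrite mule_ge0// lee_fin.
- move=> x _ a b ab; apply: lee_wpmul2l => //.
  by rewrite lee_fin; exact/lefP/nd_nnsfun_approx.
Qed.

End Density.

(** Both sides integrate [f] against the image of a finite measure with density. By [eqint_raybox]
    the two images agree on ray boxes, a generating family closed under intersection, hence on all
    Borel sets. *)
Lemma weighted_unique {R : realType} {d : nat} d1 d2 (T1 : measurableType d1) (T2 : measurableType d2)
    (mu1 : {measure set T1 -> \bar R}) (mu2 : {measure set T2 -> \bar R})
    (w1 : T1 -> R) (w2 : T2 -> R) (Z1 : T1 -> 'rV[R]_d) (Z2 : T2 -> 'rV[R]_d)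
    (f : Borel R d -> \bar R) :
  mu1.-integrable setT (EFin \o w1) -> mu2.-integrable setT (EFin \o w2) ->
  (forall t, 0 <= w1 t) -> (forall t, 0 <= w2 t) ->
  (forall i, measurable_fun setT (fun t => Z1 t 0 i)) ->
  (forall i, measurable_fun setT (fun t => Z2 t 0 i)) ->
  (forall (xi : 'rV[R]_d) (b : R),
    \int[mu1]_t (w1 t * cos (dotp xi (Z1 t) + b)) = \int[mu2]_t (w2 t * cos (dotp xi (Z2 t) + b))) ->
  nonneg f ->
  (\int[mu1]_t ((w1 t)%:E * f (Z1 t)) = \int[mu2]_t ((w2 t)%:E * f (Z2 t)))%E.
Proof.
move=> i1 i2 p1 p2 mZ1 mZ2 H [mf f0].
have mw1 : measurable_fun setT w1 by apply/measurable_EFinP; exact: (measurable_int mu1 i1).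
have mw2 : measurable_fun setT w2 by apply/measurable_EFinP; exact: (measurable_int mu2 i2).
have MZ1 : measurable_fun setT (Z1 : T1 -> Borel R d) by exact: measurable_rV.
have MZ2 : measurable_fun setT (Z2 : T2 -> Borel R d) by exact: measurable_rV.
have E d' (T : measurableType d') (mu : {measure set T -> \bar R}) (w : T -> R) (mw : measurable_fun setT w)
    (p : forall t, 0 <= w t) (Z : T -> Borel R d) (MZ : measurable_fun setT Z) g : nonneg g ->
    (\int[image_measure (density_measure mu mw p) MZ]_y g y = \int[mu]_t ((w t)%:E * g (Z t)))%E.
  move=> [mg g0]; rewrite ge0_integral_pushforward//.
  rewrite preimage_setT integral_density//.
  by exact: (measurableT_comp mg MZ).
  by move=> t; exact: g0.
rewrite -(E _ _ _ _ mw1 p1 _ MZ1)// -(E _ _ _ _ mw2 p2 _ MZ2)//.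
have mr a : measurable (raybox a : set (Borel R d)).
  by rewrite measurable_raybox; apply: sub_sigma_algebra; exists a.
have V d' (T : measurableType d') (mu : {measure set T -> \bar R}) (w : T -> R) (mw : measurable_fun setT w)
    (p : forall t, 0 <= w t) (Z : T -> Borel R d) (MZ : measurable_fun setT Z) a :
    mu.-integrable setT (EFin \o w) ->
    (image_measure (density_measure mu mw p) MZ) (raybox a) =
    (\int[mu]_t (w t * \1_(raybox a) (Z t)))%:E.
  move=> iw.
  rewrite -{1}(setIT (raybox a)) -integral_indic// (E _ _ _ _ mw p _ MZ); last exact: nonneg_indic.
  apply/esym; rewrite /Rintegral fineK; last first.
    apply: integrable_fin_num => //; apply: integrableMb => //.
    - by apply: (measurableT_comp (f := \1_(raybox a) : Borel R d -> R)) => //; exact: measurable_indic.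
    - by move=> t; rewrite indicE; case: (_ \in _); rewrite ?normr1 ?normr0.
  by apply: eq_integral => t _; rewrite EFinM.
apply: eq_measure_integral => A mA _; apply: raybox_measure_unique => // [|a].
  rewrite /image_measure/= /pushforward/= /density preimage_setT.
  have /integrableP[_] := i1; apply: le_lt_trans.
  by apply: ge0_le_integral => //; [move=> t _; rewrite lee_fin|exact/measurable_EFinP|
    apply/measurable_EFinP; exact: measurableT_comp|move=> t _; rewrite lee_fin ler_norm].
by rewrite !V//; congr EFin; apply: eqint_raybox.
Qed.

Section Chapman.
Context {R : realType} {d : nat}.
Variables (X : timechange R) (M : refmeasure R d).
Notation m := (refm M).
Local Open Scope ereal_scope.

(** The Chapman-Kolmogorov identity, read off from Fourier transforms: composing two steps
    multiplies [e^{-h phi}] and [e^{-t phi}]. A [timechange] carries only one-time laws, so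
    increments cannot be convolved directly. *)
Lemma Qop_comp (h t : R) (f : Borel R d -> \bar R) x : (0 < h)%R -> (0 < t)%R -> nonneg f ->
  Qop X M h setT (Qop X M t setT f) x = Qop X M (h + t) setT f x.
Proof.
move=> h0 t0 nf; have ht0 : (0 < h + t)%R by rewrite addr_gt0.
pose w (z : Borel R d * Borel R d) : R := (kern X h x z.1 * kern X t z.1 z.2)%R.
have mw : measurable_fun setT w.
  apply: measurable_funM; last exact: measurable_kern2.
  by apply: (measurableT_comp (measurable_kern X x h0)); exact: measurable_fst.
have w0 z : (0 <= w z)%R by rewrite mulr_ge0// kern_ge0.
have T (g : Borel R d -> \bar R) : nonneg g ->
  \int[m \x m]_z ((w z)%:E * g z.2) = Qop X M h setT (Qop X M t setT g) x.
  move=> [mg g0]; rewrite fubini_tonelli1/=; last 2 first.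
    - apply: emeasurable_funM; first exact/measurable_EFinP.
      by apply: (measurableT_comp mg); exact: measurable_snd.
    - by move=> z; rewrite mule_ge0// lee_fin.
  rewrite QopE; apply: eq_integral => y _; rewrite QopE /fubini_F /=.
  have [k1 k2] := nonneg_kern_mul X y t0 (conj mg g0).
  rewrite -ge0_integralZl//; last by rewrite lee_fin kern_ge0.
  by apply: eq_integral => z _; rewrite /w /= EFinM muleA.
have iw : (m \x m).-integrable setT (EFin \o w).
  apply/integrableP; split; first exact/measurable_EFinP.
  have := T (cst 1) (nonneg_cst ler01).
  have -> : Qop X M h setT (Qop X M t setT (cst 1)) x = 1.
    have E1 u y : (0 < u)%R -> Qop X M u setT (cst 1) y = 1.
      by move=> u0; rewrite QopE; under eq_integral do rewrite mule1; exact: kern_total.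
    by rewrite -[RHS](E1 h x h0); apply: Qop_eq => y _; rewrite E1.
  move=> E1; apply: (@le_lt_trans _ _ 1); last exact: ltry.
  rewrite -{}E1; apply: ge0_le_integral => //.
  - by apply/measurable_EFinP; apply: measurableT_comp.
  - by apply: emeasurable_funM => //; exact/measurable_EFinP.
  - by move=> z _; rewrite mule1/= ger0_norm.
rewrite -T// [in RHS]QopE.
refine (@weighted_unique R d _ _ _ (Borel R d) _ _ w (kern X (h + t) x) (fun z => z.2) (fun y => y) f iw
  (integrable_kern X M x ht0) w0 (fun y => kern_ge0 X (h + t) x y) _ _ _ nf).
- by move=> i; apply: (measurableT_comp (measurable_coord i)); exact: measurable_snd.
- by move=> i; exact: measurable_coord.
move=> xi b; rewrite kern_char//.
have bc (y : Borel R d) : (`|cos (dotp xi y + b)| <= 1)%R by exact: cos_max.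
have mc : measurable_fun setT (fun y : Borel R d => cos (dotp xi y + b)).
  apply: (measurableT_comp (f := @cos R)).
    by apply: continuous_measurable_fun; exact: continuous_cos.
  by apply: measurable_funD => //; apply: measurable_dotp; exact: measurable_coord.
have iwc : (m \x m).-integrable setT (EFin \o (fun z => w z * cos (dotp xi z.2 + b))%R).
  apply: integrableMb => //.
  by apply: (measurableT_comp mc); exact: measurable_snd.
have := @integral12_prod_meas1 _ _ _ _ R m m _ iwc; rewrite /Rintegral /fubini_F /= => <-.
transitivity (fine (\int[m]_y ((expR (- (t * tc_phi X (dotp xi xi)))) * (kern X h x y * cos (dotp xi y + b)))%:E)).
  congr fine; apply: eq_integral => y _.
  have ik := integrableMb (integrable_kern X M y t0) mc bc.
  have := RintegralE ik (kern_char X M y xi b t0).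
  transitivity (\int[m]_z ((kern X h x y)%:E * (kern X t y z * cos (dotp xi z + b))%:E)).
    by apply: eq_integral => z _; rewrite /w /= -EFinM mulrA.
  rewrite integralZl// (RintegralE ik (kern_char X M y xi b t0)) -EFinM.
  by congr EFin; ring.
have ik := integrableMb (integrable_kern X M x h0) mc bc.
under eq_integral do rewrite EFinM.
rewrite integralZl// (RintegralE ik (kern_char X M x xi b h0)) -EFinM /=.
by rewrite mulrA -expRD; congr (expR _ * _)%R; ring.
Qed.

Lemma Qop_iter (h : R) n (f : Borel R d -> \bar R) x : (0 < h)%R -> nonneg f ->
  iter n.+1 (Qop X M h setT) f x = Qop X M (n.+1%:R * h) setT f x.
Proof.
move=> h0 nf; elim: n x => [|n IH] x; first by rewrite mul1r.
transitivity (Qop X M h setT (Qop X M (n.+1%:R * h) setT f) x).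
  by rewrite iterS; apply: Qop_eq => y _; exact: IH.
rewrite (Qop_comp x h0 _ nf); last by rewrite mulr_gt0.
by have -> : (n.+2%:R * h = h + n.+1%:R * h)%R by rewrite -natr1 mulrDl mul1r addrC.
Qed.

End Chapman.

(** The integral of a nonnegative function is a supremum over the simple functions below it, whence
    monotonicity for arbitrary integrands. It serves occupation times, whose inner integrals have
    unknown measurability. *)
Lemma ge0_le_lower_integral d (T : measurableType d) (R : realType)
    (mu : {measure set T -> \bar R}) (D : set T) (f g : T -> \bar R) :
  (forall x, D x -> 0 <= f x)%E -> (forall x, D x -> f x <= g x)%E ->
  (\int[mu]_(x in D) f x <= \int[mu]_(x in D) g x)%E.
Proof.
move=> f0 fg; rewrite !ge0_integralE//; last first.
  by move=> x Dx; apply: le_trans (fg x Dx); exact: f0.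
apply: le_ereal_sup => _ [k hk <-]; exists k => // x.
apply: (le_trans (hk x)); rewrite !patchE; case: ifPn => // /set_mem; exact: fg.
Qed.

(** * Estimates on the kernel *)

Section LaplaceBounds.
Context {R : realType}.
Variable (X : timechange R).
Notation P := (tc_prob X).
Notation phi := (tc_phi X).
Implicit Types (h lam t : R).

Lemma integrable_tc_exp h lam : 0 < h -> 0 <= lam ->
  P.-integrable setT (EFin \o (fun w => expR (- (lam * tc h w)))).
Proof.
move=> h0 l0; apply: measurable_bounded_integrable => //.
- exact: tc_prob_lty.
- apply: measurableT_comp => //; apply: measurable_funN; apply: measurable_funM => //.
  exact: tc_meas.
- exists 1; split; first exact: num_real.
  move=> z hz w _; rewrite /= ger0_norm ?expR_ge0// (le_trans _ (ltW hz))//.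
  by rewrite -expR0 ler_expR oppr_le0 mulr_ge0// (le_trans (ltW h0))//; exact: tc_ge.
Qed.

(** Pairs are (coefficient, rate). These are the functions of the random time with an explicit mean,
    so a pointwise inequality involving them for [t >= h] transfers to the law of [S_h]. *)
Definition expsum (s : seq (R * R)) (t : R) : R := \sum_(p <- s) p.1 * expR (- (p.2 * t)).

Lemma tc_expsum h s : 0 < h -> all (fun p => 0 <= p.2) s ->
  P.-integrable setT (EFin \o (fun w => expsum s (tc h w))) /\
  \int[P]_w expsum s (tc h w) = \sum_(p <- s) p.1 * expR (- (h * phi p.2)).
Proof.
move=> h0; elim: s => [|p s IH] /=.
  move=> _; rewrite big_nil; split; last by rewrite /expsum; under eq_Rintegral do rewrite big_nil; exact: tc_Rint_cst.
  rewrite (_ : _ \o _ = cst 0%E); first exact: integrable0.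
  by apply/funext => w; rewrite /= /expsum big_nil.
move=> /andP[p0 /IH[i e]].
have ip := integrable_tc_exp h0 p0.
have E : (fun w : tc_space X => expsum (p :: s) (tc h w)) =
   (fun w : tc_space X => p.1 * expR (- (p.2 * tc h w)) + 1 * expsum s (tc h w)).
  by apply/funext => w; rewrite /expsum big_cons mul1r.
rewrite E; split; first exact: integrable_lin.
by rewrite Rintegral_lin// e tc_lap// big_cons mul1r.
Qed.

Lemma tc_expsum_ge h s : 0 < h -> all (fun p => 0 <= p.2) s ->
  (forall t, h <= t -> 0 <= expsum s t) -> 0 <= \sum_(p <- s) p.1 * expR (- (h * phi p.2)).
Proof.
move=> h0 s0 H; rewrite -(tc_expsum h0 s0).2.
by apply: Rintegral_ge0 => w _; apply: H; exact: tc_ge.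
Qed.

Lemma tc_integral_le h s (G : tc_space X -> \bar R) : 0 < h -> all (fun p => 0 <= p.2) s ->
  (forall w, 0 <= G w)%E -> (forall w, G w <= (expsum s (tc h w))%:E)%E ->
  (\int[P]_w G w <= (\sum_(p <- s) p.1 * expR (- (h * phi p.2)))%:E)%E.
Proof.
move=> h0 s0 G0 GH; have [i e] := tc_expsum h0 s0.
rewrite -(RintegralE i e); exact: ge0_le_lower_integral.
Qed.

Lemma tc_phi0 : phi 0 = 0.
Proof.
have := tc_lap X ltr01 (lexx 0); under eq_Rintegral do rewrite mul0r oppr0 expR0.
rewrite tc_Rint_cst mul1r => /esym/eqP; rewrite -[X in _ == X]expR0.
by move=> /eqP/expR_inj/eqP; rewrite oppr_eq0 => /eqP.
Qed.

(** The drift in terms of [phi]: at step 1 the time is at least 1, so [e^{-lam} - e^{-lam t}] is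
    nonnegative and so is its mean. *)
Lemma tc_phi_ge lam : 0 <= lam -> lam <= phi lam.
Proof.
move=> l0; have := @tc_expsum_ge 1 [:: (expR (- lam), 0); (-1, lam)] ltr01.
rewrite /= lexx l0 => /(_ isT).
rewrite !big_cons big_nil /= tc_phi0 mulr0 oppr0 expR0 !mul1r !mulr1 addr0 mulN1r subr_ge0 ler_expR lerN2.
apply=> t t1; rewrite /expsum !big_cons big_nil /= mul0r oppr0 expR0 mulr1 addr0 mulN1r subr_ge0.
by rewrite ler_expR lerN2 ler_peMr.
Qed.

(* Jensen: (E e^{-lam T})^2 <= E e^{-2 lam T}, from E (Z - c)^2 >= 0. *)
Lemma tc_phi_double lam : 0 <= lam -> phi (2 * lam) <= 2 * phi lam.
Proof.
move=> l0; set c := expR (- phi lam).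
have := @tc_expsum_ge 1 [:: (1, 2 * lam); (- (2 * c), lam); (c ^+ 2, 0)] ltr01.
rewrite /= lexx l0 mulr_ge0// => /(_ isT).
rewrite !big_cons big_nil /= tc_phi0 mulr0 oppr0 expR0 !mul1r mulr1 addr0 -/c => H.
have : c ^+ 2 <= expR (- phi (2 * lam)).
  rewrite -subr_ge0; apply: (le_trans (H _)).
    move=> t _; rewrite /expsum !big_cons big_nil /= mul0r oppr0 expR0 mulr1 mul1r addr0.
    have -> : - (2 * lam * t) = - (lam * t) + - (lam * t) by ring.
    rewrite expRD; set z := expR _.
    have -> : z * z + (- (2 * c) * z + c ^+ 2) = (z - c) ^+ 2 by ring.
    exact: sqr_ge0.
  by rewrite le_eqVlt; apply/orP; left; apply/eqP; ring.
by rewrite /c expr2 -expRD ler_expR; lra.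
Qed.

Lemma one_sub_expR_le (u : R) : 1 - expR (- u) <= u.
Proof. by have := expR_ge1Dx (- u); lra. Qed.

Lemma one_sub_expR_ge (u : R) : 0 <= u -> u <= 1 -> u / 2 <= 1 - expR (- u).
Proof.
move=> u0 u1; have : expR (- u) * expR u = 1 by rewrite -expRD addrC subrr expR0.
have := expR_ge1Dxn 1 u0; have := expR_gt0 (- u); have := expR_ge1Dx u.
by rewrite (_ : 2`! = 2%N)//; set a := expR u; set b := expR _; nra.
Qed.

Lemma tc_kern_le d h (x y : 'rV[R]_d) s : 0 < h -> all (fun p => 0 <= p.2) s ->
  (forall t, h <= t -> gauss t x y <= expsum s t) ->
  kern X h x y <= \sum_(p <- s) p.1 * expR (- (h * phi p.2)).
Proof.
move=> h0 s0 H; rewrite -lee_fin kernE//; apply: tc_integral_le => // w.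
  by rewrite lee_fin gauss_ge0.
by rewrite lee_fin; apply: H; exact: tc_ge.
Qed.

End LaplaceBounds.

Section GaussEstimates.
Context {R : realType} {d : nat}.
Implicit Types (x y c : 'rV[R]_d) (s a : R).

(** Squared distances keep Gaussian exponents and equations of spheres polynomial. The price is
    [sqd_triangle] with its factors 2, which explains the fractions of radii below. *)
Definition sqd x y : R := dotp (x - y) (x - y).

Lemma sqdE x y : sqd x y = \sum_i (x 0 i - y 0 i) ^+ 2.
Proof. by apply: eq_bigr => i _; rewrite !mxE expr2. Qed.

Lemma sqd_ge0 x y : 0 <= sqd x y.
Proof. by rewrite sqdE sumr_ge0// => i _; exact: sqr_ge0. Qed.

Lemma sqd_sym x y : sqd x y = sqd y x.
Proof. by rewrite !sqdE; apply: eq_bigr => i _; rewrite -sqrrN opprB. Qed.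

Lemma expR_neg_pow n (u : R) : 0 < u -> expR (- u) <= n`!%:R / u ^+ n.
Proof.
move=> u0; rewrite expRN -[leLHS]mul1r ler_pdivrMr ?expR_gt0//.
have un : 0 < u ^+ n by rewrite exprn_gt0.
rewrite mulrAC ler_pdivlMr// mul1r.
case: n un => [|n] un; first by rewrite expr0 mul1r -expR0 ler_expR ltW.
have := expR_ge1Dxn n (ltW u0).
have f0 : 0 < (n.+1`!)%:R :> R by rewrite ltr0n fact_gt0.
rewrite -(ler_pM2l f0) mulrDr mulrCA divff ?gt_eqF// mulr1 mulr1.
by apply: le_trans; rewrite lerDr ltW.
Qed.

(** The factor [1 - e^{-s}], rather than [s], has an explicit mean. When [sg = sqrt (4 pi s) <= 1],
    the exponential is at most a multiple of [sg^(2 (d + 2))], which beats the normalisation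
    [sg^(-d)] and leaves a factor [sg^2] proportional to [s]. When [sg > 1] the kernel is at most 1
    and [1 - e^{-s}] at least [c1]. *)
Lemma gauss_off_diag (eta : R) : 0 < eta -> exists2 C : R, 0 < C &
  forall s x y, 0 < s -> eta ^+ 2 <= sqd x y -> gauss s x y <= C * (1 - expR (- s)).
Proof.
move=> e0; have p0 : 0 < pi :> R := pi_gt0 R.
pose c1 : R := 1 - expR (- (4 * pi)^-1).
have pi4 : 0 < (4 * pi : R)^-1 by rewrite invr_gt0 mulr_gt0.
have c10 : 0 < c1 by rewrite /c1 subr_gt0 expR_lt1 oppr_lt0.
pose K : R := (d + 2)`!%:R / (pi * eta ^+ 2) ^+ (d + 2).
have pe0 : 0 < pi * eta ^+ 2 by rewrite mulr_gt0// exprn_gt0.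
have K0 : 0 < K by rewrite divr_gt0 ?exprn_gt0// ltr0n fact_gt0.
have K8 : 0 < K * (8 * pi) by apply: (mulr_gt0 K0); rewrite mulr_gt0.
have ci : 0 < c1^-1 by rewrite invr_gt0.
exists (K * (8 * pi) + c1^-1); first exact: addr_gt0.
move=> s x y s0 exy.
pose sg : R := Num.sqrt (4 * pi * s).
have sg0 : 0 < sg by rewrite sqrtr_gt0 !mulr_gt0.
have sg2 : sg ^+ 2 = 4 * pi * s by rewrite sqr_sqrtr// ltW// !mulr_gt0.
have s1 : 0 < 1 - expR (- s) by rewrite subr_gt0 -expR0 ltr_expR oppr_lt0.
have [sg1|sg1] := leP sg 1; last first.
  apply: (@le_trans _ _ (c1^-1 * (1 - expR (- s)))); last first.
    by apply: ler_wpM2r; [exact: ltW|rewrite lerDr ltW].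
  apply: (@le_trans _ _ 1).
    rewrite gaussE -/sg -[leRHS](mulr1 1) ler_pM ?expR_ge0//.
    - by rewrite exprn_ge0// invr_ge0 ltW.
    - by rewrite exprn_ile1 ?invr_ge0 ?ltW// invf_lt1.
    - by rewrite expR_le1 oppr_le0 divr_ge0 ?sqd_ge0// mulr_ge0// ltW.
  rewrite -(ler_pM2l c10) mulrA divff ?gt_eqF// mul1r mulr1 lerD2l lerN2 ler_expR lerN2.
  rewrite -[(_)^-1]mul1r ler_pdivrMr ?mulr_gt0// mulrC -sg2 -(expr1n _ 2).
  by rewrite lerXn2r ?nnegrE ?ltW.
apply: (@le_trans _ _ (K * (8 * pi) * (1 - expR (- s)))); last first.
  by apply: ler_wpM2r; [exact: ltW|rewrite lerDl ltW].
have s_le1 : s <= 1.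
  have : sg ^+ 2 <= 1 by rewrite expr_le1// ltW.
  by rewrite sg2; have := pi_ge2 R; nra.
have hs := one_sub_expR_ge (ltW s0) s_le1.
apply: (@le_trans _ _ (K * sg ^+ 2)); last first.
  rewrite sg2 -[leRHS]mulrA; apply: ler_wpM2l; first exact: ltW.
  have -> : 4 * pi * s = 8 * pi * (s / 2) by field.
  by apply: ler_wpM2l => //; apply: mulr_ge0 => //; exact: ltW.
pose u := pi * eta ^+ 2 / sg ^+ 2.
have u0 : 0 < u by rewrite divr_gt0// exprn_gt0.
have h1 : expR (- (sqd x y / (4 * s))) <= K * (sg ^+ 2) ^+ (d + 2).
  apply: (@le_trans _ _ (expR (- u))).
    rewrite ler_expR lerN2 /u sg2 (_ : pi * eta ^+ 2 / (4 * pi * s) = eta ^+ 2 / (4 * s)).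
      by rewrite ler_wpM2r// invr_ge0 mulr_ge0// ltW.
    have F (p e q : R) : p != 0 -> q != 0 -> p * e / (4 * p * q) = e / (4 * q).
      by move=> *; field; apply/andP.
    by apply: F; rewrite gt_eqF.
  apply: (le_trans (expR_neg_pow (d + 2) u0)).
  by rewrite /u /K expr_div_n invf_div mulrA mulrAC.
rewrite gaussE -/sg -/(sqd x y).
apply: (@le_trans _ _ (sg^-1 ^+ d * (K * (sg ^+ 2) ^+ (d + 2)))).
  by rewrite ler_wpM2l// exprn_ge0// invr_ge0 ltW.
rewrite mulrCA ler_pM2l// -exprM mulnDr mul2n -addnn -addnA exprD mulrA -exprMn.
have fin (r : R) : 0 < r -> r <= 1 -> (r^-1 * r) ^+ d * r ^+ (d + 2 * 2) <= r ^+ 2.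
  move=> r0 r1; rewrite mulVf; last by rewrite gt_eqF.
  rewrite expr1n mul1r (_ : (d + 2 * 2 = 2 + (d + 2))%N); last by rewrite addnCA.
  rewrite exprD -[leRHS]mulr1; apply: ler_wpM2l; first exact: exprn_ge0 (ltW r0).
  exact: exprn_ile1 (ltW r0) r1.
exact: fin.
Qed.

(** Completing the square: the product is again a Gaussian, with contracted centre and time. The
    rate [a] may be negative as long as [1 + 4 a s > 0], which [gint_cap_mid] exploits with
    [a = -1/8]. *)
Lemma gauss_tilt s a x y c : 0 < s -> 0 < 1 + 4 * a * s ->
  gauss s x y * expR (- (a * sqd y c)) =
  (Num.sqrt (1 + 4 * a * s))^-1 ^+ d * expR (- (a / (1 + 4 * a * s) * sqd x c)) *
  gauss (s / (1 + 4 * a * s)) (c + (1 + 4 * a * s)^-1 *: (x - c)) y.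
Proof.
move=> s0; set b := 1 + _ => b0; have p0 : 0 < pi :> R := pi_gt0 R.
rewrite !gaussE -[LHS]mulrA -expRD [RHS]mulrACA -exprMn -expRD; congr (_ ^+ _ * expR _).
  have -> : 4 * pi * s = 4 * pi * (s / b) * b by field; rewrite gt_eqF.
  rewrite [X in X^-1 = _]sqrtrM ?invfM 1?mulrC//.
  by rewrite ltW// !mulr_gt0// invr_gt0.
rewrite -/(sqd x y) -/(sqd _ y) !sqdE !mulr_suml !mulr_sumr -!sumrN -!big_split /=.
apply: eq_bigr => i _; rewrite !mxE.
have : s != 0 by rewrite gt_eqF.
have : b != 0 by rewrite gt_eqF.
rewrite /b => b1 s1; field.
by rewrite b1 s1.
Qed.

Lemma gauss_exp_integral (M : refmeasure R d) s a x c : 0 < s -> 0 < 1 + 4 * a * s ->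
  (\int[refm M]_y ((gauss s x y)%:E * (expR (- (a * sqd y c)))%:E) =
   ((Num.sqrt (1 + 4 * a * s))^-1 ^+ d * expR (- (a / (1 + 4 * a * s) * sqd x c)))%:E)%E.
Proof.
move=> s0 b0; set K := _ * expR _.
have K0 : 0 <= K by rewrite mulr_ge0 ?expR_ge0// exprn_ge0// invr_ge0.
have sb : 0 < s / (1 + 4 * a * s) by rewrite divr_gt0.
transitivity (\int[refm M]_y (K%:E * (gauss (s / (1 + 4 * a * s)) (c + (1 + 4 * a * s)^-1 *: (x - c)) y)%:E))%E.
  by apply: eq_integral => y _; rewrite -!EFinM gauss_tilt.
rewrite ge0_integralZl//.
- by rewrite (heat_ref_gauss _ (refm_heat M) sb) mule1.
- by apply/measurable_EFinP; exact: measurable_gaussr.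
- by move=> y _; rewrite lee_fin gauss_ge0.
Qed.

End GaussEstimates.

Section KernEstimates.
Context {R : realType} {d : nat}.
Variables (X : timechange R) (M : refmeasure R d).

Lemma kern_off_diag (eta : R) : 0 < eta -> exists2 C : R, 0 < C &
  forall h (x y : 'rV[R]_d), 0 < h -> eta ^+ 2 <= sqd x y ->
    kern X h x y <= C * h /\ kern X h x y <= C.
Proof.
move=> e0; have [C C0 H] := @gauss_off_diag R d eta e0.
have f1 := tc_phi_ge X ler01; have f0 : 0 < tc_phi X 1 by lra.
exists (C * (tc_phi X 1)); first by rewrite mulr_gt0.
move=> h x y h0 exy.
have := @tc_kern_le _ X d h x y [:: (C, 0); (- C, 1)] h0.
rewrite /= lexx ler01 => /(_ isT).
rewrite !big_cons big_nil /= tc_phi0 mulr0 oppr0 expR0 mulr1 addr0 => K.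
have {}K : kern X h x y <= C + - C * expR (- (h * tc_phi X 1)).
  apply: K => t ht; rewrite /expsum !big_cons big_nil /= mul0r oppr0 expR0 mulr1 addr0 mul1r.
  by have := H t x y (lt_le_trans h0 ht) exy; lra.
have := one_sub_expR_le (h * tc_phi X 1); have := expR_gt0 (- (h * tc_phi X 1)).
move: K; set e := expR _; set k := kern _ _ _ _; set f := tc_phi X 1 in f1 f0 *.
by move=> K e1 e2; split; nra.
Qed.

End KernEstimates.

(** * The upper barrier *)

Section Cap.
Context {R : realType}.
Implicit Types z x k : R.

(** Profile of the barrier in the signed excess of the squared distance over that of the tangent
    sphere. It is concave for [z >= 0]; the truncation at 0 stands for the exterior ball and makes a
    convex kink, the source of the loss. *)
Definition cap z : R := Num.max 0 (1 - expR (- z)).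

Lemma cap_ge0 z : 0 <= cap z.
Proof. by rewrite /cap le_max lexx. Qed.

Lemma cap_le1 z : cap z <= 1.
Proof. by rewrite /cap ge_max ler01/= lerBlDr lerDl expR_ge0. Qed.

Lemma capE z : 0 <= z -> cap z = 1 - expR (- z).
Proof. by move=> z0; apply/max_idPr; rewrite subr_ge0 expR_le1 oppr_le0. Qed.

Lemma cap_le z : 0 <= z -> cap z <= z.
Proof. by move=> z0; rewrite capE// one_sub_expR_le. Qed.

Lemma cap_neg z : z <= 0 -> cap z = 0.
Proof. by move=> z0; apply/max_idPl; rewrite subr_le0 -expR0 ler_expR oppr_ge0. Qed.

Lemma expR_sub1_le z : expR z - 1 <= z * expR z.
Proof.
have := expR_ge1Dx (- z); have := expR_gt0 z.
have : expR (- z) * expR z = 1 by rewrite -expRD addrC subrr expR0.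
by set a := expR z; set b := expR _ => h1 h2 h3; nra.
Qed.

(** Replaces [cap] by functions with explicit Gaussian means. For [z >= 0] the left side is 1; for
    [-1 <= z < 0] the excess [e^{-z} - 1] is at most [e |z|]; for [z < -1] the rate [k] takes over,
    as [(k - 1)(-z - 1) >= 0]. The prefactor [e^{1 - k}] makes this last term negligible. *)
Lemma cap_exp k z : 1 <= k ->
  cap z + expR (- z) <= 1 + expR 1 * Num.max 0 (- z) + expR (1 - k) * expR (- (k * z)).
Proof.
move=> k1; rewrite -expRD.
have e1 : 0 < expR 1 :> R := expR_gt0 _.
have m0 : 0 <= expR 1 * Num.max 0 (- z) by rewrite mulr_ge0 ?expR_ge0// le_max lexx.
have E0 := expR_ge0 (1 - k + - (k * z)).
have [z0|z0] := leP 0 z; first by rewrite capE//; lra.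
rewrite (cap_neg (ltW z0)) add0r.
have [z1|z1] := leP (-1) z; last first.
  have : expR (- z) <= expR (1 - k + - (k * z)) by rewrite ler_expR; nra.
  lra.
have -> : Num.max 0 (- z) = - z by apply/max_idPr; rewrite oppr_ge0 ltW.
have := expR_sub1_le (- z).
have : expR (- z) <= expR 1 by rewrite ler_expR; lra.
by move: E0; set a := expR (- z); set E := expR (1 - k + _); nra.
Qed.

(** The tangent line at [x] lies above the concave branch; below 0 its slope is at most 1, so the
    negative part pays for the truncation. *)
Lemma cap_tangent x z : 0 <= x ->
  cap z <= 1 - expR (- x) + expR (- x) * (z - x) + Num.max 0 (- z).
Proof.
move=> x0; have a0 := expR_gt0 (- x).
have [z0|z0] := leP 0 z.
  have -> : Num.max 0 (- z) = 0 by apply/max_idPl; rewrite oppr_le0.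
  rewrite capE//; have := expR_ge1Dx (x - z).
  have -> : expR (- z) = expR (- x) * expR (x - z) by rewrite -expRD; congr expR; ring.
  by set b := expR (x - z); nra.
have -> : Num.max 0 (- z) = - z by apply/max_idPr; rewrite oppr_ge0 ltW.
rewrite (cap_neg (ltW z0)).
have : expR (- x) * expR x = 1 by rewrite -expRD addrC subrr expR0.
have := expR_ge1Dx x; have : expR (- x) <= 1 by rewrite expR_le1 oppr_le0.
by set a := expR (- x) in a0 *; set b := expR x; nra.
Qed.

Lemma pos_part_exp (t x : R) : 0 < t -> Num.max 0 x <= t^-1 * expR (t * x).
Proof.
move=> t0; have ti : 0 <= t^-1 by rewrite invr_ge0 ltW.
rewrite ge_max (mulr_ge0 ti (expR_ge0 _)) /=.
rewrite -(ler_pM2l t0) mulrA divff ?gt_eqF// mul1r.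
by have := expR_ge1Dx (t * x); lra.
Qed.

(** The choice is [k = t^(-1/4)], written [v^-1]: then [4 k^2 t R2 = 4 v^2 R2] stays bounded, while
    [e^{-k} <= 120 v^5] is smaller than [t = v^4] by a factor [v], which beats the constants once
    [v <= v0]. *)
Lemma small_remainder (r2 R2 : R) : 0 < r2 -> 0 < R2 -> exists2 t0 : R, 0 < t0 <= 1 / 4 &
  forall t : R, 0 < t -> t <= t0 -> exists2 k, 1 <= k &
    expR (1 - k) * expR (4 * k ^+ 2 * t * R2) <= r2 / 2 * t.
Proof.
move=> r0 R0; have e2 : 0 < expR 2 :> R := expR_gt0 _.
pose v0 : R := Num.min (1 / 2) (Num.min ((4 * R2 + 1)^-1) (r2 / (240 * expR 2))).
have v00 : 0 < v0.
  rewrite !lt_min; apply/and3P; split; first lra.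
    by rewrite invr_gt0; lra.
  by rewrite divr_gt0// mulr_gt0.
exists (v0 ^+ 4).
  rewrite exprn_gt0//=; have : v0 <= 1 / 2 by rewrite ge_min lexx.
  move=> v1; have q1 : v0 ^+ 2 <= 1 / 4 by nra.
  by have := sqr_ge0 v0; rewrite (exprM v0 2 2); nra.
move=> t t0 tv; pose v := Num.sqrt (Num.sqrt t).
have v_gt0 : 0 < v by rewrite !sqrtr_gt0.
have vt : v ^+ 4 = t.
  by rewrite (exprM v 2 2) /v sqr_sqrtr ?sqrtr_ge0// sqr_sqrtr// ltW.
have vv0 : v <= v0.
  have := @ler_pXn2r R 4 isT v v0; rewrite !nnegrE (ltW v_gt0) (ltW v00) vt tv.
  by move=> /(_ isT isT) <-.
have [v1 v2 v3] : [/\ v <= 1 / 2, v * (4 * R2 + 1) <= 1 & v * (240 * expR 2) <= r2].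
  split.
  - by apply: (le_trans vv0); rewrite ge_min lexx.
  - rewrite -ler_pdivlMr; last by lra.
    by apply: (le_trans vv0); rewrite mul1r /v0 !ge_min lexx orbT.
  - rewrite -ler_pdivlMr; last by rewrite mulr_gt0.
    by apply: (le_trans vv0); rewrite /v0 !ge_min lexx !orbT.
exists v^-1; first by rewrite -[1]invr1 lef_pV2 ?posrE//; lra.
have E : 4 * v^-1 ^+ 2 * t * R2 = 4 * v ^+ 2 * R2 by rewrite -vt; field; rewrite gt_eqF.
rewrite E -expRD.
have -> : 1 - v^-1 + 4 * v ^+ 2 * R2 = (1 + 4 * v ^+ 2 * R2) + - v^-1 by ring.
rewrite expRD.
have h1 : expR (1 + 4 * v ^+ 2 * R2) <= expR 2 by rewrite ler_expR; nra.
have h2 : expR (- v^-1) <= 120 * v ^+ 5.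
  apply: (le_trans (expR_neg_pow 5 _)); first by rewrite invr_gt0.
  by rewrite exprVn invrK (_ : 5`! = 120%N).
apply: (@le_trans _ _ (expR 2 * (120 * v ^+ 5))).
  by apply: ler_pM; rewrite ?expR_ge0.
rewrite -vt (_ : expR 2 * _ = v * (240 * expR 2) / 2 * v ^+ 4); last by field.
apply: ler_wpM2r; first by rewrite exprn_ge0// ltW.
by apply: ler_wpM2r.
Qed.

End Cap.

Section CapGauss.
Context {R : realType} {d : nat}.
Variables (M : refmeasure R d) (c : 'rV[R]_d).
Notation m := (refm M).
Notation q := (fun y : 'rV[R]_d => sqd y c).
Implicit Types (x y : 'rV[R]_d) (s l b : R).

Lemma measurable_sqd : measurable_fun setT (fun y : Borel R d => sqd y c).
Proof.
under eq_fun do rewrite sqdE.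
apply: measurable_sum => i; apply: measurable_funX; apply: measurable_funB => //.
exact: measurable_coord.
Qed.

Lemma measurable_exp_sqd a : measurable_fun setT (fun y : Borel R d => expR (- (a * sqd y c))).
Proof.
apply: measurableT_comp => //; apply: measurable_funN; apply: measurable_funM => //.
exact: measurable_sqd.
Qed.

Lemma measurable_cap_sqd l b : measurable_fun setT (fun y : Borel R d => cap (l * (sqd y c - b))).
Proof.
have mz : measurable_fun setT (fun y : Borel R d => l * (sqd y c - b)).
  by apply: measurable_funM => //; apply: measurable_funB => //; exact: measurable_sqd.
apply: measurable_maxr => //; apply: measurable_funB => //.
by apply: measurableT_comp => //; exact: measurable_funN.
Qed.

Definition gint s x (f : 'rV[R]_d -> R) : \bar R := (\int[m]_y ((gauss s x y)%:E * (f y)%:E))%E.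

Lemma gint_ge0 s x f : (forall y, 0 <= f y) -> (0 <= gint s x f)%E.
Proof. by move=> f0; apply: integral_ge0 => y _; rewrite -EFinM lee_fin mulr_ge0 ?gauss_ge0. Qed.

Let mg s x (f : Borel R d -> R) : measurable_fun setT f ->
  measurable_fun setT (fun y : Borel R d => ((gauss s x y)%:E * (f y)%:E)%E).
Proof.
by move=> mf; apply: emeasurable_funM; apply/measurable_EFinP => //; exact: measurable_gaussr.
Qed.

Lemma gint_le s x f g : (forall y, 0 <= f y) -> (forall y, f y <= g y) -> (gint s x f <= gint s x g)%E.
Proof.
move=> f0 fg; apply: ge0_le_lower_integral => y _; first by rewrite -EFinM lee_fin mulr_ge0 ?gauss_ge0.
by rewrite -!EFinM lee_fin ler_wpM2l ?gauss_ge0.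
Qed.

Lemma gintD s x (f g : Borel R d -> R) : measurable_fun setT f -> measurable_fun setT g ->
  (forall y, 0 <= f y) -> (forall y, 0 <= g y) ->
  gint s x (fun y => f y + g y) = (gint s x f + gint s x g)%E.
Proof.
move=> mf mg' f0 g0; rewrite /gint -ge0_integralD//.
- by apply: eq_integral => y _; rewrite -!EFinM -EFinD mulrDr.
- by move=> y _; rewrite -EFinM lee_fin mulr_ge0 ?gauss_ge0.
- exact: mg.
- by move=> y _; rewrite -EFinM lee_fin mulr_ge0 ?gauss_ge0.
- exact: mg.
Qed.

Lemma gintZ s x a (f : Borel R d -> R) : measurable_fun setT f -> 0 <= a -> (forall y, 0 <= f y) ->
  gint s x (fun y => a * f y) = (a%:E * gint s x f)%E.
Proof.
move=> mf a0 f0; rewrite /gint -ge0_integralZl//; [|exact: mg|].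
- by apply: eq_integral => y _; rewrite -!EFinM mulrCA.
- by move=> y _; rewrite -EFinM lee_fin mulr_ge0 ?gauss_ge0.
Qed.

Lemma gint_cst s x a : 0 < s -> 0 <= a -> gint s x (fun=> a) = a%:E.
Proof.
move=> s0 a0; have := @gintZ s x a (cst 1) (@measurable_cst _ _ _ _ _ _) a0 (fun _ => ler01).
rewrite (_ : (fun y => a * cst 1 y) = fun=> a); last by apply/funext => y; rewrite mulr1.
move=> ->; rewrite /gint; under eq_integral do rewrite mule1.
by rewrite (heat_ref_gauss _ (refm_heat M) s0) mule1.
Qed.

Lemma gint_exp s x a : 0 < s -> 0 < 1 + 4 * a * s ->
  gint s x (fun y => expR (- (a * sqd y c))) =
  ((Num.sqrt (1 + 4 * a * s))^-1 ^+ d * expR (- (a / (1 + 4 * a * s) * sqd x c)))%:E.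
Proof. exact: gauss_exp_integral. Qed.

Lemma gint_exp_le s x a : 0 < s -> 0 <= a ->
  (gint s x (fun y => expR (- (a * sqd y c))) <=
   (expR (- (a * sqd x c)) * expR (4 * a ^+ 2 * s * sqd x c))%:E)%E.
Proof.
move=> s0 a0; have b0 : 1 <= 1 + 4 * a * s by rewrite lerDl !mulr_ge0// ltW.
rewrite gint_exp//; last by rewrite (lt_le_trans _ b0).
rewrite lee_fin -expRD -[leRHS]mul1r; apply: ler_pM; rewrite ?expR_ge0//.
- rewrite exprn_ile1 ?invr_ge0// invf_le1 ?sqrtr_gt0 ?(lt_le_trans _ b0)//.
  by rewrite -[leLHS]sqrtr1 ler_wsqrtr.
rewrite ler_expR.
have -> : a / (1 + 4 * a * s) = a - 4 * a ^+ 2 * s / (1 + 4 * a * s).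
  by field; rewrite gt_eqF// (lt_le_trans _ b0).
rewrite mulrBl opprB addrC lerD2l; apply: ler_wpM2r; first exact: sqd_ge0.
rewrite ler_pdivrMr ?(lt_le_trans _ b0)// ler_peMr// !mulr_ge0 ?sqr_ge0//; exact: ltW.
Qed.

(** With [u = 4 a s] and [q] the squared distance, the mean is at least [e^{-a q}] times the
    exponential of [a q u / (1 + u) - d u / 2]. As [u <= 1], the first term is at least [a q u / 2];
    the hypothesis [2 d <= a q] lets the dimension spend at most half of it. What remains is
    [a q u / 4 = a^2 q s]. *)
Lemma gint_exp_ge s x a : 0 < s -> 0 <= a -> 4 * a * s <= 1 -> (2 * d)%:R <= a * sqd x c ->
  ((expR (- (a * sqd x c)) * (1 + a ^+ 2 * sqd x c * s))%:E <=
   gint s x (fun y => expR (- (a * sqd y c))))%E.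
Proof.
move=> s0 a0 u1 dq; have u0 : 0 <= 4 * a * s by rewrite !mulr_ge0// ltW.
have b1 : 1 <= 1 + 4 * a * s by rewrite lerDl.
have b0 : 0 < 1 + 4 * a * s by rewrite (lt_le_trans _ b1).
rewrite gint_exp// lee_fin; set u := 4 * a * s in u1 u0 b1 b0 *.
have s2 : Num.sqrt (1 + u) <= expR (u / 2).
  rewrite -[leRHS]ger0_norm ?expR_ge0// -sqrtr_sqr ler_wsqrtr// expr2 -expRD.
  by rewrite (_ : u / 2 + u / 2 = u); [exact: expR_ge1Dx|lra].
have s3 : expR (- (d%:R * (u / 2))) <= (Num.sqrt (1 + u))^-1 ^+ d.
  rewrite -mulrN expRM_natl expRN.
  by rewrite lerXn2r ?nnegrE ?invr_ge0 ?expR_ge0// lef_pV2 ?posrE ?expR_gt0 ?sqrtr_gt0.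
apply: (@le_trans _ _ (expR (- (d%:R * (u / 2))) * expR (- (a / (1 + u) * sqd x c)))); last first.
  by rewrite ler_wpM2r ?expR_ge0.
have hu : u / 2 <= u / (1 + u).
  by rewrite ler_wpM2l// lef_pV2 ?posrE//; lra.
have Q0 := sqd_ge0 x c; set Q := sqd x c in dq Q0 *.
have aE : a / (1 + u) = a - a * (u / (1 + u)) by field; rewrite gt_eqF.
rewrite -expRD (_ : - (d%:R * (u / 2)) + - (a / (1 + u) * Q) =
  - (a * Q) + (a * Q * (u / (1 + u)) - d%:R * (u / 2))); last by rewrite aE; ring.
rewrite expRD ler_wpM2l ?expR_ge0//.
apply: (le_trans _ (expR_ge1Dx _)); rewrite lerD2l.
have : a * Q * (u / 2) <= a * Q * (u / (1 + u)) by rewrite ler_wpM2l// mulr_ge0.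
have : a ^+ 2 * Q * s = a * Q * u / 4 by rewrite /u; field.
have : (2 * d%:R) * u <= a * Q * u by rewrite ler_wpM2r// -natrM.
by move: (d%:R : R) => n; lra.
Qed.

(** [pos_part_exp] at the rate [1 / sqrt s], the scale of the Gaussian itself, for which the
    quadratic correction in [gint_exp_le] is the constant [e^{4 q}]. *)
Lemma gint_neg_part s x b : 0 < s -> sqd x c - b >= 0 ->
  (gint s x (fun y => (Num.max 0 (b - sqd y c))%R) <=
   (expR (4 * sqd x c) * (Num.sqrt s * expR (- ((sqd x c - b) / Num.sqrt s))))%:E)%E.
Proof.
move=> s0 rho0; have r0 : 0 < Num.sqrt s by rewrite sqrtr_gt0.
set t := (Num.sqrt s)^-1; have t0 : 0 < t by rewrite invr_gt0.
have ts : t ^+ 2 * s = 1 by rewrite /t exprVn sqr_sqrtr ?mulVf ?gt_eqF// ltW.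
apply: (@le_trans _ _ (gint s x (fun y => t^-1 * expR (t * b) * expR (- (t * sqd y c))))).
  apply: gint_le => y; first by rewrite le_max lexx.
  rewrite -mulrA -expRD -mulrN -mulrDr; exact: pos_part_exp.
have k0 : 0 <= t^-1 * expR (t * b) by rewrite mulr_ge0 ?expR_ge0// invr_ge0 ltW.
rewrite gintZ//; last exact: measurable_exp_sqd.
apply: (le_trans (lee_wpmul2l _ (gint_exp_le x s0 (ltW t0)))); first by rewrite lee_fin.
rewrite -EFinM lee_fin.
rewrite (_ : 4 * t ^+ 2 * s * sqd x c = 4 * sqd x c); last by rewrite -[4 * _ * s]mulrA ts mulr1.
rewrite (_ : t^-1 * expR (t * b) * (expR (- (t * sqd x c)) * expR (4 * sqd x c)) =
  expR (4 * sqd x c) * (t^-1 * (expR (t * b) * expR (- (t * sqd x c))))); last by ring.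
rewrite -expRD /t invrK; apply: ler_wpM2l; first exact: expR_ge0.
apply: ler_wpM2l; first exact: ltW.
by rewrite ler_expR le_eqVlt; apply/orP; left; apply/eqP; ring.
Qed.

Let mneg b : measurable_fun setT (fun y : Borel R d => Num.max 0 (b - sqd y c)).
Proof. by apply: measurable_maxr => //; apply: measurable_funB => //; exact: measurable_sqd. Qed.

Let neg0 b y : 0 <= Num.max 0 (b - sqd y c).
Proof. by rewrite le_max lexx. Qed.

Variables (r2 R2 : R).
Hypotheses (r20 : 0 < r2) (R20 : 0 < R2).
(** Bound, uniform for squared distance at most [R2], on the mean penetration below the level after
    time [s], starting at height [rho] above it. It is what crossing the tangent sphere costs. *)
Definition corr (rho s : R) := expR (4 * R2) * (Num.sqrt s * expR (- (rho / Num.sqrt s))).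

Let neg_le s x b : 0 < s -> 0 <= sqd x c - b -> sqd x c <= R2 ->
  (gint s x (fun y => (Num.max 0 (b - sqd y c))%R) <= (corr (sqd x c - b) s)%:E)%E.
Proof.
move=> s0 rho qR; apply: (le_trans (gint_neg_part s0 rho)).
rewrite lee_fin; apply: ler_wpM2r; first by rewrite mulr_ge0 ?expR_ge0.
by rewrite ler_expR ler_wpM2l.
Qed.

(** Short times at scale [l], where concavity is visible. By [cap_exp] the mean of [cap] is 1 minus
    the mean of an exponential, bounded below by [gint_exp_ge] with gain [r2 l^2 s]; half of this
    gain pays for the term of rate [k], by [ksmall], and [corr] for the negative part. *)
Lemma gint_cap_small s x l b k : 0 < s -> 0 < l -> r2 <= sqd x c -> sqd x c <= R2 ->
  0 <= sqd x c - b -> 4 * l * s <= 1 -> (2 * d)%:R <= l * r2 -> 1 <= k ->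
  expR (1 - k) * expR (4 * k ^+ 2 * (l ^+ 2 * s) * R2) <= r2 / 2 * (l ^+ 2 * s) ->
  (gint s x (fun y => cap (l * (sqd y c - b))) <=
   (1 - expR (- (l * (sqd x c - b))) * (1 + r2 / 2 * (l ^+ 2 * s)) +
    expR 1 * l * corr (sqd x c - b) s)%:E)%E.
Proof.
move=> s0 l0 rq qR rho u1 dl k1 ksmall; have l00 := ltW l0.
set A := gint _ _ _; set rh := sqd x c - b in rho *.
pose B := gint s x (fun y => expR (l * b) * expR (- (l * sqd y c))).
have kl0 : 0 <= k * l by rewrite mulr_ge0// (le_trans ler01).
have eB : (A + B <= (1 + expR 1 * l * corr rh s + expR (1 - k) * (expR (- (k * l * rh)) * expR (4 * (k * l) ^+ 2 * s * sqd x c)))%:E)%E.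
  rewrite /A /B -gintD; last 4 first.
  - exact: measurable_cap_sqd.
  - by apply: measurable_funM => //; exact: measurable_exp_sqd.
  - by move=> y; exact: cap_ge0.
  - by move=> y; rewrite mulr_ge0 ?expR_ge0.
  pose g1 y := 1 + (expR 1 * l) * Num.max 0 (b - sqd y c).
  pose g2 y := (expR (1 - k) * expR (k * l * b)) * expR (- (k * l * sqd y c)).
  apply: (@le_trans _ _ (gint s x (fun y => g1 y + g2 y))).
    apply: gint_le => y; first by rewrite addr_ge0 ?cap_ge0// mulr_ge0 ?expR_ge0.
    have := cap_exp (l * (sqd y c - b)) k1.
    have -> : - (l * (sqd y c - b)) = l * (b - sqd y c) by ring.
    have -> : Num.max 0 (l * (b - sqd y c)) = l * Num.max 0 (b - sqd y c).
      by rewrite maxr_pMr// mulr0.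
    rewrite /g1 /g2 -!mulrA -!expRD.
    have -> : l * b + - (l * sqd y c) = l * (b - sqd y c) by ring.
    by have -> : k * (l * b) + - (k * (l * sqd y c)) = - (k * (l * (sqd y c - b))) by ring.
  have el0 : 0 <= expR 1 * l by rewrite mulr_ge0 ?expR_ge0.
  have ek0 : 0 <= expR (1 - k) * expR (k * l * b) by rewrite mulr_ge0 ?expR_ge0.
  rewrite gintD; last 4 first.
  - by apply: measurable_funD => //; apply: measurable_funM.
  - by apply: measurable_funM => //; exact: measurable_exp_sqd.
  - by move=> y; rewrite addr_ge0// mulr_ge0.
  - by move=> y; rewrite mulr_ge0 ?expR_ge0.
  rewrite EFinD; apply: leeD.
    rewrite /g1 gintD//; last 2 first.
    - exact: measurable_funM.
    - by move=> y; rewrite mulr_ge0.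
    rewrite gint_cst// EFinD leeD2l// gintZ// [X in (_ <= X)%E]EFinM; apply: lee_wpmul2l => //.
    exact: neg_le.
  rewrite /g2 gintZ//; last exact: measurable_exp_sqd.
  apply: (le_trans (lee_wpmul2l _ (gint_exp_le x s0 kl0))); first by rewrite lee_fin.
  rewrite -EFinM lee_fin -[leLHS]mulrA; apply: ler_wpM2l; first exact: expR_ge0.
  rewrite [leLHS]mulrA -[X in X * _ <= _]expRD; apply: ler_wpM2r; first exact: expR_ge0.
  by rewrite ler_expR le_eqVlt; apply/orP; left; apply/eqP; rewrite /rh; ring.
have Bge : ((expR (- (l * rh)) * (1 + r2 * (l ^+ 2 * s)))%:E <= B)%E.
  rewrite /B gintZ ?expR_ge0//; last exact: measurable_exp_sqd.
  apply: (@le_trans _ _ ((expR (l * b))%:E * (expR (- (l * sqd x c)) * (1 + l ^+ 2 * sqd x c * s))%:E)%E); last first.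
    apply: lee_wpmul2l; first by rewrite lee_fin expR_ge0.
    by apply: gint_exp_ge => //; apply: (le_trans dl); rewrite ler_wpM2l.
  rewrite -EFinM lee_fin [leRHS]mulrA -[X in _ <= X * _]expRD.
  have -> : l * b + - (l * sqd x c) = - (l * rh) by rewrite /rh; ring.
  apply: ler_wpM2l; first exact: expR_ge0.
  rewrite lerD2l mulrCA -mulrA ler_wpM2l ?sqr_ge0// mulrC.
  by rewrite [leRHS]mulrC ler_wpM2l// ltW.
have {}eB := le_trans (leeD (lexx A) Bge) eB.
rewrite -leeBrDr// in eB; apply: (le_trans eB).
rewrite -EFinB lee_fin.
have kr : expR (- (k * l * rh)) <= expR (- (l * rh)).
  by rewrite ler_expR lerN2 -mulrA ler_peMl// mulr_ge0.
have kq : expR (4 * (k * l) ^+ 2 * s * sqd x c) <= expR (4 * k ^+ 2 * (l ^+ 2 * s) * R2).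
  rewrite ler_expR (_ : 4 * (k * l) ^+ 2 * s * sqd x c = 4 * k ^+ 2 * (l ^+ 2 * s) * sqd x c); last by ring.
  apply: ler_wpM2l => //; apply: mulr_ge0; first by apply: mulr_ge0 => //; exact: sqr_ge0.
  by apply: mulr_ge0; [exact: sqr_ge0|exact: ltW].
have : expR (1 - k) * (expR (- (k * l * rh)) * expR (4 * (k * l) ^+ 2 * s * sqd x c)) <=
   expR (- (l * rh)) * (r2 / 2 * (l ^+ 2 * s)).
  rewrite mulrCA; apply: ler_pM => //; rewrite ?mulr_ge0 ?expR_ge0//.
  by apply: (le_trans _ ksmall); apply: ler_wpM2l => //; exact: expR_ge0.
by move: (expR 1 * l * corr rh s) (expR (- (l * rh))) (l ^+ 2 * s) => e1 e2 e3; lra.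
Qed.

Definition cst_mid : R := let B := d%:R / 2 + R2 / 8 in 8 * (B * expR B).

Lemma cst_mid_ge0 : 0 <= cst_mid.
Proof.
have B0 : 0 <= d%:R / 2 + R2 / 8 :> R by rewrite addr_ge0// mulr_ge0// ltW.
by rewrite /cst_mid /= !mulr_ge0 ?expR_ge0.
Qed.

(** Here no gain is sought, only a loss linear in [s]. In the tangent inequality the increment of
    the squared distance is replaced by [8 (e^{increment / 8} - 1)], whose mean is explicit: the
    negative rate [-1/8] is admissible because [s <= 1] keeps [1 - s / 2] positive. *)
Lemma gint_cap_mid s x l b : 0 < s -> s <= 1 -> 0 < l -> sqd x c <= R2 -> 0 <= sqd x c - b ->
  (gint s x (fun y => cap (l * (sqd y c - b))) <=
   (1 - expR (- (l * (sqd x c - b))) + cst_mid * l * s + l * corr (sqd x c - b) s)%:E)%E.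
Proof.
move=> s0 s1 l0 qR rho; have l00 := ltW l0.
set A := gint _ _ _; set rh := sqd x c - b in rho *.
set e := expR (- (l * rh)); have e0 : 0 < e := expR_gt0 _.
have e1 : e <= 1 by rewrite expR_le1 oppr_le0 mulr_ge0.
have b0 : 0 < 1 + 4 * (- (1 / 8)) * s by lra.
pose K := 8 * l * e.
have K0 : 0 <= K by rewrite !mulr_ge0// ltW.
pose G := K * expR (- (1 / 8 * sqd x c)).
have G0 : 0 <= G by rewrite mulr_ge0 ?expR_ge0.
have main : (A + K%:E <= (1 - e + G * ((Num.sqrt (1 + 4 * (- (1 / 8)) * s))^-1 ^+ d *
   expR (- (- (1 / 8) / (1 + 4 * (- (1 / 8)) * s) * sqd x c))) + l * corr rh s)%:E)%E.
  rewrite -(gint_cst x s0 K0) -gintD//; last 2 first.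
  - exact: measurable_cap_sqd.
  - by move=> y; exact: cap_ge0.
  apply: (@le_trans _ _ (gint s x (fun y => (1 - e + G * expR (- (- (1 / 8) * sqd y c))) + l * Num.max 0 (b - sqd y c)))).
    apply: gint_le => y; first by rewrite addr_ge0 ?cap_ge0.
    have lr0 : 0 <= l * rh by rewrite mulr_ge0.
    have := cap_tangent (l * (sqd y c - b)) lr0; rewrite -/e.
    have -> : - (l * (sqd y c - b)) = l * (b - sqd y c) by ring.
    have -> : Num.max 0 (l * (b - sqd y c)) = l * Num.max 0 (b - sqd y c).
      by rewrite maxr_pMr// mulr0.
    rewrite /G -[K * _ * _]mulrA -expRD.
    have -> : l * (sqd y c - b) - l * rh = l * (sqd y c - sqd x c) by rewrite /rh; ring.
    have := expR_ge1Dx ((sqd y c - sqd x c) / 8).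
    have -> : - (1 / 8 * sqd x c) + - (- (1 / 8) * sqd y c) = (sqd y c - sqd x c) / 8 by lra.
    rewrite /K; move: (expR ((_ - _) / 8)) => E hE.
    have le0 : 0 <= l * e by rewrite mulr_ge0// ltW.
    have := ler_wpM2l le0 hE.
    by move: (Num.max _ _) (cap _) => mx cp; nra.
  have mE : measurable_fun setT (fun y : Borel R d => 1 - e + G * expR (- (- (1 / 8) * sqd y c))).
    by apply: measurable_funD => //; apply: measurable_funM => //; exact: measurable_exp_sqd.
  rewrite gintD//; last 3 first.
  - exact: measurable_funM.
  - by move=> y; rewrite addr_ge0 ?subr_ge0// mulr_ge0 ?expR_ge0.
  - by move=> y; rewrite mulr_ge0.
  rewrite EFinD; apply: leeD; last by rewrite gintZ// [X in (_ <= X)%E]EFinM; apply: lee_wpmul2l => //; exact: neg_le.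
  rewrite gintD//; last 3 first.
  - by apply: measurable_funM => //; exact: measurable_exp_sqd.
  - by move=> y; rewrite subr_ge0.
  - by move=> y; rewrite mulr_ge0 ?expR_ge0.
  rewrite gint_cst ?subr_ge0// gintZ//; last exact: measurable_exp_sqd.
  by rewrite gint_exp.
rewrite -leeBrDr// in main; apply: (le_trans main); rewrite -EFinB lee_fin.
set w := 1 + 4 * - (1 / 8) * s in b0 *.
have wE : w = 1 - s / 2 by rewrite /w; lra.
have w2 : 1 / 2 <= w by lra.
pose B := d%:R / 2 + R2 / 8.
have B0 : 0 <= B by rewrite addr_ge0// mulr_ge0// ltW.
have h1 : (Num.sqrt w)^-1 ^+ d <= expR (d%:R * (s / 2)).
  rewrite expRM_natl lerXn2r ?nnegrE ?expR_ge0 ?invr_ge0//.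
  rewrite -[leRHS]invrK lef_pV2 ?posrE ?sqrtr_gt0 ?invr_gt0 ?expR_gt0// -expRN.
  rewrite -[leLHS]ger0_norm ?expR_ge0// -sqrtr_sqr ler_wsqrtr// expr2 -expRD.
  have := one_sub_expR_ge (ltW s0) s1.
  by rewrite (_ : - (s / 2) + - (s / 2) = - s); lra.
have h2 : expR (- (1 / 8 * sqd x c)) * expR (- (- (1 / 8) / w * sqd x c)) <= expR (R2 / 8 * s).
  rewrite -expRD ler_expR.
  have -> : - (1 / 8 * sqd x c) + - (- (1 / 8) / w * sqd x c) = sqd x c * ((s / 2) / w) / 8.
    have F (v p : R) : v != 0 -> - (1 / 8 * p) + - (- (1 / 8) / v * p) = p * ((1 - v) / v) / 8.
      by move=> v0; field.
    have -> : s / 2 = 1 - w by lra.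
    by apply: F; rewrite gt_eqF.
  have hw : (s / 2) / w <= s by rewrite ler_pdivrMr//; nra.
  have hw0 : 0 <= (s / 2) / w by rewrite divr_ge0 ?(ltW b0)//; lra.
  by have := sqd_ge0 x c; move: ((s / 2) / w) hw hw0 => v *; nra.
have h3 : expR (d%:R * (s / 2)) * expR (R2 / 8 * s) <= 1 + B * expR B * s.
  rewrite -expRD (_ : d%:R * (s / 2) + R2 / 8 * s = B * s); last by rewrite /B; field.
  have := expR_sub1_le (B * s).
  have : expR (B * s) <= expR B by rewrite ler_expR ler_piMr.
  have : 0 <= B * s by rewrite mulr_ge0// ltW.
  by move: (expR (B * s)) (expR B) => E1 E2; nra.
have h4 : expR (- (1 / 8 * sqd x c)) * ((Num.sqrt w)^-1 ^+ d * expR (- (- (1 / 8) / w * sqd x c))) <= 1 + B * expR B * s.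
  apply: le_trans h3; rewrite mulrCA; exact: ler_pM.
have := ler_wpM2l K0 h4; rewrite mulrA -/G.
have : K * (1 + B * expR B * s) <= K + cst_mid * l * s.
  rewrite mulrDr mulr1 lerD2l /cst_mid /= -/B /K.
  have W0 : 0 <= B * expR B * (l * s) by rewrite !mulr_ge0 ?expR_ge0// ltW.
  have -> : 8 * l * e * (B * expR B * s) = e * (8 * (B * expR B * (l * s))) by ring.
  have -> : 8 * (B * expR B) * l * s = 1 * (8 * (B * expR B * (l * s))) by ring.
  by apply: ler_wpM2r => //; rewrite mulr_ge0.
by move: (G * _) => GG; lra.
Qed.

End CapGauss.

Section SingleCap.
Context {R : realType} {d : nat}.
Variables (X : timechange R) (M : refmeasure R d) (r2 R2 t0 : R).
Hypotheses (r20 : 0 < r2) (R20 : 0 < R2) (t00 : 0 < t0 <= 1 / 4).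
Hypothesis t0P : forall t : R, 0 < t -> t <= t0 -> exists2 k, 1 <= k &
    expR (1 - k) * expR (4 * k ^+ 2 * t * R2) <= r2 / 2 * t.
Notation phi := (tc_phi X).

Definition cst_one : R := 2 * cst_mid (d := d) R2 + 2.
Definition cst_corr : R := expR 1 * expR (4 * R2).

Lemma Qop_cap (c x : 'rV[R]_d) h l b (sK : seq (R * R)) K :
  0 < h -> 1 <= l -> (2 * d)%:R <= l * r2 ->
  r2 <= sqd x c -> sqd x c <= R2 -> 0 <= sqd x c - b ->
  all (fun p => 0 <= p.2) sK -> (forall s, h <= s -> 0 <= expsum sK s) ->
  (forall s, h <= s -> s <= 1 ->
     Num.sqrt s * expR (- ((sqd x c - b) / Num.sqrt s)) <= expsum sK s) ->
  \sum_(p <- sK) p.1 * expR (- (h * phi p.2)) <= K ->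
  (Qop X M h setT (fun y => (cap (l * (sqd y c - b)))%:E) x <=
    (1 - expR (- (l * (sqd x c - b))) -
     r2 / 2 * l ^+ 2 * h * expR (- (l * (sqd x c - b))) * (1 - 2 * (h * phi (l ^+ 2 / t0))) +
     l * (cst_one * (h * phi 1) + cst_corr * K))%:E)%E.
Proof.
move=> h0 l1 dl rq qR rho sK0 sKp sKc sKK; set rh := sqd x c - b in rho sKc *.
have l0 : 0 < l by rewrite (lt_le_trans ltr01).
have /andP[t0p t014] := t00.
set e := expR (- (l * rh)); have e0 : 0 < e := expR_gt0 _.
have e1 : e <= 1 by rewrite expR_le1 oppr_le0 mulr_ge0// ltW.
have mid0 := @cst_mid_ge0 R d R2 R20.
have E1 : 1 <= expR 1 :> R by rewrite -{1}expR0 ler_expR.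
have E4 : 1 <= expR (4 * R2) by rewrite -{1}expR0 ler_expR mulr_ge0// ltW.
have C20 : 0 < cst_corr by rewrite mulr_gt0 ?expR_gt0.
have nf : nonneg (fun y : Borel R d => (cap (l * (sqd y c - b)))%:E).
  by split; [apply/measurable_EFinP; exact: measurable_cap_sqd|move=> y; rewrite lee_fin cap_ge0].
rewrite QopE kern_mix//; [|by case: nf|by case: nf].
have eh : expR (- 1) <= 1 / 2 :> R.
  by have := @one_sub_expR_ge R 1 ler01 (lexx 1); lra.
pose g := r2 / 2 * l ^+ 2 * h * e.
have g0 : 0 <= g by rewrite !mulr_ge0 ?sqr_ge0// ?ltW// divr_gt0.
pose lam := l ^+ 2 / t0.
have lam0 : 0 <= lam by rewrite divr_ge0 ?sqr_ge0// ltW.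
(* One sum for all regimes. Its factor [1 - 2 (1 - e^{-lam s})] is at most 1, so the gain [g],
   computed with [h <= s], is not overstated at short times; once [lam s > 1] it is nonpositive and
   no gain is claimed. The term [cst_one (1 - e^{-s})] covers the linear loss up to time 1 and the
   trivial bound 1 afterwards; [sK] carries the crossings. *)
pose S : seq (R * R) := [:: (1 - e + g + l * cst_one, 0); (- (2 * g), lam); (- (l * cst_one), 1)] ++
  [seq (l * cst_corr * p.1, p.2) | p <- sK].
have SM (a : R) (f : R * R -> R) :
    \sum_(j <- sK) a * j.1 * f j = a * \sum_(j <- sK) j.1 * f j.
  by rewrite mulr_sumr; apply: eq_bigr => j _; rewrite mulrA.
have SE t : expsum S t = 1 - e - g * (1 - 2 * (1 - expR (- (lam * t)))) +
    l * (cst_one * (1 - expR (- t)) + cst_corr * expsum sK t).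
  rewrite /expsum /S big_cat /= !big_cons big_nil /= big_map /= mul0r oppr0 expR0 mul1r.
  by rewrite (SM (l * cst_corr) (fun j => expR (- (j.2 * t)))); ring.
have S0 : all (fun p => 0 <= p.2) S.
  by rewrite /S all_cat /= lexx lam0 ler01 all_map.
apply: (le_trans (tc_integral_le h0 S0 _ _)).
- by move=> w; exact: gint_ge0 (fun y => cap_ge0 _).
- move=> w; set s := tc h w; have hs : h <= s by exact: tc_ge.
  have s0 : 0 < s := lt_le_trans h0 hs.
  rewrite SE -/(gint M s x (fun y => cap (l * (sqd y c - b)))).
  have es : expR (- s) <= 1 by rewrite expR_le1 oppr_le0 ltW.
  have K0 := sKp _ hs.
  have [s1|s1] := leP s 1; last first.
    apply: (@le_trans _ _ 1%E).
      rewrite -(gint_cst M x s0 ler01); apply: gint_le => y; [exact: cap_ge0|exact: cap_le1].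
    rewrite lee_fin.
    have : expR (- s) <= 1 / 2.
      have : expR (- s) <= expR (- 1) by rewrite ler_expR lerN2 ltW.
      by lra.
    have : expR (- (lam * s)) <= 1 / 2.
      have : expR (- (lam * s)) <= expR (- 1).
        rewrite ler_expR lerN2; apply: (@le_trans _ _ lam); last by rewrite ler_peMr// ltW.
        by rewrite /lam ler_pdivlMr// mul1r (le_trans t014)//; have := sqr_ge0 (l - 1); nra.
      by lra.
    move: (expR (- s)) (expR (- (lam * s))) => E2 E3 hE3 hE2.
    have : 0 <= g * (1 / 2 - E3) by rewrite mulr_ge0//; lra.
    have : e <= l * (cst_one * (1 - E2)).
      apply: (le_trans e1); rewrite -[leLHS]mulr1; apply: ler_pM => //.
      by rewrite /cst_one; nra.
    have : 0 <= l * (cst_corr * expsum sK s) by rewrite !mulr_ge0// ltW.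
    by move: (cst_corr * _) (cst_one * _) => u v; lra.
  have kap := sKc _ hs s1.
  have ss : s / 2 <= 1 - expR (- s) by apply: one_sub_expR_ge => //; exact: ltW.
  have corrE : corr R2 rh s <= expR (4 * R2) * expsum sK s by rewrite /corr ler_wpM2l ?expR_ge0.
  have [ls|ls] := leP (lam * s) 1.
    have lst : l ^+ 2 * s <= t0.
      by move: ls; rewrite /lam mulrAC ler_pdivrMr// mul1r.
    have ls0 : 0 < l ^+ 2 * s by rewrite mulr_gt0// exprn_gt0.
    have [k k1 kk] := t0P ls0 lst.
    have u1 : 4 * l * s <= 1.
      have H : l * s <= l ^+ 2 * s.
        apply: ler_wpM2r; first exact: ltW.
        by rewrite expr2 ler_peMr// ltW.
      by rewrite -mulrA; move: (l * s) (l ^+ 2 * s) H lst => a1 a2; lra.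
    have gs := gint_cap_small M s0 l0 rq qR rho u1 dl k1 kk.
    apply: (le_trans gs).
    rewrite lee_fin -/rh -/e.
    have lam1 : expR (- (lam * s)) <= 1 by rewrite expR_le1 oppr_le0 mulr_ge0// ltW.
    have : g * (1 - 2 * (1 - expR (- (lam * s)))) <= g by rewrite ler_piMr//; move: lam1; lra.
    have : g <= e * (r2 / 2 * (l ^+ 2 * s)).
      rewrite /g (_ : r2 / 2 * l ^+ 2 * h * e = e * (r2 / 2 * (l ^+ 2 * h))); last by ring.
      apply: ler_wpM2l; first exact: ltW.
      apply: ler_wpM2l; first by rewrite divr_ge0// ltW.
      by apply: ler_wpM2l => //; exact: sqr_ge0.
    have : expR 1 * l * corr R2 rh s <= l * (cst_corr * expsum sK s).
      rewrite mulrAC mulrC; apply: ler_wpM2l; first exact: ltW.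
      rewrite /cst_corr -mulrA; apply: ler_wpM2l => //; exact: expR_ge0.
    have : 0 <= l * (cst_one * (1 - expR (- s))).
      apply: mulr_ge0; first exact: ltW.
      by apply: mulr_ge0; [rewrite /cst_one; move: mid0; lra|rewrite subr_ge0].
    by move: (expR (- (lam * s))) (expR (- s)) (corr _ _ _) (expsum _ _) => v1 v2 v3 v4; lra.
  apply: (le_trans (gint_cap_mid M R20 s0 s1 l0 qR rho)); rewrite lee_fin -/rh -/e.
  have lam2 : expR (- (lam * s)) <= 1 / 2.
    have : expR (- (lam * s)) <= expR (- 1) by rewrite ler_expR lerN2 ltW.
    by lra.
  have : 0 <= g * (1 / 2 - expR (- (lam * s))) by rewrite mulr_ge0//; lra.
  have : l * corr R2 rh s <= l * (cst_corr * expsum sK s).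
    apply: ler_wpM2l; first exact: ltW.
    apply: (le_trans corrE); apply: ler_wpM2r => //.
    by rewrite /cst_corr ler_peMl// expR_ge0.
  have : cst_mid (d := d) R2 * l * s <= l * (cst_one * (1 - expR (- s))).
    rewrite mulrAC mulrC; apply: ler_wpM2l; first exact: ltW.
    by rewrite /cst_one; move: (cst_mid _) mid0 => u *; nra.
  by move: (expR (- (lam * s))) (expR (- s)) (corr _ _ _) (expsum _ _) (cst_mid _) => v1 v2 v3 v4 v5; lra.
rewrite lee_fin /S big_cat /= !big_cons big_nil /= big_map /= tc_phi0 mulr0 oppr0 expR0.
rewrite (SM (l * cst_corr) (fun j => expR (- (h * phi j.2)))).
have h1 := one_sub_expR_le (h * phi lam).
have h2 := one_sub_expR_le (h * phi 1).
have : g * (1 - expR (- (h * phi lam))) <= g * (h * phi lam) by rewrite ler_wpM2l.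
have lc0 : 0 <= l * cst_one by apply: mulr_ge0; [exact: ltW|rewrite /cst_one; lra].
have : l * cst_one * (1 - expR (- (h * phi 1))) <= l * cst_one * (h * phi 1) by rewrite ler_wpM2l.
have lk0 : 0 <= l * cst_corr by rewrite mulr_ge0// ltW.
have := ler_wpM2l lk0 sKK.
rewrite -/g -/lam; move: (\sum_(_ <- _) _) (expR (- (h * phi lam))) (expR (- (h * phi 1))) => u1 u2 u3.
move: (h * phi lam) (h * phi 1) => v1 v2.
by lra.
Qed.

End SingleCap.

Section Scales.
Context {R : realType} (X : timechange R).
Notation phi := (tc_phi X).
Implicit Types (s rho eps h : R) (j J : nat).

(* The limit, as [h -> 0], of [E (1 - e^{-l S_h})^2 / h] at [l = 4^j]: up to constants, the
   intensity of the jumps of size at least [4^{-j}]. *)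
Definition scale_w j : R := 2 * phi (4 ^+ j) - phi (2 * 4 ^+ j).
Definition scale_a j : R := phi (4 ^+ j) / 4 ^+ j.

Let p4 j : 0 < 4 ^+ j :> R. Proof. by rewrite exprn_gt0. Qed.
Let p2 j : 0 < 2 ^+ j :> R. Proof. by rewrite exprn_gt0. Qed.

Lemma scale_w_ge0 j : 0 <= scale_w j.
Proof. by rewrite subr_ge0 tc_phi_double// ltW. Qed.

Lemma scale_w_le j : scale_w j / 4 ^+ j <= 2 * (scale_a j - scale_a j.+1).
Proof.
have h1 : phi (2 * (2 * 4 ^+ j)) <= 2 * phi (2 * 4 ^+ j).
  by apply: tc_phi_double; rewrite mulr_ge0// ltW.
rewrite /scale_w /scale_a exprS; have := p4 j.
have -> : (4 : R) * 4 ^+ j = 2 * (2 * 4 ^+ j) by ring.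
move: (4 ^+ j) h1 => a h1 a0.
have -> : 2 * (phi a / a - phi (2 * (2 * a)) / (2 * (2 * a))) = (2 * phi a - phi (2 * (2 * a)) / 2) / a.
  by field; rewrite gt_eqF.
by apply: ler_wpM2r; [rewrite invr_ge0 ltW|lra].
Qed.

Lemma scale_a_mono j J : (j <= J)%N -> scale_a J <= scale_a j.
Proof.
move=> /subnKC <-; elim: (J - j)%N => [|n IH]; first by rewrite addn0.
apply: le_trans IH; rewrite addnS.
have := scale_w_le (j + n); have : 0 <= scale_w (j + n) / 4 ^+ (j + n).
  by rewrite divr_ge0 ?scale_w_ge0// ltW.
by lra.
Qed.

Lemma scale_w_sum j J : (j <= J)%N ->
  \sum_(j <= i < J) scale_w i / 4 ^+ i <= 2 * (scale_a j - scale_a J).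
Proof.
move=> /subnKC <-; elim: (J - j)%N => [|n IH].
  by rewrite addn0 big_geq// subrr mulr0.
rewrite addnS big_nat_recr ?leq_addr//=.
by have := scale_w_le (j + n); lra.
Qed.

(** The sums telescope into differences of [scale_a], which decreases and stays nonnegative; [j0] is
    taken where it is within [e / 2] of its infimum. *)
Lemma scale_tail (e : R) m0 : 0 < e -> exists2 j0, (m0 <= j0)%N &
  forall J, (j0 <= J)%N -> \sum_(j0 <= i < J) scale_w i / 4 ^+ i <= e.
Proof.
move=> e0; pose S := range scale_a.
have hinf : has_inf S.
  split; first by exists (scale_a 0), 0%N.
  exists 0 => _ [j _ <-]; rewrite /scale_a divr_ge0// ?(ltW (p4 _))//.
  by apply: le_trans (tc_phi_ge _ _); rewrite ltW.
have e20 : 0 < e / 2 by rewrite divr_gt0.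
have [_ [j1 _ <-] h1] := inf_adherent e20 hinf.
exists (maxn m0 j1); first exact: leq_maxl.
move=> J hJ; apply: (le_trans (scale_w_sum hJ)).
have h2 := scale_a_mono (leq_maxr m0 j1).
have h3 : inf S <= scale_a J by apply: (ge_inf hinf.2); exists J.
by move: h1 h2 h3; rewrite -/S; move: (scale_a _) (scale_a (maxn _ _)) (scale_a J) (inf S) => *; lra.
Qed.

Definition scale_c rho j : R := 64 / 2 ^+ j * expR (- (2 ^+ j * rho)).

Lemma scale_c_ge0 rho j : 0 <= scale_c rho j.
Proof. by rewrite /scale_c mulr_ge0 ?expR_ge0// divr_ge0// ltW. Qed.

(** Dominates the crossing profile [sqrt s * e^{-rho / sqrt s}] by exponentials in [s]. Times above
    [4^(-j0)] are covered by [2 (1 - e^{-4^j0 s})]; times between [4^(-j-1)] and [4^(-j)] by the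
    square at scale [j], where [1 - e^{-4^j s} >= 1/8] explains the 64 in [scale_c]; times below
    [4^(-J)] by [1 - e^{-s}], because [rho] is bounded below. Squares make [scale_w] appear in the
    mean, free of the drift. *)
Definition scale_list j0 J rho : seq (R * R) :=
  [:: (3, 0); (- 2, 4 ^+ j0); (- 1, 1)] ++
  flatten [seq [:: (scale_c rho j, 0); (- (2 * scale_c rho j), 4 ^+ j); (scale_c rho j, 2 * 4 ^+ j)]
    | j <- index_iota j0 J].

Lemma scale_listE j0 J rho s : expsum (scale_list j0 J rho) s =
  2 * (1 - expR (- (4 ^+ j0 * s))) + (1 - expR (- s)) +
  \sum_(j0 <= j < J) scale_c rho j * (1 - expR (- (4 ^+ j * s))) ^+ 2.
Proof.
rewrite /expsum /scale_list big_cat /= !big_cons big_nil /= mul0r oppr0 expR0 mul1r.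
rewrite big_flatten /= big_map; congr (_ + _); first by ring.
apply: eq_bigr => j _; rewrite !big_cons big_nil /= mul0r oppr0 expR0.
have -> : - (2 * 4 ^+ j * s) = - (4 ^+ j * s) + - (4 ^+ j * s) by ring.
by rewrite expRD; ring.
Qed.

Lemma scale_list_all j0 J rho : all (fun p => 0 <= p.2) (scale_list j0 J rho).
Proof.
rewrite /scale_list all_cat /= lexx ler01 (ltW (p4 _)) /=.
apply/allP => p /flattenP[_ /mapP[j _ ->]]; rewrite !inE => /or3P[] /eqP -> //=.
Qed.

Let sub_exp01 (u : R) : 0 <= u -> 0 <= 1 - expR (- u).
Proof. by move=> u0; rewrite subr_ge0 expR_le1 oppr_le0. Qed.

Lemma scale_list_ge0 j0 J rho s : 0 <= s -> 0 <= expsum (scale_list j0 J rho) s.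
Proof.
move=> s0; rewrite scale_listE; apply: addr_ge0; first apply: addr_ge0.
- by rewrite mulr_ge0// sub_exp01// mulr_ge0// ltW.
- exact: sub_exp01.
- by apply: sumr_ge0 => j _; rewrite mulr_ge0 ?scale_c_ge0// sqr_ge0.
Qed.

Lemma scale_list_mid j0 J rho s : 0 <= rho -> (j0 <= J)%N -> s <= (4 ^+ j0)^-1 -> (4 ^+ J)^-1 < s ->
  Num.sqrt s * expR (- (rho / Num.sqrt s)) <=
  \sum_(j0 <= j < J) scale_c rho j * (1 - expR (- (4 ^+ j * s))) ^+ 2.
Proof.
move=> rho0 /subnKC <-; elim: (J - j0)%N => [|n IH] s1 s2.
  by rewrite addn0 in s2; have := lt_le_trans s2 s1; rewrite ltxx.
rewrite addnS big_nat_recr ?leq_addr//=; set k := (j0 + n)%N in IH *.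
have t0 j : 0 <= scale_c rho j * (1 - expR (- (4 ^+ j * s))) ^+ 2.
  by rewrite mulr_ge0 ?scale_c_ge0// sqr_ge0.
have [sk|sk] := ltP (4 ^+ k)^-1 s.
  by apply: (le_trans (IH s1 sk)); rewrite lerDl.
rewrite -[leLHS]add0r; apply: lerD; first by rewrite sumr_ge0.
have s0 : 0 < s by apply: le_lt_trans s2; rewrite invr_ge0 ltW.
have ks : (4 ^+ k : R) = (2 ^+ k) ^+ 2 by rewrite -exprM mulnC exprM; congr (_ ^+ _); rewrite expr2; ring.
have sq : Num.sqrt s <= (2 ^+ k)^-1.
  have -> : (2 ^+ k)^-1 = Num.sqrt ((4 ^+ k)^-1) :> R.
    by rewrite sqrtrV ?ks ?sqrtr_sqr ?ger0_norm// ltW.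
  exact: ler_wsqrtr.
have sq0 : 0 < Num.sqrt s by rewrite sqrtr_gt0.
have h1 : expR (- (rho / Num.sqrt s)) <= expR (- (2 ^+ k * rho)).
  rewrite ler_expR lerN2 mulrC; apply: ler_wpM2l => //.
  by rewrite -[2 ^+ k]invrK lef_pV2 ?posrE ?invr_gt0.
have h2 : 1 / 8 <= 1 - expR (- (4 ^+ k * s)).
  apply: (@le_trans _ _ (1 - expR (- (1 / 4)))).
    by have := @one_sub_expR_ge R (1 / 4); lra.
  rewrite lerD2l lerN2 ler_expR lerN2 mul1r.
  have : 4 ^+ k * (4 ^+ k.+1)^-1 <= 4 ^+ k * s.
    by apply: ler_wpM2l; [exact: ltW|rewrite /k -addnS ltW].
  by apply: le_trans; rewrite exprS invfM mulrCA divff ?gt_eqF// mulr1.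
have h3 : 1 / 64 <= (1 - expR (- (4 ^+ k * s))) ^+ 2 by move: (1 - _) h2 => v *; nra.
apply: (@le_trans _ _ (scale_c rho k * (1 / 64))); last by rewrite ler_wpM2l ?scale_c_ge0.
rewrite /scale_c (_ : 64 / 2 ^+ k * _ * _ = (2 ^+ k)^-1 * expR (- (2 ^+ k * rho))).
  by apply: ler_pM; rewrite ?expR_ge0// ltW.
by move: (_^-1) (expR _) => *; field.
Qed.

Lemma scale_list_ge j0 J rho eps s : 0 < eps -> eps <= rho -> (j0 <= J)%N ->
  12 / 4 ^+ J <= eps ^+ 3 -> 0 < s -> s <= 1 ->
  Num.sqrt s * expR (- (rho / Num.sqrt s)) <= expsum (scale_list j0 J rho) s.
Proof.
move=> e0 er jJ eJ s0 s1; have rho0 := lt_le_trans e0 er.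
rewrite scale_listE.
have A0 : 0 <= 1 - expR (- (4 ^+ j0 * s)) by rewrite sub_exp01// mulr_ge0// ltW.
have B0 : 0 <= 1 - expR (- s) by rewrite sub_exp01// ltW.
have C0 : 0 <= \sum_(j0 <= j < J) scale_c rho j * (1 - expR (- (4 ^+ j * s))) ^+ 2.
  by apply: sumr_ge0 => j _; rewrite mulr_ge0 ?scale_c_ge0// sqr_ge0.
have sq0 : 0 < Num.sqrt s by rewrite sqrtr_gt0.
have [sj|sj] := leP s (4 ^+ j0)^-1; last first.
  have h1 : Num.sqrt s * expR (- (rho / Num.sqrt s)) <= 1.
    rewrite -[leRHS]mulr1; apply: ler_pM; rewrite ?expR_ge0//.
      by rewrite -[leRHS]sqrtr1 ler_wsqrtr.
    by rewrite expR_le1 oppr_le0 divr_ge0// ltW.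
  have : expR (- (4 ^+ j0 * s)) <= expR (- 1).
    rewrite ler_expR lerN2; have : 4 ^+ j0 * (4 ^+ j0)^-1 <= 4 ^+ j0 * s.
      by apply: ler_wpM2l; exact: ltW.
    by rewrite mulfV ?gt_eqF.
  have : expR (- 1) <= 1 / 2 :> R by have := @one_sub_expR_ge R 1 ler01 (lexx 1); lra.
  by lra.
have [sJ|sJ] := ltP (4 ^+ J)^-1 s.
  by have := scale_list_mid (ltW rho0) jJ sj sJ; lra.
have h1 := one_sub_expR_ge (ltW s0) s1.
have u0 : 0 < rho / Num.sqrt s by rewrite divr_gt0.
(* For [s <= 4^(-J)] the profile is at most [6 s^2 / rho^3], which is below [s / 2] by the choice of
   [J] relative to [eps]. *)
have h2 := expR_neg_pow 3 u0; rewrite (_ : 3`! = 6%N)// in h2.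
have h3 : Num.sqrt s * expR (- (rho / Num.sqrt s)) <= 6 * s ^+ 2 / rho ^+ 3.
  apply: (le_trans (ler_wpM2l (ltW sq0) h2)).
  have E : s = Num.sqrt s ^+ 2 by rewrite sqr_sqrtr// ltW.
  rewrite [in leRHS]E; move: (Num.sqrt s) sq0 => v v0.
  by rewrite le_eqVlt; apply/orP; left; apply/eqP; field; rewrite !gt_eqF.
have r3 : eps ^+ 3 <= rho ^+ 3 by apply: lerXn2r => //; rewrite nnegrE ltW.
have e3 : 0 < eps ^+ 3 by rewrite exprn_gt0.
have h4 : 6 * s ^+ 2 / rho ^+ 3 <= s / 2.
  rewrite ler_pdivrMr ?(lt_le_trans e3)//.
  apply: (@le_trans _ _ (s / 2 * eps ^+ 3)); last by rewrite ler_wpM2l// divr_ge0// ltW.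
  have : s / 2 * (12 / 4 ^+ J) <= s / 2 * eps ^+ 3 by rewrite ler_wpM2l// divr_ge0// ltW.
  by apply: le_trans; move: ((4 ^+ J)^-1) sJ => v *; nra.
by lra.
Qed.

(** Since [e^{-u} <= 1 - u + u^2], each square has mean at most [h scale_w j] plus an error
    quadratic in [h], removed later by taking [h] small. *)
Lemma scale_list_phi j0 J rho h : 0 < h ->
  \sum_(p <- scale_list j0 J rho) p.1 * expR (- (h * phi p.2)) <=
  2 * (h * phi (4 ^+ j0)) + h * phi 1 +
  \sum_(j0 <= j < J) scale_c rho j * (h * scale_w j + (h * phi (2 * 4 ^+ j)) ^+ 2).
Proof.
move=> h0; rewrite /scale_list big_cat /= !big_cons big_nil /= big_flatten /= big_map.
apply: lerD.
  have := one_sub_expR_le (h * phi (4 ^+ j0)); have := one_sub_expR_le (h * phi 1).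
  by rewrite tc_phi0 mulr0 oppr0 expR0; lra.
apply: ler_sum => j _; rewrite !big_cons big_nil /= tc_phi0 mulr0 oppr0 expR0.
have a0 : 0 <= h * phi (2 * 4 ^+ j).
  by rewrite mulr_ge0 ?(ltW h0)//; apply: le_trans (tc_phi_ge _ _); rewrite mulr_ge0// ltW.
have h1 : expR (- (h * phi (2 * 4 ^+ j))) <= 1 - h * phi (2 * 4 ^+ j) + (h * phi (2 * 4 ^+ j)) ^+ 2.
  move: (h * phi _) a0 => u u0.
  rewrite expRN -[leLHS]mul1r ler_pdivrMr ?expR_gt0//.
  have e3 := expR_ge1Dx u.
  have v0 : 0 < 1 - u + u ^+ 2 by nra.
  by apply: le_trans (ler_wpM2l (ltW v0) e3); have := exprn_ge0 3 u0; nra.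
have h2 := one_sub_expR_le (h * phi (4 ^+ j)).
have c0 := scale_c_ge0 rho j.
rewrite addr0 mulr1 /scale_w.
have -> : scale_c rho j + (- (2 * scale_c rho j) * expR (- (h * phi (4 ^+ j))) +
  scale_c rho j * expR (- (h * phi (2 * 4 ^+ j)))) =
  scale_c rho j * (1 - 2 * expR (- (h * phi (4 ^+ j))) + expR (- (h * phi (2 * 4 ^+ j)))) by ring.
by apply: ler_wpM2l => //; lra.
Qed.

End Scales.

Lemma expR1_le3 (R : realType) : expR 1 <= 3 :> R.
Proof.
have e8 : expR (1 / 8) <= 8 / 7 :> R.
  have := @one_sub_expR_le R (1 / 8).
  have : expR (- (1 / 8)) * expR (1 / 8) = 1 :> R by rewrite -expRD addrC subrr expR0.
  by have := expR_gt0 (1 / 8 : R); move: (expR (1 / 8)) (expR (- (1 / 8))) => a b; nra.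
have -> : (1 : R) = 8%:R * (1 / 8) by lra.
rewrite expRM_natl; apply: (@le_trans _ _ ((8 / 7) ^+ 8)).
  by apply: lerXn2r => //; rewrite nnegrE ?expR_ge0//; lra.
by rewrite !exprS expr0; lra.
Qed.

Section UpperBarrier.
Context {R : realType} {d : nat}.
Variables (X : timechange R) (M : refmeasure R d).
Notation phi := (tc_phi X).

Definition barrier (L : seq (R * R)) (z : R) : R := \sum_(p <- L) p.1 * cap (p.2 * z).

Lemma barrier_ge0 L z : all (fun p => 0 <= p.1) L -> 0 <= barrier L z.
Proof.
move=> /allP L0; rewrite /barrier big_seq sumr_ge0// => p pL.
by rewrite mulr_ge0 ?cap_ge0//; exact: L0.
Qed.

Lemma measurable_barrier L b c :
  measurable_fun setT (fun y : Borel R d => barrier L (sqd y c - b)).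
Proof.
elim: L => [|p L IH].
  rewrite (_ : (fun y => _) = cst 0)//; apply/funext => y; exact: big_nil.
rewrite (_ : (fun y => _) = (fun y : Borel R d => p.1 * cap (p.2 * (sqd y c - b)) + barrier L (sqd y c - b))).
  by apply: measurable_funD => //; apply: measurable_funM => //; exact: measurable_cap_sqd.
by apply/funext => y; rewrite /barrier big_cons.
Qed.

Lemma barrier_nonneg L b c : all (fun p => 0 <= p.1) L ->
  nonneg (fun y : Borel R d => (barrier L (sqd y c - b))%:E).
Proof.
move=> L0; split; last by move=> y; rewrite lee_fin barrier_ge0.
by apply/measurable_EFinP; exact: measurable_barrier.
Qed.

Lemma barrier_le L z : 0 <= z -> all (fun p => (0 <= p.1) && (0 <= p.2)) L ->
  barrier L z <= (\sum_(p <- L) p.1 * p.2) * z.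
Proof.
move=> z0 /allP L0; rewrite /barrier mulr_suml big_seq [leRHS]big_seq; apply: ler_sum => p /L0 /andP[p1 p2].
by rewrite -mulrA ler_wpM2l// cap_le// mulr_ge0.
Qed.

Lemma Qop_barrier_le L b c h (x : 'rV[R]_d) (B : R * R -> R) : 0 < h ->
  all (fun p => 0 <= p.1) L ->
  (forall p, p \in L -> Qop X M h setT (fun y => (cap (p.2 * (sqd y c - b)))%:E) x <= (B p)%:E)%E ->
  (Qop X M h setT (fun y => (barrier L (sqd y c - b))%:E) x <= (\sum_(p <- L) p.1 * B p)%:E)%E.
Proof.
move=> h0; elim: L => [|p L IH] /=.
  move=> _ _; rewrite big_nil -[leRHS](Qop0 X M h setT x).
  by rewrite le_eqVlt; apply/orP; left; apply/eqP/Qop_eq => y _; rewrite /barrier big_nil.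
move=> /andP[p0 L0] H.
have nc : nonneg (fun y : Borel R d => (cap (p.2 * (sqd y c - b)))%:E).
  by split; [apply/measurable_EFinP; exact: measurable_cap_sqd|move=> y; rewrite lee_fin cap_ge0].
have -> : Qop X M h setT (fun y => (barrier (p :: L) (sqd y c - b))%:E) x =
   (Qop X M h setT (fun y => (p.1)%:E * (cap (p.2 * (sqd y c - b)))%:E + (barrier L (sqd y c - b))%:E) x)%E.
  by apply: Qop_eq => y _; rewrite /barrier big_cons.
rewrite (QopD X M x h0 measurableT (nonneg_scale p0 nc) (barrier_nonneg b c L0)).
rewrite (QopZ X M x h0 measurableT p0 nc) big_cons EFinD; apply: leeD.
  by rewrite EFinM; apply: lee_wpmul2l => //; apply: H; rewrite mem_head.
by apply: IH => // q qL; apply: H; rewrite in_cons qL orbT.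
Qed.

(** The gain at scale [2^j] and the crossing loss at that scale have the same shape
    [2^(-j) w_j h e^{-2^j rho}], so coefficients proportional to [8^(-j) w_j] cancel the losses
    exactly. All other losses are at most a constant times [h] and are paid by the single scale
    [ls], whose gain is only effective for [rho <= 1 / ls]. The shift [eps] keeps [rho >= eps], so
    finitely many scales suffice; [ls] and the slope bound 2 do not depend on it. *)
Theorem upper_barrier (r2 R2 : R) : 0 < r2 -> 0 < R2 -> exists2 ls : R, 1 <= ls &
  forall eps : R, 0 < eps -> exists2 h0 : R, 0 < h0 &
  forall h, 0 < h -> h <= h0 -> exists L : seq (R * R),
  [/\ all (fun p => (0 <= p.1) && (0 <= p.2)) L, \sum_(p <- L) p.1 * p.2 <= 2,
      (ls^-1, ls) \in L &
      forall c x : 'rV[R]_d, r2 <= sqd x c -> sqd x c <= R2 -> sqd x c - (r2 - eps) <= ls^-1 ->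
      (Qop X M h setT (fun y => (barrier L (sqd y c - (r2 - eps)))%:E) x <=
       (barrier L (sqd x c - (r2 - eps)) - h)%:E)%E].
Proof.
move=> r20 R20.
have [t0 t00 t0P] := small_remainder r20 R20; have /andP[t0p _] := t00.
pose C1 : R := cst_one (d := d) R2; pose C2 : R := cst_corr R2.
have C1_ge0 : 0 <= C1 by have := @cst_mid_ge0 R d R2 R20; rewrite /C1 /cst_one; lra.
have C2_gt0 : 0 < C2 by rewrite mulr_gt0 ?expR_gt0.
have f1 : 1 <= phi 1 := tc_phi_ge X ler01.
(* At scale [2^j] the gain is [kap r2 / 4] and the loss [2 * 64 * C2], both times
   [2^(-j) w_j h e^{-2^j rho}]; they balance for [kap = 512 C2 / r2]. The factor 2 is the total
   slope of the barrier, which [tail] keeps below 2 by choosing [j0] with weighted sum at most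
   [1 / kap]. *)
pose kap : R := 512 * C2 / r2.
have kap0 : 0 < kap by apply: divr_gt0; [apply: mulr_gt0; [rewrite ltr0n|exact: C2_gt0]|exact: r20].
pose m0 := Num.truncn ((2 * d)%:R / r2 : R).
have kapi : 0 < kap^-1 by rewrite invr_gt0.
have [j0 m0j0 tail] := scale_tail X m0.+1 kapi.
pose D0 : R := 2 * C1 * phi 1 + 2 * C2 * (2 * phi (4 ^+ j0) + phi 1 + 1) + 1.
have pj0 : 0 <= phi (4 ^+ j0) by apply: le_trans (tc_phi_ge X _); rewrite exprn_ge0.
have D00 : 0 <= D0.
  have : 0 <= C1 * phi 1 by rewrite mulr_ge0//; lra.
  have : 0 <= C2 * (2 * phi (4 ^+ j0) + phi 1 + 1) by rewrite mulr_ge0 ?(ltW C2_gt0)//; lra.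
  by rewrite /D0; lra.
(* The last summand pays for [D0]: near the sphere [e^{-ls rho} >= 1/3], so the gain [r2 ls h / 12]
   is at least [D0 h]. The [+ 1] in [D0] is the surplus that becomes the drift [- h] of the
   conclusion. *)
pose ls : R := 1 + (2 * d)%:R / r2 + 12 * D0 / r2.
have dr0 : 0 <= (2 * d)%:R / r2 by rewrite divr_ge0// ltW.
have Dr0 : 0 <= 12 * D0 / r2 by rewrite divr_ge0 ?(ltW r20)// mulr_ge0.
have ls1 : 1 <= ls by rewrite /ls; lra.
exists ls => // eps e0.
have [J jJ eJ] : exists2 J, (j0 <= J)%N & 12 / 4 ^+ J <= eps ^+ 3.
  have e3 : 0 < eps ^+ 3 by rewrite exprn_gt0.
  pose n := Num.truncn (12 / eps ^+ 3).
  exists (maxn j0 n.+1); first exact: leq_maxl.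
  rewrite ler_pdivrMr ?exprn_gt0// mulrC -ler_pdivrMr//.
  apply: ltW; apply: (lt_le_trans (truncnS_gt _)).
  rewrite -natrX ler_nat; apply: (leq_trans _ (ltnW (ltn_expl _ _)))%N => //; exact: leq_maxr.
pose G : R := phi (ls ^+ 2 / t0) + \sum_(j0 <= j < J) phi ((2 ^+ j) ^+ 2 / t0).
pose H2 : R := \sum_(j0 <= j < J) 64 * phi (2 * 4 ^+ j) ^+ 2.
have ph0 (a : R) : 0 <= a -> 0 <= phi a by move=> a0; apply: le_trans (tc_phi_ge X a0).
have G0 : 0 <= G.
  by rewrite addr_ge0 ?sumr_ge0// => *; rewrite ph0// divr_ge0 ?sqr_ge0// ltW.
have H20 : 0 <= H2 by rewrite sumr_ge0// => j _; rewrite mulr_ge0// sqr_ge0.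
(* For such [h], [h G <= 1/4] preserves at least half of every gain, and [h H2 <= 1] brings the
   quadratic errors below [h]. *)
exists ((4 * G + H2 + 1)^-1); first by rewrite invr_gt0; lra.
move=> h h0 hh.
have hG : h * (4 * G + H2 + 1) <= 1 by rewrite -ler_pdivlMr; [rewrite mul1r|lra].
have hH : h * H2 <= 1 by nra.
have hG4 : 4 * (h * G) <= 1 by nra.
pose L : seq (R * R) := (ls^-1, ls) ::
  [seq (kap / 8 ^+ j * scale_w X j, 2 ^+ j) | j <- index_iota j0 J].
have ls0 : 0 < ls by lra.
have w0 := scale_w_ge0 X.
have L0 : all (fun p => (0 <= p.1) && (0 <= p.2)) L.
  rewrite /L /= invr_ge0 (ltW ls0) /= all_map; apply/allP => j _ /=.
  by rewrite exprn_ge0// andbT mulr_ge0// divr_ge0 ?exprn_ge0// ltW.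
have L01 : all (fun p => 0 <= p.1) L.
  by apply: sub_all L0 => p /andP[].
have H1 : \sum_(p <- L) p.1 * p.2 <= 2.
  rewrite big_cons /= mulVf ?gt_eqF// big_map /=.
  have -> : \sum_(j <- index_iota j0 J) kap / 8 ^+ j * scale_w X j * 2 ^+ j =
    kap * \sum_(j0 <= j < J) scale_w X j / 4 ^+ j.
    rewrite mulr_sumr; apply: eq_bigr => j _.
    have -> : (8 : R) ^+ j = 4 ^+ j * 2 ^+ j by rewrite -exprMn; congr (_ ^+ _); ring.
    have : (4 : R) ^+ j != 0 by rewrite gt_eqF// exprn_gt0.
    have : (2 : R) ^+ j != 0 by rewrite gt_eqF// exprn_gt0.
    by move: (4 ^+ j) (2 ^+ j) (scale_w X j) => u v w v1 u1; field; apply/andP.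
  have := ler_wpM2l (ltW kap0) (tail J jJ); rewrite divff ?gt_eqF//; lra.
exists L; split => //; first by rewrite /L mem_head.
move=> c x rq qR rl; set rh := sqd x c - (r2 - eps) in rl *.
have rhe : eps <= rh by rewrite /rh; lra.
have rh0 : 0 <= rh by lra.
pose K : R := 2 * (h * phi (4 ^+ j0)) + h * phi 1 +
  \sum_(j0 <= j < J) scale_c rh j * (h * scale_w X j + (h * phi (2 * 4 ^+ j)) ^+ 2).
pose B (p : R * R) : R := 1 - expR (- (p.2 * rh)) -
     r2 / 2 * p.2 ^+ 2 * h * expR (- (p.2 * rh)) * (1 - 2 * (h * phi (p.2 ^+ 2 / t0))) +
     p.2 * (C1 * (h * phi 1) + C2 * K).
have main : forall p, p \in L -> 1 <= p.2 /\ (2 * d)%:R <= p.2 * r2 /\ h * phi (p.2 ^+ 2 / t0) <= h * G.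
  move=> p; rewrite /L in_cons => /orP[/eqP ->|/mapP[j jin ->]] /=.
    split => //; split.
      by rewrite -ler_pdivrMr// /ls; lra.
    apply: ler_wpM2l; first exact: ltW.
    by rewrite /G lerDl sumr_ge0// => j _; rewrite ph0// divr_ge0 ?sqr_ge0// ltW.
  split; first by rewrite exprn_ege1// ler1n.
  split.
    rewrite -ler_pdivrMr//; apply: ltW; apply: (lt_le_trans (truncnS_gt _)); rewrite -/m0.
    rewrite -natrX ler_nat; apply: (leq_trans _ (ltnW (ltn_expl _ _)))%N => //.
    by apply: (leq_trans m0j0); move: jin; rewrite mem_index_iota => /andP[].
  apply: ler_wpM2l; first exact: ltW.
  rewrite /G (bigD1_seq j) ?iota_uniq//= addrCA lerDl addr_ge0//.
    by rewrite ph0// divr_ge0 ?sqr_ge0// ltW.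
  by rewrite sumr_ge0// => i _; rewrite ph0// divr_ge0 ?sqr_ge0// ltW.
apply: (le_trans (Qop_barrier_le (B := B) h0 L01 _)).
  move=> p pL; have [p1 [pd pG]] := main p pL.
  apply: (@Qop_cap R d X M r2 R2 t0 r20 R20 t00 t0P c x h p.2 _ (scale_list j0 J rh) K h0 p1 pd rq qR rh0).
  - exact: scale_list_all.
  - by move=> s hs; apply: scale_list_ge0; move: h0 hs; clear -X M; lra.
  - by move=> s hs s1; apply: (scale_list_ge e0 rhe jJ eJ) => //; move: h0 hs; clear -X M; lra.
  - exact: scale_list_phi.
rewrite lee_fin.
have K0 : 0 <= K.
  rewrite !addr_ge0 ?mulr_ge0 ?ph0 ?(ltW h0) ?exprn_ge0//.
  by apply: sumr_ge0 => j _; rewrite mulr_ge0 ?scale_c_ge0// addr_ge0 ?sqr_ge0// mulr_ge0 ?(ltW h0).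
pose gain (p : R * R) := p.1 * (r2 / 4 * p.2 ^+ 2 * h * expR (- (p.2 * rh))).
have step : \sum_(p <- L) p.1 * B p <= barrier L rh - \sum_(p <- L) gain p +
   (\sum_(p <- L) p.1 * p.2) * (C1 * (h * phi 1) + C2 * K).
  rewrite /barrier mulr_suml -sumrB -big_split /= big_seq [leRHS]big_seq; apply: ler_sum => p pL.
  have [p1 [pd pG]] := main p pL.
  have /andP[p10 p20] := allP L0 p pL.
  rewrite capE ?mulr_ge0// -mulrA -mulrBr -mulrDr; apply: ler_wpM2l => //.
  rewrite /B; set e := expR _; have E0 : 0 <= e := expR_ge0 _.
  rewrite lerD2r lerD2l lerN2.
  have -> : r2 / 4 * p.2 ^+ 2 * h * e = r2 / 2 * p.2 ^+ 2 * h * e * (1 / 2) by field.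
  apply: ler_wpM2l; last by move: pG hG4; clear -X M; lra.
  by rewrite !mulr_ge0 ?sqr_ge0 ?(ltW h0)// ltW.
apply: (le_trans step).
have P0 : 0 <= C1 * (h * phi 1) + C2 * K.
  by rewrite addr_ge0// mulr_ge0 ?(ltW C2_gt0)// mulr_ge0 ?(ltW h0)//; move: f1; clear -X M; lra.
have loss : (\sum_(p <- L) p.1 * p.2) * (C1 * (h * phi 1) + C2 * K) <= 2 * (C1 * (h * phi 1) + C2 * K).
  exact: ler_wpM2r.
have Ksplit : K <= h * (2 * phi (4 ^+ j0) + phi 1 + 1) + h * \sum_(j0 <= j < J) scale_c rh j * scale_w X j.
  rewrite /K; have -> : \sum_(j0 <= j < J) scale_c rh j * (h * scale_w X j + (h * phi (2 * 4 ^+ j)) ^+ 2) =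
     h * (\sum_(j0 <= j < J) scale_c rh j * scale_w X j) + \sum_(j0 <= j < J) scale_c rh j * (h * phi (2 * 4 ^+ j)) ^+ 2.
    by rewrite mulr_sumr -big_split /=; apply: eq_bigr => j _; ring.
  have : \sum_(j0 <= j < J) scale_c rh j * (h * phi (2 * 4 ^+ j)) ^+ 2 <= h * (h * H2).
    rewrite /H2 !mulr_sumr; apply: ler_sum => j _.
    have : scale_c rh j <= 64.
      rewrite /scale_c -[leRHS]mulr1; apply: ler_pM; rewrite ?expR_ge0 ?divr_ge0 ?exprn_ge0//.
        by rewrite ler_pdivrMr ?exprn_gt0// ler_peMr// exprn_ege1// ler1n.
      by rewrite expR_le1 oppr_le0 mulr_ge0// exprn_ge0.
    have := sqr_ge0 (h * phi (2 * 4 ^+ j)).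
    have -> : h * (h * (64 * phi (2 * 4 ^+ j) ^+ 2)) = 64 * (h * phi (2 * 4 ^+ j)) ^+ 2 by ring.
    by move: (_ ^+ 2) (scale_c _ _) => u v *; rewrite ler_wpM2r.
  have : h * (h * H2) <= h * 1 by rewrite ler_wpM2l// ltW.
  by clear -X M; lra.
have gainE : \sum_(p <- L) gain p = r2 / 4 * ls * h * expR (- (ls * rh)) +
   2 * C2 * (h * \sum_(j0 <= j < J) scale_c rh j * scale_w X j).
  rewrite /L big_cons big_map /gain /=; congr (_ + _).
    by move: (expR _) => e; field; rewrite gt_eqF.
  rewrite !mulr_sumr; apply: eq_bigr => j _; rewrite /scale_c.
  have -> : (8 : R) ^+ j = (2 ^+ j) * (2 ^+ j) * (2 ^+ j) by rewrite -!exprMn; congr (_ ^+ _); ring.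
  have : (2 : R) ^+ j != 0 by rewrite gt_eqF// exprn_gt0.
  rewrite /kap; move: (2 ^+ j) (scale_w X j) (expR _) => v w e v0.
  by field; rewrite v0 gt_eqF.
have e3 : 1 / 3 <= expR (- (ls * rh)).
  apply: (@le_trans _ _ (expR (- 1))); last first.
    rewrite ler_expR lerN2; have := ler_wpM2l (ltW ls0) rl.
    by rewrite divff ?gt_eqF.
  by rewrite expRN mul1r lef_pV2 ?posrE ?expR_gt0// expR1_le3.
have ge : D0 * h <= r2 / 4 * ls * h * expR (- (ls * rh)).
  have : 12 * D0 <= r2 * ls.
    have -> : 12 * D0 = r2 * (12 * D0 / r2) by field; rewrite gt_eqF.
    by apply: ler_wpM2l; [exact: ltW|rewrite /ls; move: dr0; clear -X M; lra].
  move=> q1; apply: (@le_trans _ _ (r2 / 4 * ls * h * (1 / 3))).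
    by have := ler_wpM2r (ltW h0) q1; clear -X M; lra.
  by apply: ler_wpM2l => //; rewrite !mulr_ge0 ?(ltW h0) ?(ltW ls0)// ltW.
have := ler_wpM2l (ltW C2_gt0) Ksplit.
move: gainE loss ge; rewrite /D0 => -> loss ge.
by move: loss ge; move: (\sum_(j0 <= j < J) _) (expR _) (\sum_(p <- L) _) => u v w; clear -X M; lra.
Qed.

End UpperBarrier.

(** * Upper bounds on killed potentials *)

Lemma sqd_triangle {R : realType} {d : nat} (a b c : 'rV[R]_d) : sqd a c <= 2 * sqd a b + 2 * sqd b c.
Proof.
rewrite !sqdE !mulr_sumr -big_split /=; apply: ler_sum => i _.
by move: (a 0 i) (b 0 i) (c 0 i) => u v w; have := sqr_ge0 (u - v - (v - w)); nra.
Qed.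

Lemma sqdxx {R : realType} {d : nat} (a : 'rV[R]_d) : sqd a a = 0.
Proof. by rewrite sqdE big1// => i _; rewrite subrr expr0n. Qed.

Lemma dotp_cauchy {R : realType} {d : nat} (x y : 'rV[R]_d) : dotp x y ^+ 2 <= dotp x x * dotp y y.
Proof.
have q0 (z : 'rV[R]_d) : 0 <= dotp z z by apply: sumr_ge0 => i _; rewrite -expr2 sqr_ge0.
have [y0|y0] := eqVneq (dotp y y) 0.
  have : dotp x y = 0.
    apply: big1 => i _; have : y 0 i = 0.
      apply/eqP; rewrite -sqrf_eq0; apply/eqP.
      have p0 j : true -> 0 <= y 0 j * y 0 j by rewrite -expr2 sqr_ge0.
      by rewrite expr2; exact: (psumr_eq0P p0 y0).
    by move=> ->; rewrite mulr0.
  by move=> ->; rewrite y0 mulr0 expr0n.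
have yp : 0 < dotp y y by rewrite lt_neqAle eq_sym y0 q0.
pose t := dotp x y / dotp y y.
have := q0 (x - t *: y).
have -> : dotp (x - t *: y) (x - t *: y) = dotp x x - 2 * t * dotp x y + t ^+ 2 * dotp y y.
  by rewrite /dotp !mulr_sumr -sumrB -big_split /=; apply: eq_bigr => i _; rewrite !mxE; ring.
have -> : dotp x x - 2 * t * dotp x y + t ^+ 2 * dotp y y = dotp x x - dotp x y ^+ 2 / dotp y y.
  by rewrite /t; field.
by rewrite subr_ge0 ler_pdivrMr.
Qed.

Lemma cap_homo {R : realType} : {homo (@cap R) : x y / x <= y}.
Proof.
move=> x y xy; rewrite /cap ge_max le_max lexx /= le_max; apply/orP; right.
by rewrite lerD2l lerN2 ler_expR lerN2.
Qed.

Section Bounds.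
Context {R : realType} {d : nat}.
Variables (X : timechange R) (M : refmeasure R d) (D : set (Borel R d)).
Hypotheses (mD : measurable D) (d0 : (0 < d)%N).
Notation m := (refm M).
Hypothesis finD : (m D < +oo)%E.
Notation Q h := (Qop X M h D).
Notation U h := (Uop X M h D).
Implicit Types (x y : 'rV[R]_d) (f g : Borel R d -> \bar R) (h : R) (n : nat) (A : set 'rV[R]_d).

Definition far (s : R) y A := forall a, A a -> s ^+ 2 <= sqd y a.

Let one : Borel R d -> \bar R := fun=> 1%E.
Let n1 : nonneg one. Proof. exact: nonneg_cst ler01. Qed.

Lemma Qiter_free h n f x : 0 < h -> nonneg f ->
  (iter n.+1 (Q h) f x <= Qop X M (n.+1%:R * h) setT (fun y => f y * (\1_D y)%:E) x)%E.
Proof.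
move=> h0 nf; have nfD := nonneg_mul nf (nonneg_indic mD).
rewrite -(Qop_iter X M n x h0 nfD); elim: n x => [|n IH] x.
  by rewrite /= !Qop_mkcond; under [leRHS]eq_integral do rewrite indicT mule1.
have nq k := Qiter_nonneg X M h0 mD k nf.
have nt k := Qiter_nonneg X M h0 measurableT k nfD.
apply: (le_trans (Qop_le X M x h0 mD (nq n.+1) (nt n.+1) _)); first by move=> y _; exact: IH.
exact: (Qop_leF X M x h0 mD measurableT (nt n.+1)).
Qed.

Lemma Qiter_bound h n f x (c N : R) : 0 < h -> nonneg f -> 0 <= c ->
  (forall y, D y -> f y != 0%E -> kern X (n.+1%:R * h) x y <= c) ->
  (\int[m]_(y in D) f y <= N%:E)%E -> (iter n.+1 (Q h) f x <= (c * N)%:E)%E.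
Proof.
move=> h0 nf c0 kc fN; apply: (le_trans (Qiter_free n x h0 nf)).
have [mf f0] := nf.
apply: (@le_trans _ _ (c%:E * \int[m]_(y in D) f y)%E); last first.
  by rewrite EFinM; apply: lee_wpmul2l.
have [mfD fD0] := nonneg_mul nf (nonneg_indic mD).
rewrite QopE [in leRHS]integral_indic_mul -ge0_integralZl//.
apply: ge0_le_lower_integral => y _; first by rewrite !mule_ge0// lee_fin// kern_ge0.
rewrite indicE; have [/set_mem yD|_] := boolP (y \in D); last by rewrite !mule0.
rewrite !mule1; have [->|fy] := eqVneq (f y) 0%E; first by rewrite !mule0.
by apply: lee_wpmul2r => //; rewrite lee_fin; exact: kc.
Qed.

Lemma gmax_le (s t : R) : 0 < s -> s <= t -> gmax (d := d) t <= gmax (d := d) s.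
Proof.
move=> s0 st; have t0 := lt_le_trans s0 st; have p0 := pi_gt0 R.
apply: lerXn2r; rewrite ?nnegrE ?invr_ge0// lef_pV2 ?posrE ?sqrtr_gt0 ?mulr_gt0//.
by apply: ler_wsqrtr; rewrite ler_pM2l// mulr_gt0.
Qed.

Lemma gmax_small (e : R) : 0 < e -> exists2 T : R, 1 <= T & gmax (d := d) T <= e.
Proof.
move=> e0; exists (1 + (e ^+ 2)^-1); first by rewrite lerDl invr_ge0 exprn_ge0// ltW.
have e2 : 0 < (e ^+ 2)^-1 by rewrite invr_gt0 exprn_gt0.
set T := 1 + _; have T0 : 0 < T by rewrite /T; lra.
have s1 : 1 <= Num.sqrt (4 * pi * T).
  by rewrite -[leLHS]sqrtr1 ler_wsqrtr//; have := pi_ge2 R; rewrite /T; nra.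
apply: (@le_trans _ _ (Num.sqrt (4 * pi * T))^-1).
  rewrite /gmax -(prednK d0) exprS ler_piMr ?invr_ge0//.
  by rewrite exprn_ile1 ?invr_ge0// invf_le1// (lt_le_trans _ s1).
have sT : Num.sqrt ((e ^+ 2)^-1) <= Num.sqrt (4 * pi * T).
  by rewrite ler_wsqrtr//; have := pi_ge2 R; rewrite /T; nra.
rewrite -[leRHS]invrK lef_pV2 ?posrE ?invr_gt0 ?(lt_le_trans _ s1)//.
apply: le_trans sT; rewrite -exprVn sqrtr_sqr ger0_norm// invr_ge0; exact: ltW.
Qed.

Lemma exists_steps (T h : R) : 1 <= T -> 0 < h -> h <= 1 ->
  exists n, (T <= n.+1%:R * h) /\ n.+1%:R * h <= T + 1.
Proof.
move=> T1 h0 h1; exists (Num.truncn (T / h)).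
have Th : 0 <= T / h by rewrite divr_ge0 ?(ltW h0)//; lra.
split; first by rewrite -ler_pdivrMr// ltW// truncnS_gt.
rewrite -natr1 mulrDl mul1r lerD// -ler_pdivlMr//.
by rewrite truncn_le.
Qed.

Lemma Uop_one_le h n x : 0 < h -> (U h n one x <= (n%:R * h)%:E)%E.
Proof.
move=> h0; elim: n x => [|n IH] x /=; first by rewrite mul0r.
have nh : 0 <= n.+1%:R * h by rewrite mulr_ge0// ltW.
apply: le_trans (Qop_cst_le X M x h0 mD nh).
apply: (Qop_le X M x h0 mD (Usrc_nonneg X M h0 mD n n1) (nonneg_cst nh)).
move=> y _; rewrite mule1 -natr1 mulrDl mul1r addrC EFinD; exact: leeD.
Qed.

(** As [D] has finite volume and the kernel is at most [gmax T] after time [T], a suitable [T] makes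
    the survival probability at most 1/2. Hence [S], twice the length of such a period, bounds the
    mean lifetime, by induction on [n]. *)
Lemma Uop_one_bounded : exists2 C : R, 1 <= C &
  forall h n x, 0 < h -> h <= 1 -> (U h n one x <= C%:E)%E.
Proof.
pose N := fine (m D); have mDN : m D = N%:E by rewrite fineK// ge0_fin_numE.
have N0 : 0 <= N by rewrite -lee_fin -mDN.
have e0 : 0 < (2 * (N + 1))^-1 by rewrite invr_gt0 mulr_gt0//; lra.
have [T T1 gT] := gmax_small e0.
exists (2 * (T + 1)); first by lra.
move=> h n x h0 h1.
have [n0 [n0T n0h]] := exists_steps T1 h0 h1.
pose S := 2 * (n0.+1%:R * h).
have S0 : 0 <= S by rewrite !mulr_ge0// ltW.
apply: (@le_trans _ _ S%:E); last by rewrite lee_fin /S; lra.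
have half y : (iter n0.+1 (Q h) one y <= (1 / 2)%:E)%E.
  have g0 : 0 <= gmax (d := d) T := gmax_ge0 T.
  apply: (@le_trans _ _ (gmax (d := d) T * N)%:E).
    apply: Qiter_bound => //.
      move=> z _ _; apply: (le_trans (kern_le_gmax X y z _)); first by rewrite mulr_gt0.
      by apply: gmax_le => //; lra.
    by rewrite integral_cst// mul1e mDN.
  rewrite lee_fin; have := ler_wpM2r N0 gT.
  have : (2 * (N + 1))^-1 * (2 * (N + 1)) = 1 by rewrite mulVf// gt_eqF// mulr_gt0//; lra.
  by move: (_^-1) e0 => u *; nra.
elim/ltn_ind: n x => n IH x.
have [nn0|nn0] := leqP n n0.+1.
  apply: (le_trans (Uop_one_le n x h0)); rewrite lee_fin /S.
  have : n%:R * h <= n0.+1%:R * h by rewrite ler_wpM2r ?ler_nat// ltW.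
  have : 0 <= n0.+1%:R * h by rewrite mulr_ge0// ltW.
  by move: (n0.+1%:R * h) (n%:R * h) => a b; lra.
rewrite -(subnKC (ltnW nn0)) UopD//.
have -> : S = n0.+1%:R * h + S * (1 / 2) by rewrite /S; lra.
rewrite EFinD; apply: leeD; first exact: Uop_one_le.
apply: (@le_trans _ _ (iter n0.+1 (Q h) (fun y => S%:E * one y)%E x)).
  apply: Qiter_le => //; [exact: Uop_nonneg|exact: nonneg_scale|].
  by move=> y; rewrite mule1; apply: IH; lia.
by rewrite iterQZ// [X in (_ <= X)%E]EFinM; apply: lee_wpmul2l.
Qed.

Lemma integral_Uop h n f : 0 < h -> nonneg f ->
  (\int[m]_(y in D) U h n f y = \int[m]_(y in D) (f y * U h n one y))%E.
Proof.
move=> h0 nf; rewrite -(Uop_sym X M h0 mD n nf n1).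
by apply: eq_integral => y _; rewrite mul1e.
Qed.

(** Symmetry of the kernel moves the potential from [f] onto the constant 1, whose potential is
    bounded. *)
Lemma Uop_mass : exists2 C : R, 1 <= C & forall h n f N, 0 < h -> h <= 1 -> nonneg f ->
  (\int[m]_(y in D) f y <= N%:E)%E -> (\int[m]_(y in D) U h n f y <= (C * N)%:E)%E.
Proof.
have [C C1 HC] := Uop_one_bounded; exists C => // h n f N h0 h1 nf fN.
rewrite integral_Uop//; have [mf f0] := nf.
apply: (@le_trans _ _ (\int[m]_(y in D) (C%:E * f y))%E).
  apply: ge0_le_lower_integral => y _.
    by rewrite mule_ge0//; have [_] := Uop_nonneg X M h0 mD n n1.
  by rewrite muleC; apply: lee_wpmul2r => //; exact: HC.
rewrite ge0_integralZl//; [|exact: measurable_funTS|rewrite lee_fin; lra].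
by rewrite EFinM; apply: lee_wpmul2l => //; rewrite lee_fin; lra.
Qed.

(** During about one unit of time the off-diagonal bound controls the kernel between [x] and the
    support of [f]. Afterwards [Q^(n0 + 1) f] is bounded by [gmax 1 * N] everywhere, and the rest is
    a multiple of the mean lifetime. *)
Lemma Uop_far (eta : R) : 0 < eta -> exists2 C : R, 0 < C &
  forall h n f A N x, 0 < h -> h <= 1 -> nonneg f -> (forall y, ~ A y -> f y = 0%E) ->
  (\int[m]_(y in D) f y <= N%:E)%E -> far eta x A -> (U h n f x <= (C * N)%:E)%E.
Proof.
move=> e0; have [C C1 HC] := Uop_one_bounded.
have [K K0 HK] := @kern_off_diag R d X eta e0.
have g0 : 0 <= gmax (d := d) (1 : R) := gmax_ge0 1.
have gC : 0 <= gmax (d := d) 1 * C by apply: mulr_ge0 => //; lra.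
exists (2 * K + gmax (d := d) 1 * C); first by lra.
move=> h n f A N x h0 h1 nf fA fN xA.
have N0 : 0 <= N.
  by rewrite -lee_fin; apply: le_trans fN; apply: integral_ge0 => y _; case: nf.
have [n0 [n0T n0h]] := exists_steps (lexx 1) h0 h1.
apply: (le_trans (Uop_mono X M h0 mD x nf (leq_addl n0.+1 n))).
rewrite UopD// mulrDl EFinD; apply: leeD.
  rewrite Uop_sum//; apply: (@le_trans _ _ (\sum_(i < n0.+1) (h * (K * N))%:E)%E).
    apply: lee_sum => i _; rewrite EFinM; apply: lee_wpmul2l; first by rewrite lee_fin ltW.
    apply: Qiter_bound => //; first exact: ltW.
    move=> y Dy fy; have xy : eta ^+ 2 <= sqd x y.
      by apply: xA; apply: contrapT => nA; rewrite fA ?eqxx in fy.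
    by have ih : 0 < i.+1%:R * h; [rewrite mulr_gt0|have [] := HK _ x y ih xy].
  rewrite sumEFin lee_fin sumr_const card_ord -[leRHS]mulrA.
  rewrite (_ : h * (K * N) *+ n0.+1 = n0.+1%:R * h * (K * N)); last by rewrite -mulr_natl mulrA.
  apply: ler_wpM2r; first by rewrite mulr_ge0// ltW.
  by apply: (le_trans n0h); rewrite -(natrD _ 1 1).
rewrite -Uop_Qiter//.
have bd y : (iter n0.+1 (Q h) f y <= (gmax (d := d) 1 * N)%:E * one y)%E.
  rewrite mule1; apply: Qiter_bound => // z _ _.
  by apply: (le_trans (kern_le_gmax X y z _)); [rewrite mulr_gt0|exact: gmax_le].
have gN : 0 <= gmax (d := d) 1 * N by rewrite mulr_ge0.
apply: (le_trans (Uop_le X M h0 mD n x (Qiter_nonneg X M h0 mD _ nf) (nonneg_scale gN n1) bd)).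
rewrite UopZ// mulrAC [X in (_ <= X)%E]EFinM; apply: lee_wpmul2l => //; exact: HC.
Qed.

Variables (dl : 'rV[R]_d -> R) (r R2 : R).
Hypotheses (r0 : 0 < r) (R20 : 0 < R2) (dl0 : forall x, 0 <= dl x).
Hypothesis mdl : measurable_fun setT (dl : Borel R d -> R).
(** [c] is the centre of an exterior ball touching at [z]. The surplus [sqd y z / 2] keeps the
    barrier bounded below away from [z], so it is only needed as a supersolution near [z]. The
    function [dl] will be twice the distance to the complement, since [z] is only nearly the closest
    boundary point. *)
Hypothesis ext_ball : forall x, D x -> exists c z : 'rV[R]_d,
  [/\ forall y, D y -> r ^+ 2 + sqd y z / 2 <= sqd y c /\ sqd y c <= R2,
      sqd z c = r ^+ 2 & sqd x z <= dl x ^+ 2].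

Let sqd_near (y z c : 'rV[R]_d) v : 0 <= v -> sqd z c = r ^+ 2 -> sqd y z <= v ^+ 2 ->
  sqd y c <= r ^+ 2 + (2 * r * v + v ^+ 2).
Proof.
move=> v0 zc yz.
have cs : (dotp (y - z) (z - c)) ^+ 2 <= sqd y z * sqd z c by exact: dotp_cauchy.
have E : sqd y c = sqd y z + sqd z c + 2 * dotp (y - z) (z - c).
  rewrite !sqdE /dotp mulr_sumr -!big_split /=; apply: eq_bigr => i _; rewrite !mxE; ring.
have : dotp (y - z) (z - c) <= v * r.
  have vr : 0 <= v * r by rewrite mulr_ge0// ltW.
  have [/ltW n|n] := ltP (dotp (y - z) (z - c)) 0; first exact: le_trans n vr.
  rewrite -(@ler_pXn2r _ 2)// ?nnegrE//; apply: (le_trans cs).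
  by rewrite zc exprMn ler_wpM2r// sqr_ge0.
by rewrite E zc; lra.
Qed.

Ltac forget := clear -X M D mD d0 finD one n1 dl r R2 r0 R20 dl0 mdl ext_ball sqd_near.

(** Turns a bound on the potential away from [A], together with mass bounds, into a bound with the
    factor [dl x + eps]. By induction on the number of steps, [U f <= K N Psi] away from [A]. Far
    from [z] this is the bound assumed, as [Psi >= c']. Near [z], a step landing away from [A] uses
    the induction hypothesis and the decrease [h] of [Psi]; a step landing near [A] has kernel at
    most [K0 h] and meets total mass at most [2 C2 N]. *)
Lemma barrier_step (eta C1 C2 : R) : 0 < eta -> 0 <= C1 -> 0 <= C2 ->
  exists2 C : R, 0 < C & forall eps : R, 0 < eps -> exists2 h0 : R, 0 < h0 &
  forall h f A N, 0 < h -> h <= h0 -> nonneg f -> 0 <= N ->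
  (forall n y, D y -> far (eta / 4) y A -> (U h n f y <= (C1 * N)%:E)%E) ->
  (forall n, \int[m]_(y in D) U h n f y <= (C2 * N)%:E)%E ->
  (h%:E * \int[m]_(y in D) f y <= (C2 * N)%:E)%E ->
  (forall y, D y -> far (eta / 4) y A -> (f y <= N%:E)%E) ->
  forall n x, D x -> far eta x A -> (U h n f x <= (C * N * (dl x + eps))%:E)%E.
Proof.
move=> eta0 C10 C20; have r20 : 0 < r ^+ 2 by rewrite exprn_gt0.
have [ls ls1 Hbar] := upper_barrier X M r20 R20.
have ls0 : 0 < ls by lra.
have li0 : 0 < ls^-1 by rewrite invr_gt0.
(* Radius of the zone around [z]: small enough that the barrier inequality is valid there (height at
   most [ls^-1]) and that its points stay at distance at least [eta / 2] from [A]. *)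
have [v v0 [v1 v2 v3]] : exists2 v : R, 0 < v & [/\ 2 * r * v + v ^+ 2 <= ls^-1 / 2, v <= 1 & v ^+ 2 <= eta ^+ 2 / 16].
  have q1 : 0 < 2 * (2 * r + 1) by have := r0; lra.
  have q0 : 0 < ls^-1 / (2 * (2 * r + 1)) by apply: divr_gt0.
  exists (Num.min 1 (Num.min (eta / 4) (ls^-1 / (2 * (2 * r + 1))))).
    by rewrite !lt_min ltr01 q0 divr_gt0.
  set v := Num.min _ _; have v0 : 0 < v by rewrite /v !lt_min ltr01 q0 divr_gt0.
  have w1 : v <= 1 by rewrite /v ge_min lexx.
  have w2 : v <= eta / 4 by rewrite /v !ge_min lexx orbT.
  have w3 : v <= ls^-1 / (2 * (2 * r + 1)) by rewrite /v !ge_min lexx !orbT.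
  split => //.
    have := w3; rewrite ler_pdivlMr// => w4; have := r0.
    by move: w4; move: (ls^-1) => w; nra.
  by nra.
have eta4 : 0 < eta / 4 by rewrite divr_gt0.
have [K0 K00 HK] := @kern_off_diag R d X (eta / 4) eta4.
pose c' : R := ls^-1 * cap (ls * (v ^+ 2 / 2)).
have c'0 : 0 < c'.
  rewrite mulr_gt0// capE; last by rewrite mulr_ge0 ?(ltW ls0)// divr_ge0// exprn_ge0// ltW.
  by rewrite subr_gt0 expR_lt1 oppr_lt0 mulr_gt0// divr_gt0// exprn_gt0.
(* Multiplying the decrease [h] of [Psi], the last two summands pay for jumps to the vicinity of [A]
   and for the source [h f]; the first one makes [K N Psi] exceed [C1 N] away from [z]. *)
pose K : R := C1 / c' + 2 * K0 * C2 + 1.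
have Kc : 0 <= C1 / c' by rewrite divr_ge0// ltW.
have KC : 0 <= 2 * K0 * C2 by rewrite mulr_ge0// mulr_ge0// ltW.
have K1 : 1 <= K by rewrite /K; lra.
pose Cf : R := 2 * K * (2 * r + 2) + C1 / v.
have Cv : 0 <= C1 / v by rewrite divr_ge0// ltW.
have rp : 0 < r := r0.
have Kr : 2 <= K * (2 * r + 2).
  have : 0 <= K * r by apply: mulr_ge0; [lra|exact: ltW].
  by move: K1; move: (K) => k; lra.
exists Cf; first by rewrite /Cf; lra.
move=> eps0 eps00; pose eps := Num.min eps0 (ls^-1 / 2).
have eps_gt0 : 0 < eps by rewrite lt_min eps00 divr_gt0.
have epsl : eps <= ls^-1 / 2 by rewrite ge_min lexx orbT.
have epse : eps <= eps0 by rewrite ge_min lexx.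
have [h0 h00 HL] := Hbar eps eps_gt0.
exists (Num.min h0 1); first by rewrite lt_min h00 ltr01.
move=> h f A N hp hh nf N0 HC1 HC2 HC3 HC4 n x Dx xA.
have hh0 : h <= h0 by apply: (le_trans hh); rewrite ge_min lexx.
have hh1 : h <= 1 by apply: (le_trans hh); rewrite ge_min lexx orbT.
have farW y : far eta y A -> far (eta / 4) y A.
  by move=> H a Aa; apply: le_trans (H a Aa); rewrite expr_div_n ler_pdivrMr//; have := sqr_ge0 eta; forget; lra.
have [xv|xv] := ltP v (dl x).
  apply: (le_trans (HC1 n x Dx (farW _ xA))); rewrite lee_fin.
  have : C1 * N <= C1 / v * N * dl x.
    have -> : C1 / v * N * dl x = C1 * N * (dl x / v) by field; rewrite gt_eqF.
    by rewrite ler_peMr ?mulr_ge0// ler_pdivlMr// mul1r ltW.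
  have := dl0 x; have : 0 <= K * (2 * r + 2) * N * (dl x + eps0).
    apply: mulr_ge0; last by have := dl0 x; move: eps00; forget; lra.
    by apply: mulr_ge0 => //; move: Kr; forget; lra.
  have : 0 <= C1 / v * N * eps0 := mulr_ge0 (mulr_ge0 Cv N0) (ltW eps00).
  by rewrite /Cf; forget; lra.
have [c [z [Hcz zc xz]]] := ext_ball Dx.
have [L [L0 L2 Lls HQ]] := HL h hp hh0.
have L01 : all (fun p => 0 <= p.1) L by apply: sub_all L0 => p /andP[].
pose b := r ^+ 2 - eps; pose Psi (y : Borel R d) := barrier L (sqd y c - b).
have Psi0 y : 0 <= Psi y by exact: barrier_ge0.
have nPsi : nonneg (fun y => (Psi y)%:E) by exact: barrier_nonneg.
have xz' : sqd x z <= v ^+ 2 by apply: (le_trans xz); rewrite lerXn2r ?nnegrE// ltW.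
have big y : D y -> v ^+ 2 < sqd y z -> c' <= Psi y.
  move=> Dy yv; have [h1 _] := Hcz y Dy.
  apply: (@le_trans _ _ (ls^-1 * cap (ls * (sqd y c - b)))).
    rewrite /c'; apply: ler_wpM2l; first exact: ltW.
    apply: cap_homo; rewrite ler_pM2l// /b; move: h1 yv eps_gt0; forget; lra.
  rewrite /Psi /barrier (big_rem _ Lls) /= lerDl big_seq sumr_ge0// => p /mem_rem pL.
  by have /andP[p1 _] := allP L0 p pL; rewrite mulr_ge0// cap_ge0.
have KN0 : 0 <= K * N by rewrite mulr_ge0//; move: K1; forget; lra.
have claim k y : D y -> far (eta / 4) y A -> (U h k f y <= (K * N * Psi y)%:E)%E.
  elim: k y => [|k IH] y Dy yA; first by rewrite /= lee_fin mulr_ge0.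
  have [yz|yz] := ltP (v ^+ 2) (sqd y z).
    apply: (le_trans (HC1 k.+1 y Dy yA)); rewrite lee_fin.
    apply: (@le_trans _ _ (K * N * c')); last by rewrite ler_wpM2l// big.
    have : C1 * N <= C1 / c' * N * c' by rewrite -[leRHS]mulrAC divfK ?gt_eqF.
    have : 0 <= (2 * K0 * C2 + 1) * N * c'.
      by apply: mulr_ge0; [apply: mulr_ge0 => //; move: KC; forget; lra|exact: ltW].
    by rewrite /K; forget; lra.
  have [hy1 hy2] := Hcz y Dy.
  have hyc := sqd_near (ltW v0) zc yz.
  have QP := HQ c y.
  have {}QP : (Qop X M h setT (fun y => (Psi y)%:E) y <= (Psi y - h)%:E)%E.
    by apply: QP; [have := sqd_ge0 y z; move: hy1; forget; lra|exact: hy2|move: hyc v1 epsl; forget; lra].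
  have yA2 a : A a -> eta ^+ 2 / 4 <= sqd y a.
    move=> Aa; have := xA a Aa; have := sqd_triangle x y a; have := sqd_triangle x z y.
    by rewrite (sqd_sym z y); move: xz' yz v3; forget; lra.
  rewrite /=; pose src y := (h%:E * f y + U h k f y)%E.
  have ns : nonneg src by exact: (Usrc_nonneg X M hp mD).
  have KNp : nonneg (fun y => ((K * N)%:E * (Psi y)%:E)%E) by exact: nonneg_scale.
  have K0h : 0 <= K0 * h by rewrite mulr_ge0// ltW.
  apply: (@le_trans _ _ (Qop X M h D (fun y => ((K * N)%:E * (Psi y)%:E)%E) y + Qop X M h D (fun y => (h * N)%:E) y
     + (K0 * h)%:E * \int[m]_(w in D) src w)%E).
    have hN0 : 0 <= h * N by rewrite mulr_ge0// ltW.
    rewrite -(QopD X M y hp mD KNp (nonneg_cst hN0)).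
    have nsum := nonneg_add KNp (nonneg_cst hN0).
    have [ms s0] := ns.
    rewrite QopE [X in (_ <= X + _)%E]QopE -ge0_integralZl//; [|exact: measurable_funTS].
    have [mk k0] := nonneg_kern_mul X y hp nsum.
    rewrite -ge0_integralD//; [|exact: measurable_funTS|by move=> w _; rewrite mule_ge0|
      by apply: measurable_funTS; have [] := nonneg_scale K0h ns].
    apply: ge0_le_lower_integral => w Dw.
      by apply: mule_ge0; [rewrite lee_fin kern_ge0|exact: s0].
    have [wA|wA] := pselect (far (eta / 4) w A).
      apply: (@le_trans _ _ ((kern X h y w)%:E * ((K * N)%:E * (Psi w)%:E + (h * N)%:E))%E); last first.
        by rewrite leeDl// mule_ge0.
      apply: lee_wpmul2l; first by rewrite lee_fin kern_ge0.
      rewrite addeC; apply: leeD; first by rewrite -EFinM; exact: IH.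
      by rewrite EFinM; apply: lee_wpmul2l; [rewrite lee_fin ltW|exact: HC4].
    apply: (@le_trans _ _ ((K0 * h)%:E * src w)%E); last by rewrite leeDr.
    apply: lee_wpmul2r; [exact: s0|rewrite lee_fin].
    have [|//] := HK h y w hp; move: wA => /existsNP[a /not_implyP[Aa /negP]].
    rewrite -ltNge => wa; have := yA2 a Aa; have := sqd_triangle y w a.
    by move: wa; rewrite !expr_div_n; forget; lra.
  have P1 : (Qop X M h D (fun y => ((K * N)%:E * (Psi y)%:E)%E) y <= (K * N * (Psi y - h))%:E)%E.
    rewrite (QopZ X M y hp mD KN0 nPsi) [X in (_ <= X)%E]EFinM; apply: lee_wpmul2l => //.
    by apply: le_trans QP; exact: (Qop_leF X M y hp mD measurableT nPsi).
  have P2 : (Qop X M h D (fun y => (h * N)%:E) y <= (h * N)%:E)%E.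
    by apply: Qop_cst_le => //; rewrite mulr_ge0// ltW.
  have P3 : ((K0 * h)%:E * \int[m]_(w in D) src w <= (K0 * h * (2 * (C2 * N)))%:E)%E.
    rewrite [X in (_ <= X)%E]EFinM; apply: lee_wpmul2l => //.
    have [mf f0] := nf; have [mU U0] := Uop_nonneg X M hp mD k nf.
    have hE : (0 <= h%:E)%E by rewrite lee_fin ltW.
    have [mhf hf0] := nonneg_scale (ltW hp) nf.
    rewrite ge0_integralD//; [|exact: measurable_funTS|exact: measurable_funTS].
    rewrite ge0_integralZl//; [|exact: measurable_funTS].
    rewrite (_ : 2 * (C2 * N) = C2 * N + C2 * N); last by ring.
    by rewrite EFinD; apply: leeD.
  apply: (le_trans (leeD (leeD P1 P2) P3)); rewrite -!EFinD lee_fin.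
  have : 0 <= C1 / c' * N * h := mulr_ge0 (mulr_ge0 Kc N0) (ltW hp).
  by rewrite /K; forget; lra.
apply: (le_trans (claim n x Dx (farW _ xA))); rewrite lee_fin.
have dx0 := dl0 x.
have xc : sqd x c <= r ^+ 2 + (2 * r * dl x + dl x ^+ 2) by exact: (sqd_near dx0 zc xz).
have [hx1 _] := Hcz x Dx.
have rx0 : 0 <= sqd x c - b by rewrite /b; have := sqd_ge0 x z; move: hx1 eps_gt0; forget; lra.
have PL : Psi x <= 2 * (sqd x c - b).
  by apply: (le_trans (barrier_le rx0 L0)); apply: ler_wpM2r.
have dx1 : dl x ^+ 2 <= dl x by rewrite expr2 ler_piMr//; move: xv v2; forget; lra.
have PL2 : Psi x <= 2 * (2 * r + 2) * (dl x + eps0).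
  apply: (le_trans PL); rewrite /b.
  have : 0 <= r * eps0 by rewrite mulr_ge0// ltW.
  by move: xc dx1 epse eps00 dx0; forget; lra.
have := ler_wpM2l KN0 PL2.
have : 0 <= C1 / v * N * (dl x + eps0).
  by apply: (mulr_ge0 (mulr_ge0 Cv N0)); move: dx0 eps00; forget; lra.
by rewrite /Cf; forget; lra.
Qed.

Let weight f eps : Borel R d -> \bar R := fun y => (f y * (dl y + eps)%:E)%E.

Let weight_nonneg f eps : nonneg f -> 0 <= eps -> nonneg (weight f eps).
Proof.
move=> nf e0; apply: nonneg_mul => //; split; last by move=> y; rewrite lee_fin addr_ge0.
by apply/measurable_EFinP; exact: measurable_funD.
Qed.

Let weight_le f h eps N : nonneg f -> 0 < h -> h <= eps ->
  (\int[m]_(y in D) weight f eps y <= N%:E)%E -> (h%:E * \int[m]_(y in D) f y <= N%:E)%E.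
Proof.
move=> nf h0 he; apply: le_trans; have [mf f0] := nf.
rewrite -ge0_integralZl//; [|exact: measurable_funTS|by rewrite lee_fin ltW].
apply: ge0_le_lower_integral => y _; first by rewrite mule_ge0// lee_fin ltW.
by rewrite muleC; apply: lee_wpmul2l => //; rewrite lee_fin; have := dl0 y; lra.
Qed.

Let far_notin (e : R) y A : 0 < e -> far e y A -> ~ A y.
Proof. by move=> e0 H /H; rewrite sqdxx leNgt exprn_gt0. Qed.

(** [barrier_step] with empty target: every point is far from it, and the source is the constant
    1. *)
Lemma Uop_one_dist : exists2 C : R, 0 < C & forall eps : R, 0 < eps -> exists2 h0 : R, 0 < h0 &
  forall h n x, 0 < h -> h <= h0 -> D x -> (U h n one x <= (C * (dl x + eps))%:E)%E.
Proof.
have [C1 C11 HC1] := Uop_one_bounded; have [C2 C21 HC2] := Uop_mass.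
pose N := fine (m D); have mDN : m D = N%:E by rewrite fineK// ge0_fin_numE.
have N0 : 0 <= N by rewrite -lee_fin -mDN.
have i1 : (\int[m]_(y in D) one y = N%:E)%E by rewrite integral_cst// mul1e mDN.
have C10 : 0 <= C1 by lra.
have C2N : 0 <= C2 * N by rewrite mulr_ge0//; lra.
have [C C0 HC] := barrier_step ltr01 C10 C2N.
exists C => // eps e0; have [h0 h00 Hh] := HC eps e0.
exists (Num.min h0 1); first by rewrite lt_min h00 ltr01.
move=> h n x hp; rewrite le_min => /andP[hh0 hh1] Dx.
rewrite -(mulr1 C); apply: (Hh h one set0 1 hp hh0 n1 ler01) => //.
- by move=> k y _ _; rewrite mulr1; exact: HC1.
- by move=> k; rewrite mulr1; apply: HC2 => //; rewrite i1.
- rewrite i1 mulr1 -EFinM lee_fin; apply: ler_wpM2r => //; lra.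
Qed.

Lemma Uop_far_dist (eta : R) : 0 < eta -> exists2 C : R, 0 < C &
  forall eps : R, 0 < eps -> exists2 h0 : R, 0 < h0 &
  forall h n f A N x, 0 < h -> h <= h0 -> nonneg f -> (forall y, ~ A y -> f y = 0%E) ->
  (\int[m]_(y in D) f y <= N%:E)%E -> D x -> far eta x A -> (U h n f x <= (C * N * (dl x + eps))%:E)%E.
Proof.
move=> e0; have e4 : 0 < eta / 4 by rewrite divr_gt0.
have [C1 C10 HC1] := Uop_far e4; have [C2 C21 HC2] := Uop_mass.
have C20 : 0 <= C2 by lra.
have [C C0 HC] := barrier_step e0 (ltW C10) C20.
exists C => // eps ep; have [h0 h00 Hh] := HC eps ep.
exists (Num.min h0 1); first by rewrite lt_min h00 ltr01.
move=> h n f A N x hp; rewrite le_min => /andP[hh0 hh1] nf fA fN Dx xA.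
have I0 : (0 <= \int[m]_(y in D) f y)%E by apply: integral_ge0 => y _; case: nf.
have N0 : 0 <= N by rewrite -lee_fin; apply: le_trans fN.
apply: (Hh h f A N hp hh0 nf N0) => //.
- by move=> k y _ yA; apply: (HC1 _ _ _ A).
- by move=> k; apply: HC2.
- apply: (@le_trans _ _ (1 * N%:E)%E).
    by apply: lee_pmul => //; rewrite lee_fin// ltW.
  by rewrite -EFinM lee_fin; apply: ler_wpM2r.
- by move=> y _ yA; rewrite fA ?lee_fin//; exact: far_notin yA.
Qed.

(** The dual of [Uop_far_dist]. The first step is split at a ball around [x]: inside it the kernel
    is a source [g] of mass at most 1, and symmetry turns the integral of [g U f] into that of
    [f U g], with [U g] of order [dl y + eps] on the support of [f]. Outside the ball the kernel is
    at most [K0 h], and [Uop_one_dist] bounds the mass of [U f] by the weighted mass of [f]. *)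
Lemma Uop_weight (eta : R) : 0 < eta -> exists2 C : R, 0 < C &
  forall eps : R, 0 < eps -> exists2 h0 : R, 0 < h0 &
  forall h n f A N x, 0 < h -> h <= h0 -> nonneg f -> (forall y, ~ A y -> f y = 0%E) ->
  (\int[m]_(y in D) (f y * (dl y + eps)%:E) <= N%:E)%E -> D x -> far eta x A -> (U h n f x <= (C * N)%:E)%E.
Proof.
move=> e0; have e2 : 0 < eta / 2 by rewrite divr_gt0.
have e4 : 0 < eta / 4 by rewrite divr_gt0.
have [C4 C40 HC4] := Uop_one_dist; have [C5 C50 HC5] := Uop_far_dist e2.
have [K0 K00 HK] := @kern_off_diag R d X (eta / 4) e4.
exists (C5 + K0 * (1 + C4)); first by rewrite addr_gt0// mulr_gt0//; lra.
move=> eps ep; have [h4 h40 H4] := HC4 eps ep; have [h5 h50 H5] := HC5 eps ep.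
exists (Num.min (Num.min h4 h5) (Num.min eps 1)); first by rewrite !lt_min h40 h50 ep ltr01.
move=> h n f A N x hp; rewrite !le_min => /andP[/andP[hh4 hh5] /andP[he h1]] nf fA fN Dx xA.
have [mf f0] := nf.
have [mw w0] : nonneg (weight f eps) := weight_nonneg nf (ltW ep).
have N0 : 0 <= N by rewrite -lee_fin; apply: le_trans fN; apply: integral_ge0 => y _; exact: w0.
have CN0 : 0 <= (C5 + K0 * (1 + C4)) * N.
  by rewrite mulr_ge0// addr_ge0 ?mulr_ge0 ?(ltW C50) ?(ltW K00)//; lra.
case: n => [|n]; first by rewrite /= lee_fin.
pose B : set (Borel R d) := [set y | sqd y x < eta ^+ 2 / 8].
have mB : measurable B.
  rewrite (_ : B = (fun y : Borel R d => sqd y x) @^-1` `]-oo, eta ^+ 2 / 8[%classic).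
    by rewrite -[X in measurable X]setTI; apply: measurable_sqd => //; exact: measurable_itv.
  by apply/seteqP; split=> y; rewrite /B /= in_itv.
pose g y := ((kern X h x y)%:E * (\1_B y)%:E)%E.
have ng : nonneg g by apply: nonneg_kern_mul => //; exact: nonneg_indic.
have [mg g0] := ng; have [mU U0] := Uop_nonneg X M hp mD n nf.
have [mU1 U10] := Uop_nonneg X M hp mD n n1.
pose src y := (h%:E * f y + U h n f y)%E.
have [ms s0] : nonneg src := Usrc_nonneg X M hp mD n nf.
have K0h : 0 <= K0 * h by rewrite mulr_ge0// ltW.
have split1 : (U h n.+1 f x <= \int[m]_(y in D) (g y * U h n f y) + (K0 * h)%:E * \int[m]_(y in D) src y)%E.
  rewrite /= QopE -ge0_integralZl//; [|exact: measurable_funTS].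
  rewrite -ge0_integralD//; [|by move=> y _; exact: mule_ge0|
    by apply: measurable_funTS; exact: emeasurable_funM|by move=> y _; apply: mule_ge0|
    by apply: measurable_funTS; have [] := nonneg_scale K0h (conj ms s0)].
  apply: ge0_le_lower_integral => y Dy; first by apply: mule_ge0; [rewrite lee_fin kern_ge0|exact: s0].
  have [yB|yB] := ltP (sqd y x) (eta ^+ 2 / 8).
    rewrite /g indicE mem_set// mule1 fA; last first.
      move=> Ay; have := xA y Ay; rewrite sqd_sym.
      by have : 0 < eta ^+ 2; [rewrite exprn_gt0|lra].
    by rewrite mule0 add0e leeDl// mule_ge0.
  apply: (@le_trans _ _ ((K0 * h)%:E * src y)%E); last by rewrite leeDr// mule_ge0.
  apply: lee_wpmul2r; [exact: s0|rewrite lee_fin].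
  have [|//] := HK h x y hp; rewrite sqd_sym; apply: le_trans yB.
  by rewrite expr_div_n; have := sqr_ge0 eta; lra.
have g1 : (\int[m]_(y in D) g y <= 1%:E)%E.
  rewrite -(kern_total X M x hp); apply: (@le_trans _ _ (\int[m]_(y in D) (kern X h x y)%:E)%E).
    apply: ge0_le_lower_integral => y _; first exact: g0.
    by rewrite /g -EFinM lee_fin indicE; case: (_ \in _); rewrite ?mulr1 ?mulr0 ?kern_ge0.
  apply: ge0_subset_integral => //; first by apply/measurable_EFinP; exact: measurable_kern.
  by move=> y _; rewrite lee_fin kern_ge0.
have P1 : (\int[m]_(y in D) (g y * U h n f y) <= (C5 * N)%:E)%E.
  rewrite (Uop_sym X M hp mD n nf ng).
  apply: (@le_trans _ _ (\int[m]_(y in D) (C5%:E * weight f eps y))%E).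
    apply: ge0_le_lower_integral => y Dy.
      by rewrite mule_ge0//; have [_] := Uop_nonneg X M hp mD n ng.
    have [Ay|Ay] := pselect (A y); last by rewrite /weight fA// !mul0e mule0.
    rewrite /weight muleCA -EFinM; apply: lee_wpmul2l => //.
    rewrite -{1}(mulr1 C5); apply: (H5 h n g B 1 y) => //.
      by move=> z nBz; rewrite /g indicE memNset// mule0.
    move=> z Bz; have := xA y Ay; have := sqd_triangle x z y.
    by move: Bz; have := sqr_ge0 eta; rewrite /B /= expr_div_n (sqd_sym x z) (sqd_sym z y); lra.
  rewrite ge0_integralZl//; [|exact: measurable_funTS|by rewrite lee_fin ltW].
  by rewrite EFinM; apply: lee_wpmul2l => //; rewrite lee_fin ltW.
have P2 : ((K0 * h)%:E * \int[m]_(y in D) src y <= (K0 * (1 + C4) * N)%:E)%E.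
  rewrite -[(K0 * (1 + C4) * N)]mulrA; apply: (@le_trans _ _ (K0%:E * \int[m]_(y in D) src y)%E).
    by apply: lee_wpmul2r; [exact: integral_ge0|rewrite lee_fin ler_piMr// ltW].
  rewrite [X in (_ <= X)%E]EFinM; apply: lee_wpmul2l; first by rewrite lee_fin ltW.
  have [mhf hf0] := nonneg_scale (ltW hp) nf.
  rewrite ge0_integralD//; [|exact: measurable_funTS|exact: measurable_funTS].
  rewrite mulrDl mul1r EFinD; apply: leeD.
    rewrite ge0_integralZl//; [|exact: measurable_funTS|by rewrite lee_fin ltW].
    exact: weight_le fN.
  rewrite integral_Uop//; apply: (@le_trans _ _ (\int[m]_(y in D) (C4%:E * weight f eps y))%E).
    apply: ge0_le_lower_integral => y Dy; first exact: mule_ge0.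
    by rewrite /weight muleCA -EFinM; apply: lee_wpmul2l => //; exact: H4.
  rewrite ge0_integralZl//; [|exact: measurable_funTS|by rewrite lee_fin ltW].
  by rewrite EFinM; apply: lee_wpmul2l => //; rewrite lee_fin ltW.
by apply: (le_trans split1); rewrite mulrDl EFinD; exact: leeD.
Qed.

(** A second use of [barrier_step], now fed with the weighted bounds: the factor at the target is
    already contained in [N], and the barrier adds the factor at [x]. *)
Theorem Uop_upper (eta : R) : 0 < eta -> exists2 C : R, 0 < C &
  forall eps : R, 0 < eps -> exists2 h0 : R, 0 < h0 &
  forall h n f A N x, 0 < h -> h <= h0 -> nonneg f -> (forall y, ~ A y -> f y = 0%E) ->
  (\int[m]_(y in D) (f y * (dl y + eps)%:E) <= N%:E)%E -> D x -> far eta x A ->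
  (U h n f x <= (C * N * (dl x + eps))%:E)%E.
Proof.
move=> e0; have e4 : 0 < eta / 4 by rewrite divr_gt0.
have [C4 C40 HC4] := Uop_one_dist; have [C6 C60 HC6] := Uop_weight e4.
have C410 : 0 <= C4 + 1 by lra.
have [C C0 HC] := barrier_step e0 (ltW C60) C410.
exists C => // eps ep; have [h0 h00 Hh] := HC eps ep.
have [h4 h40 H4] := HC4 eps ep; have [h6 h60 H6] := HC6 eps ep.
exists (Num.min (Num.min h0 h4) (Num.min h6 eps)); first by rewrite !lt_min h00 h40 h60 ep.
move=> h n f A N x hp; rewrite !le_min => /andP[/andP[hh0 hh4] /andP[hh6 he]] nf fA fN Dx xA.
have [mf f0] := nf.
have [mw w0] : nonneg (weight f eps) := weight_nonneg nf (ltW ep).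
have N0 : 0 <= N by rewrite -lee_fin; apply: le_trans fN; apply: integral_ge0 => y _; exact: w0.
have C4N : 0 <= C4 * N by rewrite mulr_ge0// ltW.
have [mU1 U10] : nonneg (U h n one) := Uop_nonneg X M hp mD n n1.
apply: (Hh h f A N hp hh0 nf N0) => //.
- by move=> k y Dy yA; apply: (H6 h k f A).
- move=> k; rewrite integral_Uop//; apply: (@le_trans _ _ (C4 * N)%:E); last by rewrite lee_fin; lra.
  apply: (@le_trans _ _ (\int[m]_(y in D) (C4%:E * weight f eps y))%E).
    apply: ge0_le_lower_integral => y Dy.
      by apply: mule_ge0 => //; have [] := Uop_nonneg X M hp mD k n1.
    by rewrite /weight muleCA -EFinM; apply: lee_wpmul2l => //; exact: H4.
  rewrite ge0_integralZl//; [|exact: measurable_funTS|by rewrite lee_fin ltW].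
  by rewrite EFinM; apply: lee_wpmul2l => //; rewrite lee_fin ltW.
- by apply: (le_trans (weight_le nf hp he fN)); rewrite lee_fin; lra.
- by move=> y _ yA; rewrite fA ?lee_fin//; exact: far_notin yA.
Qed.

End Bounds.

(* [s2] is the square of the radius. *)
Definition eball {R : realType} {d : nat} (a : 'rV[R]_d) (s2 : R) : set (Borel R d) :=
  [set y | sqd y a < s2].

Lemma measurable_eball {R : realType} {d : nat} (a : 'rV[R]_d) s2 : measurable (eball a s2).
Proof.
rewrite (_ : eball a s2 = (fun y : Borel R d => sqd y a) @^-1` `]-oo, s2[%classic).
  by rewrite -[X in measurable X]setTI; apply: measurable_sqd => //; exact: measurable_itv.
by apply/seteqP; split=> y; rewrite /eball /= in_itv.
Qed.

Lemma sqrt_pow_ge {R : realType} (d : nat) (u : R) : 0 <= u ->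
  expR (- (d%:R * (u / 2))) <= (Num.sqrt (1 + u))^-1 ^+ d.
Proof.
move=> u0; have b0 : 0 < 1 + u by lra.
have s2 : Num.sqrt (1 + u) <= expR (u / 2).
  rewrite -[leRHS]ger0_norm ?expR_ge0// -sqrtr_sqr ler_wsqrtr// expr2 -expRD.
  by rewrite (_ : u / 2 + u / 2 = u); [exact: expR_ge1Dx|lra].
rewrite -mulrN expRM_natl expRN; apply: lerXn2r; rewrite ?nnegrE ?invr_ge0 ?expR_ge0//.
by rewrite lef_pV2 ?posrE ?expR_gt0 ?sqrtr_gt0.
Qed.

(** * Lower bounds on killed potentials *)

Section LowerTools.
Context {R : realType} {d : nat}.
Variables (X : timechange R) (M : refmeasure R d).
Notation m := (refm M).
Notation phi := (tc_phi X).
Implicit Types (x y : 'rV[R]_d) (f g : Borel R d -> \bar R) (h : R) (n : nat) (F : set (Borel R d)).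

(** The minorising sum may be negative where [G] is merely nonnegative, so the comparison goes
    through its positive part. *)
Lemma tc_integral_ge h s (G : tc_space X -> \bar R) : 0 < h -> all (fun p => 0 <= p.2) s ->
  (forall w, 0 <= G w)%E -> (forall w, (expsum s (tc h w))%:E <= G w)%E ->
  ((\sum_(p <- s) p.1 * expR (- (h * phi p.2)))%:E <= \int[tc_prob X]_w G w)%E.
Proof.
move=> h0 s0 G0 GH; have [i e] := tc_expsum X h0 s0.
rewrite -(RintegralE i e).
apply: (@le_trans _ _ (\int[tc_prob X]_w ((EFin \o (fun w => expsum s (tc h w)))^\+ w))%E).
  apply: le_integral => //; first exact: integrable_funepos.
  by move=> w _ /=; rewrite funeposE le_max lexx.
apply: ge0_le_lower_integral => w _; first exact: funepos_ge0.
by rewrite funeposE ge_max G0 andbT; exact: GH.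
Qed.

Lemma Qop_ge h x f s : 0 < h -> nonneg f -> all (fun p => 0 <= p.2) s ->
  (forall t, h <= t -> ((expsum s t)%:E <= \int[m]_y ((gauss t x y)%:E * f y))%E) ->
  ((\sum_(p <- s) p.1 * expR (- (h * phi p.2)))%:E <= Qop X M h setT f x)%E.
Proof.
move=> h0 [mf f0] s0 H; rewrite QopE kern_mix//; apply: tc_integral_ge => // w.
- by apply: integral_ge0 => y _; rewrite mule_ge0// lee_fin gauss_ge0.
- by apply: H; exact: tc_ge.
Qed.

Section Hopf.
Variables (K r2 q2 : R).
Hypotheses (K0 : 1 <= K) (r20 : 0 < r2) (q20 : 0 < q2).
(** The three demands on [K] that make the Hopf function a subsolution outside the ball of squared
    radius [q2]. [Kd] makes convexity beat the dimension at times with [4 K s <= 1]; [Kexp] handles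
    longer times up to 1; [Kphi] lets the gain [K^2 q h] outweigh times above 1, which cost a
    multiple of [h phi 1]. *)
Hypothesis Kd : (2 * d)%:R <= K * q2.
Hypothesis Kphi : 4 * phi 1 <= K ^+ 2 * q2.
Hypothesis Kexp : (1 + 4 * K) ^+ d <= expR (K * q2 / 4).

Let Kge0 : 0 <= K. Proof. exact: le_trans ler01 K0. Qed.

Definition hopf c y : R := Num.max 0 (expR (- (K * sqd y c)) - expR (- (K * r2))).

Lemma hopf_ge0 c y : 0 <= hopf c y. Proof. by rewrite /hopf le_max lexx. Qed.

Lemma hopf_le1 c y : hopf c y <= 1.
Proof.
rewrite /hopf ge_max ler01 /= lerBlDr.
have : expR (- (K * sqd y c)) <= 1 by rewrite expR_le1 oppr_le0 mulr_ge0 ?sqd_ge0.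
by have := expR_ge0 (- (K * r2)); lra.
Qed.

Lemma hopf_out c y : r2 <= sqd y c -> hopf c y = 0.
Proof.
move=> rq; apply/max_idPl; by rewrite subr_le0 ler_expR lerN2 ler_wpM2l.
Qed.

Lemma hopf_lower c y : expR (- (K * r2)) * (K * (r2 - sqd y c)) <= hopf c y.
Proof.
rewrite /hopf le_max; apply/orP; right.
have -> : - (K * sqd y c) = - (K * r2) + K * (r2 - sqd y c) by ring.
rewrite expRD; have := expR_ge1Dx (K * (r2 - sqd y c)); have := expR_gt0 (- (K * r2)).
by move: (expR (- _)) (expR (K * _)) => a b a0 b0; nra.
Qed.

Lemma hopf_nonneg c : nonneg (fun y : Borel R d => (hopf c y)%:E).
Proof.
split; last by move=> y; rewrite lee_fin hopf_ge0.
apply/measurable_EFinP; apply: measurable_maxr => //; apply: measurable_funB => //.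
exact: measurable_exp_sqd.
Qed.

Let gint_hopf c s x : 0 < s ->
  (gint M s x (fun y => expR (- (K * sqd y c))) <= gint M s x (hopf c) + (expR (- (K * r2)))%:E)%E.
Proof.
move=> s0; rewrite -(gint_cst M x s0 (expR_ge0 _)) -gintD; last 4 first.
- by apply: measurable_maxr => //; apply: measurable_funB => //; exact: measurable_exp_sqd.
- exact: measurable_cst.
- by move=> y; exact: hopf_ge0.
- by move=> y; exact: expR_ge0.
apply: gint_le => y; first exact: expR_ge0.
by rewrite -lerBlDr /hopf le_max lexx orbT.
Qed.

Let gint_hopf_ge c s x a : 0 < s ->
  (a%:E <= gint M s x (fun y => expR (- (K * sqd y c))))%E ->
  ((a - expR (- (K * r2)))%:E <= gint M s x (hopf c))%E.
Proof. by move=> s0 ha; rewrite EFinB leeBlDr//; apply: (le_trans ha); exact: gint_hopf. Qed.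

Let gauss_factor s : 0 < s -> 1 + 4 * K * s > 0.
Proof. by move=> s0; have := K0; have : 0 <= K * s; [apply: mulr_ge0; have := K0; lra|lra]. Qed.

(** Without restriction on [x] one step loses at most [C h]: the test sum is
    [hopf c x - C (1 - e^{-t})], and [C >= 2] makes it nonpositive for [t > 1]. *)
Lemma hopf_drift c h x : 0 < h ->
  ((hopf c x)%:E <= Qop X M h setT (fun y => (hopf c y)%:E) x + ((4 * d%:R * K + 2) * phi 1 * h)%:E)%E.
Proof.
move=> h0; set C := 4 * d%:R * K + 2.
have Kp := K0; have C2 : 2 <= C by rewrite /C lerDr !mulr_ge0//; lra.
have f0 : 0 <= phi 1 by have := tc_phi_ge X ler01; lra.
have [Q0 nq] := (Qop_nonneg X M h0 measurableT (hopf_nonneg c)).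
have [xr|xr] := leP r2 (sqd x c).
  rewrite hopf_out//; apply: adde_ge0 => //; rewrite lee_fin !mulr_ge0//; lra.
rewrite -leeBlDr// -EFinB.
have Hx : hopf c x = expR (- (K * sqd x c)) - expR (- (K * r2)).
  by apply/max_idPr; rewrite subr_ge0 ler_expR lerN2 ler_wpM2l//; lra.
have := @Qop_ge h x _ [:: (hopf c x - C, 0); (C, 1)] h0 (hopf_nonneg c).
rewrite /= lexx ler01 => /(_ isT) H.
apply: (le_trans _ (H _)).
  rewrite lee_fin !big_cons big_nil /= tc_phi0 mulr0 oppr0 expR0.
  have := one_sub_expR_le (h * phi 1); move: (expR _) => e he.
  have : C * (1 - e) <= C * (h * phi 1) by rewrite ler_wpM2l//; lra.
  by lra.
move=> s hs; have s0 := lt_le_trans h0 hs.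
rewrite /expsum !big_cons big_nil /= mul0r oppr0 expR0 mul1r mulr1 addr0.
rewrite -/(gint M s x (hopf c)).
have [s1|s1] := leP s 1; last first.
  apply: (@le_trans _ _ 0%E); last by apply: gint_ge0 => y; exact: hopf_ge0.
  rewrite lee_fin; have := hopf_le1 c x.
  have : expR (- s) <= 1 / 2.
    have : expR (- s) <= expR (- 1) by rewrite ler_expR lerN2 ltW.
    by have := @one_sub_expR_ge R 1 ler01 (lexx 1); lra.
  by move: (expR _) => e h1 h2; nra.
have u0 := gauss_factor s0.
apply: (@le_trans _ _ ((1 - d%:R * (2 * K * s)) * expR (- (K * sqd x c)) - expR (- (K * r2)))%:E).
  rewrite lee_fin Hx.
  have := one_sub_expR_ge (ltW s0) s1.
  have : expR (- (K * sqd x c)) <= 1 by rewrite expR_le1 oppr_le0 mulr_ge0 ?sqd_ge0//; lra.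
  have := expR_ge0 (- (K * sqd x c)).
  have dK : 0 <= d%:R * K by rewrite mulr_ge0//; lra.
  rewrite /C; move: (expR (- (K * sqd x c))) (expR (- s)) (d%:R : R) dK => e1 e2 D dK h1 h2 h3.
  have : D * K * s * e1 <= D * K * s by rewrite ler_piMr// mulr_ge0// ltW.
  have : D * K * s <= D * K * (2 * (1 - e2)) by rewrite ler_wpM2l//; lra.
  by lra.
apply: gint_hopf_ge => //; rewrite gint_exp// lee_fin.
have Ks : 0 <= 4 * K * s by rewrite !mulr_ge0//; lra.
apply: (@le_trans _ _ (expR (- (d%:R * (4 * K * s / 2))) * expR (- (K * sqd x c)))).
  apply: ler_wpM2r; first exact: expR_ge0.
  have := expR_ge1Dx (- (d%:R * (4 * K * s / 2))).
  by rewrite (_ : 1 + - (d%:R * (4 * K * s / 2)) = 1 - d%:R * (2 * K * s))//; field.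
apply: ler_pM; rewrite ?expR_ge0//; first exact: sqrt_pow_ge.
rewrite ler_expR lerN2; apply: ler_wpM2r; first exact: sqd_ge0.
by rewrite ler_pdivrMr// ler_peMr//; lra.
Qed.

Lemma hopf_sub c h x : 0 < h -> h <= (4 * K)^-1 -> h * phi 1 <= 1 / 4 -> q2 <= sqd x c ->
  ((hopf c x)%:E <= Qop X M h setT (fun y => (hopf c y)%:E) x)%E.
Proof.
move=> h0 hK hphi xq; have Kp := K0.
have [Q0 nq] := (Qop_nonneg X M h0 measurableT (hopf_nonneg c)).
have [xr|xr] := leP r2 (sqd x c); first by rewrite hopf_out.
have Hx : hopf c x = expR (- (K * sqd x c)) - expR (- (K * r2)).
  by apply/max_idPr; rewrite subr_ge0 ler_expR lerN2 ler_wpM2l//; lra.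
set q := sqd x c in xq xr Hx *; set e := expR (- (K * q)) in Hx.
have e0 : 0 < e := expR_gt0 _.
have q0 : 0 < q by apply: lt_le_trans xq.
have h4 : 4 * K * h <= 1.
  by have := hK; rewrite -ler_pdivlMl ?mulr1//; lra.
pose g := e * (K ^+ 2 * q) * h.
have g0 : 0 <= g := mulr_ge0 (mulr_ge0 (ltW e0) (mulr_ge0 (sqr_ge0 _) (ltW q0))) (ltW h0).
pose A := hopf c x + g.
have A0 : 0 <= A by rewrite addr_ge0// hopf_ge0.
(* The sum is [A (1 - 2 (1 - e^{-t}))], with [A] the value plus the gain [g]: at most [A] up to time
   1, nonpositive beyond. Its mean is at least [A (1 - 2 h phi 1)], and the two losses are at most
   [g / 2] each, by [Kphi] and by [h phi 1 <= 1/4]. *)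
have := @Qop_ge h x _ [:: (A - 2 * A, 0); (2 * A, 1)] h0 (hopf_nonneg c).
rewrite /= lexx ler01 => /(_ isT) H.
apply: (le_trans _ (H _)).
  rewrite lee_fin !big_cons big_nil /= tc_phi0 mulr0 oppr0 expR0.
  have : A * (1 - expR (- (h * phi 1))) <= A * (h * phi 1) by rewrite ler_wpM2l// one_sub_expR_le.
  have : hopf c x <= e by rewrite Hx; have := expR_ge0 (- (K * r2)); lra.
  have k1 : e * (4 * phi 1) * h <= g.
    rewrite /g; apply: ler_wpM2r; first exact: ltW.
    apply: ler_wpM2l; first exact: ltW.
    by apply: (le_trans Kphi); rewrite ler_wpM2l ?sqr_ge0.
  have k2 : g * (h * phi 1) <= g * (1 / 4) by rewrite ler_wpM2l.
  have f0 : 0 <= phi 1 by have := tc_phi_ge X ler01; lra.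
  have k3 : 0 <= h * phi 1 by rewrite mulr_ge0// ltW.
  move=> he; have k4 : hopf c x * (h * phi 1) <= e * (h * phi 1) by rewrite ler_wpM2r.
  by rewrite /A; move: (expR (- (h * phi 1))) => E; lra.
move=> s hs; have s0 := lt_le_trans h0 hs.
rewrite /expsum !big_cons big_nil /= mul0r oppr0 expR0 mul1r mulr1 addr0.
rewrite -/(gint M s x (hopf c)).
have [s1|s1] := leP s 1; last first.
  apply: (@le_trans _ _ 0%E); last by apply: gint_ge0 => y; exact: hopf_ge0.
  rewrite lee_fin.
  have : expR (- s) <= 1 / 2.
    have : expR (- s) <= expR (- 1) by rewrite ler_expR lerN2 ltW.
    by have := @one_sub_expR_ge R 1 ler01 (lexx 1); lra.
  by move: (expR _) => e' h1; nra.
apply: (@le_trans _ _ A%:E).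
  rewrite lee_fin; have : expR (- s) <= 1 by rewrite expR_le1 oppr_le0 ltW.
  by move: (expR _) => e' h1; nra.
have -> : A = (e + g) - expR (- (K * r2)) by rewrite /A Hx; ring.
apply: gint_hopf_ge => //.
have Kpos : 0 <= K by lra.
have [u1|u1] := leP (4 * K * s) 1.
  have dq : (2 * d)%:R <= K * q by apply: (le_trans Kd); rewrite ler_wpM2l.
  apply: (le_trans _ (gint_exp_ge M s0 Kpos u1 dq)); rewrite lee_fin -/q -/e mulrDr mulr1 lerD2l /g.
  by rewrite -mulrA ler_wpM2l ?(ltW e0)// ler_wpM2l// mulr_ge0 ?sqr_ge0// ltW.
have u0 := gauss_factor s0.
rewrite gint_exp// lee_fin -/q.
set u := 4 * K * s in u1 u0 *.
have uK : u <= 4 * K by rewrite /u ler_piMr//; lra.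
have l1 : ((1 + 4 * K) ^+ d)^-1 <= (Num.sqrt (1 + u))^-1 ^+ d.
  rewrite exprVn lef_pV2 ?posrE ?exprn_gt0 ?sqrtr_gt0//; last by lra.
  apply: lerXn2r; rewrite ?nnegrE//; first by lra.
  apply: (@le_trans _ _ (Num.sqrt ((1 + 4 * K) ^+ 2))).
    apply: ler_wsqrtr; have : 1 + u <= 1 + 4 * K by lra.
    by move: (4 * K) (Kpos) => k k0 uk; rewrite expr2; nra.
  by rewrite sqrtr_sqr ger0_norm//; lra.
have l2 : e * expR (K * q / 2) <= expR (- (K / (1 + u) * q)).
  rewrite -expRD ler_expR.
  have -> : - (K / (1 + u) * q) = - (K * q) + K * q * (u / (1 + u)) by field; rewrite gt_eqF.
  rewrite lerD2l ler_wpM2l ?mulr_ge0 ?(ltW q0)//.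
  by rewrite ler_pdivlMr//; lra.
apply: (@le_trans _ _ (((1 + 4 * K) ^+ d)^-1 * (e * expR (K * q / 2)))); last first.
  by apply: ler_pM => //; rewrite ?invr_ge0 ?exprn_ge0 ?mulr_ge0 ?expR_ge0 ?(ltW e0)//; lra.
have KD : 0 < (1 + 4 * K) ^+ d by rewrite exprn_gt0//; lra.
rewrite mulrCA; have -> : e + g = e * (1 + K ^+ 2 * q * h) by rewrite /g; ring.
apply: ler_wpM2l; first exact: ltW.
have -> : K * q / 2 = K * q / 4 + K * q / 4 by field.
rewrite expRD mulrA.
have f1 : 1 + K ^+ 2 * q * h <= expR (K * q / 4).
  apply: (le_trans _ (expR_ge1Dx _)); rewrite lerD2l.
  have := ler_wpM2l (mulr_ge0 Kpos (ltW q0)) h4; rewrite expr2; lra.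
have f2 : 1 <= ((1 + 4 * K) ^+ d)^-1 * expR (K * q / 4).
  rewrite mulrC ler_pdivlMr// mul1r; apply: (le_trans Kexp); rewrite ler_expR.
  by rewrite ler_wpM2r// ler_wpM2l.
by rewrite -[leLHS]mul1r; apply: ler_pM => //; rewrite addr_ge0// !mulr_ge0 ?sqr_ge0 ?(ltW q0)// ltW.
Qed.

End Hopf.

Lemma hopf_const (q2 : R) : 0 < q2 -> exists2 K : R, 1 <= K &
  [/\ (2 * d)%:R <= K * q2, 4 * phi 1 <= K ^+ 2 * q2 & (1 + 4 * K) ^+ d <= expR (K * q2 / 4)].
Proof.
move=> q0; have f0 : 0 <= phi 1 by have := tc_phi_ge X ler01; lra.
(* Makes the term of order [d + 1] of the exponential series at [K q2 / 4] exceed [(5 K)^d] as soon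
   as [K >= E]. *)
pose E : R := 5 ^+ d * (d.+1)`!%:R * (4 / q2) ^+ d.+1.
have E0 : 0 <= E by rewrite !mulr_ge0// exprn_ge0// divr_ge0// ltW.
have A0 : 0 <= (2 * d)%:R / q2 by rewrite divr_ge0// ltW.
have B0 : 0 <= 4 * phi 1 / q2 by rewrite divr_ge0 ?mulr_ge0// ltW.
pose K : R := 1 + (2 * d)%:R / q2 + 4 * phi 1 / q2 + E.
have K1 : 1 <= K by rewrite /K; lra.
have K0 : 0 < K by lra.
exists K => //; split.
- by rewrite -ler_pdivrMr// /K; lra.
- rewrite -ler_pdivrMr//; apply: (@le_trans _ _ K); first by rewrite /K; lra.
  by rewrite expr2 ler_peMl// ltW.
have z0 : 0 <= K * q2 / 4 by rewrite divr_ge0// mulr_ge0// ltW.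
apply: (@le_trans _ _ ((K * q2 / 4) ^+ d.+1 / (d.+1)`!%:R)); last first.
  by have := expR_ge1Dxn d z0; lra.
have F0 : 0 < (d.+1)`!%:R :> R by rewrite ltr0n fact_gt0.
rewrite ler_pdivlMr//.
apply: (@le_trans _ _ ((5 * K) ^+ d * (d.+1)`!%:R)).
  apply: ler_wpM2r; first exact: ltW.
  by apply: lerXn2r; rewrite ?nnegrE; lra.
have EK : E <= K by rewrite /K; lra.
have qd : 0 <= (q2 / 4) ^+ d.+1 by rewrite exprn_ge0// divr_ge0// ltW.
have kd : 0 <= K ^+ d by rewrite exprn_ge0// ltW.
have := ler_wpM2l (mulr_ge0 kd qd) EK.
have -> : K ^+ d * (q2 / 4) ^+ d.+1 * K = (K * q2 / 4) ^+ d.+1.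
  by rewrite -[in RHS]mulrA [in RHS]exprMn [K ^+ d.+1]exprS; ring.
apply: le_trans; rewrite /E.
have -> : K ^+ d * (q2 / 4) ^+ d.+1 * (5 ^+ d * (d.+1)`!%:R * (4 / q2) ^+ d.+1) =
  5 ^+ d * K ^+ d * (d.+1)`!%:R * ((q2 / 4) ^+ d.+1 * (4 / q2) ^+ d.+1) by ring.
rewrite -[(q2 / 4) ^+ _ * _]exprMn (_ : q2 / 4 * (4 / q2) = 1); last by field; rewrite gt_eqF.
by rewrite expr1n mulr1 exprMn.
Qed.

(** Iterating [Psi <= Q Psi + C h 1_B], with [B] the central ball, bounds [Psi] by
    [C h + C U_n 1_B + Q^(n+1) Psi]. The last term is at most [gmax] at the elapsed time multiplied
    by the volume [V]. Division by [C] leaves the linear lower bound of [hopf_lower]. *)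
Lemma hopf_bound (r2 q2 V : R) : 0 < r2 -> 0 < q2 -> exists c0 h0 : R,
  [/\ 0 < c0, 0 < h0 & forall F c h n y, measurable F -> eball c r2 `<=` F -> (m F <= V%:E)%E ->
    0 < h -> h <= h0 ->
    ((c0 * (r2 - sqd y c))%:E <=
     Uop X M h F n (fun z => (\1_(eball c q2) z)%:E) y + (h + gmax (d := d) (n.+1%:R * h) * V)%:E)%E].
Proof.
move=> r20 q20; have [K K1 [Kd Kphi Kexp]] := hopf_const q20.
have f1 := tc_phi_ge X ler01.
have K0 : 0 < K by lra.
pose C : R := (4 * d%:R * K + 2) * phi 1.
have C1 : 1 <= C.
  have : 0 <= 4 * d%:R * K by rewrite !mulr_ge0// ltW.
  by rewrite /C; move: (4 * _ * K) (phi 1) f1 => a b; nra.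
have C0 : 0 < C by lra.
pose c0 := expR (- (K * r2)) * K / C.
have fp : 0 < phi 1 by lra.
exists c0, (Num.min (4 * K)^-1 (1 / (4 * phi 1))); split.
- by rewrite divr_gt0// mulr_gt0// expR_gt0.
- by rewrite lt_min invr_gt0 mulr_gt0//= divr_gt0// mulr_gt0.
move=> F c h n y mF cF FV hp; rewrite le_min => /andP[hK hf].
have hphi : h * phi 1 <= 1 / 4.
  by have := hf; rewrite ler_pdivlMr ?mulr_gt0//; lra.
have h0 : 0 <= h := ltW hp; have C00 := ltW C0.
pose Psi z := (hopf K r2 c z)%:E.
have nP : nonneg Psi := hopf_nonneg K r2 c.
set B := eball c q2; pose b z : \bar R := (\1_B z)%:E.
have nb : nonneg b by apply: nonneg_indic; exact: measurable_eball.
have QF z : Qop X M h setT Psi z = Qop X M h F Psi z.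
  rewrite !Qop_mkcond; apply: eq_integral => w _; rewrite indicT mule1.
  rewrite indicE; have [|/negP wF] := boolP (w \in F); first by rewrite mule1.
  rewrite /Psi hopf_out ?mul0e//; rewrite leNgt; apply/negP => wr.
  by apply: wF; rewrite inE; exact: cF.
have Ch : 0 <= C * h by rewrite mulr_ge0.
have drift z : (Psi z <= Qop X M h F Psi z + (C * h)%:E * b z)%E.
  have [_ nq] := (Qop_nonneg X M hp mF nP).
  rewrite /b indicE; have [zB|zB] := boolP (z \in B).
    by rewrite mule1 -QF; apply: hopf_drift.
  rewrite mule0 adde0 -QF.
  apply: (@hopf_sub K r2 q2) => //.
  by rewrite leNgt; apply: contra zB => zB; rewrite inE.
have nU k := Uop_nonneg X M hp mF k nb.
have nQ k := Qiter_nonneg X M hp mF k nP.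
have claim k z : (Psi z <= (C * h)%:E * b z + (C%:E * Uop X M h F k b z + iter k.+1 (Qop X M h F) Psi z))%E.
  elim: k z => [|k IH] z; first by rewrite /= mule0 add0e addeC.
  apply: (le_trans (drift z)); rewrite addeC; apply: leeD => //.
  pose g1 w := (C%:E * (h%:E * b w + Uop X M h F k b w))%E.
  have ns : nonneg (fun w => (h%:E * b w + Uop X M h F k b w)%E) := Usrc_nonneg X M hp mF k nb.
  have n1 : nonneg g1 := nonneg_scale C00 ns.
  rewrite iterS (_ : Uop X M h F k.+1 b z = Qop X M h F (fun w => (h%:E * b w + Uop X M h F k b w)%E) z)//.
  rewrite -(QopZ X M z hp mF C00 ns) -(QopD X M z hp mF n1 (nQ k.+1)).
  apply: (Qop_le X M z hp mF nP (nonneg_add n1 (nQ k.+1))) => w _.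
  apply: (le_trans (IH w)); rewrite addeA; apply: leeD => //.
  have [_ b0] := nb; have [_ U0] := nU k.
  rewrite /g1 ge0_muleDr; [by rewrite muleA -EFinM|by rewrite mule_ge0// lee_fin|exact: U0].
have last : (iter n.+1 (Qop X M h F) Psi y <= (gmax (d := d) (n.+1%:R * h) * V)%:E)%E.
  apply: (Qiter_bound (D := F)) => //; first exact: gmax_ge0.
    by move=> z _ _; apply: kern_le_gmax; rewrite mulr_gt0.
  apply: le_trans FV; rewrite -[leRHS]mul1e -integral_cst//.
  by apply: ge0_le_lower_integral => z _; rewrite /Psi lee_fin ?hopf_ge0// hopf_le1.
have V0 : 0 <= V by rewrite -lee_fin; apply: le_trans FV.
have g0 : 0 <= gmax (d := d) (n.+1%:R * h) := gmax_ge0 _.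
have [_ U0] := nU n.
have low := hopf_lower K r2 c y.
have fin : ((C * (c0 * (r2 - sqd y c)))%:E <= C%:E * (Uop X M h F n b y + (h + gmax (d := d) (n.+1%:R * h) * V)%:E))%E.
  apply: (@le_trans _ _ (Psi y)).
    by rewrite lee_fin; apply: le_trans low; rewrite le_eqVlt; apply/orP; left; apply/eqP; rewrite /c0; field; rewrite gt_eqF.
  apply: (le_trans (claim n y)).
  rewrite ge0_muleDr//; last by rewrite lee_fin addr_ge0// mulr_ge0.
  rewrite addeCA; apply: leeD => //; rewrite -[X in (_ <= X)%E]EFinM mulrDr EFinD; apply: leeD.
    by rewrite /b indicE -EFinM lee_fin; case: (_ \in _); rewrite ?mulr1// mulr0.
  by apply: (le_trans last); rewrite lee_fin ler_peMl// mulr_ge0.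
by rewrite EFinM lee_pmul2l// in fin; rewrite lte_fin.
Qed.

(** A maximum principle: killing on leaving [F] forfeits only what would be collected from the first
    position in [F' \ F], at most [B]. [iter_kill_le] is the analogue for iterates of the free
    walk. *)
Lemma Uop_subset_le h n F F' f x (B : R) : 0 < h -> measurable F -> measurable F' -> F `<=` F' ->
  nonneg f -> 0 <= B ->
  (forall k y, F' y -> ~ F y -> (h%:E * f y + Uop X M h F' k f y <= B%:E)%E) ->
  (Uop X M h F' n f x <= Uop X M h F n f x + B%:E)%E.
Proof.
move=> hp mF mF' FF nf B0 HB; have h0 : 0 <= h := ltW hp.
have mD : measurable (F' `\` F) by exact: measurableD.
have nU' k := Uop_nonneg X M hp mF' k nf; have nU k := Uop_nonneg X M hp mF k nf.
have nS' k := Usrc_nonneg X M hp mF' k nf; have nS k := Usrc_nonneg X M hp mF k nf.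
have nB := nonneg_cst B0 : nonneg (fun _ : Borel R d => B%:E).
elim: n x => [|n IH] x; first by rewrite /= add0e lee_fin.
have FD : F' = F `|` (F' `\` F) by rewrite setDUK.
have dj : [disjoint F & F' `\` F] by apply/disj_setPS => y [Fy []].
rewrite /= [X in Qop _ _ _ X _ _]FD (QopU X M x hp mF mD (nS' n) dj).
apply: (@le_trans _ _ ((Uop X M h F n.+1 f x + Qop X M h F (fun=> B%:E) x) + Qop X M h (F' `\` F) (fun=> B%:E) x)%E).
  apply: leeD.
    rewrite /= -(QopD X M x hp mF (nS n) nB).
    apply: (Qop_le X M x hp mF (nS' n) (nonneg_add (nS n) nB)) => y _.
    by rewrite -addeA; apply: leeD.
  apply: (Qop_le X M x hp mD (nS' n) nB) => y [F'y nFy]; exact: HB.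
rewrite -addeA; apply: leeD => //.
by rewrite -(QopU X M x hp mF mD nB dj) -FD; exact: Qop_cst_le.
Qed.

Lemma iter_kill_le h n F f x (B : R) : 0 < h -> measurable F -> nonneg f -> 0 <= B ->
  (forall i y, (i < n)%N -> ~ F y -> (iter i (Qop X M h setT) f y <= B%:E)%E) ->
  (iter n (Qop X M h setT) f x <= iter n (Qop X M h F) f x + B%:E)%E.
Proof.
move=> hp mF nf B0; have nB := nonneg_cst B0 : nonneg (fun _ : Borel R d => B%:E).
have mC : measurable (~` F) by exact: measurableC.
have nT k := Qiter_nonneg X M hp measurableT k nf; have nF k := Qiter_nonneg X M hp mF k nf.
have dj : [disjoint F & ~` F] by rewrite disj_set2E setICr.
elim: n x => [|n IH] x HB; first by rewrite /= leeDl.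
have {}IH y : (iter n (Qop X M h setT) f y <= iter n (Qop X M h F) f y + B%:E)%E.
  by apply: IH => i z ilt; apply: HB; exact: leq_trans ilt _.
rewrite !iterS -[X in Qop _ _ _ X _ _](setUv F) (QopU X M x hp mF mC (nT n) dj).
apply: (@le_trans _ _ ((Qop X M h F (iter n (Qop X M h F) f) x + Qop X M h F (fun=> B%:E) x) + Qop X M h (~` F) (fun=> B%:E) x)%E).
  apply: leeD.
    rewrite -(QopD X M x hp mF (nF n) nB).
    by apply: (Qop_le X M x hp mF (nT n) (nonneg_add (nF n) nB)) => y _; exact: IH.
  by apply: (Qop_le X M x hp mC (nT n) nB) => y nFy; exact: HB.
rewrite -addeA; apply: leeD => //.
by rewrite -(QopU X M x hp mF mC nB dj) setUv; exact: Qop_cst_le.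
Qed.

Lemma tc_phi_pow2 k (lam : R) : 0 <= lam -> phi (2 ^+ k * lam) <= 2 ^+ k * phi lam.
Proof.
move=> l0; elim: k => [|k IH]; first by rewrite !mul1r.
rewrite exprS -mulrA; apply: (le_trans (tc_phi_double X _)); first by rewrite mulr_ge0// exprn_ge0.
by rewrite -mulrA ler_wpM2l.
Qed.

(** With good probability the random time at step about [t = 2^(-k)] stays below [A = 2^a t]:
    doubling gives [phi (1 / A) <= phi 1 / A], so [a] can be chosen with [s phi (1 / A) <= 1/4].
    Between [s] and [A] the Gaussian is at least [e^{-1} >= 1/3] at squared distance [4 t], its
    normalisation being at least 1 because [4 pi A <= 1]. *)
Lemma kern_lower : exists a : nat, forall (k : nat) (s : R) x y,
  (2 ^+ k)^-1 <= s -> s <= 2 * (2 ^+ k)^-1 -> (4 * pi * 2 ^+ a <= 2 ^+ k :> R) ->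
  sqd x y <= 4 * (2 ^+ k)^-1 -> 1 / 6 <= kern X s x y.
Proof.
have f1 := tc_phi_ge X ler01.
exists (Num.truncn (8 * phi 1)).+1 => k s x y; set a := (Num.truncn (8 * phi 1)).+1.
set t := (2 ^+ k)^-1 => s1 s2 ta xy.
have t0 : 0 < t by rewrite invr_gt0 exprn_gt0.
have s0 : 0 < s by lra.
have pa : 0 < 2 ^+ a :> R by rewrite exprn_gt0.
have pk : 0 < 2 ^+ k :> R by rewrite exprn_gt0.
have a8 : 8 * phi 1 <= 2 ^+ a.
  apply: ltW; apply: (lt_le_trans (truncnS_gt _)); rewrite -natrX ler_nat.
  exact: (ltnW (ltn_expl _ _)).
have pi0 := pi_gt0 R.
have ak : (a <= k)%N.
  rewrite -(@ler_eXn2l R 2) ?ltr1n//; apply: le_trans ta; rewrite ler_peMl// ?ltW//.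
  by have := pi_ge2 R; lra.
pose A : R := 2 ^+ a * t.
have A0 : 0 < A by rewrite mulr_gt0.
have tA : t * 2 ^+ k = 1 by rewrite mulVf// gt_eqF.
have A1 : 4 * pi * A <= 1.
  have -> : 4 * pi * A = (4 * pi * 2 ^+ a) * t by rewrite /A; ring.
  by have := ler_wpM2r (ltW t0) ta; rewrite (mulrC (2 ^+ k)) tA.
have lamE : A^-1 = 2 ^+ (k - a) * 1.
  rewrite mulr1 /A /t invfM invrK mulrC.
  rewrite -{1}(subnK ak) exprD mulfK// gt_eqF//.
have hphi : s * phi A^-1 <= 1 / 4.
  have : phi A^-1 <= A^-1 * phi 1 by rewrite {1}lamE; apply: (le_trans (tc_phi_pow2 _ ler01)); rewrite lamE mulr1.
  have AI : A^-1 * A = 1 by rewrite mulVf// gt_eqF.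
  have : s * (A^-1 * phi 1) <= 1 / 4.
    have : 2 * t * (A^-1 * phi 1) <= 1 / 4.
      have tE : t = A / 2 ^+ a by rewrite /A; field; rewrite gt_eqF.
      have -> : 2 * t * (A^-1 * phi 1) = 2 * phi 1 / 2 ^+ a * (A^-1 * A) by rewrite tE; ring.
      by rewrite AI mulr1 ler_pdivrMr//; lra.
    apply: le_trans; apply: ler_wpM2r => //.
    by rewrite mulr_ge0 ?invr_ge0 ?(ltW A0)//; lra.
  by move=> v1 v2; apply: le_trans v1; apply: ler_wpM2l => //; exact: ltW.
rewrite -lee_fin kernE//.
(* The test sum [- 1/3 + (2/3) e^{-u / A}] is at most 1/3 for [u <= A] and nonpositive beyond; its
   mean is at least [1/3 - 1/6]. *)
have := @tc_integral_ge s [:: (- (1 / 3), 0); (2 / 3, A^-1)] (fun w => (gauss (tc s w) x y)%:E) s0.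
have Ai0 : 0 <= A^-1 by rewrite invr_ge0 ltW.
rewrite /= lexx Ai0 => /(_ isT) H; apply: (le_trans _ (H _ _)).
- rewrite lee_fin !big_cons big_nil /= tc_phi0 mulr0 oppr0 expR0.
  by have := one_sub_expR_le (s * phi A^-1); lra.
- by move=> w; rewrite lee_fin gauss_ge0.
move=> w; set u := tc s w; have su : s <= u by exact: tc_ge.
have u0 : 0 < u by lra.
rewrite /expsum !big_cons big_nil /= mul0r oppr0 expR0 lee_fin.
have [uA|uA] := leP u A; last first.
  apply: (@le_trans _ _ 0); last exact: gauss_ge0.
  have : expR (- (A^-1 * u)) <= expR (- 1).
    by rewrite ler_expR lerN2 mulrC ler_pdivlMr// mul1r ltW.
  by have := @one_sub_expR_ge R 1 ler01 (lexx 1); lra.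
have e1 : expR (- (A^-1 * u)) <= 1 by rewrite expR_le1 oppr_le0 mulr_ge0// ltW.
apply: (@le_trans _ _ (1 / 3)); first by lra.
rewrite gaussE -[leLHS]mul1r; apply: ler_pM => //.
  rewrite exprVn -[leLHS]invr1 lef_pV2 ?posrE ?exprn_gt0 ?sqrtr_gt0 ?mulr_gt0//.
  apply: exprn_ile1; first exact: sqrtr_ge0.
  rewrite -[leRHS]sqrtr1; apply: ler_wsqrtr; apply: le_trans A1.
  by rewrite ler_wpM2l// mulr_ge0// ltW.
apply: (@le_trans _ _ (expR (- 1))).
  by rewrite expRN mul1r lef_pV2 ?posrE ?expR_gt0// expR1_le3.
rewrite ler_expR lerN2 ler_pdivrMr ?mulr_gt0// mul1r.
by apply: (le_trans xy); rewrite ler_pM2l//; lra.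
Qed.

(** The free walk reaches the small ball with kernel at least 1/6. Killing outside [F] costs at most
    the return from a distance [eta], that is [K] times the elapsed time [2 t], made at most 1/12 by
    the choice of [k]. Half of the lower bound survives. *)
Lemma near_lower (s2 : R) : 0 < s2 -> exists2 t : R, 0 < t &
  forall F a h, measurable F -> eball a s2 `<=` F -> 0 < h -> h <= t ->
  exists n, n%:R * h <= 2 * t /\
  forall f x, nonneg f -> (\int[m]_(y in eball a t) f y < +oo)%E -> eball a t x ->
   ((1 / 12)%:E * \int[m]_(y in eball a t) f y <= iter n (Qop X M h F) f x)%E.
Proof.
move=> s20; have [a0 Ha] := kern_lower.
pose eta := Num.sqrt s2 / 2.
have e0 : 0 < eta by rewrite divr_gt0// sqrtr_gt0.
have eta2 : eta ^+ 2 = s2 / 4 by rewrite expr_div_n sqr_sqrtr ?(ltW s20)//; field.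
have [K K0 HK] := @kern_off_diag R d X eta e0.
pose k := (Num.truncn (4 * pi * 2 ^+ a0 + 4 / s2 + 24 * K : R)).+1.
have pi0 := pi_gt0 R; have pa : 0 < 2 ^+ a0 :> R by rewrite exprn_gt0.
have A1 : 0 < 4 * pi * 2 ^+ a0 :> R by rewrite mulr_gt0// mulr_gt0.
have A2 : 0 < 4 / s2 by rewrite divr_gt0.
have pk : 4 * pi * 2 ^+ a0 + 4 / s2 + 24 * K <= 2 ^+ k :> R.
  apply: ltW; apply: (lt_le_trans (truncnS_gt _)); rewrite -[leRHS]natrX ler_nat.
  exact: (ltnW (ltn_expl _ _)).
have k0 : 0 < 2 ^+ k :> R by rewrite exprn_gt0.
pose t : R := (2 ^+ k)^-1; have t0 : 0 < t by rewrite invr_gt0.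
have tk : t * 2 ^+ k = 1 by rewrite mulVf// gt_eqF.
have ts : t <= s2 / 4.
  have : 4 / s2 <= 2 ^+ k by lra.
  move=> /(ler_wpM2l (ltW t0)); rewrite tk mulrA ler_pdivrMr//; lra.
have tK : 24 * (K * t) <= 1.
  have : 24 * K <= 2 ^+ k by lra.
  by move=> /(ler_wpM2l (ltW t0)); rewrite tk; lra.
exists t => // F a h mF aF h0 ht.
have nn : exists n, (0 < n)%N /\ t <= n%:R * h /\ n%:R * h <= 2 * t.
  exists (Num.truncn (t / h)).+1; split => //.
  have Th : 0 <= t / h by rewrite divr_ge0// ltW.
  split; first by rewrite -ler_pdivrMr// ltW// truncnS_gt.
  rewrite -natr1 mulrDl mul1r (_ : 2 * t = t + t); last by ring.
  by rewrite lerD// -ler_pdivlMr// truncn_le.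
have [n [n0 [n1 n2]]] := nn; exists n; split => // f x nf Ioo ax.
set B := eball a t; have mB : measurable B by exact: measurable_eball.
pose f1 y := (f y * (\1_B y)%:E)%E.
have nf1 : nonneg f1 := nonneg_mul nf (nonneg_indic mB).
have [mf1 f10] := nf1; have [mf f0] := nf.
set I := (\int[m]_(y in B) f y)%E.
have IE : I = (\int[m]_y f1 y)%E by rewrite /I integral_indic_mul.
have I0 : (0 <= I)%E by exact: integral_ge0.
have le1 : (iter n (Qop X M h F) f1 x <= iter n (Qop X M h F) f x)%E.
  apply: Qiter_le => // y; rewrite /f1 indicE.
  by case: (_ \in _); rewrite ?mule1 ?mule0.
apply: le_trans le1.
have PT : ((1 / 6)%:E * I <= iter n (Qop X M h setT) f1 x)%E.
  rewrite -(prednK n0) Qop_iter// prednK// QopE IE -ge0_integralZl//.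
  apply: ge0_le_lower_integral => y _; first exact: mule_ge0.
  rewrite /f1 indicE; have [yB|yB] := boolP (y \in B); last by rewrite !mule0.
  apply: lee_wpmul2r; first by rewrite mule_ge0.
  rewrite lee_fin; apply: (Ha k) => //; first by lra.
  have := sqd_triangle x a y; move: yB; rewrite inE /B /eball /= (sqd_sym a y) => yB.
  by move: ax; rewrite /eball /= -/t; lra.
have Ifin : I \is a fin_num by rewrite ge0_fin_numE.
pose N := fine I; have IN : I = N%:E by rewrite fineK.
have N0 : 0 <= N by rewrite -lee_fin -IN.
have kill : (iter n (Qop X M h setT) f1 x <= iter n (Qop X M h F) f1 x + (1 / 12 * N)%:E)%E.
  apply: iter_kill_le => //; first by rewrite mulr_ge0//.
  move=> i y ilt nFy.
  have yfar z : B z -> eta ^+ 2 <= sqd y z.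
    move=> Bz; rewrite eta2; have : s2 <= sqd y a.
      by rewrite leNgt; apply/negP => ya; apply: nFy; exact: aF.
    have := sqd_triangle y z a; move: Bz; rewrite /B /eball /= => *; lra.
  case: i ilt => [|i] ilt.
    rewrite /= /f1 indicE memNset ?mule0 ?lee_fin ?mulr_ge0// => By.
    by have := yfar y By; rewrite sqdxx leNgt exprn_gt0.
  have ih : 0 < i.+1%:R * h by rewrite mulr_gt0.
  apply: (@le_trans _ _ (K * (2 * t) * N)%:E); last first.
    by rewrite lee_fin ler_wpM2r//; lra.
  apply: (Qiter_bound (D := setT)) => //; last by rewrite -IE IN.
    by rewrite !mulr_ge0// ltW.
  move=> z _ fz; have [|k1 _] := HK (i.+1%:R * h) y z ih.
    apply: yfar; apply: contrapT => nB; move: fz.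
    by rewrite /f1 indicE memNset// mule0 eqxx.
  apply: (le_trans k1); apply: ler_wpM2l; first exact: ltW.
  by apply: le_trans n2; rewrite ler_wpM2r ?ler_nat ?(ltnW ilt)// ltW.
have := le_trans PT kill; rewrite IN -EFinM.
rewrite -leeBlDr// -EFinB; apply: le_trans; rewrite -EFinM lee_fin; lra.
Qed.

End LowerTools.

(** * Geometry of C^{1,1} sets *)

Section Geometry.
Context {R : realType} {d : nat}.
Implicit Types (x y z n : 'rV[R]_d) (D : set 'rV[R]_d).

Lemma dotp_ge0 x : 0 <= dotp x x.
Proof. by apply: sumr_ge0 => i _; rewrite -expr2 sqr_ge0. Qed.

Lemma enorm2 x : enorm x ^+ 2 = dotp x x.
Proof. by rewrite /enorm sqr_sqrtr// dotp_ge0. Qed.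

Lemma enorm_ge0 x : 0 <= enorm x. Proof. exact: sqrtr_ge0. Qed.

Lemma sqd_enorm x y : sqd x y = enorm (x - y) ^+ 2.
Proof. by rewrite enorm2. Qed.

Lemma enorm_lt x (a : R) : 0 < a -> (enorm x < a) = (dotp x x < a ^+ 2).
Proof.
move=> a0; rewrite -enorm2 ltr_pXn2r// ?nnegrE ?enorm_ge0//; exact: ltW.
Qed.

Lemma enorm_le x (a : R) : 0 <= a -> (enorm x <= a) = (dotp x x <= a ^+ 2).
Proof. by move=> a0; rewrite -enorm2 ler_pXn2r// ?nnegrE ?enorm_ge0. Qed.

Lemma dotpZr (a : R) x y : dotp x (a *: y) = a * dotp x y.
Proof. by rewrite dotpC dotpZ dotpC. Qed.

Lemma dotpDr x y z : dotp x (y + z) = dotp x y + dotp x z.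
Proof. by rewrite dotpC dotpD !(dotpC x). Qed.

Lemma dotpNr x y : dotp x (- y) = - dotp x y.
Proof. by rewrite dotpC dotpN dotpC. Qed.

Lemma sqd_shift (a : R) x z n : dotp n n = 1 ->
  sqd x (z + a *: n) = sqd x z - 2 * a * dotp (x - z) n + a ^+ 2.
Proof.
move=> n1; rewrite /sqd opprD addrA -scaleNr; move: (x - z) => w.
by rewrite dotpD !dotpDr !dotpZ !dotpZr n1 (dotpC n w); ring.
Qed.

Lemma coord_sqd x y i : (x 0 i - y 0 i) ^+ 2 <= sqd x y.
Proof.
rewrite sqdE (bigD1 i)//= lerDl sumr_ge0// => j _; exact: sqr_ge0.
Qed.

Lemma sqd_cube x y (e : R) : 0 <= e -> cube y e x -> sqd x y <= d%:R * e ^+ 2.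
Proof.
move=> e0 xy; rewrite sqdE; apply: (@le_trans _ _ (\sum_(i < d) e ^+ 2)).
  apply: ler_sum => i _; have /ltW := xy i; rewrite ler_norml => /andP[a b].
  by rewrite -ler_sqrt ?sqr_ge0// sqrtr_sqr sqrtr_sqr (ger0_norm e0) ler_norml a b.
by rewrite sumr_const card_ord mulr_natl.
Qed.

Lemma open_sqdP D : open D <-> forall x, D x -> exists2 e : R, 0 < e & eball x (e ^+ 2) `<=` D.
Proof.
split=> [/open_rV_ballP oD x /oD[e e0 eD]|H].
  exists e => // y; rewrite /eball /= => yx; apply: eD => i.
  rewrite -(@ltr_pXn2r _ 2)// ?nnegrE ?(ltW e0)//; apply: le_lt_trans yx.
  by rewrite real_normK ?num_real//; exact: coord_sqd.
apply/open_rV_ballP => x /H[e e0 eD].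
have E (k r : R) : 0 <= k -> 0 < r -> k * r ^+ 2 < (r * (k + 1)) ^+ 2.
  move=> kk rr; rewrite exprMn mulrC (ltr_pM2l (exprn_gt0 2 rr)) sqrrD expr1n mulr1 mulr2n.
  by have := sqr_ge0 k; lra.
have k0 : 0 < (d%:R + 1 : R) by rewrite ltr_wpDl.
exists (Num.min e 1 / (d%:R + 1)); first by rewrite divr_gt0// lt_min e0 ltr01.
set r := Num.min e 1 / _ => y xy; apply: eD; rewrite /eball /=.
have r0 : 0 <= r by rewrite divr_ge0 ?(ltW k0)// le_min (ltW e0) ler01.
apply: (le_lt_trans (sqd_cube r0 xy)).
have re : r * (d%:R + 1) <= e by rewrite /r divfK ?gt_eqF// ge_min lexx.
have n0 : 0 <= d%:R :> R by [].
have [rz|rz] := eqVneq r 0; first by rewrite rz expr0n mulr0 exprn_gt0.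
have rp : 0 < r by rewrite lt_neqAle eq_sym rz.
apply: (@lt_le_trans _ _ ((r * (d%:R + 1)) ^+ 2)).
  exact: E.
apply: lerXn2r; rewrite ?nnegrE ?(ltW e0)// mulr_ge0// ltW.
Qed.

Lemma open_eball (a : 'rV[R]_d) s : open (eball a s : set 'rV[R]_d).
Proof.
apply/open_sqdP => x; rewrite /eball /= => xa.
pose q := sqd x a; have q0 : 0 <= q := sqd_ge0 _ _.
pose e := Num.min 1 ((s - q) / (2 * (Num.sqrt q + 1))).
have sq0 : 0 <= Num.sqrt q := sqrtr_ge0 q.
have sp : 0 < 2 * (Num.sqrt q + 1) by lra.
have e0 : 0 < e by rewrite lt_min ltr01 divr_gt0// subr_gt0.
exists e => // y; rewrite /eball /= => yx.
have E : sqd y a = sqd y x + q + 2 * dotp (y - x) (x - a).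
  rewrite /q !sqdE /dotp mulr_sumr -!big_split /=; apply: eq_bigr => i _; rewrite !mxE; ring.
have cs := dotp_cauchy (y - x) (x - a).
have : dotp (y - x) (x - a) <= e * Num.sqrt q.
  have eq0 : 0 <= e * Num.sqrt q by rewrite mulr_ge0// ltW.
  have [/ltW n|n] := ltP (dotp (y - x) (x - a)) 0; first exact: le_trans n eq0.
  rewrite -(@ler_pXn2r _ 2)// ?nnegrE//; apply: (le_trans cs).
  rewrite exprMn sqr_sqrtr//; apply: ler_wpM2r => //; exact: ltW.
have e1 : e <= 1 by rewrite ge_min lexx.
have e2 : e * (2 * (Num.sqrt q + 1)) <= s - q.
  by rewrite -ler_pdivlMr// ge_min lexx orbT.
have e3 : e ^+ 2 <= e by rewrite expr2 ler_piMl// ltW.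
by rewrite E; move: (Num.sqrt q) sq0 e2 => v v0 e2 h; lra.
Qed.

Section Delta.
Variables (D : set 'rV[R]_d) (w0 : 'rV[R]_d).
Hypotheses (oD : open D) (w0D : ~ D w0).

Let S x := [set enorm (x - y) | y in ~` D].

Let S0 x : S x !=set0. Proof. by exists (enorm (x - w0)), w0. Qed.

Let Slb x : lbound (S x) 0. Proof. by move=> _ [y _ <-]; exact: enorm_ge0. Qed.

Lemma delta_ge0 x : 0 <= delta D x.
Proof. exact: lb_le_inf (S0 x) (@Slb x). Qed.

Lemma delta_le x y : ~ D y -> delta D x <= enorm (x - y).
Proof. by move=> Dy; apply: ge_inf; [exists 0; exact: Slb|exists y]. Qed.

Lemma delta_lt x (a : R) : delta D x < a -> exists2 y, ~ D y & enorm (x - y) < a.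
Proof. by move=> /(inf_lt (S0 x))[_ [y Dy <-]]; exists y. Qed.

Lemma delta_ball x y : sqd y x < delta D x ^+ 2 -> D y.
Proof.
move=> yx; apply: contrapT => Dy; have := delta_le x Dy.
rewrite leNgt => /negP; apply.
rewrite -(@ltr_pXn2r _ 2)// ?nnegrE ?enorm_ge0 ?delta_ge0//.
by rewrite -sqd_enorm sqd_sym.
Qed.

Lemma delta_gt0 x : D x -> 0 < delta D x.
Proof.
move=> /(open_sqdP D).1 -/(_ oD)[e e0 eD].
apply: (lt_le_trans e0); apply: (lb_le_inf (S0 x)) => _ [y Dy <-].
rewrite leNgt; apply/negP => ye; apply: Dy; apply: eD; rewrite /eball /=.
by rewrite sqd_sym sqd_enorm ltr_pXn2r ?nnegrE ?enorm_ge0// ltW.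
Qed.

Lemma open_delta_lt (a : R) : open [set x | delta D x < a].
Proof.
rewrite (_ : [set _ | _] = \bigcup_(y in ~` D) (if 0 < a then eball y (a ^+ 2) else set0)).
  by apply: bigcup_open => y _; case: ifP => _; [exact: open_eball|exact: open0].
apply/seteqP; split=> x /=.
  move=> xa; have a0 : 0 < a := le_lt_trans (delta_ge0 x) xa.
  have [y Dy ya] := delta_lt xa; exists y => //; rewrite a0 /eball /= sqd_enorm.
  by rewrite ltr_pXn2r ?nnegrE ?enorm_ge0// ltW.
case=> y Dy; case: ifP => // a0; rewrite /eball /= sqd_enorm => xy.
apply: (le_lt_trans (delta_le x Dy)); move: xy.
by rewrite ltr_pXn2r ?nnegrE ?enorm_ge0// ltW.
Qed.

Lemma measurable_delta : measurable_fun setT (delta D : Borel R d -> R).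
Proof.
apply: (measurability (@RGenInftyO.G R)); first exact: RGenInftyO.measurableE.
move=> _ [_ [a ->] <-]; rewrite setTI; apply: sub_sigma_algebra.
rewrite (_ : _ @^-1` _ = [set x | delta D x < a]); first exact: open_delta_lt.
by apply/seteqP; split=> x; rewrite /= in_itv.
Qed.

(** The boundary point is the first point outside [D] on the segment from [x] to [w]: openness of
    [D] puts the infimum outside, and earlier parameters make it a limit of points of [D]. *)
Lemma exit_point x w : D x -> ~ D w -> exists2 z, bdry D z & sqd x z <= sqd x w.
Proof.
move=> Dx Dw; pose p (t : R) := x + t *: (w - x).
pose T := [set t : R | 0 <= t /\ ~ D (p t)].
have p1 : p 1 = w by rewrite /p scale1r addrC subrK.
have T1 : T 1 by split; rewrite ?p1.
have T0 : has_inf T by split; [exists 1|exists 0 => t []].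
pose t0 := inf T; have t00 : 0 <= t0 by apply: lb_le_inf; [exists 1|move=> t []].
have t01 : t0 <= 1 by apply: ge_inf T1; exact: T0.2.
have pp (s t : R) : sqd (p s) (p t) = (s - t) ^+ 2 * dotp (w - x) (w - x).
  rewrite /sqd /p opprD addrACA subrr add0r -scalerBl.
  by rewrite dotpZ dotpZr mulrA expr2.
have Esq (t : R) : 0 <= t -> t <= 1 -> (0 - t) ^+ 2 <= (0 - 1) ^+ 2.
  by move=> a b; rewrite !sub0r !sqrrN expr1n exprn_ile1.
have q0 := dotp_ge0 (w - x); set q := dotp (w - x) (w - x) in pp q0.
have near (e : R) : 0 < e -> exists2 s : R, 0 < s & s ^+ 2 * q < e ^+ 2.
  move=> e0; exists (e / (q + 1)); first by rewrite divr_gt0// ltr_wpDl.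
  have q1 : 0 < q + 1 by rewrite ltr_wpDl.
  rewrite expr_div_n mulrAC ltr_pdivrMr ?exprn_gt0// ltr_pM2l ?exprn_gt0//; nra.
have sqm (s e : R) (v : R) : 0 <= v -> v <= s -> s ^+ 2 * q < e ^+ 2 -> v ^+ 2 * q < e ^+ 2.
  move=> v0 vs; apply: le_lt_trans; apply: ler_wpM2r => //.
  by apply: lerXn2r; rewrite ?nnegrE//; apply: le_trans vs.
have Dz : ~ D (p t0).
  move=> /(open_sqdP D).1 -/(_ oD)[e e0 eD].
  have [s s0 se] := near e e0.
  have : inf T < t0 + s by rewrite ltrDl.
  move=> /inf_lt -/(_ _)[|t [t_ge0 Dt] ts]; first by exists 1.
  have tT : T t by split.
  apply: Dt; apply: eD; rewrite /eball /= pp.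
  apply: (sqm s) => //; last by rewrite lerBlDl ltW.
  by rewrite subr_ge0; apply: (ge_inf T0.2).
have t0p : 0 < t0.
  rewrite lt_neqAle t00 andbT; apply/negP => /eqP t0E; apply: Dz.
  by rewrite -t0E /p scale0r addr0.
exists (p t0); last first.
  have -> : x = p 0 by rewrite /p scale0r addr0.
  rewrite -p1 !pp; apply: ler_wpM2r => //.
  exact: Esq.
split; last by move=> /interior_subset.
move=> B /nbhs_interior; rewrite nbhsE => -[B' [oB' B'z] B'B].
have [e e0 eB] := (open_sqdP B').1 oB' _ B'z.
have [s s0 se] := near e e0.
pose t := Num.max 0 (t0 - s).
have tt0 : t < t0 by rewrite gt_max t0p ltrBlDr ltrDl.
have tge : 0 <= t by rewrite le_max lexx.
exists (p t); split.
  apply: contrapT => Dt; have : T t by [].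
  by move=> /(ge_inf T0.2); rewrite leNgt tt0.
apply: interior_subset; apply: B'B; apply: eB; rewrite /eball /= pp -sqrrN opprB.
apply: (sqm s) => //; first by rewrite subr_ge0 ltW.
by rewrite lerBlDl -lerBlDr le_max lexx orbT.
Qed.

End Delta.

Lemma dotp_mx x y : dotp x y = (x *m y^T) 0 0.
Proof. by rewrite mxE; apply: eq_bigr => i _; rewrite mxE. Qed.

End Geometry.

Lemma firstc_lastc {R : realType} {d : nat} (w : 'rV[R]_d) : (0 < d)%N ->
  dotp w w = enorm' (firstc w) ^+ 2 + lastc w ^+ 2.
Proof.
case: d w => // d w _; rewrite /enorm' sqr_sqrtr; last by apply: sumr_ge0 => *; exact: sqr_ge0.
rewrite /dotp big_ord_recr /= /lastc (big_pred1 ord_max); last by move=> i; rewrite /= -val_eqE.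
rewrite expr2; congr (_ + _).
by apply: eq_bigr => i _; rewrite mxE expr2; congr (w _ _ * w _ _); exact: val_inj.
Qed.

(** Mean value theorem along the ray through [a]: the gradient vanishes at 0 and is Lipschitz, so at
    [c a] it is at most [L0 c |a|]. *)
Lemma graph_bound {R : realType} {d : nat} (phi : 'rV[R]_d.-1 -> R) (L0 : R) : 0 < L0 ->
  phi 0 = 0 -> (forall a, differentiable phi a) -> (forall h, 'd phi 0 h = 0) ->
  (forall a b h, `|'d phi a h - 'd phi b h| <= L0 * enorm' (a - b) * enorm' h) ->
  forall a, `|phi a| <= L0 * enorm' a ^+ 2.
Proof.
move=> L00 p0 dp dp0 lip a.
pose g (t : R) := phi (t *: a).
have dg (t : R) : is_derive t (1 : R) g ('d phi (t *: a) a).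
  have E : (fun h : R => h^-1 *: ((g \o shift t) (h *: 1) - g t)) =
      (fun h : R => h^-1 *: ((phi \o shift (t *: a)) (h *: a) - phi (t *: a))).
    by apply/funext => h; rewrite /g /= -scalerDl; congr (_ *: (phi (_ *: a) - _)); rewrite /GRing.scale /= mulr1.
  have df := dp (t *: a).
  apply: DeriveDef; first by rewrite /derivable E; exact: diff_derivable.
  by rewrite /derive E; exact: (deriveE _ df).
have cg : {within `[0, 1], continuous g}%classic.
  apply: continuous_subspaceT => t; apply: differentiable_continuous.
  exact/derivable1_diffP/ex_derive.
have [c c01 gc] := MVT ltr01 (fun t _ => dg t) cg.
have -> : phi a = g 1 - g 0 by rewrite /g scale1r scale0r p0 subr0.
rewrite gc subr0 mulr1.
have L b : `|'d phi b a| <= L0 * enorm' b * enorm' a.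
  have dist0 (z w B : R) : z = 0 -> `|w - z| <= B -> `|w| <= B by move=> ->; rewrite subr0.
  have h0 := dp0 a; have b0 : b - 0 = b by rewrite subr0.
  by have := lip b 0 a; rewrite b0; apply: dist0.
have H := L (c *: a).
apply: (le_trans H).
move: c01; rewrite in_itv /= => /andP[c0 c1].
have -> : enorm' (c *: a) = c * enorm' a.
  rewrite /enorm' -[X in _ = X * _]ger0_norm ?(ltW c0)// -sqrtr_sqr -sqrtrM ?sqr_ge0//.
  by congr Num.sqrt; rewrite mulr_sumr; apply: eq_bigr => i _; rewrite mxE exprMn.
have e0 : 0 <= enorm' a := sqrtr_ge0 _.
have -> : L0 * (c * enorm' a) * enorm' a = c * (L0 * enorm' a ^+ 2) by ring.
by rewrite ler_piMl ?(ltW c1)// mulr_ge0 ?sqr_ge0// ltW.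
Qed.

(** The inner normal is the last column of the orthogonal matrix. With the quadratic bound on the
    graph, the local chart becomes a separation from the tangent plane, up to [L0] times the squared
    distance. *)
Lemma bdry_normal {R : realType} {d : nat} (D : set 'rV[R]_d) r0 L0 Q : (0 < d)%N ->
  C11_open D r0 L0 -> bdry D Q ->
  exists2 n, dotp n n = 1 & forall y, sqd y Q < r0 ^+ 2 ->
    (L0 * sqd y Q < dotp (y - Q) n -> D y) /\ (dotp (y - Q) n < - (L0 * sqd y Q) -> ~ D y).
Proof.
move=> d0 [oD [r00 [L00 H]]] /H {H} [ O [phi [OO [p0 [dp [dp0 [lip gr]]]]]]].
pose n : 'rV[R]_d := \row_j \sum_(i < d | val i == d.-1) O j i.
have lastE u : lastc (u *m O) = dotp u n.
  rewrite /lastc /dotp; under eq_bigr do rewrite mxE; rewrite exchange_big /=.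
  by apply: eq_bigr => j _; rewrite mxE mulr_sumr.
have normE u : dotp (u *m O) (u *m O) = dotp u u.
  by rewrite !dotp_mx trmx_mul mulmxA -(mulmxA u) OO mulmx1.
have n1 : dotp n n = 1.
  have OT : O^T *m O = 1%:M by rewrite mulmx1C.
  rewrite /n; clear -OT d0; case: d d0 O OT => // d' _ O OT.
  have /matrixP/(_ ord_max ord_max) := OT; rewrite !mxE eqxx mulr1n => <-.
  apply: eq_bigr => j _; rewrite !mxE (big_pred1 ord_max)//.
exists n => // y yQ.
have yr : enorm (y - Q) < r0 by rewrite enorm_lt.
have gb := graph_bound L00 p0 dp dp0 lip (firstc ((y - Q) *m O)).
have := firstc_lastc ((y - Q) *m O) d0; rewrite normE -/(sqd y Q) => sE.
have := gr y; rewrite lastE; move: (phi _) gb => p gb [g1 g2].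
have gb' : `|p| <= L0 * sqd y Q.
  by apply: (le_trans gb); rewrite ler_pM2l// sE lerDl sqr_ge0.
move: gb'; rewrite ler_norml => /andP[pl pu]; split.
  by move=> h; apply: (proj2 (g2 _)); split=> //; exact: le_lt_trans h.
by move=> h Dy; have [_] := g1 (conj yr Dy); lra.
Qed.

(** On [D] the normal component of [y - z] is at least [- q / (4 r)], where [q = sqd y z]: within
    [r0] because [L0 <= 1 / (4 r)], beyond because [r0 >= 4 r] and by Cauchy-Schwarz. The 4, where 2
    would give tangency, leaves the surplus [q / 2] outside. *)
Lemma tangent_balls {R : realType} {d : nat} (D : set 'rV[R]_d) r0 L0 r z : (0 < d)%N ->
  C11_open D r0 L0 -> 0 < r -> 4 * r * L0 <= 1 -> 4 * r <= r0 -> bdry D z ->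
  exists n, [/\ dotp n n = 1, forall y, D y -> r ^+ 2 + sqd y z / 2 <= sqd y (z + (- r) *: n) &
    forall y, sqd y (z + r *: n) < r ^+ 2 -> D y].
Proof.
move=> d0 C11 rp rL rr0 Bz.
have L00 : 0 < L0 by case: C11 => _ [_ []].
have [n n1 H] := bdry_normal d0 C11 Bz; exists n; split=> // y.
  move=> Dy; rewrite sqd_shift// sqrrN; have := fun h => proj2 (H y h).
  have := dotp_cauchy (y - z) n; rewrite n1 mulr1.
  have := sqd_ge0 y z; rewrite -/(sqd y z).
  move: (sqd y z) (dotp (y - z) n) => q p q0 pq h.
  suff : - (q / (4 * r)) <= p.
    by rewrite -mulNr ler_pdivrMr ?mulr_gt0//; lra.
  rewrite leNgt; apply/negP => pl; have [qr|qr] := ltP q (r0 ^+ 2).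
    apply: (h qr) => //; apply: lt_le_trans pl _; rewrite lerN2 ler_pdivlMr ?mulr_gt0//.
    by rewrite mulrAC ler_piMl// mulrC.
  have q16 : (4 * r) ^+ 2 <= q.
    by apply: le_trans qr; apply: lerXn2r; rewrite ?nnegrE ?mulr_ge0 ?(ltW rp)//; lra.
  have : q / (4 * r) < - p by lra.
  rewrite ltr_pdivrMr ?mulr_gt0// => qp.
  have : q ^+ 2 < (- p * (4 * r)) ^+ 2 by rewrite ltr_pXn2r ?nnegrE// (le_trans q0)// ltW.
  rewrite exprMn sqrrN => /lt_le_trans -/(_ _ (ler_pM (sqr_ge0 p) (sqr_ge0 _) pq q16)).
  by rewrite expr2 ltxx.
rewrite sqd_shift//; have := fun h => proj1 (H y h).
have := dotp_cauchy (y - z) n; rewrite n1 mulr1 -/(sqd y z); have := sqd_ge0 y z.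
move: (sqd y z) (dotp (y - z) n) => q p q0 pq h qp.
have qp' : q < 2 * r * p by lra.
have r2 : 0 < 2 * r by lra.
have p0 : 0 < p by have := le_lt_trans q0 qp'; rewrite (pmulr_rgt0 _ r2).
have p2 : p < 2 * r by rewrite -(ltr_pM2r p0) -expr2; exact: le_lt_trans qp'.
apply: h.
  apply: (lt_le_trans qp'); apply: (@le_trans _ _ ((4 * r) ^+ 2)); first nra.
  by apply: lerXn2r; rewrite ?nnegrE ?mulr_ge0 ?(ltW rp)//; lra.
have : L0 * q * (4 * r) <= q by rewrite mulrAC mulrC ler_piMr//; lra.
have : 0 <= L0 * q by rewrite mulr_ge0// ltW.
move: (L0 * q) => a a0 aq; have : a * (4 * r) < 2 * r * p by lra.
by move=> arp; rewrite -(ltr_pM2r rp); nra.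
Qed.

Section C11.
Context {R : realType} {d : nat}.
Variables (D : set 'rV[R]_d) (r0 L0 r : R) (w0 : 'rV[R]_d).
Hypotheses (d0 : (0 < d)%N) (C11 : C11_open D r0 L0) (rp : 0 < r)
  (rL : 4 * r * L0 <= 1) (rr0 : 4 * r <= r0) (w0D : ~ D w0).

Let oD : open D. Proof. by case: C11. Qed.

Lemma near_bdry x : D x -> exists2 z, bdry D z & sqd x z <= (2 * delta D x) ^+ 2.
Proof.
move=> Dx; have dp := delta_gt0 oD w0D Dx.
have [w Dw xw] : exists2 w, ~ D w & enorm (x - w) < 2 * delta D x.
  by apply: (delta_lt w0D); lra.
have [z Bz zw] := exit_point oD Dx Dw; exists z => //; apply: (le_trans zw).
by rewrite sqd_enorm; apply: lerXn2r; rewrite ?nnegrE ?enorm_ge0 ?(ltW xw)// mulr_ge0// ltW.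
Qed.

Lemma exterior_ball K : (forall x, D x -> sqd x w0 <= K) ->
  exists2 R2, 0 < R2 & forall x, D x -> exists c z,
    [/\ forall y, D y -> r ^+ 2 + sqd y z / 2 <= sqd y c /\ sqd y c <= R2,
        sqd z c = r ^+ 2 & sqd x z <= (2 * delta D x) ^+ 2].
Proof.
move=> DK; exists (24 * `|K| + 4 * r ^+ 2 + 1); first by have := sqr_ge0 r; have := normr_ge0 K; lra.
move=> x Dx; have [z Bz xz] := near_bdry Dx.
have [n [n1 ext _]] := tangent_balls d0 C11 rp rL rr0 Bz.
have zc : sqd z (z + (- r) *: n) = r ^+ 2.
  by rewrite sqd_shift// sqdxx subrr /dotp big1 ?sqrrN; [ring|move=> i _; rewrite mxE mul0r].
exists (z + (- r) *: n), z; split=> // y Dy; split; first exact: ext.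
have h1 := sqd_triangle y x (z + (- r) *: n).
have h2 := sqd_triangle x z (z + (- r) *: n).
have h3 := sqd_triangle y w0 x.
have h4 : sqd x z <= 4 * K.
  apply: (le_trans xz); rewrite exprMn.
  have : delta D x ^+ 2 <= sqd x w0.
    rewrite sqd_enorm; apply: lerXn2r; rewrite ?nnegrE ?enorm_ge0 ?(delta_ge0 w0D)//.
    exact: delta_le.
  have := DK x Dx; have -> : (2 : R) ^+ 2 = 4 by ring.
  by lra.
have := DK x Dx; have := DK y Dy; have := ler_norm K.
rewrite (sqd_sym w0 x) zc in h3 h2; lra.
Qed.

(** First, [x] is at distance at least [r + delta D x] from the exterior centre [e]; otherwise a
    point of [D] on the segment to [e], closer than [delta D x] to [x], would enter the exterior
    ball. Expanding the squared distances to the two tangent centres turns this into [r^2 - sqd x c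
    >= 2 r delta + delta^2 - 2 sqd x z]. The boundary point [z] is only within [2 delta], so
    [delta <= r / 8] is used to absorb the last term. *)
Lemma interior_ball x : D x -> delta D x <= r / 8 ->
  exists2 c, eball c (r ^+ 2) `<=` D & r * delta D x <= r ^+ 2 - sqd x c.
Proof.
move=> Dx dr; have dp := delta_gt0 oD w0D Dx.
have [z Bz xz] := near_bdry Dx.
have [n [n1 ext int]] := tangent_balls d0 C11 rp rL rr0 Bz.
exists (z + r *: n); first by move=> y; rewrite /eball /=; exact: int.
pose e := z + (- r) *: n.
have xe : (r + delta D x) ^+ 2 <= sqd x e.
  rewrite leNgt; apply/negP => xe; have rd : 0 < r + delta D x by lra.
  pose t := delta D x / (r + delta D x); pose y := x + t *: (e - x).
  have yx : sqd y x = t ^+ 2 * sqd x e.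
    by rewrite /sqd /y addrAC subrr add0r dotpZ dotpZr -opprB dotpN dotpNr; ring.
  have ye : sqd y e = (1 - t) ^+ 2 * sqd x e.
    rewrite /sqd (_ : y - e = (1 - t) *: (x - e)) ?dotpZ ?dotpZr; first ring.
    by rewrite /y; apply/rowP => i; rewrite !mxE; ring.
  have t1 : 1 - t = r / (r + delta D x).
    by rewrite /t -[1](@divff _ (r + delta D x)) ?gt_eqF// -mulrBl addrK.
  have scale a : 0 < a -> (a / (r + delta D x)) ^+ 2 * sqd x e < a ^+ 2.
    by move=> a0; rewrite expr_div_n mulrAC ltr_pdivrMr ?exprn_gt0// ltr_pM2l ?exprn_gt0.
  have Dy : D y by apply: (delta_ball w0D (x := x)); rewrite yx; exact: scale.
  have := ext y Dy; have := sqd_ge0 y z; have := scale r rp; rewrite -t1 -ye -/e; lra.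
move: xe; rewrite /e !sqd_shift// sqrrN sqrrD.
move: xz; rewrite exprMn; have -> : (2 : R) ^+ 2 = 4 by ring.
rewrite mulr2n.
move: (sqd x z) (dotp _ n) (delta D x) dr dp => q p a ar a0 qa H.
have : 8 * (a * a) <= r * a by rewrite mulrA ler_pM2r//; lra.
have aux (b ra a2 rp' : R) : 0 <= a2 -> q <= 4 * a2 -> b + (ra + ra) + a2 <= q - 2 * - rp' + b ->
    8 * a2 <= ra -> ra <= b - (q - 2 * rp' + b) by move=> *; lra.
move: qa H; rewrite -!(mulrA 2) mulNr (expr2 a); apply: aux; apply: mulr_ge0; exact: ltW.
Qed.

End C11.

Section Bounded.
Context {R : realType} {d : nat}.
Variables (D : set 'rV[R]_d).
Hypothesis bD : bounded_set_e D.

Lemma bounded_sqd w0 : exists K, forall x, D x -> sqd x w0 <= K.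
Proof.
have [M HM] := bD; exists (2 * M ^+ 2 + 2 * dotp w0 w0) => x Dx.
apply: (le_trans (sqd_triangle x 0 w0)); apply: lerD; apply: ler_wpM2l => //.
  rewrite sqd_enorm subr0; apply: lerXn2r; rewrite ?nnegrE ?enorm_ge0 ?HM//.
  exact: le_trans (enorm_ge0 x) (HM _ Dx).
by rewrite sqd_sym /sqd subr0.
Qed.

Lemma bounded_cube : exists2 M, 0 < M & D `<=` cube 0 M.
Proof.
have [K HK] := bounded_sqd 0; exists (`|K| + 1); first by rewrite ltr_wpDl.
move=> x Dx i; rewrite mxE subr0.
have := coord_sqd x 0 i; rewrite mxE subr0 => h.
rewrite -(@ltr_pXn2r _ 2)// ?nnegrE ?addr_ge0// real_normK ?num_real//.
by have := HK x Dx; have := ler_norm K; have := normr_ge0 K; nra.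
Qed.

Lemma bounded_proper : (0 < d)%N -> exists w0, ~ D w0.
Proof.
move=> d0; have [M M0 HM] := bounded_cube; exists (const_mx M) => /HM/(_ (Ordinal d0)).
by rewrite !mxE subr0 gtr0_norm// ltxx.
Qed.

(** A finite partition into cells of small diameter. It replaces compactness where constants
    attached to centres of interior balls must be uniform. *)
Lemma finite_cells (t : R) : 0 < t -> exists N (idx : 'rV[R]_d -> 'I_N),
  forall x y, D x -> D y -> idx x = idx y -> sqd x y < t.
Proof.
move=> t0; have [M M0 HM] := bounded_cube.
pose e : R := Num.min 1 (t / (d%:R + 1)).
have d1 : 0 < d%:R + 1 :> R by rewrite ltr_wpDl.
have e0 : 0 < e by rewrite lt_min ltr01 divr_gt0.
pose fl (x : 'rV[R]_d) i := Num.truncn ((x 0 i + M) / e).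
pose K := (Num.truncn (2 * M / e)).+1.
pose cell (x : 'rV[R]_d) : {ffun 'I_d -> 'I_K} := [ffun i => inord (fl x i)].
exists #|{ffun 'I_d -> 'I_K}|, (fun x => enum_rank (cell x)) => x y Dx Dy /enum_rank_inj/ffunP E.
apply: (@le_lt_trans _ _ (d%:R * e ^+ 2)); last first.
  have e1 : e <= 1 by rewrite ge_min lexx.
  have : e * (d%:R + 1) <= t by rewrite -ler_pdivlMr// ge_min lexx orbT.
  have : e ^+ 2 <= e by rewrite expr2 ler_piMl// ltW.
  have : 0 <= d%:R :> R by [].
  by move: (d%:R : R) => k k0 h1 h2; nra.
apply: sqd_cube; first exact: ltW.
have pos (z : 'rV[R]_d) i : D z -> 0 <= (z 0 i + M) / e /\ (z 0 i + M) / e <= 2 * M / e.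
  move=> /HM/(_ i); rewrite mxE subr0 ltr_norml => /andP[a b].
  by split; [rewrite divr_ge0// ?(ltW e0)//|rewrite ler_pM2r ?invr_gt0//]; lra.
have flK (z : 'rV[R]_d) i : D z -> (fl z i < K)%N.
  by move=> Dz; rewrite ltnS le_truncn//; case: (pos z i Dz).
move=> i; have := E i; rewrite !ffunE => /(congr1 val); rewrite /= !inordK ?flK// => fE.
have [px _] := pos x i Dx; have [py _] := pos y i Dy.
have /andP[x1 x2] := truncn_itv px; have /andP[y1 y2] := truncn_itv py.
rewrite -/(fl x i) -/(fl y i) fE in x1 x2 y1 y2.
move: x1 x2 y1 y2; rewrite -natr1 ler_pdivlMr// ltr_pdivrMr// ler_pdivlMr// ltr_pdivrMr// !mulrDl !mul1r.
move=> *; rewrite ltr_norml; apply/andP; split; lra.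
Qed.

End Bounded.

(** * Bounded random variables, finite conditioning and independence *)

Section Bounded.
Context {dT : measure_display} {T : measurableType dT} {R : realType}.
Variable (P : probability T R).

Lemma bounded_integrable (f : T -> R) C : measurable_fun setT f -> (forall w, `|f w| <= C) ->
  P.-integrable setT (EFin \o f).
Proof.
move=> mf fC; apply: measurable_bounded_integrable => //.
  by apply: (@le_lt_trans _ _ 1%E); [exact: probability_le1|exact: ltry].
by exists C; split; [exact: num_real|move=> x Cx w _; exact: le_trans (fC w) (ltW Cx)].
Qed.

Lemma Rintegral_unit_cst (c : R) : \int[P]_w c = c.
Proof. by rewrite Rintegral_cst// (_ : fine (P setT) = 1) ?mulr1//; rewrite probability_setT. Qed.

Lemma bounded_cvg (f_ : nat -> T -> R) (f : T -> R) C :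
  (forall n, measurable_fun setT (f_ n)) -> (forall n w, `|f_ n w| <= C) ->
  (forall w, f_ ^~ w @ \oo --> f w) ->
  \int[P]_w f_ n w @[n --> \oo] --> \int[P]_w f w.
Proof.
move=> mf fC cf.
have mf' : measurable_fun setT f by apply: measurable_fun_cvg mf _ => w _; exact: cf.
have fC' w : `|f w| <= C.
  have cn : `|f_ n w| @[n --> \oo] --> `|f w| by apply: cvg_norm; exact: cf.
  by rewrite -(cvg_lim _ cn)//; apply: limr_le; [exact: (cvgP _ cn)|exact: nearW].
have : (\int[P]_w (f_ n w)%:E)%E @[n --> \oo] --> (\int[P]_w (f w)%:E)%E.
  apply: (@dominated_cvg _ _ _ P setT measurableT _ _ (cst C%:E)) => //.
  - by move=> n; apply/measurable_EFinP.
  - by move=> w _; apply/cvg_EFin; [exact: nearW|exact: cf].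
  - by apply: (@bounded_integrable (cst C) `|C|).
  - by move=> n w _; rewrite lee_fin.
by rewrite (RintegralE (bounded_integrable mf' fC') erefl) => /fine_cvg.
Qed.

Lemma measurable_cos_comp (f : T -> R) : measurable_fun setT f -> measurable_fun setT (fun w => cos (f w)).
Proof.
by apply: measurableT_comp; apply: continuous_measurable_fun; exact: continuous_cos.
Qed.

Lemma cosB_integrable (f : T -> R) : measurable_fun setT f ->
  P.-integrable setT (EFin \o (fun w => cos (f w))).
Proof. by move=> mf; apply: (@bounded_integrable _ 1); [exact: measurable_cos_comp|move=> w; exact: cos_max]. Qed.

Lemma Rintegral_sum (I : Type) (s : seq I) (G : I -> T -> R) C :
  (forall v, measurable_fun setT (G v)) -> (forall v w, `|G v w| <= C) ->
  \int[P]_w \sum_(v <- s) G v w = \sum_(v <- s) \int[P]_w G v w.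
Proof.
move=> mG GC; elim: s => [|v s IH].
  by rewrite big_nil -[RHS]Rintegral_unit_cst; apply: eq_Rintegral => w _; rewrite big_nil.
rewrite big_cons -IH -RintegralD//; last 2 first.
- exact: bounded_integrable (GC v).
- apply: (@bounded_integrable _ ((size s)%:R * C)); first exact: measurable_sum.
  move=> w; elim: (s) => [|u s' IH']; first by rewrite big_nil normr0 mul0r.
  rewrite big_cons /= -natr1 mulrDl mul1r addrC; apply: (le_trans (ler_normD _ _)).
  by apply: lerD.
by apply: eq_Rintegral => w _; rewrite big_cons.
Qed.

Section FiniteIndex.
Variables (I : finType) (q : T -> I).
Hypothesis mq : forall v, measurable [set w | q w = v].

Let ind (v : I) (w : T) : R := \1_[set w | q w = v] w.

Lemma finite_indexE (G : I -> R) w : G (q w) = \sum_v ind v w * G v.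
Proof.
rewrite (bigD1 (q w))//= /ind indicE mem_set// mul1r big1 ?addr0// => v vq.
by rewrite indicE memNset ?mul0r//= => E; rewrite E eqxx in vq.
Qed.

Let mind v : measurable_fun setT (ind v). Proof. exact: measurable_indic. Qed.

Lemma measurable_finite_index (G : I -> T -> R) : (forall v, measurable_fun setT (G v)) ->
  measurable_fun setT (fun w => G (q w) w).
Proof.
move=> mG; rewrite (_ : (fun w => _) = fun w => \sum_v ind v w * G v w).
  by apply: measurable_sum => v; apply: measurable_funM.
by apply/funext => w; rewrite (finite_indexE (G ^~ w)).
Qed.

Lemma Rintegral_finite_index (G : I -> T -> R) C :
  (forall v, measurable_fun setT (G v)) -> (forall v w, `|G v w| <= C) ->
  \int[P]_w G (q w) w = \sum_v \int[P]_w (\1_[set w | q w = v] w * G v w).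
Proof.
move=> mG GC; rewrite -(@Rintegral_sum _ _ _ C).
- by apply: eq_Rintegral => w _; rewrite (finite_indexE (G ^~ w)).
- by move=> v; apply: measurable_funM => //; exact: mind.
- move=> v w; rewrite normrM; apply: le_trans (GC v w); rewrite ler_piMl//.
  by rewrite indicE; case: (_ \in _); rewrite ?normr1 ?normr0.
Qed.

End FiniteIndex.

(** The cosine is shifted to the nonnegative [1 + cos]. Independence says that the law of [Z] on [E]
    is [P E] times the law of [Z], so both measures integrate the shifted function equally. *)
Lemma indep_cos (E : set T) (Z : T -> R) b : measurable E -> measurable_fun setT Z ->
  (forall B, measurable B -> P (Z @^-1` B `&` E) = (P (Z @^-1` B) * P E)%E) ->
  \int[P]_w (\1_E w * cos (Z w + b)) = \int[P]_w \1_E w * \int[P]_w cos (Z w + b).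
Proof.
move=> mE mZ indep.
have E0 w : 0 <= \1_E w :> R by [].
have m1 : measurable_fun setT (\1_E : T -> R) by exact: measurable_indic.
have mc : measurable_fun setT (fun w => cos (Z w + b)).
  by apply: measurable_cos_comp; exact: measurable_funD.
have pE : P E = (\int[P]_w \1_E w)%:E.
  rewrite -(RintegralE (c := \int[P]_w \1_E w) _ erefl) ?integral_indic ?setIT//.
  by apply: (@bounded_integrable _ 1) => // w; rewrite indicE; case: (_ \in _); rewrite ?normr1 ?normr0.
set p := \int[P]_w \1_E w in pE *.
have p0 : 0 <= p by apply: Rintegral_ge0 => w _.
pose g (z : R) : \bar R := (1 + cos (z + b))%:E.
have g0 z : (0 <= g z)%E by rewrite lee_fin; have := cos_geN1 (z + b); lra.
have mg : measurable_fun setT g.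
  apply/measurable_EFinP; apply: measurable_funD => //.
  apply: (measurableT_comp (f := @cos R)); last exact: measurable_funD.
  by apply: continuous_measurable_fun; exact: continuous_cos.
have L : (\int[image_measure (density_measure P m1 E0) mZ]_z g z = \int[P]_w ((\1_E w)%:E * g (Z w)))%E.
  rewrite ge0_integral_pushforward// preimage_setT integral_density//.
    by exact: (measurableT_comp mg mZ).
  by move=> w; exact: g0.
have Rr : (\int[mscale (NngNum p0) (image_measure P mZ)]_z g z = p%:E * \int[P]_w g (Z w))%E.
  by rewrite ge0_integral_mscale// ge0_integral_pushforward.
have : (\int[P]_w ((\1_E w)%:E * g (Z w)) = p%:E * \int[P]_w g (Z w))%E.
  rewrite -L -Rr; apply: eq_measure_integral => B mB _.
  rewrite /mscale /image_measure /= /pushforward /= /density.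
  have mZB : measurable (Z @^-1` B) by rewrite -[_ @^-1` _]setTI; apply: (mZ _ B mB).
  transitivity (P (Z @^-1` B `&` E)); first by rewrite integral_indic// setIC.
  by rewrite indep// pE muleC.
have i1 := @bounded_integrable _ 1 m1.
have {}i1 : P.-integrable setT (EFin \o (\1_E : T -> R)).
  by apply: i1 => w; rewrite indicE; case: (_ \in _); rewrite ?normr1 ?normr0.
have ic : P.-integrable setT (EFin \o (fun w => cos (Z w + b))).
  by apply: cosB_integrable; exact: measurable_funD.
have i1c := integrableMb i1 mc (fun w => cos_max _).
have j1 : P.-integrable setT (EFin \o (fun=> 1)) by apply: (@bounded_integrable (cst 1) 1) => // w; rewrite normr1.
have -> : (\int[P]_w ((\1_E w)%:E * g (Z w)) = (p + \int[P]_w (\1_E w * cos (Z w + b)))%:E)%E.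
  rewrite -[p]mul1r -[\int[P]_w (_ * _)]mul1r -Rintegral_lin//.
  rewrite -(RintegralE (integrable_lin 1 1 i1 i1c) erefl); apply: eq_integral => w _.
  by rewrite -EFinM; congr EFin; ring.
have -> : (\int[P]_w g (Z w) = (1 + \int[P]_w (cos (Z w + b)))%:E)%E.
  rewrite -[X in (X + _)%:E](Rintegral_unit_cst 1) -[\int[P]_w 1]mul1r -[\int[P]_w (cos _)]mul1r -Rintegral_lin//.
  rewrite -(RintegralE (integrable_lin 1 1 j1 ic) erefl); apply: eq_integral => w _.
  by congr EFin; ring.
by rewrite -EFinM => -[]; rewrite mulrDr mulr1 => /addrI.
Qed.

End Bounded.

(** Truncation at [4^N] leaves finitely many values. The extra [k / 2^N] makes the approximate times
    strictly increasing in [k], as the increments in [brownian] require even where the subordinator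
    stands still. Both effects vanish in the limit. *)
Lemma dyadic_approx {R : realType} (s : R) k : 0 <= s ->
  (fun N => (minn (Num.truncn (2 ^+ N * s)) (4 ^ N) + k)%N%:R / 2 ^+ N : R) @ \oo --> s.
Proof.
move=> s0.
have c0 : (fun N => (k.+1)%:R * (2^-1 : R) ^+ N) @ \oo --> (0 : R).
  by apply: cvg_geometric; rewrite gtr0_norm ?invr_gt0// invf_lt1//; lra.
have cl : (fun N => s - (k.+1)%:R * (2^-1 : R) ^+ N) @ \oo --> s.
  by rewrite -[X in _ --> X]subr0; apply: cvgB => //; exact: cvg_cst.
have cu : (fun N => s + (k.+1)%:R * (2^-1 : R) ^+ N) @ \oo --> s.
  by rewrite -[X in _ --> X]addr0; apply: cvgD => //; exact: cvg_cst.
apply: squeeze_cvgr cl cu; exists (Num.truncn s).+1 => // N /= sN.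
have p0 : 0 < (2 : R) ^+ N by rewrite exprn_gt0.
have sp : s < 2 ^+ N.
  apply: (lt_le_trans (truncnS_gt s)); rewrite -natrX ler_nat.
  by apply: (leq_trans sN); exact: ltnW (ltn_expl _ _).
have ps0 : 0 <= 2 ^+ N * s by rewrite mulr_ge0// ltW.
have /andP[t1 t2] := truncn_itv ps0.
have -> : minn (Num.truncn (2 ^+ N * s)) (4 ^ N) = Num.truncn (2 ^+ N * s).
  apply/minn_idPl; rewrite -(ler_nat R); apply: (le_trans t1).
  rewrite natrX (_ : 4%:R = 2 * 2 :> R) ?exprMn; last by rewrite -natrM.
  by rewrite ler_pM2l// ltW.
rewrite natrD exprVn; move: t1 t2; rewrite -!(natr1 (Num.truncn _)) -(natr1 k).
move: (Num.truncn (2 ^+ N * s)) => a; move: ((2 : R) ^+ N) p0 => p p0 t1 t2; rewrite !mulrDl.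
have k0 : 0 <= k%:R / p by rewrite divr_ge0// ltW.
have i0 : 0 <= 1 / p by rewrite divr_ge0// ltW.
have a1 : a%:R / p <= s by rewrite ler_pdivrMr// mulrC.
have a2 : s <= a%:R / p + 1 / p by rewrite -mulrDl ler_pdivlMr// mulrC ltW.
by apply/andP; split; lra.
Qed.

(** * Subordinate Brownian motion sampled at equidistant times *)

Section Process.
Context {R : realType} {d : nat} {dO : measure_display} {Omega : measurableType dO}.
Variables (P : probability Omega R) (W : R -> Omega -> 'rV[R]_d) (S : R -> Omega -> R) (mu0 : R -> R).
Hypotheses (bW : brownian P W) (sS : subordinator P S mu0) (indWS : independent_WS P W S).

Notation phi := (laplace_exponent mu0).
Notation gW := (g_sigma_algebraType (gen_W W)).
Notation gS := (g_sigma_algebraType (gen_S S)).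

Let mW t i : measurable_fun setT (fun w => W t w 0 i). Proof. exact: bW.1. Qed.

Let mgW t i : measurable_fun (setT : set gW) (fun w => W t w 0 i).
Proof. by move=> _ B mB; rewrite setTI; apply: sub_sigma_algebra; exists t, i, B. Qed.

Let mS t : measurable_fun setT (S t). Proof. exact: sS.1. Qed.

Let mgS t : measurable_fun (setT : set gS) (S t).
Proof. by move=> _ B mB; rewrite setTI; apply: sub_sigma_algebra; exists t, B. Qed.

Lemma S_mono w s t : 0 <= s -> s <= t -> S s w <= S t w.
Proof. by case: sS => _ [_ [H _]]; exact: H. Qed.

Lemma S_ge0 w t : 0 <= t -> 0 <= S t w.
Proof. by move=> t0; have := S_mono w (lexx 0) t0; case: sS => _ [-> _]. Qed.

Definition incr (n : nat) (xi : nat -> 'rV[R]_d) (t : nat -> R) w : R :=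
  \sum_(k < n) dotp (xi k) (W (t k.+1) w - W (t k) w).

Let measurable_incr_gen dT (T : measurableType dT) (V : R -> T -> 'rV[R]_d) n (xi : nat -> 'rV[R]_d) (t : nat -> R) :
  (forall t i, measurable_fun setT (fun w => V t w 0 i)) ->
  measurable_fun setT (fun w => \sum_(k < n) dotp (xi k) (V (t k.+1) w - V (t k) w)).
Proof.
move=> mV; apply: measurable_sum => k; apply: measurable_dotp => i.
rewrite (_ : (fun w => _) = fun w => V (t k.+1) w 0 i - V (t k) w 0 i); first exact: measurable_funB.
by apply/funext => w; rewrite !mxE.
Qed.

Lemma brownian_cos n (t : nat -> R) xi b : t 0%N = 0 -> (forall k, (k < n)%N -> t k < t k.+1) ->
  \int[P]_w cos (incr n xi t w + b) =
  \prod_(k < n) expR (- ((t k.+1 - t k) * dotp (xi k) (xi k))) * cos b.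
Proof.
move=> t0 tm; have [/(congr1 fine) c /(congr1 fine) s] := bW.2.2.2 n t xi t0 tm.
have mi : measurable_fun setT (incr n xi t) := measurable_incr_gen n xi t mW.
have ic := cosB_integrable P mi.
have is_ : P.-integrable setT (EFin \o (fun w => sin (incr n xi t w))).
  apply: (@bounded_integrable _ _ _ _ _ 1); last by move=> w; exact: sin_max.
  apply: (measurableT_comp (f := @sin R)) => //.
  by apply: continuous_measurable_fun; exact: continuous_sin.
transitivity (cos b * \int[P]_w cos (incr n xi t w) + (- sin b) * \int[P]_w sin (incr n xi t w)).
  rewrite -Rintegral_lin//; apply: eq_Rintegral => w _; rewrite cosD; ring.
by rewrite /Rintegral /incr c s /= mulr0 addr0 mulrC.
Qed.

Lemma indep_WS_cos (E : set Omega) n t xi b : <<s gen_S S >> E -> measurable E ->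
  \int[P]_w (\1_E w * cos (incr n xi t w + b)) = \int[P]_w \1_E w * \int[P]_w cos (incr n xi t w + b).
Proof.
move=> gE mE; apply: indep_cos => //; first exact: (measurable_incr_gen n xi t mW).
move=> B mB; apply: indWS => //.
have : measurable_fun (setT : set gW) (incr n xi t) := @measurable_incr_gen _ gW W n xi t mgW.
by move=> /(_ measurableT B mB); rewrite setTI.
Qed.

Section Grid.
Variables (h : R) (n N : nat).
Hypothesis h0 : 0 < h.

Let I := {ffun 'I_n.+1 -> 'I_(4 ^ N).+1}.

Let g (r : R) : nat := minn (Num.truncn (2 ^+ N * r)) (4 ^ N).

Let gE w (k : 'I_n.+1) : (g (S (k%:R * h) w) < (4 ^ N).+1)%N.
Proof. by rewrite ltnS geq_minr. Qed.

Definition grid w : I := [ffun k => Ordinal (gE w k)].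

Definition gtime (v : I) (k : nat) : R := (v (inord k) + k)%N%:R / 2 ^+ N.

Let mg : measurable_fun setT (fun r : R => (g r)%:R : R).
Proof.
apply: nondecreasing_measurable => // r s rs; rewrite ler_nat /g leq_min geq_minr andbT.
by apply: (leq_trans (geq_minl _ _)); apply: le_truncn; rewrite ler_wpM2l// exprn_ge0.
Qed.

Let grid_level dT (T : measurableType dT) (V : R -> T -> R) (v : I) : (forall t, measurable_fun setT (V t)) ->
  measurable [set w | forall k : 'I_n.+1, g (V (k%:R * h) w) = v k].
Proof.
move=> mV; rewrite (_ : [set _ | _] = \bigcap_(k in [set: 'I_n.+1]) [set w | g (V (k%:R * h) w) = v k]); last first.
  by apply/seteqP; split=> [w H k _|w H k]; [exact: H|exact: H].
apply: fin_bigcap_measurable => // k _.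
have := measurableT_comp (f := fun r : R => (g r)%:R : R) mg (mV (k%:R * h)).
move=> /(_ measurableT [set (v k)%:R] (measurable_set1 _)); rewrite setTI.
congr (measurable _); apply/seteqP; split=> w /=; first by move/eqP; rewrite eqr_nat => /eqP.
by move=> ->.
Qed.

Let grid_eq v : [set w | grid w = v] = [set w | forall k : 'I_n.+1, g (S (k%:R * h) w) = v k].
Proof.
apply/seteqP; split=> w /= H; first by move=> k; rewrite -H ffunE.
by apply/ffunP => k; rewrite ffunE; apply: val_inj; rewrite /= H.
Qed.

Lemma measurable_grid v : measurable [set w | grid w = v].
Proof. by rewrite grid_eq; exact: grid_level. Qed.

Lemma gen_grid v : <<s gen_S S >> [set w | grid w = v].
Proof. by rewrite grid_eq; exact: (@grid_level _ gS). Qed.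

Lemma gtimeE w k : (k <= n)%N -> gtime (grid w) k = (minn (Num.truncn (2 ^+ N * S (k%:R * h) w)) (4 ^ N) + k)%N%:R / 2 ^+ N.
Proof. by move=> kn; rewrite /gtime ffunE /= inordK. Qed.

Lemma gtime0 w : gtime (grid w) 0 = 0.
Proof.
rewrite gtimeE// mul0r; case: sS => _ [-> _].
by rewrite mulr0 truncn0 min0n mul0r.
Qed.

Lemma gtime_lt w k : (k < n)%N -> gtime (grid w) k < gtime (grid w) k.+1.
Proof.
move=> kn; rewrite !gtimeE//; last exact: ltnW.
rewrite ltr_pM2r ?invr_gt0 ?exprn_gt0// ltr_nat addnS ltnS leq_add2r.
rewrite -(ler_nat R); apply: (_ : {homo (fun r : R => (g r)%:R : R) : r s / r <= s}).
  move=> r s rs; rewrite ler_nat /g leq_min geq_minr andbT.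
  by apply: (leq_trans (geq_minl _ _)); apply: le_truncn; rewrite ler_wpM2l// exprn_ge0.
by apply: S_mono; rewrite ?mulr_ge0 ?(ltW h0)// ler_pM2r// ler_nat.
Qed.

(** Conditioning on the finitely many values of the grid: on each event, known to [S] alone, the
    Brownian times are deterministic, so independence and the Gaussian characteristic function
    apply. *)
Lemma grid_cos xi b :
  \int[P]_w cos (incr n xi (gtime (grid w)) w + b) =
  cos b * \int[P]_w \prod_(k < n)
    expR (- ((gtime (grid w) k.+1 - gtime (grid w) k) * dotp (xi k) (xi k))).
Proof.
(* Unattained values [v] may give times that are not increasing; they carry no mass and get weight
   0. *)
pose c (v : I) : R := if pselect (exists w, grid w = v) then
  \prod_(k < n) expR (- ((gtime v k.+1 - gtime v k) * dotp (xi k) (xi k))) else 0.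
have cE w : c (grid w) = \prod_(k < n)
    expR (- ((gtime (grid w) k.+1 - gtime (grid w) k) * dotp (xi k) (xi k))).
  by rewrite /c; case: pselect => // -[]; exists w.
have c0 v : 0 <= c v <= 1.
  rewrite /c; case: pselect => [e|_] /=; last by rewrite lexx ler01.
  case: e => w <-.
  rewrite prodr_ge0/=; last by move=> k _; exact: expR_ge0.
  apply: prodr_ile1 => k _; rewrite expR_ge0 /= expR_le1 oppr_le0 mulr_ge0//.
    by rewrite subr_ge0 ltW// gtime_lt.
  by apply: sumr_ge0 => i _; rewrite -expr2 sqr_ge0.
have mi v : measurable_fun setT (fun w => cos (incr n xi (gtime v) w + b)).
  by apply: measurable_cos_comp; apply: measurable_funD => //; exact: (measurable_incr_gen n xi (gtime v) mW).
have iI v : P.-integrable setT (EFin \o (\1_[set w | grid w = v] : Omega -> R)).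
  apply: (@bounded_integrable _ _ _ _ _ 1); first by apply: measurable_indic; exact: measurable_grid.
  by move=> w; rewrite indicE; case: (_ \in _); rewrite ?normr1 ?normr0.
have iC : P.-integrable setT (EFin \o (fun w => c (grid w))).
  apply: (@bounded_integrable _ _ _ _ _ 1).
    by apply: (measurable_finite_index measurable_grid (G := fun v _ => c v)) => v.
  by move=> w; case/andP: (c0 (grid w)) => h1 h2; rewrite ger0_norm.
transitivity (\int[P]_w (cos b * c (grid w))); last first.
  by rewrite RintegralZl//; congr (_ * _); apply: eq_Rintegral => w _; rewrite cE.
rewrite (Rintegral_finite_index P measurable_grid (G := fun v w => cos (incr n xi (gtime v) w + b)) (C := 1))//; last first.
  by move=> v w; exact: cos_max.
rewrite (Rintegral_finite_index P measurable_grid (G := fun v _ => cos b * c v) (C := 1)) => [||v w]//; last first.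
  rewrite normrM mulr_ile1//; first exact: cos_max.
  by case/andP: (c0 v) => h1 h2; rewrite ger0_norm.
apply: eq_bigr => v _; rewrite (indep_WS_cos _ _ _ _ (gen_grid v) (measurable_grid v)).
under [RHS]eq_Rintegral do rewrite mulrC.
rewrite RintegralZl// [RHS]mulrC; have [[w wv]|nv] := pselect (exists w, grid w = v).
  congr (_ * _); rewrite -wv cE mulrC; apply: brownian_cos; first exact: gtime0.
  exact: gtime_lt.
rewrite (_ : \int[P]_w \1_[set w | grid w = v] w = 0) ?mul0r//.
rewrite -[RHS](Rintegral_unit_cst P 0); apply: eq_Rintegral => w _.
by rewrite indicE memNset//= => E; apply: nv; exists w.
Qed.

End Grid.

Lemma measurable_grid_fun h n N (G : {ffun 'I_n.+1 -> 'I_(4 ^ N).+1} -> Omega -> R) :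
  (forall v, measurable_fun setT (G v)) -> measurable_fun setT (fun w => G (grid h n N w) w).
Proof. by move=> mG; exact: (@measurable_finite_index _ _ R _ _ (@measurable_grid h n N) G mG). Qed.

Lemma path_cvg w (u : nat -> R) (s : R) i : (forall n, 0 <= u n) -> 0 <= s -> u @ \oo --> s ->
  W (u n) w 0 i @[n --> \oo] --> W s w 0 i.
Proof.
move=> u0 s0 us; have := (subspace_continuousP _ _).1 (bW.2.2.1 w) s.
rewrite /= in_itv /= s0 => /(_ isT) H.
have c : W (u n) w @[n --> \oo] --> W s w.
  apply: cvg_trans H; move=> A; rewrite !nbhs_simpl /= => WA.
  have : \forall n \near \oo, [set x | `[0, +oo[%classic x -> A (W x w)] (u n) by exact: us WA.
  by apply: filterS => n; apply; rewrite /= in_itv /= u0.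
apply: (@continuous_cvg _ _ _ _ _ _ (fun M : 'rV[R]_d => M 0 i)) => //.
exact: coord_continuous.
Qed.

Section Skeleton.
Variable h : R.
Hypothesis h0 : 0 < h.

Definition skel (k : nat) (w : Omega) : 'rV[R]_d := W (S (k%:R * h) w) w.

Let kh0 (k : nat) : 0 <= k%:R * h. Proof. by rewrite mulr_ge0// ltW. Qed.

Lemma grid_cvg n k w : (k <= n)%N -> (fun N => gtime (grid h n N w) k) @ \oo --> S (k%:R * h) w.
Proof.
move=> kn; rewrite (_ : (fun N => _) = fun N =>
    (minn (Num.truncn (2 ^+ N * S (k%:R * h) w)) (4 ^ N) + k)%N%:R / 2 ^+ N).
  by apply: dyadic_approx; exact: S_ge0.
by apply/funext => N; exact: gtimeE.
Qed.

Let gtime_ge0 n N (v : {ffun 'I_n.+1 -> 'I_(4 ^ N).+1}) k : 0 <= gtime v k.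
Proof. by rewrite divr_ge0// exprn_ge0. Qed.

Let skel_cvg n k w i : (k <= n)%N ->
  (fun N => W (gtime (grid h n N w) k) w 0 i) @ \oo --> skel k w 0 i.
Proof.
move=> kn; apply: (@path_cvg w _ _ i (fun N => gtime_ge0 _ k)); first exact: S_ge0.
exact: grid_cvg.
Qed.

Lemma measurable_skel k i : measurable_fun setT (fun w => skel k w 0 i).
Proof.
apply: (@measurable_fun_cvg _ _ _ setT (fun N w => W (gtime (grid h k N w) k) w 0 i)).
  move=> N; have H := @measurable_grid_fun h k N (fun v w => W (gtime v k) w 0 i).
  by apply: H => v; exact: mW.
by move=> w _; exact: skel_cvg.
Qed.

Lemma skel0 w : skel 0 w = 0.
Proof. by rewrite /skel mul0r; case: sS => _ [-> _]; exact: bW.2.1. Qed.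

(** Limit of [grid_cos] as the grid is refined: continuity of Brownian paths on one side and
    dominated convergence on both, after which the joint Laplace transform of the increments of [S]
    gives the product. *)
Lemma skel_cos n (xi : nat -> 'rV[R]_d) b :
  \int[P]_w cos (\sum_(k < n) dotp (xi k) (skel k.+1 w - skel k w) + b) =
  \prod_(k < n) expR (- (h * phi (dotp (xi k) (xi k)))) * cos b.
Proof.
have dist k : k.+1%:R * h - k%:R * h = h by rewrite -mulrBl -natrB// subSnn mul1r.
have xx k : 0 <= dotp (xi k) (xi k) by apply: sumr_ge0 => i _; rewrite -expr2 sqr_ge0.
have L : \int[P]_w cos (incr n xi (gtime (grid h n N w)) w + b) @[N --> \oo] -->
    \int[P]_w cos (\sum_(k < n) dotp (xi k) (skel k.+1 w - skel k w) + b).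
  apply: (@bounded_cvg _ _ _ _ _ _ 1).
  - move=> N; have H := @measurable_grid_fun h n N (fun v w => cos (incr n xi (gtime v) w + b)).
    apply: H => v.
    by apply: measurable_cos_comp; apply: measurable_funD => //; exact: (measurable_incr_gen n xi (gtime v) mW).
  - by move=> N w; exact: cos_max.
  - move=> w; apply: (@continuous_cvg _ _ _ _ _ _ (@cos R)); first exact: continuous_cos.
    apply: cvgD; last exact: cvg_cst.
    apply: cvg_big => [|k _]; first exact: add_continuous.
    apply: cvg_big => [|i _]; first exact: add_continuous.
    apply: cvgM; first exact: cvg_cst.
    rewrite !mxE; under eq_cvg do rewrite !mxE.
    by apply: cvgB; apply: skel_cvg; [exact: ltn_ord|exact: ltnW (ltn_ord _)].
have Rr : cos b * \int[P]_w \prod_(k < n)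
      expR (- ((gtime (grid h n N w) k.+1 - gtime (grid h n N w) k) * dotp (xi k) (xi k))) @[N --> \oo] -->
    cos b * \int[P]_w expR (- \sum_(k < n) dotp (xi k) (xi k) * (S (k.+1%:R * h) w - S (k%:R * h) w)).
  apply: cvgM; first exact: cvg_cst.
  apply: (@bounded_cvg _ _ _ _ _ _ 1).
  - move=> N; have H := @measurable_grid_fun h n N (fun v _ => \prod_(k < n) expR (- ((gtime v k.+1 - gtime v k) * dotp (xi k) (xi k)))).
    apply: H => v.
    exact: measurable_cst.
  - move=> N w; rewrite ger0_norm; last by apply: prodr_ge0 => k _; exact: expR_ge0.
    have : 0 <= \prod_(k < n) expR (- ((gtime (grid h n N w) k.+1 - gtime (grid h n N w) k) * dotp (xi k) (xi k))) <= 1.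
      rewrite prodr_ge0/=; last by move=> k _; exact: expR_ge0.
      apply: prodr_ile1 => k _; rewrite expR_ge0 /= expR_le1 oppr_le0 mulr_ge0//.
      by rewrite subr_ge0 ltW// gtime_lt.
    by case/andP.
  - move=> w; rewrite -sumrN; under eq_cvg do rewrite -expR_sum.
    apply: (@continuous_cvg _ _ _ _ _ _ (@expR R)); first exact: continuous_expR.
    apply: cvg_big => [|k _]; first exact: add_continuous.
    apply: cvgN; rewrite mulrC; apply: cvgM; last exact: cvg_cst.
    by apply: cvgB; apply: grid_cvg; [exact: ltn_ord|exact: ltnW (ltn_ord _)].
have E : (fun N => \int[P]_w cos (incr n xi (gtime (grid h n N w)) w + b)) =
    (fun N => cos b * \int[P]_w \prod_(k < n)
      expR (- ((gtime (grid h n N w) k.+1 - gtime (grid h n N w) k) * dotp (xi k) (xi k)))).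
  by apply/funext => N; exact: grid_cos.
rewrite E in L; have -> := @cvg_unique _ (@Rhausdorff R) _ _ _ _ L Rr.
rewrite mulrC; congr (_ * _).
case: sS => _ [_ [_ [_ H]]].
have tm (k : nat) : (k < n)%N -> k%:R * h < k.+1%:R * h by rewrite ltr_pM2r// ltr_nat.
have := H n (fun k => k%:R * h) (fun k => dotp (xi k) (xi k)) (mul0r h) tm xx.
move=> /(congr1 fine) /= E2; rewrite /Rintegral E2.
by apply: eq_bigr => k _; rewrite dist.
Qed.

End Skeleton.

End Process.

Section Skeleton.
Context {R : realType} {d : nat} {dO : measure_display} {Omega : measurableType dO}.
Variables (P : probability Omega R) (W : R -> Omega -> 'rV[R]_d) (S : R -> Omega -> R) (mu0 : R -> R).
Hypotheses (lv : levy_density mu0) (bW : brownian P W) (sS : subordinator P S mu0)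
  (indWS : independent_WS P W S).

Notation phi := (laplace_exponent mu0).

Lemma laplace_exponent_ge (lam : R) : 0 <= lam -> lam <= phi lam.
Proof.
move=> l0; rewrite lerDl; apply: fine_ge0; apply: integral_ge0 => t /= t0.
rewrite lee_fin mulr_ge0//; last exact: lv.1.
by rewrite subr_ge0 expR_le1 oppr_le0 mulr_ge0// ltW.
Qed.

Lemma subordinator_laplace (h lam : R) : 0 < h -> 0 <= lam ->
  (\int[P]_w (expR (- (lam * S h w)))%:E = (expR (- (h * phi lam)))%:E)%E.
Proof.
move=> h0 l0; case: sS => _ [S0 [_ [_ H]]].
have := H 1%N (fun k => k%:R * h) (fun=> lam) (mul0r h).
rewrite big_ord1 !mul1r !mul0r subr0 => <- //; last first.
  by move=> [|//] _; rewrite mul0r mul1r.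
by apply: eq_integral => w _; rewrite big_ord1 mul1r mul0r S0 subr0.
Qed.

(* The unit drift of the Laplace exponent makes [S h >= h] almost surely. *)
Lemma subordinator_drift (h : R) : 0 < h -> {ae P, forall w, h <= S h w}.
Proof.
move=> h0; pose A (k : nat) := [set w | S h w < h - k.+1%:R^-1].
have mS := sS.1 h.
have mA k : measurable (A k).
  rewrite (_ : A k = S h @^-1` `]-oo, (h - k.+1%:R^-1)[); last by apply/seteqP; split=> w; rewrite /A /= in_itv.
  by rewrite -[X in measurable X]setTI; apply: mS.
have PA k : P (A k) = 0%E.
  have pf : (P (A k) \is a fin_num)%E.
    by rewrite ge0_fin_numE//; apply: le_lt_trans (probability_le1 P (mA k)) _; rewrite ltry.
  have key (lam : R) : 0 <= lam -> fine (P (A k)) <= expR (- (lam / k.+1%:R)).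
    move=> l0; rewrite -lee_fin fineK//.
    have mE : measurable_fun setT (fun w => (expR (- (lam * S h w)))%:E).
      apply/measurable_EFinP; apply: (measurableT_comp (f := @expR R)) => //.
      by apply: measurableT_comp => //; apply: measurable_funM.
    have : ((expR (lam / k.+1%:R))%:E * P (A k) <= (expR (lam * h))%:E * \int[P]_w (expR (- (lam * S h w)))%:E)%E.
      have m1 : measurable_fun setT (fun w => (\1_(A k) w : R)%:E).
        by apply/measurable_EFinP; exact: measurable_indic.
      have Z (c : R) (g : Omega -> \bar R) : measurable_fun setT g -> (forall w, 0 <= g w)%E -> 0 <= c ->
          (c%:E * \int[P]_w g w = \int[P]_w (c%:E * g w))%E by move=> *; rewrite ge0_integralZl.
      rewrite -(setIT (A k)) -integral_indic// Z ?expR_ge0// Z ?expR_ge0//.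
      apply: ge0_le_integral => //.
      - exact: emeasurable_funM.
      - exact: emeasurable_funM.
      move=> w _; rewrite -!EFinM lee_fin -expRD indicE.
      have [/set_mem /= wA|_] := boolP (w \in A k); last by rewrite mulr0 expR_ge0.
      rewrite mulr1 ler_expR -mulrBr; apply: ler_wpM2l => //.
      by move: wA; rewrite /A /=; move: (k.+1%:R^-1) => a; lra.
    rewrite subordinator_laplace// -EFinM -expRD => H.
    have {}H : ((expR (lam / k.+1%:R))%:E * P (A k) <= 1)%E.
      apply: (le_trans H); rewrite lee_fin expR_le1.
      by have := laplace_exponent_ge l0; move: (phi lam) => p lp; nra.
    move: H; rewrite -(fineK pf) -EFinM !lee_fin => H.
    by rewrite expRN -[leRHS]mul1r ler_pdivlMr ?expR_gt0// mulrC.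
  rewrite -(fineK pf); congr EFin; apply/eqP; rewrite eq_le fine_ge0// andbT.
  apply/ler_addgt0Pr => e e0; rewrite add0r.
  have k0 : 0 < k.+1%:R :> R by [].
  apply: (le_trans (key (k.+1%:R * e^-1) _)); first by rewrite mulr_ge0// invr_ge0 ltW.
  rewrite mulrAC mulfV ?gt_eqF// mul1r expRN -[leRHS]invrK lef_pV2 ?posrE ?expR_gt0 ?invr_gt0//.
  by have := expR_ge1Dx e^-1; lra.
apply: (@negligibleS _ _ _ P (\bigcup_k A k)); last first.
  apply: negligible_bigcup => k; exists (A k); split; [exact: mA|exact: PA|by []].
move=> w /= /negP; rewrite -ltNge => wh.
exists (Num.truncn (h - S h w)^-1) => //; rewrite /A /=.
have d0 : 0 < h - S h w by rewrite subr_gt0.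
have := truncnS_gt (h - S h w)^-1; move: (Num.truncn _) => k kk.
have : k.+1%:R^-1 < h - S h w by rewrite -[ltRHS]invrK ltf_pV2 ?posrE ?invr_gt0.
by move: (k.+1%:R^-1) => a; lra.
Qed.

(* Almost surely [S h] itself; the maximum makes the lower bound hold everywhere. *)
Definition tchange (h : R) (w : Omega) : R := Num.max h (S h w).

Lemma tchange_laplace (h lam : R) : 0 < h -> 0 <= lam ->
  \int[P]_w expR (- (lam * tchange h w)) = expR (- (h * phi lam)).
Proof.
move=> h0 l0; rewrite /Rintegral.
transitivity (fine (\int[P]_w (expR (- (lam * S h w)))%:E)); last by rewrite subordinator_laplace.
congr fine.
have mS : measurable_fun setT (S h) := sS.1 h.
have mE (f : Omega -> R) : measurable_fun setT f -> measurable_fun setT (fun w => (expR (- (lam * f w)))%:E).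
  move=> mf; apply/measurable_EFinP; apply: (measurableT_comp (f := @expR R)) => //.
  by apply: measurableT_comp => //; apply: measurable_funM.
apply: ae_eq_integral => //; first by apply: mE; exact: measurable_maxr.
  exact: mE.
by apply: filterS (subordinator_drift h0) => w hw _; rewrite /tchange (max_idPr hw).
Qed.

Lemma tchange_ge (h : R) w : h <= tchange h w.
Proof. by rewrite le_max lexx. Qed.

Definition process_timechange : timechange R :=
  @TimeChange R dO Omega P tchange phi
    (fun h => measurable_maxr (measurable_cst h) (sS.1 h))
    (fun h w _ => tchange_ge h w)
    tchange_laplace.

Variables (h : R) (x : 'rV[R]_d).
Hypothesis h0 : 0 < h.

Definition walk (k : nat) (w : Omega) : 'rV[R]_d := x + skel W S h k w.

Lemma walk0 w : walk 0 w = x.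
Proof. by rewrite /walk (skel0 bW sS) addr0. Qed.

Lemma measurable_walk k i : measurable_fun setT (fun w => walk k w 0 i).
Proof.
rewrite (_ : (fun w => _) = fun w => x 0 i + skel W S h k w 0 i).
  by apply: measurable_funD => //; exact: (measurable_skel bW sS h0).
by apply/funext => w; rewrite mxE.
Qed.

Lemma measurable_walkT k : measurable_fun setT (walk k : Omega -> Borel R d).
Proof. by apply: measurable_rV => i; exact: measurable_walk. Qed.

Definition future (j n : nat) (xi : nat -> 'rV[R]_d) w : R :=
  \sum_(k < n) dotp (xi k) (walk (j + k).+1 w - walk (j + k) w).

Definition damping (n : nat) (xi : nat -> 'rV[R]_d) : R :=
  \prod_(k < n) expR (- (h * phi (dotp (xi k) (xi k)))).

Lemma measurable_future j n xi : measurable_fun setT (future j n xi).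
Proof.
apply: measurable_sum => k; apply: measurable_dotp => i.
rewrite (_ : (fun w => _) = fun w => walk (j + k).+1 w 0 i - walk (j + k) w 0 i).
  by apply: measurable_funB; exact: measurable_walk.
by apply/funext => w; rewrite !mxE.
Qed.

(* [V] is a function of the walk up to time [j]: the later increments are independent of it. *)
Definition future_indep (j : nat) (V : Omega -> R) :=
  forall (g : Borel R d -> R) C, measurable_fun setT g -> (forall y, `|g y| <= C) ->
  forall n xi b, \int[P]_w (V w * g (walk j w) * cos (future j n xi w + b)) =
    damping n xi * cos b * \int[P]_w (V w * g (walk j w)).

Definition weight (V : Omega -> R) := measurable_fun setT V /\ forall w, 0 <= V w <= 1.

Lemma future_indep0 : future_indep 0 (cst 1).
Proof.
move=> g C mg gC n xi b.
have E : \int[P]_w cos (future 0 n xi w + b) = damping n xi * cos b.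
  rewrite -(skel_cos bW sS indWS h0); apply: eq_Rintegral => w _; congr (cos (_ + _)).
  by apply: eq_bigr => k _; rewrite /walk opprD addrACA subrr add0r.
transitivity (\int[P]_w (g x * cos (future 0 n xi w + b))).
  by apply: eq_Rintegral => w _; rewrite /= walk0 mul1r.
rewrite RintegralZl//; last first.
  by apply: cosB_integrable; apply: measurable_funD => //; exact: measurable_future.
rewrite E mulrC; congr (_ * _).
rewrite -[LHS](Rintegral_unit_cst P); apply: eq_Rintegral => w _; by rewrite /= walk0 mul1r.
Qed.

Section Step.
Variables (j : nat) (V : Omega -> R).
Hypotheses (wV : weight V) (fV : future_indep j V).

Let V0 w : 0 <= V w. Proof. by case/andP: (wV.2 w). Qed.
Let mV : measurable_fun setT V. Proof. exact: wV.1. Qed.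

Let intV (g : Omega -> R) C : measurable_fun setT g -> (forall w, `|g w| <= C) ->
  P.-integrable setT (EFin \o (fun w => V w * g w)).
Proof.
move=> mg gC; apply: (@bounded_integrable _ _ _ _ _ C); first exact: measurable_funM.
by move=> w; rewrite normrM ger0_norm//; case/andP: (wV.2 w) => _ V1; apply: le_trans (gC w); rewrite ler_piMl.
Qed.

Let integrable_weight : P.-integrable setT (EFin \o V).
Proof.
apply: (@bounded_integrable _ _ _ _ _ 1) => // w.
by case/andP: (wV.2 w) => V0' V1; rewrite ger0_norm.
Qed.

(** A phase depending on the present is split off by the addition formula; the sine part is a cosine
    shifted by [pi / 2], for which [future_indep] gives 0. *)
Lemma future_phase (p : Borel R d -> R) n xi : measurable_fun setT p ->
  \int[P]_w (V w * cos (future j n xi w + p (walk j w))) =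
  damping n xi * \int[P]_w (V w * cos (p (walk j w))).
Proof.
move=> mp.
have mc : measurable_fun setT (fun y => cos (p y)) by exact: measurable_cos_comp.
have ms : measurable_fun setT (fun y => sin (p y)).
  apply: (measurableT_comp (f := @sin R)) => //.
  by apply: continuous_measurable_fun; exact: continuous_sin.
have e1 := fV mc (fun y => cos_max _) n xi 0.
have e2 := fV ms (fun y => sin_max _) n xi (pi / 2).
rewrite cos0 mulr1 in e1; rewrite cos_pihalf mulr0 mul0r in e2.
have mf b : measurable_fun setT (fun w => cos (future j n xi w + b)).
  by apply: measurable_cos_comp; apply: measurable_funD => //; exact: measurable_future.
have I (u : Borel R d -> R) b : measurable_fun setT u -> (forall y, `|u y| <= 1) ->
    P.-integrable setT (EFin \o (fun w => V w * u (walk j w) * cos (future j n xi w + b))).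
  move=> mu u1; apply: integrableMb => //; last by move=> w; exact: cos_max.
  by apply: (intV (C := 1)) => //; exact: (measurableT_comp mu (measurable_walkT j)).
have i1 := I _ 0 mc (fun y => cos_max _); have i2 := I _ (pi / 2) ms (fun y => sin_max _).
transitivity (1 * \int[P]_w (V w * cos (p (walk j w)) * cos (future j n xi w + 0)) +
    1 * \int[P]_w (V w * sin (p (walk j w)) * cos (future j n xi w + pi / 2))).
  rewrite -Rintegral_lin//; apply: eq_Rintegral => w _; rewrite cosD addr0 cosDpihalf; ring.
by rewrite e1 e2; ring.
Qed.

Let xi_cons (z : 'rV[R]_d) (xi : nat -> 'rV[R]_d) (k : nat) := if k is k'.+1 then xi k' else z.

Let future_cons z n xi w : future j n.+1 (xi_cons z xi) w =
  dotp z (walk j.+1 w - walk j w) + future j.+1 n xi w.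
Proof.
rewrite /future big_ord_recl /= addn0; congr (_ + _).
by apply: eq_bigr => k _; rewrite /bump /= add1n addnS addSn.
Qed.

Let damping_cons z n xi : damping n.+1 (xi_cons z xi) = expR (- (h * phi (dotp z z))) * damping n xi.
Proof. by rewrite /damping big_ord_recl. Qed.

Let measurable_phase (z : 'rV[R]_d) c : measurable_fun setT (fun y : Borel R d => dotp z y + c).
Proof. by apply: measurable_funD => //; apply: measurable_dotp; exact: measurable_coord. Qed.

Let step_phase z c : \int[P]_w (V w * cos (dotp z (walk j.+1 w) + c)) =
  expR (- (h * phi (dotp z z))) * \int[P]_w (V w * cos (dotp z (walk j w) + c)).
Proof.
have := future_phase 1 (fun=> z) (measurable_phase z c).
rewrite /damping big_ord1 => <-; apply: eq_Rintegral => w _; congr (_ * cos _).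
by rewrite /future big_ord1 /= addn0 addrA -dotpDr subrK.
Qed.

(** Product-to-sum: the two cosines combine into phases whose first increment carries the frequency
    [z] or [- z], so that one more increment is released from the future. *)
Let step_char n xi b z c :
  \int[P]_w (V w * cos (future j.+1 n xi w + b) * cos (dotp z (walk j.+1 w) + c)) =
  damping n xi * cos b * \int[P]_w (V w * cos (dotp z (walk j.+1 w) + c)).
Proof.
have p1 := future_phase n.+1 (xi_cons z xi) (measurable_phase z (c + b)).
have p2 := future_phase n.+1 (xi_cons (- z) xi) (measurable_phase (- z) (b - c)).
rewrite !damping_cons dotpN dotpNr opprK in p1 p2.
have mw z' c' : measurable_fun setT (fun w => cos (dotp z' (walk j w) + c')).
  apply: measurable_cos_comp; apply: measurable_funD => //.
  by apply: measurable_dotp => i; exact: measurable_walk.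
have J z' c' xi' : P.-integrable setT (EFin \o (fun w => V w * cos (future j n.+1 xi' w + (dotp z' (walk j w) + c')))).
  apply: (intV (C := 1)); last by move=> w; exact: cos_max.
  apply: measurable_cos_comp; apply: measurable_funD; first exact: measurable_future.
  by apply: measurable_funD => //; apply: measurable_dotp => i; exact: measurable_walk.
have J' z' c' : P.-integrable setT (EFin \o (fun w => V w * cos (dotp z' (walk j w) + c'))).
  by apply: (intV (C := 1)) => // w; exact: cos_max.
transitivity (\int[P]_w (2^-1 * (V w * cos (future j n.+1 (xi_cons z xi) w + (dotp z (walk j w) + (c + b)))) +
    2^-1 * (V w * cos (future j n.+1 (xi_cons (- z) xi) w + (dotp (- z) (walk j w) + (b - c)))))).
  apply: eq_Rintegral => w _; rewrite !future_cons !dotpN.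
  have -> : dotp z (walk j.+1 w) = dotp z (walk j.+1 w - walk j w) + dotp z (walk j w).
    by rewrite -dotpDr subrK.
  move: (dotp z (walk j.+1 w - walk j w)) (dotp z (walk j w)) (future _ _ _ w) => I a F.
  rewrite (_ : I + F + (a + (c + b)) = (F + b) + (I + a + c)); last by ring.
  rewrite (_ : - I + F + (- a + (b - c)) = (F + b) - (I + a + c)); last by ring.
  by move: (F + b) (I + a + c) => ? ?; rewrite cosD cosB; field.
rewrite Rintegral_lin// p1 p2 step_phase.
transitivity (expR (- (h * phi (dotp z z))) * damping n xi *
   (2^-1 * \int[P]_w (V w * cos (dotp z (walk j w) + (c + b))) +
    2^-1 * \int[P]_w (V w * cos (dotp (- z) (walk j w) + (b - c))))); first by ring.
rewrite -Rintegral_lin//.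
rewrite (_ : \int[P]_w _ = cos b * \int[P]_w (V w * cos (dotp z (walk j w) + c))); first by ring.
rewrite -RintegralZl//; apply: eq_Rintegral => w _; rewrite dotpN.
move: (dotp z (walk j w)) => a.
rewrite (_ : a + (c + b) = (a + c) + b); last by ring.
rewrite (_ : - a + (b - c) = - ((a + c) - b)); last by ring.
by move: (a + c) => ?; rewrite cosN cosD cosB; field.
Qed.

(** For bounded nonnegative [g], the weights [V (1 + cos)] and [V (1 + D)] are nonnegative and
    induce the same characteristic function at [walk j.+1] by [step_char], so [weighted_unique]
    applies. General [g] is the difference of [g + C] and [C]. *)
Lemma future_indep_step : future_indep j.+1 V.
Proof.
have base (g : Borel R d -> R) C : measurable_fun setT g -> (forall y, 0 <= g y <= C) ->
    forall n xi b, \int[P]_w (V w * g (walk j.+1 w) * cos (future j.+1 n xi w + b)) =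
    damping n xi * cos b * \int[P]_w (V w * g (walk j.+1 w)).
  move=> mg gC n xi b; pose D := damping n xi * cos b.
  have D1 : `|D| <= 1.
    rewrite normrM mulr_ile1//; last exact: cos_max.
    rewrite ger0_norm; last by apply: prodr_ge0 => k _; exact: expR_ge0.
    have : 0 <= damping n xi <= 1.
      rewrite prodr_ge0/=; last by move=> k _; exact: expR_ge0.
      apply: prodr_ile1 => k _; rewrite expR_ge0 /= expR_le1 oppr_le0 mulr_ge0 ?(ltW h0)//.
      by have := laplace_exponent_ge (dotp_ge0 (xi k)); apply: le_trans; exact: dotp_ge0.
    by case/andP.
  have mf : measurable_fun setT (fun w => cos (future j.+1 n xi w + b)).
    by apply: measurable_cos_comp; apply: measurable_funD => //; exact: measurable_future.
  have mgw : measurable_fun setT (fun w => g (walk j.+1 w)).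
    exact: (measurableT_comp mg (measurable_walkT j.+1)).
  have gC' w : `|g (walk j.+1 w)| <= C by case/andP: (gC (walk j.+1 w)) => a1 a2; rewrite ger0_norm.
  have iV (u : Omega -> R) : measurable_fun setT u -> (forall w, `|u w| <= 1) ->
      P.-integrable setT (EFin \o (fun w => V w * (1 + u w))).
    move=> mu u1; apply: (intV (C := 2)); first exact: measurable_funD.
    by move=> w; apply: (le_trans (ler_normD _ _)); rewrite normr1; have := u1 w; lra.
  have := @weighted_unique R d _ _ _ _ P P (fun w => V w * (1 + cos (future j.+1 n xi w + b)))
    (fun w => V w * (1 + D)) (walk j.+1) (walk j.+1) (EFin \o g).
  have i1 := iV _ mf (fun w => cos_max _).
  have i2 := iV (cst D) (measurable_cst D) (fun _ => D1).
  move=> /(_ i1 i2); rewrite /= => H.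
  have {}H : (\int[P]_w ((V w * (1 + cos (future j.+1 n xi w + b)))%:E * (g (walk j.+1 w))%:E) =
      \int[P]_w ((V w * (1 + D))%:E * (g (walk j.+1 w))%:E))%E.
    apply: H => [w|w|i|i|z c|].
    - by rewrite mulr_ge0//; have := cos_geN1 (future j.+1 n xi w + b); lra.
    - by rewrite mulr_ge0//; move: D1; rewrite ler_norml => /andP[]; lra.
    - exact: measurable_walk.
    - exact: measurable_walk.
    - have mz : measurable_fun setT (fun w => cos (dotp z (walk j.+1 w) + c)).
        apply: measurable_cos_comp; apply: measurable_funD => //.
        by apply: measurable_dotp => i; exact: measurable_walk.
      have k1 : P.-integrable setT (EFin \o (fun w => V w * cos (dotp z (walk j.+1 w) + c))).
        by apply: (intV (C := 1)) => // w; exact: cos_max.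
      have k2 : P.-integrable setT (EFin \o
          (fun w => V w * cos (future j.+1 n xi w + b) * cos (dotp z (walk j.+1 w) + c))).
        apply: integrableMb => //; last by move=> w; exact: cos_max.
        by apply: (intV (C := 1)) => // w; exact: cos_max.
      transitivity (\int[P]_w (V w * cos (dotp z (walk j.+1 w) + c)) +
          \int[P]_w (V w * cos (future j.+1 n xi w + b) * cos (dotp z (walk j.+1 w) + c))).
        rewrite -RintegralD//; apply: eq_Rintegral => w _; ring.
      rewrite step_char -/D.
      transitivity ((1 + D) * \int[P]_w (V w * cos (dotp z (walk j.+1 w) + c))); first by ring.
      by rewrite -RintegralZl//; apply: eq_Rintegral => w _; ring.
    - split; first exact/measurable_EFinP.
      by move=> y; rewrite lee_fin; case/andP: (gC y).
  have j1 : P.-integrable setT (EFin \o (fun w => V w * g (walk j.+1 w))) by exact: (intV mgw gC').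
  have j2 := integrableMb j1 mf (fun w => cos_max _).
  move: H => /(congr1 fine).
  rewrite (_ : fine _ = \int[P]_w (1 * (V w * g (walk j.+1 w)) +
      1 * (V w * g (walk j.+1 w) * cos (future j.+1 n xi w + b)))); last first.
    by congr fine; apply: eq_integral => w _; rewrite -EFinM; congr EFin; ring.
  rewrite Rintegral_lin// !mul1r => E.
  have : \int[P]_w (V w * g (walk j.+1 w)) +
      \int[P]_w (V w * g (walk j.+1 w) * cos (future j.+1 n xi w + b)) =
      (1 + D) * \int[P]_w (V w * g (walk j.+1 w)).
    rewrite E -RintegralZl//; congr fine; apply: eq_integral => w _.
    by rewrite -EFinM; congr EFin; ring.
  by rewrite mulrDl mul1r => /addrI.
move=> g C mg gC n xi b.
have C0 : 0 <= C by exact: le_trans (normr_ge0 _) (gC 0).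
have := base (fun y => g y + C) (2 * C) => H1.
have {}H1 := H1 (measurable_funD mg (measurable_cst C)).
have {}H1 : forall n xi b, _ := H1 (fun y => ltac:(by have := gC y; rewrite ler_norml => /andP[h1 h2]; apply/andP; split; lra)).
have H2 := base (cst C) C (measurable_cst C) (fun y => ltac:(by rewrite /= C0 lexx)).
have mgw : measurable_fun setT (fun w => g (walk j.+1 w)).
  exact: (measurableT_comp mg (measurable_walkT j.+1)).
have mf : measurable_fun setT (fun w => cos (future j.+1 n xi w + b)).
  by apply: measurable_cos_comp; apply: measurable_funD => //; exact: measurable_future.
have j1 : P.-integrable setT (EFin \o (fun w => V w * (g (walk j.+1 w) + C))).
  apply: (intV (C := 2 * C)); first exact: measurable_funD.
  by move=> w; apply: (le_trans (ler_normD _ _)); rewrite (ger0_norm C0); have := gC (walk j.+1 w); lra.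
have j2 : P.-integrable setT (EFin \o (fun w => V w * C)).
  by apply: (intV (C := C)) => // w; rewrite ger0_norm.
have j1c := integrableMb j1 mf (fun w => cos_max _).
have j2c := integrableMb j2 mf (fun w => cos_max _).
transitivity (1 * \int[P]_w (V w * (g (walk j.+1 w) + C) * cos (future j.+1 n xi w + b)) +
   (-1) * \int[P]_w (V w * C * cos (future j.+1 n xi w + b))).
  by rewrite -Rintegral_lin//; apply: eq_Rintegral => w _; ring.
have h1 := H1 n xi b; have h2 := H2 n xi b; rewrite /= in h1 h2; rewrite h1 h2.
transitivity (damping n xi * cos b * (1 * \int[P]_w (V w * (g (walk j.+1 w) + C)) +
   (-1) * \int[P]_w (V w * C))); first by ring.
by rewrite -Rintegral_lin//; congr (_ * _); apply: eq_Rintegral => w _; ring.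
Qed.

Variable M : refmeasure R d.
Notation X := process_timechange.
Notation m := (refm M).

(** The law of [walk j.+1] under the weight [V], and the one obtained by applying the kernel at
    [walk j], have the same characteristic function, by [step_phase] and [kern_char]. *)
Lemma walk_markov (f : Borel R d -> \bar R) : nonneg f ->
  (\int[P]_w ((V w)%:E * f (walk j.+1 w)) = \int[P]_w ((V w)%:E * Qop X M h setT f (walk j w)))%E.
Proof.
move=> nf; pose K (z : Omega * Borel R d) : R := V z.1 * kern X h (walk j z.1) z.2.
have mK2 : measurable_fun setT (fun z : Omega * Borel R d => kern X h (walk j z.1) z.2).
  have mp : measurable_fun setT (fun z : Omega * Borel R d => (walk j z.1 : Borel R d, z.2)).
    apply: measurable_fun_pair; last exact: measurable_snd.
    by apply: (measurableT_comp (measurable_walkT j)); exact: measurable_fst.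
  exact: (measurableT_comp (measurable_kern2 X h0) mp).
have mK : measurable_fun setT K.
  by apply: measurable_funM => //; apply: (measurableT_comp mV); exact: measurable_fst.
have K0 z : 0 <= K z by rewrite mulr_ge0// kern_ge0.
have T (g : Borel R d -> \bar R) : nonneg g ->
    (\int[P \x m]_z ((K z)%:E * g z.2) = \int[P]_w ((V w)%:E * Qop X M h setT g (walk j w)))%E.
  move=> [mg g0]; rewrite fubini_tonelli1/=; last 2 first.
    - apply: emeasurable_funM; first exact/measurable_EFinP.
      by apply: (measurableT_comp mg); exact: measurable_snd.
    - by move=> z; rewrite mule_ge0// lee_fin.
  apply: eq_integral => w _; rewrite QopE /fubini_F /=.
  have [k1 k2] := nonneg_kern_mul X (walk j w) h0 (conj mg g0).
  rewrite -ge0_integralZl//; last by rewrite lee_fin.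
  by apply: eq_integral => z _; rewrite /K /= EFinM muleA.
have iK : (P \x m)%E.-integrable setT (EFin \o K).
  apply/integrableP; split; first exact/measurable_EFinP.
  have := T (cst 1%E) (nonneg_cst ler01).
  under [X in _ = X -> _]eq_integral => w _.
    have -> : (Qop X M h setT (cst 1) (walk j w) = 1)%E.
      by rewrite QopE; under eq_integral do rewrite mule1; exact: kern_total.
    over.
  move=> E1; apply: (@le_lt_trans _ _ (\int[P]_w ((V w)%:E * 1))%E).
    rewrite -{}E1; apply: ge0_le_integral => //.
    - by apply/measurable_EFinP; apply: measurableT_comp.
    - by apply: emeasurable_funM => //; exact/measurable_EFinP.
    - by move=> z _; rewrite mule1/= ger0_norm.
  under eq_integral do rewrite mule1.
  by rewrite (RintegralE integrable_weight erefl) ltry.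
rewrite -T//.
refine (@weighted_unique R d _ _ _ _ _ _ V K (walk j.+1) (fun z => z.2) f integrable_weight iK V0 K0 _ _ _ nf).
- by move=> i; exact: measurable_walk.
- by move=> i; apply: (measurableT_comp (measurable_coord i)); exact: measurable_snd.
move=> z c; rewrite step_phase.
have bc (y : Borel R d) : (`|cos (dotp z y + c)| <= 1)%R by exact: cos_max.
have mc : measurable_fun setT (fun y : Borel R d => cos (dotp z y + c)).
  by apply: (measurableT_comp (f := @cos R)); [apply: continuous_measurable_fun; exact: continuous_cos|exact: measurable_phase].
have iKc : (P \x m)%E.-integrable setT (EFin \o (fun z' => K z' * cos (dotp z z'.2 + c))%R).
  apply: integrableMb => //.
  by apply: (measurableT_comp mc); exact: measurable_snd.
have := @integral12_prod_meas1 _ _ _ _ R P m _ iKc; rewrite /Rintegral /fubini_F /= => <-.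
have ic : P.-integrable setT (EFin \o (fun w => V w * cos (dotp z (walk j w) + c))).
  by apply: (intV (C := 1)); [exact: (measurableT_comp mc (measurable_walkT j))|move=> w; exact: cos_max].
rewrite -[LHS]/(_ * \int[P]_w _) -RintegralZl//; congr fine; apply: eq_integral => w _.
have ik := integrableMb (integrable_kern X M (walk j w) h0) mc bc.
transitivity (\int[m]_y ((V w)%:E * (kern X h (walk j w) y * cos (dotp z y + c))%:E))%E.
  rewrite integralZl// (RintegralE ik (kern_char X M (walk j w) z c h0)) -EFinM.
  by congr EFin; rewrite /=; ring.
by apply: eq_integral => y _; rewrite /K /= -EFinM mulrA.
Qed.

End Step.

Variables (M : refmeasure R d) (F : set (Borel R d)).
Hypothesis mF : measurable F.
Notation X := process_timechange.

(** The starting point is not tested, in agreement with [Qop], where only landing points are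
    killed. *)
Fixpoint stay (k : nat) (w : Omega) : R :=
  if k is k'.+1 then stay k' w * \1_F (walk k'.+1 w) else 1.

Lemma stay_weight k : weight (stay k).
Proof.
elim: k => [|k [mV V01]]; first by split=> [|w /=]; [exact: measurable_cst|rewrite ler01 lexx].
split=> [|w /=].
  apply: measurable_funM => //.
  apply: (measurableT_comp (f := \1_F : Borel R d -> R)); last exact: measurable_walkT.
  exact: measurable_indic.
case/andP: (V01 w) => v0 v1; rewrite indicE.
by case: (_ \in _); rewrite ?mulr1 ?mulr0 ?v0 ?lexx ?ler01.
Qed.

Lemma stay_future k : future_indep k (stay k).
Proof.
elim: k => [|k IH]; first exact: future_indep0.
have := future_indep_step (stay_weight k) IH => H g C mg gC n xi b.
have e1 : \int[P]_w (stay k.+1 w * g (walk k.+1 w) * cos (future k.+1 n xi w + b)) =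
    \int[P]_w (stay k w * (\1_F (walk k.+1 w) * g (walk k.+1 w)) * cos (future k.+1 n xi w + b)).
  by apply: eq_Rintegral => w _; rewrite /= mulrA.
have e2 : \int[P]_w (stay k.+1 w * g (walk k.+1 w)) =
    \int[P]_w (stay k w * (\1_F (walk k.+1 w) * g (walk k.+1 w))).
  by apply: eq_Rintegral => w _; rewrite /= mulrA.
rewrite e1 e2.
have := H (fun y => \1_F y * g y) C _ _ n xi b.
apply; first by apply: measurable_funM => //; exact: measurable_indic.
move=> y; rewrite normrM; apply: le_trans (gC y); rewrite ler_piMl//.
by rewrite indicE; case: (_ \in _); rewrite ?normr1 ?normr0.
Qed.

Lemma walk_killed k (f : Borel R d -> \bar R) : nonneg f ->
  (\int[P]_w ((stay k w)%:E * f (walk k w)) = iter k (Qop X M h F) f x)%E.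
Proof.
elim: k f => [|k IH] f nf.
  transitivity (\int[P]_w f x)%E.
    by apply: eq_integral => w _; rewrite /= mul1e walk0.
  rewrite integral_cst//; transitivity (f x * 1)%E; last by rewrite mule1.
  by congr (_ * _)%E; exact: probability_setT.
rewrite iterSr -IH; last exact: Qop_nonneg.
have nF : nonneg (fun y => (f y * (\1_F y)%:E)%E) by apply: nonneg_mul => //; exact: nonneg_indic.
rewrite -[RHS](_ : (\int[P]_w ((stay k w)%:E * Qop X M h setT (fun y => f y * (\1_F y)%:E) (walk k w)))%E = _).
  rewrite -(walk_markov (stay_weight k) (@stay_future k) M nF).
  by apply: eq_integral => w _; rewrite /= EFinM -muleA; congr (_ * _)%E; rewrite muleC.
by apply: eq_integral => w _; rewrite [in RHS]Qop_mkcond QopE.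
Qed.

End Skeleton.

(** * Occupation times *)

Section Liminf.
Context {R : realType}.
Implicit Types u : nat -> \bar R.
Local Open Scope ereal_scope.

Lemma limn_einf_le u (B : \bar R) : (forall n, u n <= B) -> limn_einf u <= B.
Proof.
move=> uB; rewrite limn_einf_lim; apply: lime_le.
  by apply/cvg_ex; eexists; apply: ereal_nondecreasing_cvgn; exact: nondecreasing_einfs.
apply: nearW => n; apply: le_trans (uB n); apply: ereal_inf_lbound; exists n => //=.
Qed.

Lemma limn_einf_ge u (c : \bar R) N : (forall n, (N <= n)%N -> c <= u n) -> c <= limn_einf u.
Proof.
move=> cu; rewrite limn_einf_lim.
have H := ereal_nondecreasing_cvgn (nondecreasing_einfs u).
rewrite (cvg_lim _ H)//; apply: (@le_trans _ _ (einfs u N)); last by apply: ereal_sup_ubound; exists N.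
by apply: le_ereal_inf_tmp => _ [n /= Nn <-]; exact: cu.
Qed.

Lemma measurable_limn_einf dT (T : measurableType dT) (f : nat -> T -> \bar R) :
  (forall n, measurable_fun setT (f n)) -> measurable_fun setT (fun x => limn_einf (f^~ x)).
Proof.
move=> mf; rewrite /limn_einf; apply: measurableT_comp => //.
have := @measurable_fun_limn_esup _ T R setT (fun n x => - f n x); apply=> n.
exact: measurableT_comp.
Qed.

End Liminf.

Definition mesh (R : realType) (N : nat) : R := 2^-1 ^+ N.

Lemma mesh_gt0 (R : realType) N : 0 < mesh R N.
Proof. by rewrite exprn_gt0// invr_gt0. Qed.

Lemma mesh_small (R : realType) (e : R) : 0 < e -> exists N0, forall N, (N0 <= N)%N -> mesh R N < e.
Proof.
move=> e0; exists (Num.truncn e^-1).+1 => N NN; rewrite /mesh exprVn -[ltRHS]invrK ltf_pV2 ?posrE ?exprn_gt0 ?invr_gt0//.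
apply: (lt_le_trans (truncnS_gt _)); rewrite -natrX ler_nat.
by apply: (leq_trans NN); exact: ltnW (ltn_expl _ _).
Qed.

Section Sampling.
Context {R : realType} {d : nat} {dO : measure_display} {Omega : measurableType dO}.
Variables (P : probability Omega R) (W : R -> Omega -> 'rV[R]_d) (S : R -> Omega -> R) (mu0 : R -> R).
Hypotheses (lv : levy_density mu0) (bW : brownian P W) (sS : subordinator P S mu0)
  (indWS : independent_WS P W S).
Variables (M : refmeasure R d).
Notation X := (process_timechange lv sS).
Notation leb := (@lebesgue_measure R).
Implicit Types (A D F : set 'rV[R]_d) (x : 'rV[R]_d) (w : Omega) (t : R).

Lemma path_right G x t w : open G -> 0 <= t -> G (Xp W S x t w) ->
  exists2 e, 0 < e & forall s, t <= s -> s < t + e -> G (Xp W S x s w).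
Proof.
move=> oG t0 Gt.
have H := (subspace_continuousP _ _).1 (bW.2.2.1 w) (S t w).
rewrite /= in_itv /= (S_ge0 sS w t0) in H; have {}H := H isT.
have oG' : nbhs (W (S t w) w) [set y | G (x + y)].
  apply: open_nbhs_nbhs; split=> //.
  apply/open_sqdP => y /((open_sqdP G).1 oG)[e e0 eG]; exists e => // z zy; apply: eG.
  by move: zy; rewrite /eball /= /sqd opprD addrACA subrr add0r.
have /nbhs_ballP[e1 /= e10 B1] : nbhs (S t w) (fun r => `[0, +oo[%classic r -> G (x + W r w)) by exact: H oG'.
have /nbhs_ballP[e2 /= e20 B2] : nbhs t (fun s => t < s -> ball (S t w) e1 (S s w)).
  by have : nbhs (S t w) (ball (S t w) e1) by [exact: nbhsx_ballx]; move=> /(sS.2.2.2.1 w t t0).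
exists e2 => // s ts se; have [<-//|nts] := eqVneq t s.
have tls : t < s by rewrite lt_neqAle nts.
apply: B1; last by rewrite /= in_itv /= (S_ge0 sS w (le_trans t0 ts)).
apply: B2 => //; rewrite /ball /= distrC ger0_norm; lra.
Qed.

Definition slot (h : R) (k : nat) : set R := `[k%:R * h, k.+1%:R * h[%classic.

Lemma slotE h k t : 0 < h -> 0 <= t -> slot h k t <-> Num.truncn (t / h) = k.
Proof.
move=> h0 t0; have th : 0 <= t / h by rewrite divr_ge0// ltW.
rewrite /slot /= in_itv /=; split=> [/andP[a b]|<-].
  by apply: truncn_def; rewrite ler_pdivlMr// ltr_pdivrMr// a b.
by have /andP[a b] := truncn_itv th; rewrite -ler_pdivlMr// -ltr_pdivrMr// a b.
Qed.

Lemma slot_length h k : 0 <= h -> (\int[leb]_t (\1_(slot h k) t)%:E = h%:E)%E.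
Proof.
move=> h0; rewrite integral_indic//; last exact: measurable_itv.
transitivity (leb (slot h k)); first exact: (congr1 _ (setIT _)).
rewrite /slot lebesgue_measure_itv/= lte_fin; case: ltP => [_|H].
  by rewrite -EFinB -mulrBl -natrB// subSnn mul1r.
congr EFin; apply/eqP; rewrite eq_le h0 /=.
by move: H; rewrite -natr1 mulrDl mul1r gerDl.
Qed.

(** On the slot from [k h] to [(k + 1) h] the walk is read at the right end point: paths are only
    right-continuous, and the next grid time tends to [t] from the right. *)
Definition sampled h (x : 'rV[R]_d) F A (n : nat) (z : Omega * R) : R :=
  \sum_(k < n) stay W S h x F k.+1 z.1 * \1_A (walk W S h x k.+1 z.1) * \1_(slot h k) z.2.

Lemma sampledE h x F A n w t : 0 < h -> 0 <= t -> sampled h x F A n (w, t) =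
  if (Num.truncn (t / h) < n)%N then
    stay W S h x F (Num.truncn (t / h)).+1 w * \1_A (walk W S h x (Num.truncn (t / h)).+1 w)
  else 0.
Proof.
move=> h0 t0; have off (k : nat) : k != Num.truncn (t / h) -> \1_(slot h k) t = 0 :> R.
  by move=> kt; rewrite indicE memNset// => /(slotE k h0 t0) E; rewrite E eqxx in kt.
rewrite /sampled; case: ifPn => [tn|tn].
  rewrite (bigD1 (Ordinal tn))//= big1 ?addr0 => [|k kt].
    have -> : \1_(slot h (Num.truncn (t / h))) t = 1 :> R by rewrite indicE mem_set//; exact/(slotE _ h0 t0).
    by rewrite mulr1.
  by rewrite off ?mulr0.
rewrite big1// => k _; rewrite off ?mulr0//.
by apply: contra tn => /eqP <-; exact: ltn_ord.
Qed.

Lemma stay1P h x F k w : stay W S h x F k w =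
  (if pselect (forall j, (0 < j <= k)%N -> F (walk W S h x j w)) then 1 else 0).
Proof.
elim: k => [|k IH] /=; first by case: pselect => // -[] [|j].
rewrite IH indicE; case: pselect => /= [H|H]; case: pselect => /= [H'|H'].
- by rewrite mem_set ?mul1r//; apply: H'; rewrite leqnn.
- rewrite memNset ?mulr0// => Fk; apply: H' => j /andP[j0]; rewrite leq_eqVlt => /predU1P[->//|jk].
  by apply: H; rewrite j0.
- by case: H => j /andP[j0 jk]; apply: H'; rewrite j0 leqW.
- by rewrite mul0r.
Qed.

Lemma sampled01 h x F A n w t : 0 < h -> 0 <= sampled h x F A n (w, t) <= \1_(slot (n%:R * h) 0) t.
Proof.
move=> h0; have [t0|t0] := leP 0 t.
  rewrite sampledE//; case: ifPn => [tn|_]; last by rewrite lexx/=.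
  have -> : \1_(slot (n%:R * h) 0) t = 1 :> R.
    rewrite indicE mem_set// /slot /= in_itv /= mul0r t0 mul1r/= -ltr_pdivrMr//.
    by apply: (lt_le_trans (truncnS_gt _)); rewrite ler_nat.
  rewrite stay1P indicE; case: (pselect _) => _ /=; case: (_ \in _); by rewrite ?mulr1 ?mulr0 ?mul0r ?lexx ?ler01.
rewrite /sampled big1 => [|k _]; first by rewrite lexx indicE ler0n.
have -> : \1_(slot h k) t = 0 :> R; last by rewrite mulr0.
rewrite indicE memNset// /slot /= in_itv /= => /andP[a _].
have : 0 <= k%:R * h by rewrite mulr_ge0// ltW.
by move=> /le_trans/(_ a); rewrite leNgt t0.
Qed.

Section Integral.
Variables (h : R) (x : 'rV[R]_d) (F A : set (Borel R d)) (n : nat).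
Hypotheses (h0 : 0 < h) (mF : measurable F) (mA : measurable A).

Let a (k : nat) w : R := stay W S h x F k w * \1_A (walk W S h x k w).

Let ma k : measurable_fun setT (a k).
Proof.
apply: measurable_funM; first exact: (stay_weight bW sS x h0 mF k).1.
apply: (measurableT_comp (f := \1_A : Borel R d -> R)); first exact: measurable_indic.
exact: (measurable_walkT bW sS x h0).
Qed.

Let a0 k w : 0 <= a k w.
Proof. by rewrite mulr_ge0//; case/andP: ((stay_weight bW sS x h0 mF k).2 w). Qed.

Let mslot k : measurable (slot h k). Proof. exact: measurable_itv. Qed.

Let mterm k : measurable_fun setT (fun z : Omega * R => a k.+1 z.1 * \1_(slot h k) z.2).
Proof.
apply: measurable_funM.
  by apply: (measurableT_comp (ma k.+1)); exact: measurable_fst.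
apply: (measurableT_comp (f := \1_(slot h k) : R -> R)); last exact: measurable_snd.
exact: measurable_indic.
Qed.

Let mtermE k : measurable_fun setT (fun z : Omega * R => (a k.+1 z.1 * \1_(slot h k) z.2)%:E).
Proof. by apply/measurable_EFinP; exact: mterm. Qed.

Lemma measurable_sampled : measurable_fun setT (sampled h x F A n).
Proof. by apply: measurable_sum => k; exact: mterm. Qed.

Lemma sampled_integral :
  (\int[P \x leb]_z (sampled h x F A n z)%:E = Uop X M h F n (fun y => (\1_A y)%:E) x)%E.
Proof.
have nA : nonneg (fun y : Borel R d => (\1_A y : R)%:E) by exact: nonneg_indic.
rewrite (Uop_sum X M h0 mF n x nA).
transitivity (\int[P \x leb]_z \sum_(k < n) (a k.+1 z.1 * \1_(slot h k) z.2)%:E)%E.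
  by apply: eq_integral => z _; rewrite sumEFin.
rewrite ge0_integral_sum//; last 2 first.
- by move=> k; apply/measurable_EFinP; exact: mterm.
- by move=> k z _; rewrite lee_fin mulr_ge0.
apply: eq_bigr => k _.
have tz (z : Omega * R) : (0 <= (a k.+1 z.1 * \1_(slot h k) z.2)%:E)%E by rewrite lee_fin mulr_ge0.
transitivity (\int[P]_w \int[leb]_t (a k.+1 w * \1_(slot h k) t)%:E)%E.
  by have := @fubini_tonelli1 _ _ _ _ R P leb _ (mtermE k) tz; rewrite /fubini_F /= => ->.
rewrite -(walk_killed lv bW sS indWS x h0 M mF k.+1 nA) -ge0_integralZl//; last 3 first.
- apply: emeasurable_funM; apply/measurable_EFinP; first exact: (stay_weight bW sS x h0 mF k.+1).1.
  apply: (measurableT_comp (f := \1_A : Borel R d -> R)); first exact: measurable_indic.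
  exact: (measurable_walkT bW sS x h0).
- by move=> w _; rewrite -EFinM lee_fin a0.
- by rewrite lee_fin ltW.
have mI : measurable_fun setT (fun t : R => (\1_(slot h k) t : R)%:E).
  by apply/measurable_EFinP; exact: measurable_indic.
apply: eq_integral => w _; rewrite /fubini_F /=.
under eq_integral do rewrite EFinM.
rewrite ge0_integralZl//; last by rewrite lee_fin a0.
rewrite muleC EFinM; congr (_ * _)%E; exact: (slot_length k (ltW h0)).
Qed.

End Integral.

Definition occupation D A x : \bar R := (\int[P]_w \int[leb]_(t in [set t : R | (0 <= t)%R /\
   (t%:E < exit_time W S D x w)%E]) (\1_A (Xp W S x t w))%:E)%E.

Lemma exit_lt D x t w : (t%:E < exit_time W S D x w)%E -> forall s, 0 < s -> s <= t -> D (Xp W S x s w).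
Proof.
move=> te s s0 st; apply: contrapT => Ds.
have : (exit_time W S D x w <= s%:E)%E by apply: ereal_inf_lbound; exists s.
by move=> /(lt_le_trans te); rewrite lte_fin ltNge st.
Qed.

Lemma exit_gt D x t w : open D -> 0 <= t -> (forall s, 0 <= s -> s <= t -> D (Xp W S x s w)) ->
  (t%:E < exit_time W S D x w)%E.
Proof.
move=> oD t0 H; have [e e0 He] := path_right oD t0 (H t t0 (lexx t)).
apply: (@lt_le_trans _ _ (t + e)%:E); first by rewrite lte_fin ltrDl.
apply: le_ereal_inf_tmp => _ [s [s0 Ds] <-]; rewrite lee_fin leNgt; apply/negP => se.
by apply: Ds; have [st|/ltW ts] := leP s t; [apply: H => //; exact: ltW|exact: He].
Qed.

Let hitset D A x w (t : R) : Prop := [/\ 0 <= t, (t%:E < exit_time W S D x w)%E & A (Xp W S x t w)].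

Let hit D A x (z : Omega * R) : R := \1_[set t | hitset D A x z.1 t] z.2.

Let occupationE D A x : occupation D A x = (\int[P]_w \int[leb]_t (hit D A x (w, t))%:E)%E.
Proof.
apply: eq_integral => w _; rewrite [LHS]integral_mkcond; apply: eq_integral => t _.
rewrite patchE /hit !indicE; case: ifPn => [/set_mem [h1 h2]|/negP nt].
  congr (_%:R)%:E; congr nat_of_bool; apply/idP/idP => /set_mem h3; apply/mem_set; first by split.
  by case: h3.
by rewrite memNset// => -[h1 h2 _]; apply: nt; apply/mem_set.
Qed.

Lemma next_gt h t : 0 < h -> 0 <= t -> t < (Num.truncn (t / h)).+1%:R * h <= t + h.
Proof.
move=> h0 t0; have th : 0 <= t / h by rewrite divr_ge0// ltW.
have /andP[a b] := truncn_itv th; rewrite -ltr_pdivrMr// b /=.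
by rewrite -natr1 mulrDl mul1r lerD2r -ler_pdivlMr.
Qed.

(** Fatou from below. If the path is in the open set [A] at time [t], before its exit, then it is
    still alive and in [A] at the next grid time of every fine mesh, so the indicator is at most the
    lower limit of the sampled ones. The [4^N] steps of length [2^(-N)] eventually cover every [t].
    The bound is asked for infinitely many [N] only, so that its negation holds for all large
    [N]. *)
Lemma occupation_le D A x (B : R) : open D -> open A ->
  (forall N0, exists2 N, (N0 <= N)%N &
    (Uop X M (mesh R N) D (4 ^ N) (fun y => (\1_A y)%:E) x <= B%:E)%E) ->
  (occupation D A x <= B%:E)%E.
Proof.
move=> oD oA HB0; have [nu nuN HB] := all_sig2 (fun N0 => cid2 (HB0 N0)); pose f N z := (sampled (mesh R (nu N)) x D A (4 ^ (nu N)) z)%:E.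
have mD : measurable (D : set (Borel R d)) by exact: sub_sigma_algebra.
have mA : measurable (A : set (Borel R d)) by exact: sub_sigma_algebra.
have mf N : measurable_fun setT (f N).
  by apply/measurable_EFinP; apply: measurable_sampled => //; exact: mesh_gt0.
have f0 N z : (0 <= f N z)%E.
  by case: z => w t; rewrite lee_fin; case/andP: (sampled01 x D A (4 ^ (nu N)) w t (mesh_gt0 R (nu N))).
have L0 z : (0 <= limn_einf (f ^~ z))%E by apply: (@limn_einf_ge _ _ _ 0%N) => N _; exact: f0.
apply: (@le_trans _ _ (\int[P \x leb]_z limn_einf (f ^~ z))%E); last first.
  apply: (le_trans (@fatou _ _ _ (P \x leb)%E setT measurableT f mf (fun N z _ => f0 N z))).
  apply: limn_einf_le => N; rewrite sampled_integral//; last exact: mesh_gt0.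
rewrite fubini_tonelli1//; last exact: measurable_limn_einf.
rewrite occupationE; apply: ge0_le_lower_integral => w _; first by apply: integral_ge0 => t _; rewrite lee_fin.
apply: ge0_le_lower_integral => t _; first by rewrite lee_fin.
rewrite /hit indicE; case: (boolP (_ \in _)) => [/set_mem [/= t0 te At]|_]; last exact: L0.
have [e1 e10 H1] := path_right oA t0 At.
have [e2 e20 H2] : exists2 e2, 0 < e2 & forall s, 0 < s -> s < t + e2 -> D (Xp W S x s w).
  have [Et|Et] : exit_time W S D x w = +oo%E \/ exit_time W S D x w \is a fin_num.
    by move: te; case: (exit_time W S D x w) => [r _|_|//]; [right|left].
    by exists 1 => // s s0 _; apply: (@exit_lt _ _ s); rewrite ?Et ?ltry.
  exists (fine (exit_time W S D x w) - t); first by rewrite subr_gt0 -lte_fin fineK.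
  move=> s s0; rewrite addrC subrK => se; apply: (@exit_lt _ _ s) => //.
  by rewrite -(fineK Et) lte_fin.
have [N1 HN1] := mesh_small e10; have [N2 HN2] := mesh_small e20.
apply: (@limn_einf_ge _ _ _ (N1 + N2 + (Num.truncn t).+1)%N) => N NN.
have h0 := mesh_gt0 R (nu N); set h := mesh R (nu N) in h0 *.
have he1 : h < e1.
  by apply: HN1; apply: leq_trans (nuN N); apply: leq_trans NN; rewrite -addnA leq_addr.
have he2 : h < e2.
  by apply: HN2; apply: leq_trans (nuN N); apply: leq_trans NN; rewrite addnAC leq_addl.
have /andP[n1 n2] := next_gt h0 t0.
rewrite /f sampledE// -/h ifT; last first.
  rewrite truncn_lt_nat ?divr_ge0 ?(ltW h0)// ltr_pdivrMr//.
  rewrite /h /mesh exprVn natrX (_ : 4%:R = 2 * 2 :> R) ?exprMn; last by rewrite -natrM.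
  rewrite mulfK ?gt_eqF ?exprn_gt0//; apply: (lt_le_trans (truncnS_gt _)).
  rewrite -natrX ler_nat; apply: (@leq_trans (nu N)); last exact: ltnW (ltn_expl _ _).
  by apply: leq_trans (nuN N); apply: leq_trans NN; exact: leq_addl.
rewrite stay1P indicE; case: pselect => [H|H] /=.
  by rewrite mem_set ?mul1r//; apply: H1; [exact: ltW|lra].
case: H => j /andP[j0 jk]; apply: H2; first by rewrite mulr_gt0// ltr0n.
have : j%:R * h <= (Num.truncn (t / h)).+1%:R * h by rewrite ler_pM2r// ler_nat.
by lra.
Qed.

(** Fatou for the complement [j - s], with [j] the indicator of the bounded horizon [T]. If the path
    leaves the closed [F] by time [t], or is outside the closed [A'] at [t], right-continuity shows
    it at a grid time of every fine mesh, so the sampled indicator is eventually 0. *)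
Lemma occupation_ge D F A A' x (T c : R) (nn : nat -> nat) N0 : open D -> closed F -> F `<=` D ->
  closed A' -> A' `<=` A -> 0 <= T ->
  (forall N, (N0 <= N)%N -> (nn N)%:R * mesh R N <= T /\
    (c%:E <= Uop X M (mesh R N) F (nn N) (fun y => (\1_A' y)%:E) x)%E) ->
  (c%:E <= occupation D A x)%E.
Proof.
move=> oD cF FD cA AA T0 Hc.
have mC (C : set 'rV[R]_d) : closed C -> measurable (C : set (Borel R d)).
  by move=> cC; rewrite -[C]setCK; apply: measurableC; apply: sub_sigma_algebra; exact: closed_openC.
have mF := mC _ cF; have mA := mC _ cA.
pose J : set R := slot T 0.
have mJ : measurable J by exact: measurable_itv.
pose s N z : R := sampled (mesh R (N0 + N)) x F A' (nn (N0 + N)) z.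
have ms N : measurable_fun setT (s N) by apply: measurable_sampled => //; exact: mesh_gt0.
have msE N : measurable_fun setT (fun z => (s N z)%:E) by apply/measurable_EFinP; exact: ms.
have s01 N w t : 0 <= s N (w, t) <= \1_J t.
  have /andP[-> /= H] := sampled01 x F A' (nn (N0 + N)) w t (mesh_gt0 R (N0 + N)).
  apply: (le_trans H); rewrite !indicE; case: (boolP (t \in slot (_ * _) 0)) => // /set_mem.
  rewrite /J /slot /= !in_itv /= !mul0r !mul1r => /andP[t0 tT].
  rewrite mem_set//= in_itv /= t0 (lt_le_trans tT)//.
  by case: (Hc (N0 + N)%N) => //; rewrite leq_addr.
pose j (z : Omega * R) : R := \1_J z.2.
have mj : measurable_fun setT j.
  apply: (measurableT_comp (f := \1_J : R -> R)); last exact: measurable_snd.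
  exact: measurable_indic.
pose g N z := (j z - s N z)%:E.
have mg N : measurable_fun setT (g N) by apply/measurable_EFinP; exact: measurable_funB.
have g0 N z : (0 <= g N z)%E.
  by case: z => w t; rewrite lee_fin subr_ge0; case/andP: (s01 N w t).
have gj N z : (g N z <= (j z)%:E)%E.
  by case: z => w t; rewrite lee_fin lerBlDr lerDl; case/andP: (s01 N w t).
pose L z := limn_einf (g ^~ z).
have mL : measurable_fun setT L by exact: measurable_limn_einf.
have L0 z : (0 <= L z)%E by apply: (@limn_einf_ge _ _ _ 0%N) => N _; exact: g0.
have Lj z : (L z <= (j z)%:E)%E by apply: limn_einf_le => N; exact: gj.
have Lf z : (L z \is a fin_num)%E by rewrite ge0_fin_numE//; apply: le_lt_trans (Lj z) _; rewrite ltry.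
have ij : (\int[P \x leb]_z (j z)%:E = T%:E)%E.
  rewrite fubini_tonelli1//; [|exact/measurable_EFinP|by move=> z; rewrite lee_fin].
  transitivity (\int[P]_w T%:E)%E.
    by apply: eq_integral => w _; exact: (slot_length 0 T0).
  rewrite integral_cst//; transitivity (T%:E * 1)%E; last by rewrite mule1.
  by congr (_ * _)%E; exact: probability_setT.
have ig N : (\int[P \x leb]_z g N z <= (T - c)%:E)%E.
  have : (\int[P \x leb]_z (g N z + (s N z)%:E) = T%:E)%E.
    by rewrite -ij; apply: eq_integral => z _; rewrite /g -EFinD subrK.
  have sE0 z : (0 <= (s N z)%:E)%E by case: z => w t; rewrite lee_fin; case/andP: (s01 N w t).
  rewrite (ge0_integralD (P \x leb)%E measurableT (fun z _ => g0 N z) (mg N) (fun z _ => sE0 z) (msE N)).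
  rewrite sampled_integral//; last exact: mesh_gt0.
  have [_] := Hc (N0 + N)%N (leq_addr _ _).
  move: (Uop _ _ _ _ _ _ _) (integral _ _ _) => [u| |] [v| |] //=.
  by rewrite lee_fin => cu -[E]; rewrite lee_fin; lra.
have iL : (\int[P \x leb]_z L z <= (T - c)%:E)%E.
  apply: (le_trans (@fatou _ _ _ (P \x leb)%E setT measurableT g mg (fun N z _ => g0 N z))).
  by apply: limn_einf_le => N; exact: ig.
pose K z := ((j z)%:E - L z)%E.
have mK : measurable_fun setT K by apply: emeasurable_funB => //; exact/measurable_EFinP.
have K0 z : (0 <= K z)%E by rewrite /K; have := Lj z; rewrite -(fineK (Lf z)) lee_fin -EFinB lee_fin subr_ge0.
have iK : (c%:E <= \int[P \x leb]_z K z)%E.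
  have : (\int[P \x leb]_z (K z + L z) = T%:E)%E.
    by rewrite -ij; apply: eq_integral => z _; rewrite /K subeK.
  rewrite (ge0_integralD (P \x leb)%E measurableT (fun z _ => K0 z) mK (fun z _ => L0 z) mL); move: iL (integral_ge0 (P \x leb)%E (fun z (_ : setT z) => L0 z))
     (integral_ge0 (P \x leb)%E (fun z (_ : setT z) => K0 z)).
  have aux (p q : \bar R) : (p <= (T - c)%:E -> 0 <= p -> 0 <= q -> q + p = T%:E -> c%:E <= q)%E.
    by case: p q => [p| |] [q| |] //=; rewrite !lee_fin => pT p0 q0 [E]; lra.
  exact: aux.
apply: (le_trans iK); rewrite fubini_tonelli1// occupationE.
apply: ge0_le_lower_integral => w _; first by apply: integral_ge0 => t _.
apply: ge0_le_lower_integral => t _ //.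
rewrite /hit indicE; case: (boolP (_ \in _)) => [_|nh].
  rewrite /K leeBlDr//; apply: (@le_trans _ _ 1%E).
    by rewrite /j lee_fin indicE; case: (_ \in _).
  by rewrite -[leLHS]adde0 leeD.
suff : ((j (w, t))%:E <= L (w, t))%E by move=> H; rewrite /K; move: H; rewrite -(fineK (Lf _)) lee_fin -EFinB lee_fin subr_le0.
have [t0|t0] := leP 0 t; last first.
  rewrite /j indicE memNset ?L0// /J /slot /= in_itv /= mul0r => /andP[a _].
  by rewrite leNgt t0 in a.
have avoid (C : set 'rV[R]_d) r : closed C -> 0 <= r -> ~ C (Xp W S x r w) ->
    exists N1, forall N, (N1 <= N)%N -> ~ C (walk W S (mesh R (N0 + N)) x (Num.truncn (r / mesh R (N0 + N))).+1 w).
  move=> cC r0 Cr; have [e e0 He] := path_right (closed_openC cC) r0 Cr.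
  have [N1 HN1] := mesh_small e0; exists N1 => N NN.
  have h0 := mesh_gt0 R (N0 + N); have /andP[n1 n2] := next_gt h0 r0.
  have hN : mesh R (N0 + N) < e by apply: HN1; exact: leq_trans NN (leq_addl _ _).
  by apply: He; [exact: ltW|apply: (le_lt_trans n2); rewrite ltrD2l].
have [N1 HN1] : exists N1, forall N, (N1 <= N)%N -> s N (w, t) = 0.
  have [Ft|] := pselect (forall r, 0 <= r -> r <= t -> F (Xp W S x r w)).
    have At : ~ A' (Xp W S x t w).
      move=> At; move/negP: nh; apply; apply/mem_set; split=> //; last exact: AA.
      by apply: exit_gt => // r r0 rt; apply: FD; exact: Ft.
    have [N1 HN1] := avoid _ _ cA t0 At; exists N1 => N NN.
    by rewrite /s sampledE ?mesh_gt0// stay1P indicE memNset ?mulr0 ?if_same//; exact: HN1.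
  move=> /existsNP[r /not_implyP[r0 /not_implyP[rt Fr]]].
  have [N1 HN1] := avoid _ _ cF r0 Fr; exists N1 => N NN.
  have h0 := mesh_gt0 R (N0 + N).
  rewrite /s sampledE// stay1P; case: pselect => [H|_] /=; last by rewrite mul0r if_same.
  case: (HN1 N NN); apply: H; rewrite /= ltnS; apply: le_truncn.
  by rewrite ler_pM2r ?invr_gt0.
by apply: (@limn_einf_ge _ _ _ N1) => N NN; rewrite /g HN1// subr0.
Qed.

End Sampling.

(** * Potentials and occupation times in C^{1,1} sets *)

Section Domain.
Context {R : realType} {d : nat}.
Variables (X : timechange R) (M : refmeasure R d) (D : set 'rV[R]_d) (r0 L0 : R).
Hypotheses (d0 : (0 < d)%N) (C11 : C11_open D r0 L0) (bD : bounded_set_e D).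
Notation m := (refm M).
Notation U := (Uop X M).
Let one : Borel R d -> \bar R := fun=> 1%E.
Let n1 : nonneg one. Proof. exact: nonneg_cst ler01. Qed.

Lemma ball_radius : exists r : R, [/\ 0 < r, 4 * r * L0 <= 1 & 4 * r <= r0].
Proof.
case: C11 => _ [r00 [L00 _]]; exists (Num.min (4 * L0)^-1 (r0 / 4)).
have L4 : 0 < 4 * L0 by rewrite mulr_gt0.
split; first by rewrite lt_min invr_gt0 L4 divr_gt0.
- rewrite mulrAC -ler_pdivlMl// mulr1 ge_min lexx//.
- by rewrite mulrC -ler_pdivlMr// ge_min lexx orbT.
Qed.

Lemma open_domain : open D. Proof. by case: C11. Qed.

Lemma measurable_open (A : set 'rV[R]_d) : open A -> measurable (A : set (Borel R d)).
Proof. exact: sub_sigma_algebra. Qed.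

Let mD : measurable (D : set (Borel R d)) := measurable_open open_domain.

Lemma bounded_finite : (m D < +oo)%E.
Proof.
have [K K0 DK] := bounded_cube bD.
apply: le_lt_trans (heat_ref_cube K (refm_heat M)); apply: le_measure => //; rewrite inE//.
exact: measurable_open (@open_cube _ _ _ _).
Qed.

Let finD := bounded_finite.

Lemma delta_out (x : 'rV[R]_d) : ~ D x -> delta D x = 0.
Proof.
move=> Dx; apply/eqP; rewrite eq_le (delta_ge0 Dx) andbT.
apply: (le_trans (delta_le x Dx)); rewrite enorm_le//.
by rewrite subrr /dotp big1 ?expr0n// => i _; rewrite mxE mul0r.
Qed.

Definition core (k : R) : set 'rV[R]_d := [set x | k <= delta D x].

Lemma core_sub k : 0 < k -> core k `<=` D.
Proof. by move=> k0 x; rewrite /core /= => kx; apply: contrapT => /delta_out E; move: kx; rewrite E leNgt k0. Qed.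

Lemma core_le k k' : k' <= k -> core k `<=` core k'.
Proof. by move=> kk x; exact: le_trans. Qed.

Lemma closed_core k : closed (core k).
Proof.
have [w0 w0D] := bounded_proper bD d0.
rewrite (_ : core k = ~` [set x | delta D x < k]); first exact/open_closedC/(open_delta_lt w0D).
by apply/seteqP; split=> x; rewrite /core /= leNgt => /negP.
Qed.

Lemma measurable_core k : measurable (core k : set (Borel R d)).
Proof. by rewrite -[core k]setCK; apply: measurableC; apply: measurable_open; exact: (closed_openC (@closed_core k)). Qed.

Lemma one_dist : exists2 C : R, 0 < C & forall eps : R, 0 < eps -> exists2 h0 : R, 0 < h0 &
  forall h n x, 0 < h -> h <= h0 -> D x -> (U h D n one x <= (C * (2 * delta D x + eps))%:E)%E.
Proof.
have [w0 w0D] := bounded_proper bD d0; have [K HK] := bounded_sqd bD w0.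
have [r [rp rL rr]] := ball_radius.
have [R2 R20 ext] := exterior_ball d0 C11 rp rL rr w0D HK.
have dl0 (x : 'rV[R]_d) : 0 <= 2 * delta D x by rewrite mulr_ge0// (delta_ge0 w0D).
exact: (Uop_one_dist X mD d0 finD rp R20 dl0 ext).
Qed.

Lemma upper_dist (eta : R) : 0 < eta -> exists2 C : R, 0 < C &
  forall eps : R, 0 < eps -> exists2 h0 : R, 0 < h0 &
  forall h n f A N x, 0 < h -> h <= h0 -> nonneg f -> (forall y, ~ A y -> f y = 0%E) ->
  (\int[m]_(y in D) (f y * (2 * delta D y + eps)%:E) <= N%:E)%E -> D x -> far eta x A ->
  (U h D n f x <= (C * N * (2 * delta D x + eps))%:E)%E.
Proof.
move=> eta0; have [w0 w0D] := bounded_proper bD d0; have [K HK] := bounded_sqd bD w0.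
have [r [rp rL rr]] := ball_radius.
have [R2 R20 ext] := exterior_ball d0 C11 rp rL rr w0D HK.
have dl0 (x : 'rV[R]_d) : 0 <= 2 * delta D x by rewrite mulr_ge0// (delta_ge0 w0D).
have mdl : measurable_fun setT ((fun x => 2 * delta D x) : Borel R d -> R).
  by apply: measurable_funM => //; exact: (measurable_delta w0D).
exact: (Uop_upper X mD d0 finD rp R20 dl0 mdl ext eta0).
Qed.

(** A point outside the core is within [k] of the complement, so by [one_dist] at most a multiple of
    [k] of time remains; [Uop_subset_le] turns this into the error. *)
Lemma core_approx : exists2 C : R, 0 < C & forall k : R, 0 < k -> exists2 h0 : R, 0 < h0 &
  forall h n f x, 0 < h -> h <= h0 -> nonneg f -> (forall y, (f y <= 1)%E) ->
  (U h D n f x <= U h (core k) n f x + (C * k)%:E)%E.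
Proof.
have [C C0 HC] := one_dist; exists (1 + 3 * C); first by lra.
move=> k k0; have [h0 h00 H] := HC k k0; exists (Num.min h0 k); first by rewrite lt_min h00.
move=> h n f x hp; rewrite le_min => /andP[hh hk] nf f1.
apply: Uop_subset_le => //; [exact: measurable_core|exact: core_sub|by rewrite mulr_ge0 ?(ltW k0)//; lra|].
move=> j y Dy /negP; rewrite /core /= -ltNge => yk.
apply: (@le_trans _ _ (h%:E + (C * (2 * delta D y + k))%:E)%E).
  apply: leeD; first by rewrite -[leRHS]mule1; apply: lee_wpmul2l => //; rewrite lee_fin ltW.
  by apply: (le_trans (Uop_le X M hp mD j y nf n1 f1)); exact: H.
rewrite -EFinD lee_fin; have : C * (2 * delta D y + k) <= C * (3 * k) by rewrite ler_pM2l//; lra.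
by lra.
Qed.

Lemma Uop_subset h n F F' f x : 0 < h -> measurable F -> measurable F' -> F `<=` F' -> nonneg f ->
  (U h F n f x <= U h F' n f x)%E.
Proof.
move=> h0 mF mF' FF nf; elim: n x => [x|n IH x]; first exact: lexx.
have nS := Usrc_nonneg X M h0 mF n nf; have nS' := Usrc_nonneg X M h0 mF' n nf.
apply: (@le_trans _ _ (Qop X M h F' (fun y => h%:E * f y + U h F n f y)%E x)); first exact: Qop_leF.
by apply: Qop_le => // y _; apply: leeD.
Qed.

(** After [j] steps survival has probability at most [gmax] at the elapsed time multiplied by the
    volume of [D], and the potential still to come is at most the mean lifetime. *)
Lemma Uop_tail : exists2 C : R, 0 < C & forall h j n f x, 0 < h -> h <= 1 -> nonneg f ->
  (forall y, (f y <= 1)%E) -> (0 < j)%N ->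
  (U h D n f x <= U h D j f x + (C * gmax (d := d) (j%:R * h))%:E)%E.
Proof.
have [C C1 HC] := Uop_one_bounded X mD d0 finD.
pose V := fine (m D); have mV : m D = V%:E by rewrite fineK// ge0_fin_numE.
have V0 : 0 <= V by rewrite -lee_fin -mV.
exists (C * (V + 1)); first by rewrite mulr_gt0//; lra.
move=> h j n f x h0 h1 nf f1 j0.
have C0 : 0 <= C by lra.
apply: (@le_trans _ _ (U h D (j + n) f x)); first by apply: Uop_mono => //; exact: leq_addl.
rewrite (UopD X M h0 mD)//; apply: leeD => //.
have nU := Uop_nonneg X M h0 mD n nf.
apply: (@le_trans _ _ (iter j (Qop X M h D) (fun y => C%:E * one y)%E x)).
  apply: Qiter_le => //; first exact: nonneg_scale.
  by move=> y; rewrite mule1; apply: (le_trans (Uop_le X M h0 mD n y nf n1 f1)); exact: HC.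
rewrite (iterQZ X M h0 mD j x C0 n1).
have [j' jE] : exists j', j = j'.+1 by case: (j) j0 => // j' _; exists j'.
have jh : 0 < j'.+1%:R * h by rewrite mulr_gt0.
have := @Qiter_bound _ _ X M D mD h j' one x (gmax (d := d) (j%:R * h)) V h0 n1 (gmax_ge0 _).
rewrite jE => H; rewrite -mulrA EFinM; apply: lee_wpmul2l => //.
apply: (le_trans (H _ _)).
- by move=> y _ _; exact: kern_le_gmax.
- by rewrite integral_cst// mul1e mV.
- by rewrite lee_fin mulrC ler_wpM2r ?gmax_ge0//; lra.
Qed.

Section Ball.
Variables (r : R).
Hypotheses (rp : 0 < r) (rL : 4 * r * L0 <= 1) (rr0 : 4 * r <= r0).

Lemma gmax_pow2 (e : R) : 0 < e -> exists a : nat, forall T, 2 ^+ a <= T -> gmax (d := d) T <= e.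
Proof.
move=> e0; have [T T1 gT] := gmax_small d0 e0.
exists (Num.truncn T).+1 => T' TT; apply: le_trans gT; apply: gmax_le; first by lra.
apply: le_trans TT; apply: ltW; apply: (lt_le_trans (truncnS_gt _)).
by rewrite -natrX ler_nat; exact: ltnW (ltn_expl _ _).
Qed.

(** With [e = c0 r delta D y], moving from [y] to a nearby [y'] leaves [e / 2]; the step size, the
    tail and the passage to the core cost [e / 8] each. The remaining [e / 8] is [l delta D y], with
    [l] independent of [y], while the scales [rho], [k], [h0], [a] may depend on it. *)
Lemma hopf_core (q2 : R) : 0 < q2 -> exists2 l : R, 0 < l &
  forall y, D y -> delta D y <= r / 8 -> exists c, [/\ D c, eball c (r ^+ 2) `<=` D &
    exists rho k h0 (a : nat), [/\ 0 < rho, 0 < k, 0 < h0 &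
    forall h n k' y', 0 < h -> h <= h0 -> 2 ^+ a <= n%:R * h -> k' <= k -> cube y rho y' ->
    ((l * delta D y)%:E <= U h (core k') n (fun z => (\1_(eball c q2) z)%:E) y')%E]].
Proof.
move=> q20; have [w0 w0D] := bounded_proper bD d0.
pose V := fine (m D); have mV : m D = V%:E by rewrite fineK// ge0_fin_numE.
have V0 : 0 <= V by rewrite -lee_fin -mV.
have [c0 [h1 [c00 h10 H]]] := hopf_bound X M V (exprn_gt0 2 rp) q20.
have [C1 C10 HC1] := core_approx.
exists (c0 * r / 8); first by rewrite divr_gt0// mulr_gt0.
move=> y Dy yr; have dp := delta_gt0 open_domain w0D Dy.
have [c cD cy] := interior_ball d0 C11 rp rL rr0 w0D Dy yr.
have Dc : D c by apply: cD; rewrite /eball /= sqdxx exprn_gt0.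
exists c; split=> //.
pose e := c0 * r * delta D y; have e0 : 0 < e by rewrite /e !mulr_gt0.
have [rho rho0 Hrho] : exists2 rho : R, 0 < rho &
    forall y', cube y rho y' -> r * delta D y / 2 <= r ^+ 2 - sqd y' c.
  have yin : eball c (r ^+ 2 - r * delta D y / 2) y.
    rewrite /eball /=; have : 0 < r * delta D y by rewrite mulr_gt0.
    by move: (sqd y c) cy => q cy rd; lra.
  have [rho rho0 Hr] := (open_rV_ballP _).1 (@open_eball _ _ c (r ^+ 2 - r * delta D y / 2)) y yin.
  by exists rho => // y' /Hr; rewrite /eball /=; move: (sqd y' c) => q h; lra.
have e8 : 0 < e / (8 * (V + 1)) by rewrite divr_gt0// mulr_gt0//; lra.
have [a Ha] := gmax_pow2 e8.
have k0 : 0 < e / (8 * C1) by rewrite divr_gt0// mulr_gt0.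
have [h2 h20 H2] := HC1 _ k0.
exists rho, (e / (8 * C1)), (Num.min (Num.min h1 h2) (e / 8)), a; split=> //.
  by rewrite !lt_min h10 h20 divr_gt0.
move=> h n k' y' h0; rewrite !le_min => /andP[/andP[hh1 hh2] he] an kk yy.
have nq : nonneg (fun z : Borel R d => (\1_(eball c q2) z : R)%:E).
  by apply: nonneg_indic; exact: measurable_eball.
have q1 (z : Borel R d) : ((\1_(eball c q2) z : R)%:E <= 1)%E.
  by rewrite lee_fin indicE; case: (_ \in _).
have A1 := H D c h n y' mD cD _ h0 hh1; rewrite mV lexx in A1; have {}A1 := A1 isT.
have A2 := H2 h n _ y' h0 hh2 nq q1.
have A3 : (U h (core (e / (8 * C1))) n (fun z => (\1_(eball c q2) z)%:E) y' <=
    U h (core k') n (fun z => (\1_(eball c q2) z)%:E) y')%E.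
  by apply: Uop_subset => //; [exact: measurable_core|exact: measurable_core|exact: core_le].
have B1 : c0 * (r * delta D y / 2) <= c0 * (r ^+ 2 - sqd y' c) by rewrite ler_pM2l// Hrho.
have B2 : gmax (d := d) (n.+1%:R * h) * V <= e / 8.
  have : gmax (d := d) (n.+1%:R * h) <= e / (8 * (V + 1)).
    by apply: Ha; apply: (le_trans an); rewrite ler_pM2r// ler_nat.
  rewrite ler_pdivlMr; last by rewrite mulr_gt0//; lra.
  by move: (gmax _) (gmax_ge0 (d := d) (n.+1%:R * h)) => G G0; nra.
have B3 : C1 * (e / (8 * C1)) = e / 8 by field; rewrite gt_eqF.
rewrite B3 in A2.
have : ((c0 * (r * delta D y / 2))%:E <= U h (core k') n (fun z => (\1_(eball c q2) z)%:E) y' + (e / 8 + (e / 8 + e / 8))%:E)%E.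
  apply: (le_trans _ (le_trans A1 _)); first by rewrite lee_fin.
  rewrite [in leRHS]EFinD addeA; apply: leeD; last by rewrite lee_fin; apply: lerD.
  by apply: (le_trans A2); exact: leeD.
have aux (u : \bar R) (p q s : R) : (p%:E <= u + q%:E -> (s + q <= p)%R -> s%:E <= u)%E.
  by case: u => [u| |]; rewrite ?leey// -?EFinD !lee_fin => *; lra.
by move=> /aux; apply; rewrite /e; move: (delta D y) => dl; lra.
Qed.

End Ball.

End Domain.

Section Metric.
Context {R : realType} {d : nat}.
Implicit Types (x y z p : 'rV[R]_d) (D : set 'rV[R]_d).

Lemma delta_near D w0 y z : ~ D w0 -> sqd z y <= delta D y ^+ 2 / 4 -> delta D y / 2 <= delta D z.
Proof.
move=> w0D zy; apply: lb_le_inf; first by exists (enorm (z - w0)), w0.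
move=> _ [w Dw <-].
have dy0 := delta_ge0 w0D y; have h := delta_le y Dw.
rewrite -(@ler_pXn2r _ 2)// ?nnegrE ?enorm_ge0 ?divr_ge0// -sqd_enorm expr_div_n.
have h2 : delta D y ^+ 2 <= sqd y w.
  by rewrite sqd_enorm; apply: lerXn2r; rewrite ?nnegrE ?enorm_ge0.
have := sqd_triangle y z w; rewrite (sqd_sym y z); have -> : (2 : R) ^+ 2 = 4 by ring.
by lra.
Qed.

Lemma delta_center D w0 p s : ~ D w0 -> 0 <= s -> eball p (s ^+ 2) `<=` D -> s <= delta D p.
Proof.
move=> w0D s0 H; apply: lb_le_inf; first by exists (enorm (p - w0)), w0.
move=> _ [w Dw <-]; rewrite leNgt; apply/negP => ws; apply: Dw; apply: H.
rewrite /eball /= sqd_sym sqd_enorm ltr_pXn2r ?nnegrE ?enorm_ge0//.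
Qed.

Lemma sqd_bounded D p K : (forall x, D x -> sqd x p <= K) -> bounded_set_e D.
Proof.
move=> DK; exists (2 * `|K| + 2 * sqd p 0 + 1) => x Dx.
have K0 := normr_ge0 K; have p0 := sqd_ge0 p 0.
rewrite enorm_le; last by lra.
have := sqd_triangle x p 0; rewrite /(sqd x 0) subr0; have := DK x Dx; have := ler_norm K.
by move: (sqd p 0) (sqd x p) (`|K|) (dotp x x) p0 K0 => a b k q a0 k0 *; nra.
Qed.

Lemma eball_bounded p s : bounded_set_e (eball p s).
Proof. by apply: (@sqd_bounded _ p s) => x; rewrite /eball /=; exact: ltW. Qed.

Lemma cube_bounded p (s : R) : bounded_set_e (cube p s).
Proof.
apply: (@sqd_bounded _ p (d%:R * `|s| ^+ 2)) => x xs; apply: sqd_cube => // i.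
by apply: (lt_le_trans (xs i)); exact: ler_norm.
Qed.

Lemma core_exhaust (m : {measure set (Borel R d) -> \bar R}) D (g : \bar R) (c : R) : (0 < d)%N ->
  open D -> bounded_set_e D -> 0 < c ->
  (forall k : R, 0 < k -> (c%:E * m (core D k) <= g)%E) -> (c%:E * m D <= g)%E.
Proof.
move=> d0 oD bD c0 H; have [w0 w0D] := bounded_proper bD d0.
pose A (i : nat) : set (Borel R d) := core D (i.+1%:R^-1).
have mA i : measurable (A i) by exact: measurable_core.
have AD : \bigcup_i A i = D.
  apply/seteqP; split=> [x [i _]|x Dx]; first by apply: core_sub; rewrite ?invr_gt0.
  have dp := delta_gt0 oD w0D Dx; exists (Num.truncn (delta D x)^-1) => //.
  rewrite /A /core /= -[leRHS]invrK lef_pV2 ?posrE ?invr_gt0//; apply: ltW; exact: truncnS_gt.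
have mD : measurable (D : set (Borel R d)) by exact: measurable_open.
have ndA : nondecreasing_seq A.
  by move=> i j ij; apply/subsetPset; apply: core_le; rewrite lef_pV2 ?posrE// ler_nat.
have cv : m (A i) @[i --> \oo] --> m D.
  by rewrite -AD; apply: nondecreasing_cvg_mu => //; rewrite AD.
have cv2 : (c%:E * m (A i))%E @[i --> \oo] --> (c%:E * m D)%E by exact: cvgeZl.
rewrite -(cvg_lim _ cv2)//; apply: lime_le; first by apply/cvg_ex; exists (c%:E * m D)%E.
by apply: nearW => i; apply: H; rewrite invr_gt0.
Qed.

Lemma eball_finite (M : refmeasure R d) p s : (refm M (eball p s) < +oo)%E.
Proof.
have [K K0 HK] := bounded_cube (@eball_bounded p s).
apply: le_lt_trans (heat_ref_cube K (refm_heat M)); apply: le_measure => //; rewrite inE.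
  exact: measurable_eball.
exact: measurable_open (@open_cube _ _ _ _).
Qed.

End Metric.

Lemma mesh_pow (R : realType) k N : (2 ^ (k + N))%N%:R * mesh R N = 2 ^+ k.
Proof. by rewrite /mesh exprVn natrX exprD mulfK// gt_eqF// exprn_gt0. Qed.

Lemma le_sum4 (a b c e N : nat) : (a + b + c + e <= N)%N ->
  [/\ (a <= N)%N, (b <= N)%N, (c <= N)%N & (e <= N)%N].
Proof. by move=> h; split; lia. Qed.

Lemma lt_sum3 (a b c N : nat) : ((a + b + c).+1 <= N)%N -> [/\ (a <= N)%N, (b < N)%N & (c < N)%N].
Proof. by move=> h; split; lia. Qed.

Section Lower.
Context {R : realType} {d : nat} {dO : measure_display} {Omega : measurableType dO}.
Variables (P : probability Omega R) (W : R -> Omega -> 'rV[R]_d) (S : R -> Omega -> R) (mu0 : R -> R).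
Hypotheses (lv : levy_density mu0) (bW : brownian P W) (sS : subordinator P S mu0)
  (indWS : independent_WS P W S).
Variables (M : refmeasure R d) (D : set 'rV[R]_d) (r0 L0 : R) (x0 : 'rV[R]_d).
Hypotheses (d0 : (0 < d)%N) (C11 : C11_open D r0 L0) (bD : bounded_set_e D) (Dx0 : D x0).
Notation X := (process_timechange lv sS).
Notation m := (refm M).
Notation U h F n f := (Uop X M h F n f).
Notation ind A := (fun z : Borel R d => (\1_A z : R)%:E).
Notation occ A := (occupation P W S D A x0).

Let oD : open D := open_domain C11.
Let mD : measurable (D : set (Borel R d)) := measurable_open oD.

Let ind1 (A : set 'rV[R]_d) (z : Borel R d) : ((\1_A z : R)%:E <= 1)%E.
Proof. by rewrite lee_fin indicE; case: (_ \in _). Qed.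

Let ind_le (A B : set 'rV[R]_d) (z : Borel R d) : A `<=` B -> ((\1_A z : R)%:E <= (\1_B z : R)%:E)%E.
Proof.
move=> AB; rewrite lee_fin !indicE; case: (boolP (z \in A)) => [/set_mem/AB zB|_]; last exact: ler0n.
by rewrite mem_set.
Qed.

(** By contraposition of [occupation_le], a positive occupation time keeps the walk potentials above
    some [b] for all large [N]; tail and core errors are then below [b / 4] each. One integer [K]
    serves as lower bound, depth of the core and time horizon, so that finitely many sets admit a
    common value. *)
Lemma occupation_pos (B : set 'rV[R]_d) : open B -> (0 < occ B)%E -> exists K0, forall K, (K0 <= K)%N ->
  exists N1, forall N, (N1 <= N)%N ->
  ((K.+1%:R^-1)%:E <= U (mesh R N) (core D K.+1%:R^-1) (2 ^ (K + N)) (ind B) x0)%E.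
Proof.
move=> oB occ0; have nB : nonneg (ind B) by apply: nonneg_indic; exact: measurable_open.
have [b b0 bocc] : exists2 b : R, 0 < b & (b%:E < occ B)%E.
  move: occ0; case: (occ B) => [g| |//]; last by exists 1 => //; rewrite ltry.
  by rewrite lte_fin => g0; exists (g / 2); rewrite ?lte_fin; lra.
have [N0 HN0] : exists N0, forall N, (N0 <= N)%N -> (b%:E < U (mesh R N) D (4 ^ N) (ind B) x0)%E.
  apply: contrapT => /forallNP H; have : (occ B <= b%:E)%E; last by rewrite leNgt bocc.
  apply: (@occupation_le R d dO Omega P W S mu0 lv bW sS indWS M D B x0 b oD oB) => N0.
  have /existsNP[N /not_implyP[NN /negP]] := H N0; rewrite -leNgt => h; by exists N.
have [C C0 HC] := Uop_tail X M d0 C11 bD; have [C1 C10 HC1] := core_approx X M d0 C11 bD.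
have e0 : 0 < b / (4 * C) by rewrite divr_gt0// mulr_gt0.
have [a Ha] := gmax_pow2 d0 e0.
exists (a + Num.truncn (4 * C1 / b) + Num.truncn (2 / b)).+1%N => K /lt_sum3[Ka Kb Kc].
have k0 : 0 < K.+1%:R^-1 :> R by rewrite invr_gt0.
have KC (q : R) : (Num.truncn q < K)%N -> 0 <= q -> q * K.+1%:R^-1 <= 1.
  move=> qK q0; rewrite ler_pdivrMr// mul1r; apply: ltW; apply: (lt_le_trans (truncnS_gt _)).
  by rewrite ler_nat; apply: leqW.
have e1 : C1 * K.+1%:R^-1 <= b / 4.
  have : 4 * C1 / b * K.+1%:R^-1 <= 1 by apply: KC => //; rewrite divr_ge0 ?(ltW b0)// mulr_ge0// ltW.
  by rewrite mulrAC ler_pdivrMr// mul1r; move: (K.+1%:R^-1) => k; lra.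
have e2 : K.+1%:R^-1 <= b / 2.
  have : 2 / b * K.+1%:R^-1 <= 1 by apply: KC => //; rewrite divr_ge0 ?(ltW b0).
  by rewrite mulrAC ler_pdivrMr// mul1r; move: (K.+1%:R^-1) => k; lra.
have [h0 h00 H] := HC1 _ k0.
have [N1 HN1] := mesh_small (ltr01 : 0 < 1 :> R); have [N2 HN2] := mesh_small h00.
exists (N0 + N1 + N2 + 0)%N => N /le_sum4[NN0 NN1 NN2 _]; have hp := mesh_gt0 R N.
have A1 := HN0 N NN0.
have j0 : (0 < 2 ^ (K + N))%N by rewrite expn_gt0.
have A2 := HC (mesh R N) (2 ^ (K + N))%N (4 ^ N)%N _ x0 hp (ltW (HN1 N NN1)) nB (@ind1 B) j0.
have A3 := H (mesh R N) (2 ^ (K + N))%N _ x0 hp (ltW (HN2 N NN2)) nB (@ind1 B).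
rewrite mesh_pow in A2.
have G : C * gmax (d := d) (2 ^+ K) <= b / 4.
  have : gmax (d := d) (2 ^+ K) <= b / (4 * C).
    by apply: Ha; rewrite -!natrX ler_nat leq_exp2l.
  by rewrite ler_pdivlMr ?mulr_gt0//; lra.
have {}A1 : (b%:E <= U (mesh R N) (core D K.+1%:R^-1) (2 ^ (K + N)) (ind B) x0 + (b / 4 + b / 4)%:E)%E.
  apply: (le_trans (ltW A1)); apply: (le_trans A2); rewrite [in leRHS]EFinD addeA; apply: leeD.
    by apply: (le_trans A3); apply: leeD => //; rewrite lee_fin.
  by rewrite lee_fin.
move: A1 e2; move: (K.+1%:R^-1) (U _ _ _ _ _) => k [u| |]; rewrite ?leey// -?EFinD ?lee_fin => *; lra.
Qed.

(** From [x0] to [B], then from [B] to [A]. Symmetry turns the lower bound [v] for the potential of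
    [B] on [A] into one for the average over [B] of the potential of [A]; [near] makes it pointwise
    on [B], at the cost of 1/12; [Uop_Uop] attaches the time spent in [B] from [x0]. *)
Lemma lower_chain (F A B : set (Borel R d)) h n1 n2 n (t v b : R) p : 0 < h -> measurable F ->
  measurable A -> measurable B -> A `<=` F -> B = eball p t ->
  (forall f x, nonneg f -> (\int[m]_(y in eball p t) f y < +oo)%E -> eball p t x ->
   ((1 / 12)%:E * \int[m]_(y in eball p t) f y <= iter n2 (Qop X M h F) f x)%E) ->
  0 <= v -> 0 <= b -> (forall y, A y -> (v%:E <= U h F n (ind B) y)%E) -> (m A < +oo)%E ->
  (b%:E <= U h F n1 (ind B) x0)%E ->
  ((v * fine (m A) / 12 * b)%:E <= (n1%:R * h)%:E * U h F (n1 + (n2 + n)) (ind A) x0)%E.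
Proof.
move=> h0 mF mA mB AF BE near v0 b0 vU mAy bU.
have nA : nonneg (ind A) := nonneg_indic mA; have nB : nonneg (ind B) := nonneg_indic mB.
have nU := Uop_nonneg X M h0 mF n nA.
pose a := fine (m A); have aE : m A = a%:E by rewrite fineK// ge0_fin_numE.
have a0 : 0 <= a by rewrite -lee_fin -aE.
have I1 : ((v * a)%:E <= \int[m]_(y in B) U h F n (ind A) y)%E.
  apply: (@le_trans _ _ (\int[m]_(y in F) ((\1_B y)%:E * U h F n (ind A) y))%E).
    rewrite (Uop_sym X M h0 mF n nA nB).
    apply: (@le_trans _ _ (\int[m]_(y in F) (v%:E * (\1_A y)%:E))%E).
      rewrite ge0_integralZl//; last first.
        by apply: measurable_funTS; exact: nA.1.
      by rewrite integral_indic// (setIidl AF) aE -EFinM.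
    apply: ge0_le_lower_integral => y Fy; first by rewrite -EFinM lee_fin mulr_ge0.
    rewrite indicE; case: (boolP (y \in A)) => [/set_mem Ay|_]; last by rewrite mule0 mul0e.
    by rewrite mule1 mul1e; exact: vU.
  rewrite (integral_mkcond F) (integral_mkcond B).
  apply: ge0_le_lower_integral => y _; rewrite !patchE; have [_ U0] := nU.
    by case: ifP => // _; rewrite mule_ge0// lee_fin.
  rewrite indicE; case: ifP => [_|_]; case: ifP => // _; rewrite ?mul1e ?mul0e//.
have fin : (\int[m]_(y in eball p t) U h F n (ind A) y < +oo)%E.
  apply: (@le_lt_trans _ _ (\int[m]_(y in eball p t) (n%:R * h)%:E)%E).
    apply: ge0_le_lower_integral => y _; first exact: nU.2.
    apply: (le_trans _ (Uop_one_le X M mF n y h0)).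
    by apply: Uop_le.
  rewrite integral_cst; last exact: measurable_eball.
  by rewrite lte_mul_pinfty ?lee_fin ?mulr_ge0 ?(ltW h0)//; exact: eball_finite.
have pt y : (((v * a / 12)%:E * (\1_B y)%:E) <= U h F (n2 + n) (ind A) y)%E.
  have [_ nU2] := Uop_nonneg X M h0 mF (n2 + n) nA.
  rewrite indicE; case: (boolP (y \in B)) => [/set_mem By|_]; last by rewrite mule0 nU2.
  rewrite mule1 UopD//; apply: (@le_trans _ _ (iter n2 (Qop X M h F) (U h F n (ind A)) y)).
    rewrite BE in By; apply: (le_trans _ (near _ _ nU fin By)).
    have -> : v * a / 12 = 1 / 12 * (v * a) by field.
    by rewrite EFinM -BE; apply: lee_wpmul2l => //; rewrite lee_fin.
  by rewrite leeDr//; exact: (Uop_nonneg X M h0 mF n2 nA).2.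
have va : 0 <= v * a / 12 by rewrite !mulr_ge0.
apply: (le_trans _ (Uop_Uop X M h0 mF n1 (n2 + n) x0 nA)).
apply: (@le_trans _ _ (U h F n1 (fun y => (v * a / 12)%:E * (\1_B y)%:E)%E x0)); last first.
  by apply: Uop_le => //; [exact: nonneg_scale|exact: Uop_nonneg].
by rewrite UopZ// EFinM; apply: lee_wpmul2l.
Qed.

(** [lower_chain] holds uniformly over fine meshes within the fixed horizon [2^K + 2 t + 2^a], so it
    passes to the process by [occupation_ge]. The division by [2^K] undoes the time factor of
    [Uop_Uop]. *)
Lemma chain_large (A B : set 'rV[R]_d) (v : R) (K a : nat) (k t : R) p :
  open B -> B = eball p t -> 0 < t -> closed A -> measurable (A : set (Borel R d)) ->
  (m A < +oo)%E -> 0 < v -> 0 < k -> k <= K.+1%:R^-1 -> A `<=` core D k ->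
  (exists h1, 0 < h1 /\ forall h n y, 0 < h -> h <= h1 -> 2 ^+ a <= n%:R * h -> A y ->
    (v%:E <= U h (core D k) n (ind B) y)%E) ->
  (exists N1, forall N, (N1 <= N)%N ->
    ((K.+1%:R^-1)%:E <= U (mesh R N) (core D K.+1%:R^-1) (2 ^ (K + N)) (ind B) x0)%E) ->
  (forall h, 0 < h -> h <= t -> exists n2, n2%:R * h <= 2 * t /\
    forall f x, nonneg f -> (\int[m]_(y in eball p t) f y < +oo)%E -> eball p t x ->
    ((1 / 12)%:E * \int[m]_(y in eball p t) f y <= iter n2 (Qop X M h (core D k)) f x)%E) ->
  forall A', A `<=` A' -> ((v * fine (m A) / 12 * K.+1%:R^-1 / 2 ^+ K)%:E <= occ A')%E.
Proof.
move=> oB BE t0 cA mA mAy v0 k0 kK AF [h1 [h10 H1]] [N1 HN1] near A' AA.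
have mF := measurable_core d0 bD k : measurable (core D k : set (Borel R d)).
have mB : measurable (B : set (Borel R d)) by exact: measurable_open.
have nA : nonneg (ind A) := nonneg_indic mA; have nB : nonneg (ind B) := nonneg_indic mB.
have [N2 HN2] := mesh_small h10; have [N3 HN3] := mesh_small t0.
have /choice[nn Hnn] : forall N, exists n, (N1 + N2 + N3 + 0 <= N)%N ->
    n%:R * mesh R N <= 2 ^+ K + (2 * t + 2 ^+ a) /\
    ((v * fine (m A) / 12 * K.+1%:R^-1 / 2 ^+ K)%:E <= U (mesh R N) (core D k) n (ind A) x0)%E.
  move=> N; have [/le_sum4[NN1 NN2 NN3 _]|] := boolP (N1 + N2 + N3 + 0 <= N)%N; last by exists 0%N.
  have hp := mesh_gt0 R N.
  have [n2 [n2t near2]] := near _ hp (ltW (HN3 N NN3)).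
  exists (2 ^ (K + N) + (n2 + 2 ^ (a + N)))%N => _; split.
    by rewrite !natrD !mulrDl !mesh_pow; lra.
  have bU : ((K.+1%:R^-1)%:E <= U (mesh R N) (core D k) (2 ^ (K + N)) (ind B) x0)%E.
    apply: (le_trans (HN1 N NN1)).
    exact: (Uop_subset X M _ x0 hp (measurable_core d0 bD _) mF (core_le kK) nB).
  have vU y : A y -> (v%:E <= U (mesh R N) (core D k) (2 ^ (a + N)) (ind B) y)%E.
    move=> Ay; apply: H1 => //; last by rewrite mesh_pow.
    exact: ltW (HN2 N NN2).
  have b0 : 0 <= K.+1%:R^-1 :> R by rewrite invr_ge0.
  have := lower_chain hp mF mA mB AF BE near2 (ltW v0) b0 vU mAy bU.
  rewrite mesh_pow; have p0 : 0 < 2 ^+ K :> R by rewrite exprn_gt0.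
  move: (U _ _ _ _ _) (2 ^+ K) p0 (v * _ / 12 / _) => [u| |] q q0 s; rewrite ?leey//.
    by rewrite -EFinM !lee_fin ler_pdivrMr// mulrC.
  by rewrite gt0_muleNy ?lte_fin.
apply: (@occupation_ge R d dO Omega P W S mu0 lv bW sS indWS M D (core D k) A' A x0
  (2 ^+ K + (2 * t + 2 ^+ a)) _ nn (N1 + N2 + N3 + 0)%N oD) => //.
- exact: closed_core.
- exact: core_sub.
- by rewrite !addr_ge0 ?exprn_ge0// mulr_ge0// ltW.
Qed.

(** If no time is spent in [B], some fine mesh has a small potential of [B'] at [x0]. Points of [A]
    see [B'] with potential at least [v], so chaining makes the potential of [A] small too; its tail
    and core errors are at most [e / 3] each. *)
Lemma chain_zero (A B B' : set 'rV[R]_d) (v k1 : R) (a : nat) :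
  open A -> closed B' -> B' `<=` B -> occ B = 0%E -> 0 < v -> 0 < k1 ->
  (exists h1, 0 < h1 /\ forall h n k y, 0 < h -> h <= h1 -> 2 ^+ a <= n%:R * h -> 0 < k -> k <= k1 -> A y ->
    (v%:E <= U h (core D k) n (ind B') y)%E) ->
  occ A = 0%E.
Proof.
move=> oA cB BB occB v0 k10 [h1 [h10 H1]].
have mA : measurable (A : set (Borel R d)) := measurable_open oA.
have mB : measurable (B' : set (Borel R d)).
  by rewrite -[B']setCK; apply: measurableC; apply: measurable_open; exact: (closed_openC cB).
have nA : nonneg (ind A) := nonneg_indic mA; have nB : nonneg (ind B') := nonneg_indic mB.
apply/eqP; rewrite eq_le; apply/andP; split; last first.
  by apply: integral_ge0 => w _; apply: integral_ge0 => s _; rewrite lee_fin.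
apply/lee_addgt0Pr => e e0; rewrite add0e.
have [C C0 HC] := Uop_tail X M d0 C11 bD; have [C1 C10 HC1] := core_approx X M d0 C11 bD.
have e3 : 0 < e / (3 * C) by rewrite divr_gt0// mulr_gt0.
have [j Hj] := gmax_pow2 d0 e3.
pose k := Num.min k1 (e / (3 * C1)).
have k0 : 0 < k by rewrite lt_min k10 divr_gt0// mulr_gt0.
have mF := measurable_core d0 bD k : measurable (core D k : set (Borel R d)).
have [h2 h20 H2] := HC1 _ k0.
have [N1 HN1] := mesh_small (ltr01 : 0 < 1 :> R); have [N2 HN2] := mesh_small h20.
have [N3 HN3] := mesh_small h10.
pose c := e * v / (3 * 2 ^+ j).
have p0 : 0 < 2 ^+ j :> R by rewrite exprn_gt0.
have c0 : 0 < c by rewrite divr_gt0 ?mulr_gt0.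
apply: (@occupation_le R d dO Omega P W S mu0 lv bW sS indWS M D A x0 e oD oA) => N0.
pose nn N := (2 ^ (j + N) + 2 ^ (a + N))%N.
have [N NN UN] : exists2 N, (N0 + N1 + N2 + N3 <= N)%N &
    (U (mesh R N) (core D k) (nn N) (ind B') x0 < c%:E)%E.
  apply: contrapT => H; have : (c%:E <= occ B)%E; last by rewrite occB lee_fin leNgt c0.
  apply: (@occupation_ge R d dO Omega P W S mu0 lv bW sS indWS M D (core D k) B B' x0
    (2 ^+ j + 2 ^+ a) c nn (N0 + N1 + N2 + N3)%N oD) => //.
  - exact: closed_core.
  - exact: core_sub.
  move=> N NN; split; first by rewrite natrD mulrDl !mesh_pow.
  by rewrite leNgt; apply/negP => uc; apply: H; exists N.
have [NN0 NN1 NN2 NN3] := le_sum4 NN; exists N => //.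
have hp := mesh_gt0 R N; have h1N : mesh R N <= 1 := ltW (HN1 N NN1).
have A1 : (v%:E * U (mesh R N) (core D k) (2 ^ (j + N)) (ind A) x0 <= (2 ^+ j * c)%:E)%E.
  apply: (@le_trans _ _ (((2 ^ (j + N))%N%:R * mesh R N)%:E * U (mesh R N) (core D k) (nn N) (ind B') x0)%E); last first.
    by rewrite mesh_pow EFinM; apply: lee_wpmul2l; [rewrite lee_fin ltW|exact: ltW].
  apply: (le_trans _ (Uop_Uop X M hp mF _ _ x0 nB)); rewrite -UopZ ?(ltW v0)//.
  apply: Uop_le => //; [exact: nonneg_scale (ltW v0) nA|exact: Uop_nonneg|].
  move=> y; rewrite indicE; case: (boolP (y \in A)) => [/set_mem Ay|_].
    rewrite mule1; apply: H1 => //; last by rewrite ge_min lexx.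
    - exact: ltW (HN3 N NN3).
    - by rewrite mesh_pow.
  by rewrite mule0; exact: (Uop_nonneg X M hp mF _ nB).2.
have {}A1 : (U (mesh R N) (core D k) (2 ^ (j + N)) (ind A) x0 <= (e / 3)%:E)%E.
  move: A1; have -> : 2 ^+ j * c = v * (e / 3) by rewrite /c; field; rewrite gt_eqF.
  move: (U _ _ _ _ _) => [u| |]; rewrite ?leNye//.
    by rewrite -EFinM !lee_fin ler_pM2l.
  by rewrite gt0_muley ?lte_fin.
have j0 : (0 < 2 ^ (j + N))%N by rewrite expn_gt0.
have A2 := HC (mesh R N) (2 ^ (j + N))%N (4 ^ N)%N _ x0 hp h1N nA (@ind1 A) j0.
have A3 := H2 (mesh R N) (2 ^ (j + N))%N _ x0 hp (ltW (HN2 N NN2)) nA (@ind1 A).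
rewrite mesh_pow in A2.
apply: (le_trans A2); have -> : e = e / 3 + e / 3 + e / 3 by field.
rewrite EFinD; apply: leeD; last first.
  by rewrite lee_fin; have := Hj _ (lexx _); rewrite ler_pdivlMr ?mulr_gt0//; lra.
rewrite EFinD; apply: (le_trans A3); apply: leeD => //; rewrite lee_fin.
have : k <= e / (3 * C1) by rewrite ge_min lexx orbT.
by rewrite ler_pdivlMr ?mulr_gt0//; lra.
Qed.

End Lower.

Section Martin.
Context {R : realType} {d : nat} {dO : measure_display} {Omega : measurableType dO}.
Variables (P : probability Omega R) (W : R -> Omega -> 'rV[R]_d) (S : R -> Omega -> R) (mu0 : R -> R).
Hypotheses (lv : levy_density mu0) (bW : brownian P W) (sS : subordinator P S mu0)
  (indWS : independent_WS P W S).
Variables (M : refmeasure R d) (D : set 'rV[R]_d) (r0 L0 : R) (x0 : 'rV[R]_d).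
Hypotheses (d0 : (0 < d)%N) (C11 : C11_open D r0 L0) (bD : bounded_set_e D) (Dx0 : D x0).
Notation X := (process_timechange lv sS).
Notation m := (refm M).
Notation U h F n f := (Uop X M h F n f).
Notation ind A := (fun z : Borel R d => (\1_A z : R)%:E).
Notation occ x A := (occupation P W S D A x).

Let oD : open D := open_domain C11.
Let mD : measurable (D : set (Borel R d)) := measurable_open oD.

Let occ_ge0 x A : (0 <= occ x A)%E.
Proof. by apply: integral_ge0 => w _; apply: integral_ge0 => s _; rewrite lee_fin. Qed.

Let ind_le (A B : set 'rV[R]_d) (z : Borel R d) : A `<=` B -> ((\1_A z : R)%:E <= (\1_B z : R)%:E)%E.
Proof.
move=> AB; rewrite lee_fin !indicE; case: (boolP (z \in A)) => [/set_mem/AB zB|_]; last exact: ler0n.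
by rewrite mem_set.
Qed.

Let cube_sqd y (e : R) : 0 < e -> exists2 rho, 0 < rho & forall rho', 0 < rho' -> rho' <= rho ->
  forall z : 'rV[R]_d, cube y rho' z -> sqd z y <= e ^+ 2.
Proof.
move=> e0; have k0 : 0 < d%:R + 1 :> R by rewrite ltr_wpDl.
exists (e / (d%:R + 1)); first by rewrite divr_gt0.
move=> rho' p0 pe z zy; apply: (le_trans (sqd_cube (ltW p0) zy)).
apply: (@le_trans _ _ (d%:R * (e / (d%:R + 1)) ^+ 2)).
  by apply: ler_wpM2l => //; apply: lerXn2r; rewrite ?nnegrE ?divr_ge0 ?(ltW e0) ?(ltW k0) ?(ltW p0).
rewrite expr_div_n mulrCA ger_pMr ?exprn_gt0// ler_pdivrMr ?exprn_gt0// mul1r.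
have : 0 <= d%:R :> R by []. by move: (d%:R : R) => k kk; nra.
Qed.

(** The centre of the interior ball at [y] lies in one of finitely many cells. Replacing it by the
    representative of its cell leaves finitely many balls [eball (p j) t], hence a common [K] and a
    constant independent of [y]. Whether the process from [x0] spends time in that ball decides
    between the two alternatives. *)
Lemma lower_bound : exists c0 r1 : R, [/\ 0 < c0, 0 < r1 & forall y, D y -> delta D y <= r1 ->
  exists2 rho0 : R, 0 < rho0 &
    (forall rho, 0 < rho -> rho <= rho0 -> occ x0 (cube y rho) = 0%E) \/
    (forall rho, 0 < rho -> rho <= rho0 ->
      ((c0 * delta D y)%:E * m (cube y rho : set 'rV[R]_d) <= occ x0 (cube y rho))%E)].
Proof.
have [w0 w0D] := bounded_proper bD d0.
have [r [rp rL rr]] := ball_radius C11.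
have r24 : 0 < r ^+ 2 / 4 by rewrite divr_gt0// exprn_gt0.
have [t t0 near] := near_lower X M r24.
have t16 : 0 < t / 16 by rewrite divr_gt0.
have [l l0 H] := hopf_core X M d0 C11 bD rp rL rr t16.
have [n [idx Hidx]] := finite_cells bD t16.
pose good c := D c /\ eball c (r ^+ 2) `<=` D.
have /choice[p Hp] : forall j : 'I_n, exists p, forall c, good c -> idx c = j -> good p /\ idx p = j.
  move=> j; have [[c [gc cj]]|nc] := pselect (exists c, good c /\ idx c = j); first by exists c.
  by exists 0 => c gc cj; case: nc; exists c.
have /choice[K0 HK0] : forall j : 'I_n, exists K0, (0 < occ x0 (eball (p j) t))%E -> forall K, (K0 <= K)%N ->
    exists N1, forall N, (N1 <= N)%N ->
    ((K.+1%:R^-1)%:E <= U (mesh R N) (core D K.+1%:R^-1) (2 ^ (K + N)) (ind (eball (p j) t)) x0)%E.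
  move=> j; have [/(occupation_pos lv bW sS indWS M d0 C11 bD (@open_eball _ _ (p j) t))[K0 HK]|nc] :=
    pselect (0 < occ x0 (eball (p j) t))%E; first by exists K0.
  by exists 0%N => /nc.
pose K := (\max_j K0 j)%N.
have k0 : 0 < K.+1%:R^-1 :> R by rewrite invr_gt0.
have pK : 0 < 2 ^+ K :> R by rewrite exprn_gt0.
exists (l / 12 * K.+1%:R^-1 / 2 ^+ K), (r / 8); split; first by rewrite divr_gt0// mulr_gt0// divr_gt0.
  by rewrite divr_gt0.
move=> y Dy yr; have dp := delta_gt0 oD w0D Dy.
have [c [Dc cD [rho1 [k [h1 [a [rho10 kp h10 Hh]]]]]]] := H y Dy yr.
have [[Dq qD] qi] := Hp (idx c) c (conj Dc cD) erefl; set q := p (idx c) in Dq qD qi.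
have cq : sqd c q < t / 16 := Hidx c q Dc Dq (esym qi).
have sub z : eball c (t / 16) z -> sqd z q < t / 4.
  by rewrite /eball /= => zc; have := sqd_triangle z c q; lra.
have ld : 0 < l * delta D y by rewrite mulr_gt0.
have mc : measurable (eball c (t / 16) : set (Borel R d)) by exact: measurable_eball.
have [zo|nz] := eqVneq (occ x0 (eball q t)) 0%E.
  have st : 0 < Num.sqrt t by rewrite sqrtr_gt0.
  exists rho1 => //; left => rho rho0 rhor.
  have [w1 w1B] := bounded_proper (@eball_bounded _ _ q t) d0.
  apply: (@chain_zero R d dO Omega P W S mu0 lv bW sS indWS M D r0 L0 x0 d0 C11 bD _ (eball q t)
    (core (eball q t) (Num.sqrt t / 2)) (l * delta D y) k a) => //.
  - exact: open_cube.
  - by apply: closed_core => //; exact: eball_bounded.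
  - by apply: core_sub; rewrite divr_gt0.
  have mB : measurable (core (eball q t) (Num.sqrt t / 2) : set (Borel R d)).
    by apply: measurable_core => //; exact: eball_bounded.
  exists h1; split=> // h j k' z hp hh ja k'0 k'k zy.
  apply: (le_trans (Hh h j k' z hp hh ja k'k _)); first by move=> i; exact: lt_le_trans (zy i) rhor.
  apply: Uop_le => //; [exact: measurable_core|exact: nonneg_indic|exact: nonneg_indic|].
  move=> v; apply: ind_le => {}v /sub vq.
  apply: (lb_le_inf); first by exists (enorm (v - w1)), w1.
  move=> _ [w wB <-]; rewrite -(@ler_pXn2r _ 2)// ?nnegrE ?enorm_ge0 ?divr_ge0 ?(ltW st)//.
  rewrite -sqd_enorm expr_div_n sqr_sqrtr ?(ltW t0)//; have -> : (2 : R) ^+ 2 = 4 by ring.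
  have : t <= sqd w q by rewrite leNgt; apply/negP.
  by have := sqd_triangle w v q; rewrite (sqd_sym w v); lra.
have d2 : 0 < delta D y / 2 by rewrite divr_gt0.
have [rho2 rho20 H2] := cube_sqd y d2.
exists (Num.min rho1 rho2); first by rewrite lt_min rho10.
right=> rho rho0; rewrite le_min => /andP[rhor1 rhor2].
have cf : bounded_set_e (cube y rho) := @cube_bounded _ _ y rho.
have oA : open (cube y rho : set 'rV[R]_d) by exact: open_cube.
pose kk := Num.min (Num.min k K.+1%:R^-1) (Num.min (r / 2) (delta D y / 2)).
have kk0 : 0 < kk by rewrite !lt_min kp k0 d2 divr_gt0.
have kk1 : kk <= k by rewrite /kk !ge_min lexx.
have kk2 : kk <= K.+1%:R^-1 by rewrite /kk !ge_min lexx !orbT.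
have kk3 : kk <= r / 2 by rewrite /kk !ge_min lexx !orbT.
have kk4 : kk <= delta D y / 2 by rewrite /kk !ge_min lexx !orbT.
apply: core_exhaust => //; first by rewrite mulr_gt0// divr_gt0// mulr_gt0// divr_gt0.
move=> k' k'0; set A' := core (cube y rho) k'.
have A'A : A' `<=` cube y rho by exact: core_sub.
have mA' : measurable (A' : set (Borel R d)) by exact: measurable_core.
have fA' : (m A' < +oo)%E.
  have [K1 K10 HK1] := bounded_cube cf.
  apply: le_lt_trans (heat_ref_cube K1 (refm_heat M)); apply: le_measure; rewrite ?inE//.
    exact: measurable_open (@open_cube _ _ _ _).
  by move=> z /A'A/HK1.
have vE : ((l / 12 * K.+1%:R^-1 / 2 ^+ K * delta D y)%:E * m A' =
    (l * delta D y * fine (m A') / 12 * K.+1%:R^-1 / 2 ^+ K)%:E)%E.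
  have /fineK <- : m A' \is a fin_num by rewrite ge0_fin_numE.
  by rewrite -EFinM /=; congr EFin; move: (K.+1%:R^-1) ((2 ^+ K)^-1) => i1 i2; field.
rewrite vE; apply: (@chain_large R d dO Omega P W S mu0 lv bW sS indWS M D r0 L0 x0 d0 C11 bD A'
   (eball q t) (l * delta D y) K a kk t q) => //.
- exact: open_eball.
- by apply: closed_core.
- move=> z /A'A/(H2 _ rho0 rhor2) zy; rewrite /core /=; apply: (le_trans kk4).
  by apply: (delta_near w0D); move: zy; rewrite expr_div_n (_ : (2 : R) ^+ 2 = 4)//; ring.
- exists h1; split=> // h j z hp hh ja /A'A zy.
  apply: (le_trans (Hh h j kk z hp hh ja kk1 _)); first by move=> i; exact: lt_le_trans (zy i) rhor1.
  have mB : measurable (eball q t : set (Borel R d)) by exact: measurable_eball.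
  apply: Uop_le => //; [exact: measurable_core|exact: nonneg_indic|exact: nonneg_indic|].
  by move=> v; apply: ind_le => {}v /sub vq; rewrite /eball /=; lra.
- have pos : (0 < occ x0 (eball q t))%E by rewrite lt_neqAle eq_sym nz occ_ge0.
  by apply: (HK0 (idx c) pos); exact: leq_bigmax.
- move=> h hp ht; apply: near => //; first exact: measurable_core.
  move=> z; rewrite /eball /core /= => zq; apply: (le_trans kk3).
  have rq : r <= delta D q by apply: (delta_center w0D) => //; exact: ltW.
  have h1' : r ^+ 2 <= delta D q ^+ 2 by apply: lerXn2r; rewrite ?nnegrE ?(ltW rp) ?(le_trans (ltW rp) rq).
  have : delta D q / 2 <= delta D z by apply: (delta_near w0D); apply: ltW; apply: (lt_le_trans zq); rewrite ler_pM2r ?invr_gt0.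
  by lra.
Qed.

Lemma occupation_upper (eta : R) : 0 < eta -> exists2 C : R, 0 < C & forall x y, D x -> D y ->
  eta <= enorm (x - y) -> exists2 rho0 : R, 0 < rho0 & forall rho, 0 < rho -> rho <= rho0 ->
  (occ x (cube y rho) <= (C * delta D x * delta D y)%:E * m (cube y rho : set 'rV[R]_d))%E.
Proof.
move=> e0; have [w0 w0D] := bounded_proper bD d0.
have e2 : 0 < eta / 2 by rewrite divr_gt0.
have [C C0 HC] := upper_dist X M d0 C11 bD e2.
(* The 5 comes from [2 delta D z + eps <= 5 delta D y] on the cube and the 3 from
   [2 delta D x + eps <= 3 delta D x], once [eps] is below both distances. *)
exists (15 * C); first by rewrite mulr_gt0.
move=> x y Dx Dy xy; have dx := delta_gt0 oD w0D Dx; have dy := delta_gt0 oD w0D Dy.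
have [rho1 rho10 H1] := cube_sqd y e2; have [rho2 rho20 H2] := cube_sqd y dy.
exists (Num.min rho1 rho2); first by rewrite lt_min rho10.
move=> rho rho0; rewrite le_min => /andP[rhor1 rhor2]; set A := cube y rho.
have oA : open (A : set 'rV[R]_d) by exact: open_cube.
have mA : measurable (A : set (Borel R d)) := measurable_open oA.
have nA : nonneg (ind A) := nonneg_indic mA.
have fA : (m A < +oo)%E.
  have [K1 K10 HK1] := bounded_cube (@cube_bounded _ _ y rho).
  apply: le_lt_trans (heat_ref_cube K1 (refm_heat M)); apply: le_measure; rewrite ?inE//.
  exact: measurable_open (@open_cube _ _ _ _).
have mE : m A = (fine (m A))%:E by rewrite fineK// ge0_fin_numE.
have a0 : 0 <= fine (m A) by exact: fine_ge0.
set a := fine (m A) in mE a0.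
have A2 z : A z -> delta D z <= 2 * delta D y.
  move=> /(H2 _ rho0 rhor2) zy; rewrite leNgt; apply/negP => h.
  have : delta D z / 2 <= delta D y.
    apply: (delta_near w0D); rewrite sqd_sym; apply: (le_trans zy).
    have : delta D y ^+ 2 <= (delta D z / 2) ^+ 2.
      by apply: lerXn2r; rewrite ?nnegrE; lra.
    by rewrite expr_div_n (_ : (2 : R) ^+ 2 = 4)//; ring.
  by lra.
have farA : far (eta / 2) x A.
  move=> z /(H1 _ rho0 rhor1) zy; have := sqd_triangle x z y.
  have : eta ^+ 2 <= sqd x y.
    by rewrite sqd_enorm; apply: lerXn2r; rewrite ?nnegrE ?enorm_ge0 ?(ltW e0).
  by move: zy; rewrite !expr_div_n (_ : (2 : R) ^+ 2 = 4); [lra|ring].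
pose eps := Num.min (delta D x) (delta D y).
have ep : 0 < eps by rewrite lt_min dx.
have ex : eps <= delta D x by rewrite ge_min lexx.
have ey : eps <= delta D y by rewrite ge_min lexx orbT.
have [h0 h00 H] := HC eps ep; have [N0 HN0] := mesh_small h00.
have NB : (\int[m]_(z in D) ((\1_A z)%:E * (2 * delta D z + eps)%:E) <= (5 * delta D y * a)%:E)%E.
  have mZ : (\int[m]_z ((5 * delta D y)%:E * (\1_A z)%:E) = (5 * delta D y * a)%:E)%E.
    rewrite ge0_integralZl//; [|exact: nA.1|by rewrite lee_fin mulr_ge0// ltW].
    by rewrite integral_indic// setIT mE.
  rewrite -mZ integral_mkcond; apply: ge0_le_lower_integral => z _.
    rewrite patchE; case: ifP => // _; rewrite -EFinM lee_fin mulr_ge0// addr_ge0 ?(ltW ep)//.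
    by rewrite mulr_ge0// (delta_ge0 w0D).
  have r0' : (0 <= (5 * delta D y)%:E * (\1_A z)%:E)%E by rewrite -EFinM lee_fin !mulr_ge0// ltW.
  rewrite patchE; case: ifP => // _; move: r0'; rewrite indicE.
  case: (boolP (z \in A)) => [/set_mem/A2 zA _|_]; last by rewrite mul0e.
  by rewrite mul1e mule1 lee_fin; lra.
have out z : ~ A z -> ((\1_A z : R)%:E = 0)%E by move=> Az; rewrite indicE memNset.
have : (occ x A <= (C * (5 * delta D y * a) * (2 * delta D x + eps))%:E)%E.
  apply: (@occupation_le R d dO Omega P W S mu0 lv bW sS indWS M D A x _ oD oA) => N1.
  exists (N0 + N1)%N; first exact: leq_addl.
  apply: (H _ _ _ A) => //; first exact: mesh_gt0.
  by apply: ltW; apply: HN0; exact: leq_addr.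
move=> /le_trans; apply; rewrite mE -EFinM lee_fin.
have q0 : 0 <= C * (5 * delta D y * a) by rewrite !mulr_ge0// ?(ltW dy)// ltW.
apply: (@le_trans _ _ (C * (5 * delta D y * a) * (3 * delta D x))); first by apply: ler_wpM2l => //; lra.
by rewrite le_eqVlt; apply/orP; left; apply/eqP; ring.
Qed.

End Martin.

(** * The Martin kernel *)

Section MartinBound.
Context {R : realType} {d : nat} {dO : measure_display} {Omega : measurableType dO}.
Variables (P : probability Omega R) (W : R -> Omega -> 'rV[R]_d) (S : R -> Omega -> R) (mu0 : R -> R).
Hypotheses (lv : levy_density mu0) (bW : brownian P W) (sS : subordinator P S mu0)
  (indWS : independent_WS P W S).
Variables (D : set 'rV[R]_d) (r0 L0 : R) (x0 : 'rV[R]_d).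
Hypotheses (d0 : (0 < d)%N) (C11 : C11_open D r0 L0) (bD : bounded_set_e D).

Let oD : open D := open_domain C11.

Let G x y (rho : R) : \bar R := ((((2 * rho) ^+ d)^-1)%:E * occupation P W S D (cube y rho) x)%E.

Let greenE x y : green P W S D x y = lim (G x y @ 0^'+).
Proof. by []. Qed.

Let G0 x y rho : 0 < rho -> (0 <= G x y rho)%E.
Proof.
move=> p0; rewrite mule_ge0 ?lee_fin ?invr_ge0 ?exprn_ge0 ?mulr_ge0 ?(ltW p0)//.
by apply: integral_ge0 => w _; apply: integral_ge0 => s _; rewrite lee_fin.
Qed.

Let near0 (rho0 : R) (Q : R -> Prop) : 0 < rho0 -> (forall rho, 0 < rho -> rho <= rho0 -> Q rho) ->
  \forall rho \near (0 : R)^'+, Q rho.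
Proof.
move=> p0 H; near=> rho; apply: H; first by near: rho; exact: nbhs_right_gt.
by near: rho; exact: nbhs_right_le.
Unshelve. all: by end_near. Qed.

Let green_ge0 x y : (0 <= green P W S D x y)%E.
Proof.
rewrite greenE; have [c|/dvgP->] := pselect (cvg (G x y @ 0^'+)); last by [].
apply: lime_ge => //; apply: (near0 ltr01) => rho p0 _; exact: G0.
Qed.

(** Both occupation bounds carry the factor [delta D y] times the volume of the cube, so these
    cancel in the quotient and only [delta D x] is left. *)
Lemma green_ratio (eta : R) : 0 < eta -> exists C r1 : R, [/\ 0 < C, 0 < r1 &
  forall x y, D x -> D y -> eta <= enorm (x - y) -> delta D y <= r1 ->
  0 <= fine (green P W S D x y) / fine (green P W S D x0 y) <= C * delta D x].
Proof.
move=> e0; have [m Hm] := @heat_ref_exists R d.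
pose M : refmeasure R d := @RefMeasure R d (sigma_finite_pack (heat_ref_sigma_finite Hm)) Hm.
have [w0 w0D] := bounded_proper bD d0.
have [C C0 HU] := occupation_upper lv bW sS indWS M d0 C11 bD e0.
have [c0 [r1 [c00 r10 HL]]] := lower_bound lv bW sS indWS M x0 d0 C11 bD.
have C'0 : 0 < C / c0 by rewrite divr_gt0.
exists (C / c0), r1; split=> // x y Dx Dy xy yr.
have dx := delta_gt0 oD w0D Dx; have dy := delta_gt0 oD w0D Dy.
have K0 : 0 < C / c0 * delta D x by rewrite mulr_gt0.
set K := C / c0 * delta D x in K0 *.
have gx := green_ge0 x y; have g0 := green_ge0 x0 y.
apply/andP; split; first exact: (divr_ge0 (fine_ge0 gx) (fine_ge0 g0)).
have [rho1 rho10 H1] := HU x y Dx Dy xy.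
have [rho2 rho20 [Z|L]] := HL y Dy yr.
  (* In the degenerate alternative the denominator vanishes and the quotient is 0 by convention. *)
  have -> : green P W S D x0 y = 0%E.
    rewrite greenE; apply: lim_near_cst => //; apply: (near0 rho20) => rho p0 pr.
    by rewrite /G Z// mule0.
  by rewrite fine0 invr0 mulr0 ltW.
have GG : \forall rho \near (0 : R)^'+, (G x y rho <= K%:E * G x0 y rho)%E.
  have rm : 0 < Num.min rho1 rho2 by rewrite lt_min rho10.
  apply: (near0 rm) => rho p0; rewrite le_min => /andP[pr1 pr2].
  rewrite /G muleCA; apply: lee_wpmul2l.
    by rewrite lee_fin invr_ge0 exprn_ge0// mulr_ge0// ltW.
  apply: (le_trans (H1 rho p0 pr1)).
  have -> : C * delta D x * delta D y = K * (c0 * delta D y) by rewrite /K; field; rewrite gt_eqF.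
  by rewrite EFinM -muleA; apply: lee_wpmul2l; [rewrite lee_fin ltW|exact: L].
(* A differentiation limit that fails to exist is the default point, with real part 0, so the
   quotient is 0; likewise for the denominator below. *)
have [cx|/dvgP ex] := pselect (cvg (G x y @ 0^'+)); last first.
  by rewrite (greenE x y) ex (_ : fine point = 0)// mul0r ltW.
have [cx0|/dvgP ex0] := pselect (cvg (G x0 y @ 0^'+)); last first.
  by rewrite (greenE x0 y) ex0 (_ : fine point = 0)// invr0 mulr0 ltW.
have ck : (K%:E * G x0 y rho)%E @[rho --> (0 : R)^'+] --> (K%:E * green P W S D x0 y)%E.
  by apply: cvgeZl => //; rewrite greenE.
have : (green P W S D x y <= K%:E * green P W S D x0 y)%E.
  have ckc : cvg ((fun rho => K%:E * G x0 y rho)%E @ (0 : R)^'+) by apply/cvg_ex; eexists; exact: ck.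
  have E1 : (lim (G x y @ 0^'+) <= lim ((fun rho => K%:E * G x0 y rho)%E @ (0 : R)^'+))%E := lee_lim cx ckc GG.
  have E2 : lim ((fun rho => K%:E * G x0 y rho)%E @ (0 : R)^'+) = (K%:E * green P W S D x0 y)%E.
    exact: (cvg_lim _ ck).
  by rewrite (greenE x y) -E2; exact: E1.
move: gx g0; case: (green P W S D x0 y) => [g| |]; case: (green P W S D x y) => [f| |] //=;
  rewrite ?lee_fin ?mul0r ?invr0 ?mulr0 ?(ltW K0)//.
move=> f0 g0 fg; have [->|gn] := eqVneq g 0; first by rewrite invr0 mulr0 ltW.
by rewrite ler_pdivrMr// lt_neqAle eq_sym gn.
Qed.

(** For [y] in [D] close to [z] the distance to the complement is small and [|x - y| >= eta / 2], so
    the ratio bound holds near the limit point; a limit that fails to exist has value 0. *)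
Lemma martin_bound (eta : R) : 0 < eta -> exists2 C : R, 0 < C & forall x z, D x -> bdry D z ->
  eta <= enorm (x - z) -> 0 <= martin P W S D x0 x z <= C * delta D x.
Proof.
move=> e0; have [w0 w0D] := bounded_proper bD d0.
have e2 : 0 < eta / 2 by rewrite divr_gt0.
have [C [r1 [C0 r10 H]]] := green_ratio e2; exists C => // x z Dx [cz iz] xz.
have Dz : ~ D z by move=> Dz; apply: iz; exact: oD.
have CK : 0 <= C * delta D x by rewrite mulr_ge0 ?(delta_ge0 w0D)// ltW.
have pf : ProperFilter (within D (nbhs z)) by exact: within_nbhs_proper.
have nr : \forall y \near within D (nbhs z),
    0 <= fine (green P W S D x y) / fine (green P W S D x0 y) <= C * delta D x.
  have n1 : nbhs z [set y | delta D y < r1].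
    apply: open_nbhs_nbhs; split; first exact: open_delta_lt w0D _.
    by rewrite /= (delta_out Dz).
  have n2 : nbhs z (eball z (eta ^+ 2 / 4)).
    apply: open_nbhs_nbhs; split; first exact: open_eball.
    by rewrite /eball /= sqdxx divr_gt0// exprn_gt0.
  pose Q y := 0 <= fine (green P W S D x y) / fine (green P W S D x0 y) <= C * delta D x.
  have : nbhs z [set y | D y -> Q y]; last by [].
  apply: (filterS _ (filterI n1 n2)) => y [yr yz] Dy.
  apply: H => //; last exact: (ltW yr).
  rewrite -(@ler_pXn2r _ 2)// ?nnegrE ?enorm_ge0 ?(ltW e2)// -sqd_enorm expr_div_n.
  have : eta ^+ 2 <= sqd x z by rewrite sqd_enorm; apply: lerXn2r; rewrite ?nnegrE ?enorm_ge0 ?(ltW e0).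
  have -> : (2 : R) ^+ 2 = 4 by ring.
  by have := sqd_triangle x y z; move: yz; rewrite /eball /=; lra.
rewrite /martin; set F := (X in lim X).
have [c|/dvgP ->] := pselect (cvg F); last by rewrite /= lexx CK.
apply/andP; split.
  by apply: limr_ge => //; apply: filterS nr => y /andP[].
by apply: limr_le => //; apply: filterS nr => y /andP[].
Qed.

Lemma martin_ge0 x z : D x -> bdry D z -> 0 <= martin P W S D x0 x z.
Proof.
move=> Dx Bz; have e0 : 0 < enorm (x - z).
  rewrite lt_neqAle enorm_ge0 andbT eq_sym; apply/negP => /eqP E.
  have Dz : ~ D z by case: Bz => _ iz Dz; apply: iz; exact: oD.
  have [w0 w0D] := bounded_proper bD d0.
  by have := delta_le x Dz; rewrite E leNgt (delta_gt0 oD w0D Dx).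
have [C _ H] := martin_bound e0.
by case/andP: (H x z Dx Bz (lexx _)).
Qed.

End MartinBound.

(** * The boundary limit *)

Section LowerIntegralComparison.
Import HBNNSimple.
Context {dT : measure_display} {T : measurableType dT} {R : realType}.
Variables (m1 m2 : {measure set T -> \bar R}) (B E : set T) (g : T -> \bar R).

Lemma sintegral_le_measure (c : R) (k : {nnsfun T >-> R}) : 0 <= c ->
  (forall x, ~ E x -> k x = 0) ->
  (forall A, measurable A -> A `<=` E -> m1 A <= c%:E * m2 A)%E ->
  (sintegral m1 k <= c%:E * sintegral m2 k)%E.
Proof.
move=> c0 kE dom; rewrite !sintegralE ge0_mule_fsumr; last first.
  move=> x; have [x0|x0] := leP 0 x; first by rewrite mule_ge0.
  rewrite (_ : k @^-1` [set x] = set0) ?measure0 ?mule0//.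
  by apply/seteqP; split => // w /= kw; move: x0; rewrite -kw ltNge fun_ge0.
apply: lee_fsum => // x [w _ kw]; rewrite muleCA.
have x0 : 0 <= x by rewrite -kw fun_ge0.
have [->|xn] := eqVneq x 0; first by rewrite !mul0e.
apply: lee_wpmul2l; rewrite ?lee_fin//; apply: dom.
  exact: measurable_funPTI.
by move=> y /= ky; apply: contrapT => /kE; rewrite ky => /eqP; rewrite (negbTE xn).
Qed.

(** The integral is a supremum over simple functions [h] below [g] on [B]. On [E] the integral of
    [h] is compared level set by level set through the domination of measures; off [E], [h] is at
    most [K] and the total mass at most [b]. Measurability is thus asked of [h] alone, as the Martin
    kernel in its boundary variable requires. *)
Lemma integral_le_measure_split (c K b : R) :
  measurable E -> E `<=` B -> (forall x, B x -> 0 <= g x)%E ->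
  0 <= c -> 0 <= K ->
  (forall A, measurable A -> A `<=` E -> m1 A <= c%:E * m2 A)%E ->
  (forall x, B x -> ~ E x -> g x <= K%:E)%E ->
  (m1 setT <= b%:E)%E ->
  (\int[m1]_(x in B) g x <= c%:E * \int[m2]_(x in B) g x + (K * b)%:E)%E.
Proof.
move=> mE EB g0 c0 K0 dom gK mb; rewrite (ge0_integralE m1)//.
apply: ge_ereal_sup => _ [h hg <-].
have hge : forall x, 0 <= h x by move=> x; exact: fun_ge0.
have mh (A : set T) : measurable_fun A (EFin \o h).
  by apply/measurable_EFinP; apply: measurable_funTS.
rewrite -integralT_nnsfun -(setUv E) ge0_integral_setU//; first last.
- by apply/disj_set2P; rewrite setICr.
- by move=> x _; rewrite lee_fin.
- exact: measurableC.
apply: leeD; last first.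
  apply: (@le_trans _ _ (\int[m1]_(x in ~` E) cst K%:E x)%E).
    apply: ge0_le_lower_integral => x Ex; first by rewrite lee_fin.
    apply: (le_trans (hg x)); rewrite patchE; case: ifPn => [/set_mem Bx|_]; first exact: gK.
    by rewrite lee_fin.
  rewrite integral_cst; last exact: measurableC.
  rewrite EFinM; apply: lee_wpmul2l; first by rewrite lee_fin.
  by apply: (le_trans _ mb); apply: le_measure; rewrite ?inE//; exact: measurableC.
rewrite integral_nnsfun// (mrestrict h mE).
have pE x : proj_nnsfun h mE x = (h \_ E) x by rewrite mrestrict.
apply: (@le_trans _ _ (c%:E * sintegral m2 (proj_nnsfun h mE))%E).
  apply: (@sintegral_le_measure c (proj_nnsfun h mE)) => //.
  by move=> x Ex; rewrite pE patchE memNset.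
apply: lee_wpmul2l; first by rewrite lee_fin.
rewrite ge0_integralE//; apply: ereal_sup_ubound; exists (proj_nnsfun h mE) => //= x.
rewrite (_ : h x * _ = (h \_ E) x); last exact: (pE x).
rewrite !patchE; case: ifPn => [/set_mem Ex|_].
  by have := hg x; rewrite patchE.
by case: ifPn => // /set_mem Bx; exact: g0.
Qed.

End LowerIntegralComparison.

Section RatioLimit.
Context {R : realType} {X : Type}.
Variables (F : set_system X) (D : set X) (u v dl : X -> R) (l : R).
Context {FF : Filter F}.

Lemma quotient_cvg :
  F D -> (forall x, D x -> 0 < dl x) -> (forall x, D x -> 0 <= u x) -> (forall x, D x -> 0 <= v x) ->
  (forall e, 0 < e -> exists2 C, 0 <= C &
     F [set x | `|u x - l * v x| <= e * v x + C * dl x]) ->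
  ((dl x)%:E / (v x)%:E)%E @[x --> F] --> 0%E ->
  ((u x)%:E / (v x)%:E)%E @[x --> F] --> l%:E.
Proof.
move=> FD dl0 u0 v0 H /fine_cvgP[nf cf].
(* The quotient is taken in the extended reals, where division by 0 gives [+oo]; its convergence to
   0 therefore forces [v] to be positive near the limit. *)
have vn : F [set x | 0 < v x].
  apply: filterS2 FD nf => x Dx; rewrite /= inver; case: ifPn => [/eqP v0x|vx _].
    by rewrite gt0_muley// lte_fin dl0.
  by rewrite lt_neqAle eq_sym vx v0.
apply/fine_cvgP; split.
  by apply: filterS vn => x /= vx; rewrite inver gt_eqF.
apply/cvgrPdist_le => e e0.
have e2 : 0 < e / 2 by rewrite divr_gt0.
have [C C0 HC] := H _ e2.
have C1 : 0 < C + 1 by rewrite ltr_wpDl.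
have k0 : 0 < e / 2 / (C + 1) by rewrite divr_gt0.
move/cvgrPdist_le/(_ _ k0): cf => near_dl.
apply: (filterS _ (filterI (filterI FD vn) (filterI HC near_dl))) => x [[Dx vx] [hx dx]]; move: vx hx dx => /= vx hx.
rewrite inver gt_eqF//= sub0r normrN => dx.
have dv : dl x <= e / 2 / (C + 1) * v x.
  by rewrite -ler_pdivrMr//; apply: le_trans dx; exact: ler_norm.
have -> : l - u x / v x = (l * v x - u x) / v x by field; rewrite gt_eqF.
rewrite normrM (gtr0_norm (x := (v x)^-1)) ?invr_gt0// ler_pdivrMr// distrC.
apply: (le_trans hx).
have : C * dl x <= e / 2 * v x.
  apply: (@le_trans _ _ ((C + 1) * (e / 2 / (C + 1) * v x))).
    apply: ler_pM => //; first exact: ltW (dl0 _ Dx).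
    by rewrite lerDl.
  by rewrite le_eqVlt; apply/orP; left; apply/eqP; field; rewrite gt_eqF.
by lra.
Qed.

End RatioLimit.

Section BoundaryRatio.
Context {R : realType} {d : nat} {dO : measure_display} {Omega : measurableType dO}.
Variables (P : probability Omega R) (W : R -> Omega -> 'rV[R]_d) (S : R -> Omega -> R) (mu0 : R -> R).
Hypotheses (lv : levy_density mu0) (bW : brownian P W) (sS : subordinator P S mu0)
  (indWS : independent_WS P W S).
Variables (D : set 'rV[R]_d) (r0 L0 : R) (x0 Q : 'rV[R]_d).
Hypotheses (d0 : (0 < d)%N) (C11 : C11_open D r0 L0) (bD : bounded_set_e D).
Local Notation B := (bdry D).
Local Notation M := (martin P W S D x0).
Local Notation bmeas := {measure set (Borel R d) -> \bar R}.
Local Notation martin_int m x := (\int[m]_(z in bdry D) (martin P W S D x0 x z)%:E)%E.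

Let bdry_near eta : set (Borel R d) := bdry D `&` eball Q (eta ^+ 2).

Lemma measurable_bdry : measurable (B : set (Borel R d)).
Proof.
apply: measurableD; last by apply: measurable_open; exact: open_interior.
by rewrite -[closure D]setCK; apply: measurableC; apply: measurable_open; apply: closed_openC; exact: closed_closure.
Qed.

(** For [x] close to [Q], boundary points outside the [eta]-ball are at distance at least [eta / 2]
    from [x]. There [martin_bound] makes the kernel at most a multiple of [delta D x], the constant
    bound that [integral_le_measure_split] needs. *)
Lemma martin_int_domination (m1 m2 : bmeas) (c eta : R) : 0 <= c -> 0 < eta ->
  (m1 setT < +oo)%E ->
  (forall A, measurable A -> A `<=` bdry_near eta -> m1 A <= c%:E * m2 A)%E ->
  exists2 C : R, 0 <= C & \forall x \near Q, D x ->
    (martin_int m1 x <= c%:E * martin_int m2 x + (C * delta D x)%:E)%E.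
Proof.
move=> c0 e0 fin dom; have e2 : 0 < eta / 2 by rewrite divr_gt0.
have [C C0 HC] := martin_bound lv bW sS indWS x0 d0 C11 bD e2.
have [w0 w0D] := bounded_proper bD d0.
have mf : m1 setT \is a fin_num by rewrite ge0_fin_numE.
exists (C * fine (m1 setT)); first by apply: mulr_ge0; [exact: ltW|exact: fine_ge0].
have nQ : nbhs Q (eball Q (eta ^+ 2 / 4)).
  apply: open_nbhs_nbhs; split; first exact: open_eball.
  by rewrite /eball /= sqdxx divr_gt0// exprn_gt0.
apply: filterS nQ => x xQ Dx.
rewrite mulrAC; apply: (@integral_le_measure_split _ _ _ m1 m2 B (bdry_near eta)) => //.
- by apply: measurableI; [exact: measurable_bdry|exact: measurable_eball].
- by move=> z [].
- by move=> z Bz; rewrite lee_fin; exact: (martin_ge0 lv bW sS indWS x0 d0 C11 bD).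
- by rewrite mulr_ge0 ?(delta_ge0 w0D)// ltW.
- move=> z Bz nz; rewrite lee_fin.
  suff xz : eta / 2 <= enorm (x - z) by case/andP: (HC x z Dx Bz xz).
  rewrite -(@ler_pXn2r _ 2)// ?nnegrE ?enorm_ge0 ?(ltW e2)// -sqd_enorm expr_div_n.
  have : eta ^+ 2 <= sqd z Q by rewrite leNgt; apply/negP => zQ; apply: nz; split.
  have -> : (2 : R) ^+ 2 = 4 by ring.
  by have := sqd_triangle z x Q; rewrite (sqd_sym z x); move: xQ; rewrite /eball /=; lra.
- by rewrite fineK.
Qed.

Section Density.
Variables (f : 'rV[R]_d -> R) (nu mu : bmeas).
Hypotheses (nuf : (nu setT < +oo)%E) (muf : (mu setT < +oo)%E).
Hypotheses (fint : nu.-integrable B (fun z => (f z)%:E))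
  (dens : forall A : set (Borel R d), measurable A -> (mu A = \int[nu]_(z in A) (f z)%:E)%E).
Hypothesis fQ : f z @[z --> within (bdry D) (nbhs Q)] --> f Q.

Lemma density_near_bounds (e : R) : 0 < e -> exists2 eta : R, 0 < eta &
  forall A : set (Borel R d), measurable A -> A `<=` bdry_near eta ->
    ((f Q - e)%:E * nu A <= mu A <= (f Q + e)%:E * nu A)%E.
Proof.
move=> e0; move/cvgrPdist_le: fQ => /(_ _ e0); rewrite /prop_near1 /= /within nbhsE => -[U [oU UQ] HU].
have [eta eta0 sub] := (open_sqdP _).1 oU _ UQ.
exists eta => // A mA AE.
have AB : A `<=` B by move=> z /AE[].
have fA : (fun z : Borel R d => (f z)%:E) = EFin \o f by [].
have iA : nu.-integrable A (fun z => (f z)%:E).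
  exact: integrableS measurable_bdry mA AB fint.
have nA : (nu A < +oo)%E.
  by apply: le_lt_trans nuf; apply: le_measure; rewrite ?inE.
have ic (r : R) : nu.-integrable A (cst r%:E).
  apply/integrableP; split; first exact: measurable_cst.
  rewrite (eq_integral (cst `|r|%:E)) ?integral_cst//.
  by rewrite lte_mul_pinfty.
have near z : A z -> `|f Q - f z| <= e.
  by move=> Az; have [Bz zQ] := AE z Az; exact: (HU z (sub z zQ) Bz).
rewrite dens// -!integral_cst//; apply/andP; split; apply: le_integral => // z /set_mem Az;
  by rewrite lee_fin; have := near z Az; rewrite ler_norml => /andP[]; lra.
Qed.

Lemma martin_ratio_near (u v : 'rV[R]_d -> R) (e : R) : 0 < e ->
  (forall x, D x -> ((u x)%:E = martin_int mu x)%E) ->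
  (forall x, D x -> ((v x)%:E = martin_int nu x)%E) ->
  exists2 C : R, 0 <= C & \forall x \near Q, D x ->
    `|u x - f Q * v x| <= e * v x + C * delta D x.
Proof.
move=> e0 uE vE; have [eta eta0 dA] := density_near_bounds e0.
have [w0 w0D] := bounded_proper bD d0.
have u0 x : D x -> 0 <= u x.
  move=> Dx; rewrite -lee_fin uE//; apply: integral_ge0 => z Bz.
  by rewrite lee_fin; exact: (martin_ge0 lv bW sS indWS x0 d0 C11 bD).
have v0 x : D x -> 0 <= v x.
  move=> Dx; rewrite -lee_fin vE//; apply: integral_ge0 => z Bz.
  by rewrite lee_fin; exact: (martin_ge0 lv bW sS indWS x0 d0 C11 bD).
have dl0 x : 0 <= delta D x := delta_ge0 w0D x.
have nu_fin (A : set (Borel R d)) : measurable A -> nu A \is a fin_num.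
  by move=> mA; rewrite ge0_fin_numE//; apply: le_lt_trans nuf; apply: le_measure; rewrite ?inE.
have [C1 C10 H1] : exists2 C : R, 0 <= C & \forall x \near Q, D x ->
    u x <= (f Q + e) * v x + C * delta D x.
  have [fe|fe] := leP 0 (f Q + e).
    have [|C C0 HC] := @martin_int_domination mu nu _ eta fe eta0 muf.
      by move=> A mA /(dA A mA)/andP[].
    exists C => //; apply: filterS HC => x H Dx.
    by move: (H Dx); rewrite -uE// -vE// -EFinM -EFinD lee_fin.
  (* A negative [f Q + e] is possible only if [nu] vanishes near [Q], because [mu] is nonnegative.
     Then both integrals are at most a multiple of [delta D x], and the negative factor of [v] is
     compensated in the constant. *)
  have nu0 (A : set (Borel R d)) : measurable A -> A `<=` bdry_near eta -> nu A = 0%E.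
    move=> mA AE; have /andP[_ up] := dA A mA AE.
    have : (0 <= (f Q + e)%:E * nu A)%E by apply: le_trans up.
    have := measure_ge0 nu A; rewrite -(fineK (nu_fin A mA)) -EFinM !lee_fin.
    move=> n0; rewrite nmulr_rge0// => n1.
    by congr EFin; apply/eqP; rewrite eq_le n1 fine_ge0.
  have [|C C0 HC] := @martin_int_domination mu nu 0 eta (lexx _) eta0 muf.
    by move=> A mA AE; have /andP[_] := dA A mA AE; rewrite nu0// !mule0.
  have [|C' C'0 HC'] := @martin_int_domination nu nu 0 eta (lexx _) eta0 nuf.
    by move=> A mA AE; rewrite nu0// mule0.
  exists (C - (f Q + e) * C').
    by rewrite subr_ge0; apply: le_trans C0; rewrite mulr_le0_ge0// ltW.
  apply: filterS2 HC HC' => x H H' Dx.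
  move: (H Dx) (H' Dx); rewrite -uE// -vE// mul0e !add0e !lee_fin => ux vx.
  have : (f Q + e) * (C' * delta D x) <= (f Q + e) * v x by rewrite ler_nM2l.
  lra.
have [C2 C20 H2] : exists2 C : R, 0 <= C & \forall x \near Q, D x ->
    (f Q - e) * v x <= u x + C * delta D x.
  have [fe|fe] := leP (f Q - e) 0.
    exists 0 => //; apply: (@filterS _ (nbhs Q) _ setT _ _ filterT) => x _ Dx.
    rewrite mul0r addr0; apply: le_trans (u0 _ Dx).
    by rewrite mulr_le0_ge0// v0.
  have fe' : 0 <= (f Q - e)^-1 by rewrite invr_ge0 ltW.
  have [|C C0 HC] := @martin_int_domination nu mu _ eta fe' eta0 nuf.
    by move=> A mA /(dA A mA)/andP[lo _]; rewrite lee_pdivlMl.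
  exists ((f Q - e) * C); first by rewrite mulr_ge0// ltW.
  apply: filterS HC => x H Dx.
  move: (H Dx); rewrite -uE// -vE// -EFinM -EFinD lee_fin => vx.
  have -> : u x + (f Q - e) * C * delta D x = (f Q - e) * ((f Q - e)^-1 * u x + C * delta D x).
    by field; rewrite gt_eqF.
  by rewrite ler_pM2l.
exists (C1 + C2); first exact: addr_ge0.
apply: filterS2 H1 H2 => x H1 H2 Dx; rewrite ler_norml.
have := H1 Dx; have := H2 Dx.
have p1 := mulr_ge0 C10 (dl0 x); have p2 := mulr_ge0 C20 (dl0 x).
by move=> h1 h2; apply/andP; split; lra.
Qed.

End Density.
End BoundaryRatio.

Theorem theorem3p5
  (R : realType) (d : nat)
  (dO : measure_display) (Omega : measurableType dO) (P : probability Omega R)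
  (W : R -> Omega -> 'rV[R]_d) (S : R -> Omega -> R) (mu0 : R -> R)
  (D : set 'rV[R]_d) (r0 L0 : R) (x0 Q : 'rV[R]_d)
  (v u f : 'rV[R]_d -> R)
  (nu mu : {measure set (Borel R d) -> \bar R}) :
  (2 <= d)%N ->
  levy_density mu0 ->
  brownian P W ->
  subordinator P S mu0 ->
  independent_WS P W S ->
  bounded_set_e D -> C11_open D r0 L0 ->
  D x0 -> bdry D Q ->
  (* v is a nonnegative harmonic_XD function w.r.t. X^D with Martin measure nu *)
  harmonic_XD P W S D v ->
  (nu setT < +oo)%E -> nu (~` bdry D) = 0%E ->
  (forall x, D x ->
     ((v x)%:E = \int[nu]_(z in bdry D) (martin P W S D x0 x z)%:E)%E) ->
  (* d mu = f d nu, f in L^1(bdry D, nu), f continuous at Q *)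
  nu.-integrable (bdry D) (fun z => (f z)%:E) ->
  (forall A : set (Borel R d), measurable A ->
     (mu A = \int[nu]_(z in A) (f z)%:E)%E) ->
  (mu setT < +oo)%E -> mu (~` bdry D) = 0%E ->
  f z @[z --> within (bdry D) (nbhs Q)] --> f Q ->
  (* u(x) = int_{bdry D} M_D(x,z) mu(dz) *)
  (forall x, D x ->
     ((u x)%:E = \int[mu]_(z in bdry D) (martin P W S D x0 x z)%:E)%E) ->
  ( (((delta D x)%:E / (v x)%:E)%E @[x --> within D (nbhs Q)] --> 0%E) ->
    (((u x)%:E / (v x)%:E)%E @[x --> within D (nbhs Q)] --> (f Q)%:E) )
  /\
  ( (forall beta : R, 1 < beta ->
       ((delta D x)%:E / (v x)%:E)%E @[x --> within (ntA D r0 Q beta) (nbhs Q)]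
         --> 0%E) ->
    (forall beta : R, 1 < beta ->
       ((u x)%:E / (v x)%:E)%E @[x --> within (ntA D r0 Q beta) (nbhs Q)]
         --> (f Q)%:E) ).
Proof.
move=> d2 lv bW sS indWS bD C11 _ _ _ nuf _ vE fint dens muf _ fQ uE.
have d0 : (0 < d)%N by exact: leq_trans d2.
have [w0 w0D] := bounded_proper bD d0.
have oD : open D by case: C11.
have int_ge0 (m : {measure set (Borel R d) -> \bar R}) x : D x ->
    (0 <= \int[m]_(z in bdry D) (martin P W S D x0 x z)%:E)%E.
  move=> Dx; apply: integral_ge0 => z Bz; rewrite lee_fin.
  exact: (martin_ge0 lv bW sS indWS x0 d0 C11 bD).
(* Both assertions are instances for a subset [A] of [D]: the estimate of [martin_ratio_near] holds
   on a full neighbourhood of [Q] in [D], so only the filter in the hypothesis changes. *)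
have limit (A : set 'rV[R]_d) : A `<=` D ->
    ((delta D x)%:E / (v x)%:E)%E @[x --> within A (nbhs Q)] --> 0%E ->
    ((u x)%:E / (v x)%:E)%E @[x --> within A (nbhs Q)] --> (f Q)%:E.
  move=> AD; apply: (@quotient_cvg _ _ _ A).
  - exact: (@filterS _ (nbhs Q) _ setT _ _ filterT).
  - by move=> x /AD Dx; exact: (delta_gt0 oD w0D Dx).
  - by move=> x /AD Dx; rewrite -lee_fin uE ?int_ge0.
  - by move=> x /AD Dx; rewrite -lee_fin vE ?int_ge0.
  - move=> e e0; have [C C0 H] := martin_ratio_near lv bW sS indWS d0 C11 bD nuf muf fint dens fQ e0 uE vE.
    by exists C => //; apply: (filterS _ H) => x h Ax; apply: h; exact: AD.
by split=> [|H beta b1]; apply: limit => //; [move=> x []|exact: H].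
Qed.
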